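(* Let $X$ be a right-angled hyperbolic building of finite thickness, and let $G$ be a group acting strongly transitively (by type-preserving automorphisms) on $X$. Then the associated unitary representation $\rho_0$ of $G$ on $L^2(\partial X,\mu)$, given by $$(\rho_0(g)f)(x)=f(g^{-1}x)\left[\frac{d(g_*\mu)}{d\mu}(x)\right]^{1/2},$$ is irreducible, i.e. $L^2(\partial X,\mu)$ has no closed $G$-invariant subspaces other than $0$ and the whole space.
   Context: Right-angled hyperbolic Coxeter group: let $P$ be a compact polytope (finitely many faces) in hyperbolic space $\mathbb{H}^d$, $d\ge 2$, all of whose dihedral angles equal $\pi/2$; $S$ is the set of reflections across the codimension-1 faces of $P$, and $W$ is the group generated by $S$. The $W$-translates of $P$ tessellate $\mathbb{H}^d$. Fix an identification of $\mathbb{H}^d$ with the Poincaré ball such that the centre $0$ is an interior point of $P$. The orbit map $w\mapsto w0$ identifies $\partial W=\partial\mathbb{H}^d=S^{d-1}$; $l$ denotes Lebesgue measure on $S^{d-1}$, viewed on $\partial W$. Building: a right-angled hyperbolic building $X$ is a building with Weyl group such a $(W,S)$, viewed as a set of chambers with a $W$-valued distance; apartments are images of $W$-distance preserving maps $W\to X$. Its hyperbolic realization $|X|$ has chambers isometric to $P$ and apartments isometric to $\mathbb{H}^d$ tessellated by copies of $P$; it is CAT$(-1)$ with compact Gromov boundary $\partial X$. Finite thickness: each codimension-1 face of type $s\in S$ lies in exactly $q_s+1<\infty$ chambers, $q_s\ge 1$ depending only on $s$. $\mathrm{Aut}(X)$ is the group of bijections of $X$ preserving the $W$-valued distance, with the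 compact-open topology coming from its action on $X$; it acts on $\partial X$. An action on $X$ is strongly transitive if it is transitive on the set of pairs (chamber, apartment containing it). Measure: for a chamber $c$, let $\mathrm{Aut}(X)_c$ be its (compact open) stabilizer and $\nu_c$ its Haar probability measure. Choose an apartment $A\ni c$. The $c$-based folding $X\to W$ (sending $x$ to the $W$-distance from $c$ to $x$) identifies $\partial A$ with $\partial W$; $l_c$ is the measure on $\partial A$ corresponding to $l$. Let $p^c:\mathrm{Aut}(X)_c\times\partial A\to\partial X$, $(b,x)\mapsto bx$, and $\mu_c=p^c_*(\nu_c\times l_c)$ (independent of $A$). Fix a base chamber $c_0$ and put $\mu=\mu_{c_0}$. For $g\in\mathrm{Aut}(X)$, $g_*\mu$ and $\mu$ are mutually absolutely continuous. *)

(* Defs.v *)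
From HB Require Import structures.
From mathcomp Require Import all_boot all_order all_algebra.
From mathcomp.real_closed Require Import complex.
From mathcomp Require Import all_classical all_reals all_analysis.

Set Implicit Arguments.
Unset Strict Implicit.
Unset Printing Implicit Defensive.

Import Order.TTheory GRing.Theory Num.Theory.
Import numFieldNormedType.Exports.

Local Open Scope complex_scope.
Local Open Scope classical_set_scope.
Local Open Scope ring_scope.

(* H^d is the upper sheet of the hyperboloid in R^{d,1}; a point is a column
   whose first d entries are space-like and whose last entry is time-like.
   [to_ball] is the usual stereographic identification with the Poincare ball;
   it sends [origin] to the centre 0. *)
Section hyperbolic_space.
Variables (R : realType) (d : nat).
Local Notation vec := 'cV[R]_(d + 1).

Definition lorentz_mx : 'M[R]_(d + 1) := block_mx 1%:M 0 0 (- 1%:M).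
Definition lorentz (x y : vec) : R := (x^T *m lorentz_mx *m y) 0 0.

Definition hyperboloid : set vec :=
  [set x | lorentz x x = -1 /\ 0 < dsubmx x 0 0].

Definition arcosh (t : R) : R := ln (t + Num.sqrt (t ^+ 2 - 1)).
Definition hyp_dist (x y : vec) : R := arcosh (- lorentz x y).

Definition origin : vec := col_mx 0 1%:M.
Definition to_ball (x : vec) : 'cV[R]_d :=
  (1 + dsubmx x 0 0)^-1 *: usubmx x.

Definition half_space (e : vec) : set vec := [set x | lorentz x e <= 0].
Definition wall (e : vec) : set vec := [set x | lorentz x e = 0].
Definition reflection_mx (e : vec) : 'M[R]_(d + 1) :=
  1%:M - 2%:R *: (e *m e^T *m lorentz_mx).

(* Interior angle, along the intersection of the two walls, of the region
   bounded by the walls with unit outward normals e and f: it is pi minus the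
   angle between the normals. *)
Definition dihedral_angle (e f : vec) : R := acos (- lorentz e f).

End hyperbolic_space.

(* A compact polytope of H^d, given by the unit outward normals to its
   codimension-1 faces.  The relative interior of a face of codimension 1
   (resp. 2) consists of the points of the polytope lying on exactly one
   (resp. two) of the walls. *)
Record right_angled_polytope (R : realType) (d : nat) := RightAngledPolytope {
  facet : finType;
  normal : facet -> 'cV[R]_(d + 1);
  polytope_set : set 'cV[R]_(d + 1) :=
    hyperboloid (d := d) `&` \bigcap_(s in [set: facet]) half_space (normal s);
  normal_unit : forall s, lorentz (normal s) (normal s) = 1;
  facet_codim1 : forall s,
    exists2 x, polytope_set x & forall t, wall (normal t) x <-> t = s;
  polytope_compact : compact polytope_set;
  origin_interior : forall s, lorentz (origin R d) (normal s) < 0;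
  right_angles : forall s t, s <> t ->
    (exists2 x, polytope_set x &
       forall u, wall (normal u) x <-> u = s \/ u = t) ->
    dihedral_angle (normal s) (normal t) = pi / 2%:R }.

Section weyl_group.
Variables (R : realType) (d : nat) (P : right_angled_polytope R d).

Definition refl (s : facet P) : 'M[R]_(d + 1) := reflection_mx (normal s).
Definition eval_word (w : seq (facet P)) : 'M[R]_(d + 1) :=
  foldr (fun s g => refl s *m g) 1%:M w.

(* The generators are involutions, so the group they generate is the set of
   values of words. *)
Definition weyl : set 'M[R]_(d + 1) := range eval_word.

Definition word_length (g : 'M[R]_(d + 1)) : nat :=
  get [set k | (exists2 w, eval_word w = g & size w = k) /\
               forall w, eval_word w = g -> (k <= size w)%N].

End weyl_group.

Record building (R : realType) (d : nat) (P : right_angled_polytope R d) :=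
  Building {
  chamber :> Type;
  wdist : chamber -> chamber -> 'M[R]_(d + 1);
  wdist_weyl : forall x y, weyl P (wdist x y);
  wdist_eq1 : forall x y, wdist x y = 1%:M <-> x = y;
  wdist_step : forall x' x y (s : facet P), wdist x' x = refl s ->
    (wdist x' y = refl s *m wdist x y \/ wdist x' y = wdist x y) /\
    (word_length P (refl s *m wdist x y) = (word_length P (wdist x y)).+1 ->
     wdist x' y = refl s *m wdist x y);
  wdist_ex : forall x y (s : facet P),
    exists2 x', wdist x' x = refl s & wdist x' y = refl s *m wdist x y }.

Section building_theory.
Variables (R : realType) (d : nat) (P : right_angled_polytope R d).
Variable X : building P.

Definition panel (s : facet P) (x : X) : set X :=
  [set y | wdist x y = 1%:M \/ wdist x y = refl s].

Definition finite_thickness := exists q : facet P -> nat,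
  (forall s, (0 < q s)%N) /\
  forall s (x : X), (panel s x #= `I_(q s).+1)%card.

Definition is_apartment (A : set X) := exists alpha : 'M[R]_(d + 1) -> X,
  (forall u v, weyl P u -> weyl P v ->
     wdist (alpha u) (alpha v) = invmx u *m v) /\
  A = alpha @` weyl P.

(* A point (x, p) of [realization] is the point of |X| at position p in the
   chamber x, the latter being identified with the polytope.  Two chambers x, y
   lie in a common apartment, where, if x is placed at the polytope, y is its
   translate by wdist x y; apartments are isometrically embedded in |X|.  So
   |X| is the metric quotient of [realization] by the pseudometric [rdist]. *)
Definition realization : Type :=
  (X * {p : 'cV[R]_(d + 1) | polytope_set P p})%type.

Definition rdist (a b : realization) : R :=
  hyp_dist (sval a.2) (wdist a.1 b.1 *m sval b.2).

Definition gromov_product (z a b : realization) : R :=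
  (rdist z a + rdist z b - rdist a b) / 2%:R.

(* liminf_{i, j -> oo} (u i | v j)_z = +oo, for every base point z (the choice
   of z is immaterial). *)
Definition asymptotic (u v : nat -> realization) :=
  forall (z : realization) (M : R), exists N, forall i j,
    (N <= i)%N -> (N <= j)%N -> M <= gromov_product z (u i) (v j).

Definition to_infinity (u : nat -> realization) := asymptotic u u.

Definition boundary_class (u : nat -> realization) : set (nat -> realization) :=
  [set v | to_infinity v /\ asymptotic u v].

Definition boundary : Type :=
  {xi : set (nat -> realization) |
    exists2 u, to_infinity u & xi = boundary_class u}.

HB.instance Definition _ := gen_eqMixin boundary.
HB.instance Definition _ := gen_choiceMixin boundary.

Definition boundary_nbhd (z : realization) (M : R) (xi : boundary) :
    set boundary :=
  [set eta | exists u v, [/\ sval xi u, sval eta v &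
     exists N, forall i j, (N <= i)%N -> (N <= j)%N ->
       M <= gromov_product z (u i) (v j)]].

Definition boundary_open : set (set boundary) :=
  [set U | forall xi, U xi -> forall z, exists M, boundary_nbhd z M xi `<=` U].

Record aut := Aut {
  aut_fun :> X -> X;
  aut_bij : bijective aut_fun;
  aut_wdist : forall x y, wdist (aut_fun x) (aut_fun y) = wdist x y }.

Definition aut_id : aut :=
  @Aut id (Bijective (fun=> erefl) (fun=> erefl)) (fun _ _ => erefl).

Definition aut_comp (g h : aut) : aut :=
  @Aut (g \o h) (bij_comp (aut_bij g) (aut_bij h))
    (fun x y => etrans (aut_wdist g (h x) (h y)) (aut_wdist h x y)).

Definition real_act (g : aut) (a : realization) : realization :=
  (g a.1, a.2).

Lemma rdist_act g a b : rdist (real_act g a) (real_act g b) = rdist a b.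
Proof. by rewrite /rdist /real_act /= aut_wdist. Qed.

Lemma real_act_bij g : bijective (real_act g).
Proof.
have [g' gK g'K] := aut_bij g.
by exists (fun a => (g' a.1, a.2)) => -[a p]; rewrite /real_act /= ?gK ?g'K.
Qed.

Lemma asymptotic_act g u v :
  asymptotic (real_act g \o u) (real_act g \o v) <-> asymptotic u v.
Proof.
have [h gK hK] := real_act_bij g.
have E z a b : gromov_product (real_act g z) (real_act g a) (real_act g b) =
    gromov_product z a b by rewrite /gromov_product !rdist_act.
split=> uv z M.
  have [N HN] := uv (real_act g z) M; exists N => i j Ni Nj.
  by rewrite -E; exact: HN.
have [N HN] := uv (h z) M; exists N => i j Ni Nj.
by rewrite -[z]hK E; exact: HN.
Qed.

Lemma boundary_act_subproof g (xi : boundary) :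
  exists2 u, to_infinity u &
    [set real_act g \o v | v in sval xi] = boundary_class u.
Proof.
case: xi => /= _ [u uoo ->]; exists (real_act g \o u).
  exact: (asymptotic_act g u u).2.
have [h gK hK] := real_act_bij g.
apply/seteqP; split => [_ [v [voo uv] <-]|v [voo uv]].
  by split; apply: (asymptotic_act g _ _).2.
have vE : real_act g \o (h \o v) = v by apply/funext => i /=; rewrite hK.
exists (h \o v); last exact: vE.
by split; apply: (asymptotic_act g _ _).1; rewrite vE.
Qed.

Definition boundary_act (g : aut) (xi : boundary) : boundary :=
  exist _ [set real_act g \o v | v in sval xi] (boundary_act_subproof g xi).

Definition stabilizer (c : X) : Type := {g : aut | g c = c}.
Definition stab_fun (c : X) (g : stabilizer c) : X -> X := sval g.

Section stabilizer.
Variable c : X.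

HB.instance Definition _ := gen_eqMixin (stabilizer c).
HB.instance Definition _ := gen_choiceMixin (stabilizer c).

Definition stab_id : stabilizer c := exist (fun g : aut => g c = c) aut_id erefl.
HB.instance Definition _ := isPointed.Build (stabilizer c) stab_id.

Definition stab_mul (g h : stabilizer c) : stabilizer c :=
  exist (fun g : aut => g c = c) (aut_comp (sval g) (sval h))
    (etrans (congr1 (sval g) (svalP h)) (svalP g)).

(* The compact-open topology: the compact subsets of the discrete set X are the
   finite ones. *)
Definition stab_open : set (set (stabilizer c)) :=
  [set U | forall g, U g -> exists2 F : set X, finite_set F &
     [set h | forall x, F x -> stab_fun h x = stab_fun g x] `<=` U].

Definition borel_stab := g_sigma_algebraType stab_open.

Definition is_haar_probability (nu : probability borel_stab R) :=
  forall (g : stabilizer c) (E : set borel_stab), measurable E ->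
    nu [set h | E (stab_mul g h)] = nu E.

End stabilizer.

(* Measurable types must be inhabited; the boundary point xi0 serves no other
   purpose. *)
Definition pointed_boundary (xi0 : boundary) : Type := boundary.
HB.instance Definition _ (xi0 : boundary) := Choice.on (pointed_boundary xi0).
HB.instance Definition _ (xi0 : boundary) :=
  isPointed.Build (pointed_boundary xi0) xi0.

Definition borel_boundary (xi0 : boundary) :=
  g_sigma_algebraType (boundary_open : set (set (pointed_boundary xi0))).

Definition borel_act (xi0 : boundary) (g : aut) :
  borel_boundary xi0 -> borel_boundary xi0 := boundary_act g.

End building_theory.

Section sphere.
Variable R : realType.

Definition enorm k (x : 'cV[R]_k) : R := Num.sqrt ((x^T *m x) 0 0).

(* d-dimensional Lebesgue measure of a Borel set, as an iterated integral. *)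
Fixpoint volume (k : nat) : set 'cV[R]_k -> \bar R :=
  match k with
  | 0 => fun A => (\1_A (0 : 'cV[R]_0))%:E
  | k'.+1 => fun A =>
    (\int[lebesgue_measure]_x
       volume [set y : 'cV[R]_k' | A (col_mx (x%:M : 'cV[R]_1) y)])%E
  end.

(* The unit sphere S^k of R^(k+1). *)
Definition sphere (k : nat) : Type := {x : 'cV[R]_k.+1 | enorm x = 1}.

Variable k : nat.

Lemma enorm_pole : enorm (delta_mx 0 0 : 'cV[R]_k.+1) = 1.
Proof. by rewrite /enorm trmx_delta mul_delta_mx mxE !eqxx sqrtr1. Qed.

HB.instance Definition _ := gen_eqMixin (sphere k).
HB.instance Definition _ := gen_choiceMixin (sphere k).
HB.instance Definition _ :=
  isPointed.Build (sphere k) (exist _ (delta_mx 0 0) enorm_pole).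

Definition sphere_open : set (set (sphere k)) :=
  [set U | exists2 V : set 'cV[R]_k.+1, open V & U = sval @^-1` V].

Definition borel_sphere := g_sigma_algebraType sphere_open.

Definition cone (E : set (sphere k)) : set 'cV[R]_k.+1 :=
  [set x | exists2 xi, E xi & exists2 r : R, 0 < r <= 1 & x = r *: sval xi].

(* Surface measure, from the volume of the cone over E in the unit ball. *)
Definition sphere_measure (E : set borel_sphere) : \bar R :=
  (k.+1%:R%:E * volume (cone E))%E.

End sphere.

Section boundary_measure.
Variables (R : realType) (n : nat) (P : right_angled_polytope R n.+1).
Variables (X : building P) (xi0 : boundary X) (c : X).

Lemma origin_in_polytope : polytope_set P (origin R n.+1).
Proof.
split; last by move=> s _; exact/ltW/origin_interior.
split; last by rewrite /origin col_mxKd mxE eqxx.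
rewrite /lorentz /origin /lorentz_mx tr_col_mx trmx0 trmx1 mul_row_block.
by rewrite mul_row_col !(mul0mx, mulmx0, mul1mx, mulmx1, add0r, addr0) !mxE eqxx.
Qed.

Definition centre (x : X) : realization X :=
  (x, exist _ (origin R n.+1) origin_in_polytope).

(* The identification of the boundary sphere of H^d with the boundary of the
   apartment A containing c: the folding x |-> wdist c x based at c restricts
   to a bijection from A onto W, and W is embedded in the ball by its orbit map
   w |-> w 0. *)
Definition apartment_boundary (A : set X) (xi : borel_sphere R n) :
    borel_boundary xi0 :=
  get [set eta : pointed_boundary xi0 | exists x : nat -> X,
    [/\ forall k, A (x k),
        to_ball (wdist c (x k) *m origin R n.+1) @[k --> \oo] --> sval xi &
        sval eta (fun k => centre (x k))]].

Definition spread (A : set X) (bx : borel_stab c * borel_sphere R n) :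
    borel_boundary xi0 :=
  borel_act (sval bx.1) (apartment_boundary A bx.2).

(* mu is the image of nu x l under [spread], l being Lebesgue measure on the
   sphere. *)
Definition is_boundary_measure (nu : probability (borel_stab c) R)
    (mu : {measure set (borel_boundary xi0) -> \bar R}) :=
  exists2 A, is_apartment A /\ A c &
    forall E : set (borel_boundary xi0), measurable E ->
      mu E = pushforward (nu \x @sphere_measure R n)%E (spread A) E.

End boundary_measure.

Section group_action.
Variables (R : realType) (d : nat) (P : right_angled_polytope R d).
Variables (X : building P) (G : groupType) (act : G -> aut X).

Definition is_aut_action :=
  (forall x, act 1%g x = x) /\
  forall g h x, act (g * h)%g x = act g (act h x).

Definition strongly_transitive :=
  forall (c c' : X) (A A' : set X), is_apartment A -> A c ->
    is_apartment A' -> A' c' ->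
    exists g, act g c = c' /\ act g @` A = A'.

End group_action.

Section L2.
Context (disp : measure_display) (T : measurableType disp) (R : realType).
Variable mu : {measure set T -> \bar R}.
Local Notation C := R[i].

(* Complex-valued square-integrable functions; they represent elements of L^2,
   equality in L^2 being equality almost everywhere. *)
Definition L2 : set (T -> C) :=
  [set f : T -> C | @complex.Re R \o f \in Lfun mu 2%:E /\
           @complex.Im R \o f \in Lfun mu 2%:E].

Definition L2_dist2 (f g : T -> C) : \bar R :=
  (\int[mu]_x ((complex.Re (f x - g x)) ^+ 2 +
               (complex.Im (f x - g x)) ^+ 2)%:E)%E.

(* Being closed, V is in particular stable under almost everywhere equality. *)
Definition closed_subspace (V : set (T -> C)) :=
  [/\ V `<=` L2,
      V (fun=> 0),
      forall f g, V f -> V g -> V (fun x => f x + g x),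
      forall (a : C) f, V f -> V (fun x => a * f x) &
      forall (F : nat -> T -> C) f, (forall k, V (F k)) -> L2 f ->
        L2_dist2 (F k) f @[k --> \oo] --> 0%E -> V f].

Definition L2_zero : set (T -> C) :=
  [set f : T -> C | L2 f /\ {ae mu, forall x, f x = 0}].

Definition irreducible_on_L2 (G : Type) (rho : G -> (T -> C) -> (T -> C)) :=
  forall V, closed_subspace V -> (forall g f, V f -> V (rho g f)) ->
    V = L2_zero \/ V = L2.

(* h is a version of the density of nu with respect to mu. *)
Definition is_density (nu : set T -> \bar R) (h : T -> R) :=
  [/\ measurable_fun setT h, forall x, 0 <= h x &
      forall E, measurable E -> nu E = (\int[mu]_(x in E) (h x)%:E)%E].

End L2.

Section representation.
Variables (R : realType) (d : nat) (P : right_angled_polytope R d).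
Variables (X : building P) (xi0 : boundary X).
Variables (G : groupType) (act : G -> aut X).

Definition rho0 (D : G -> borel_boundary xi0 -> R) (g : G)
    (f : borel_boundary xi0 -> R[i]) :
    borel_boundary xi0 -> R[i] :=
  fun x => f (borel_act (act g^-1%g) x) *
           (Num.sqrt (D g x))%:C.

End representation.

(* Main.v *)
Require Import Defs.
From HB Require Import structures.
From mathcomp Require Import all_boot all_order all_algebra.
From mathcomp.real_closed Require Import complex.
From mathcomp Require Import all_classical all_reals all_analysis.
From mathcomp Require Import finmap measurable_realfun.
From mathcomp Require Import ring lra zify.

(** Let [f] be a nonzero vector of a closed invariant subspace and [h] a nonzero
    vector orthogonal to that subspace, so that [<rho_0(g) f, h> = 0] for all [g].

    The measure of the shadow of a chamber [p] seen from [c0] is comparable to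
    [weight c0 p = exp (- (d - 1) dist c0 p) / N], where [N] is the number of
    chambers at the same [W]-distance, and near [p] the density of [g_* mu] is
    comparable to [weight (g c0) p / weight c0 p].  Hence its square root has an
    integral comparable to [sqrt (weight c0 (g c0))] over the set of ideal points
    beyond [p] both from [c0] and from [g c0], for each [p] coarsely between [c0]
    and [g c0].  Along a geodesic of length [k] this makes about [k] such shells,
    and together with two end regions they cover the boundary.

    Let [y1 = g1 c0] and [y2 = g2 c0] be chambers in whose shadows [h] and [f] are
    close to nonzero constants, up to a small part of the mass, and let [g] run
    over the elements with [g c0] and [g^-1 c0] at distance about [k] from [c0].
    Average the coefficients of [g1 g g2^-1], divided by
    [sqrt (weight c0 (g1 g g2^-1 c0))]: the part of the shells where [f] and [h]
    are close to constants contributes at least a multiple of [k].  By the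
    inequality of arithmetic and geometric means the exceptional part of each
    shell contributes a small constant, and the end regions a bounded amount,
    which contradicts the vanishing of the coefficients for large [k]. *)

Set Implicit Arguments.
Unset Strict Implicit.
Unset Printing Implicit Defensive.

Import Order.TTheory GRing.Theory Num.Theory.
Import numFieldNormedType.Exports.

Local Open Scope classical_set_scope.
Local Open Scope ring_scope.

(** * The hyperboloid model *)

(** Shadows, weights and densities are controlled only up to multiplicative constants, so the
    estimates are one-sided. This is why [f] and [h] enter them through the majorants [1 + |f|] and
    [1 + |h|], and why the vanishing of the coefficients is used just once, as an integrated
    pointwise inequality.

    The exponent 1/2 makes all shells count equally: [weight] is multiplicative along geodesics up
    to constants, so the geometric mean of the weights of [p] seen from [c0] and from [g c0] has the
    same order for every [p] between them. The gain is then linear in the number of shells, but so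
    is the error, and the error must have the smaller slope. If the exceptional parts have relative
    mass [v ^ 2], the inequality of means with ratio [v] gives a slope of order [v]. The number [v]
    is fixed before [g1] and [g2]; these affect only the end regions, whose total is constant in
    [k].

    Density points are replaced by a covering comparison for tiles of bounded overlap. Right angles
    enter through the dichotomy for products of normals, which ties word length to the sides of
    walls; the axioms of a building mention only word length. *)

Section dot.
Variable R : realType.

Definition dot k (x y : 'cV[R]_k) : R := \sum_i x i 0 * y i 0.

Lemma dotC k (x y : 'cV[R]_k) : dot x y = dot y x.
Proof. by apply: eq_bigr => i _; rewrite mulrC. Qed.

Lemma dotDl k (x y z : 'cV[R]_k) : dot (x + y) z = dot x z + dot y z.
Proof. by rewrite -big_split; apply: eq_bigr => i _; rewrite mxE mulrDl. Qed.

Lemma dotZl k a (x y : 'cV[R]_k) : dot (a *: x) y = a * dot x y.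
Proof. by rewrite mulr_sumr; apply: eq_bigr => i _; rewrite mxE mulrA. Qed.

Lemma dotDr k (x y z : 'cV[R]_k) : dot x (y + z) = dot x y + dot x z.
Proof. by rewrite dotC dotDl !(dotC x). Qed.

Lemma dotZr k a (x y : 'cV[R]_k) : dot x (a *: y) = a * dot x y.
Proof. by rewrite dotC dotZl dotC. Qed.

Lemma dot_ge0 k (x : 'cV[R]_k) : 0 <= dot x x.
Proof. by apply: sumr_ge0 => i _; rewrite -expr2 sqr_ge0. Qed.

Lemma dot_eq0 k (x : 'cV[R]_k) : dot x x = 0 -> x = 0.
Proof.
move/eqP; rewrite psumr_eq0; last by move=> i _; rewrite -expr2 sqr_ge0.
move/allP => h; apply/colP => i; rewrite mxE.
by have := h i (mem_index_enum i); rewrite -expr2 sqrf_eq0 => /eqP.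
Qed.

Lemma dot0l k (y : 'cV[R]_k) : dot 0 y = 0.
Proof. by rewrite -(scale0r y) dotZl mul0r. Qed.

Lemma dotNl k (x y : 'cV[R]_k) : dot (- x) y = - dot x y.
Proof. by rewrite -scaleN1r dotZl mulN1r. Qed.

Lemma dotBl k (x y z : 'cV[R]_k) : dot (x - y) z = dot x z - dot y z.
Proof. by rewrite dotDl dotNl. Qed.

Lemma dotBr k (x y z : 'cV[R]_k) : dot x (y - z) = dot x y - dot x z.
Proof. by rewrite dotC dotBl !(dotC x). Qed.

Lemma dot_sqr_le k (x y : 'cV[R]_k) : dot x y ^+ 2 <= dot x x * dot y y.
Proof.
have [->|y0] := eqVneq y 0; first by rewrite dotC !dot0l expr0n mulr0.
have yy : 0 < dot y y.
  rewrite lt_neqAle dot_ge0 andbT eq_sym; apply: contra_neq y0; exact: dot_eq0.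
have := dot_ge0 (dot y y *: x - dot x y *: y).
rewrite dotBl !dotBr !dotZl !dotZr (dotC y x).
set a := dot x x; set b := dot x y; set c := dot y y in yy *.
rewrite (_ : _ - _ = c * (a * c - b ^+ 2)); last by ring.
by rewrite pmulr_rge0// subr_ge0.
Qed.

Lemma dot_enorm k (x : 'cV[R]_k) : enorm x ^+ 2 = dot x x.
Proof.
have e : (x^T *m x) 0 0 = dot x x.
  by rewrite mxE; apply: eq_bigr => i _; rewrite mxE.
by rewrite /enorm e sqr_sqrtr ?dot_ge0.
Qed.

End dot.

Section lorentz.
Variables (R : realType) (d : nat).
Local Notation vec := 'cV[R]_(d + 1).
Implicit Types x y z e n : vec.

Definition tm x : R := dsubmx x 0 0.
Definition sp x : 'cV[R]_d := usubmx x.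

Lemma lorentzE x y : lorentz x y = dot (sp x) (sp y) - tm x * tm y.
Proof.
rewrite /lorentz /lorentz_mx -{1}(vsubmxK x) -{1}(vsubmxK y) tr_col_mx.
rewrite mul_row_block mul_row_col !mulmx0 addr0 add0r mulmx1 mulmxN mulmx1.
rewrite mxE [in RHS]/dot; congr (_ + _).
  by rewrite mxE; apply: eq_bigr => i _; rewrite mxE.
by rewrite mulNmx mxE mxE big_ord1 mxE.
Qed.

Lemma lorentzC x y : lorentz x y = lorentz y x.
Proof. by rewrite !lorentzE dotC mulrC. Qed.

Lemma lorentzDl x y z : lorentz (x + y) z = lorentz x z + lorentz y z.
Proof. by rewrite /lorentz linearD/= !mulmxDl mxE. Qed.

Lemma lorentzZl a x y : lorentz (a *: x) y = a * lorentz x y.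
Proof. by rewrite /lorentz linearZ/= -!scalemxAl mxE. Qed.

Lemma lorentzDr x y z : lorentz x (y + z) = lorentz x y + lorentz x z.
Proof. by rewrite /lorentz mulmxDr mxE. Qed.

Lemma lorentzZr a x y : lorentz x (a *: y) = a * lorentz x y.
Proof. by rewrite /lorentz -!scalemxAr mxE. Qed.

Lemma lorentzNl x y : lorentz (- x) y = - lorentz x y.
Proof. by rewrite -scaleN1r lorentzZl mulN1r. Qed.

Lemma lorentzNr x y : lorentz x (- y) = - lorentz x y.
Proof. by rewrite -scaleN1r lorentzZr mulN1r. Qed.

Lemma lorentzBl x y z : lorentz (x - y) z = lorentz x z - lorentz y z.
Proof. by rewrite lorentzDl lorentzNl. Qed.

Lemma lorentzBr x y z : lorentz x (y - z) = lorentz x y - lorentz x z.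
Proof. by rewrite lorentzDr lorentzNr. Qed.

Lemma lorentz0l x : lorentz 0 x = 0.
Proof. by rewrite -(scale0r x) lorentzZl mul0r. Qed.

Lemma lorentz0r x : lorentz x 0 = 0.
Proof. by rewrite lorentzC lorentz0l. Qed.

Lemma lorentz_suml (I : Type) (r : seq I) (p : pred I) (F : I -> vec) y :
  lorentz (\sum_(i <- r | p i) F i) y = \sum_(i <- r | p i) lorentz (F i) y.
Proof.
apply: (big_morph (fun z => lorentz z y)); last exact: lorentz0l.
by move=> ? ?; rewrite lorentzDl.
Qed.

Lemma lorentz_sumr (I : Type) (r : seq I) (p : pred I) (F : I -> vec) x :
  lorentz x (\sum_(i <- r | p i) F i) = \sum_(i <- r | p i) lorentz x (F i).
Proof.
rewrite lorentzC lorentz_suml; apply: eq_bigr => i _; exact: lorentzC.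
Qed.

Definition lorentzL := (lorentzDl, lorentzBl, lorentzZl, lorentzNl,
  lorentzDr, lorentzBr, lorentzZr, lorentzNr).

(** The open cone over the hyperboloid. It is stable under sums and positive multiples, so
    normalisation can be postponed to [future_normalize]. *)
Definition future x := lorentz x x < 0 /\ 0 < tm x.

Lemma future_sp x : future x -> dot (sp x) (sp x) < tm x ^+ 2.
Proof. by case; rewrite lorentzE -expr2 subr_lt0. Qed.

Lemma ler_sqr_pos (a b : R) : 0 <= b -> a ^+ 2 <= b ^+ 2 -> a <= b.
Proof.
move=> b0; rewrite -real_normK ?num_real// ler_pXn2r ?nnegrE//.
by apply: le_trans; exact: ler_norm.
Qed.

(** Since [x] lies strictly inside the light cone, Cauchy-Schwarz bounds the product of the
    space-like parts strictly by [tm x * tm n]. *)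
Lemma future_causal_lt0 x n : future x -> 0 < tm n -> lorentz n n <= 0 ->
  lorentz x n < 0.
Proof.
move=> fx n0; rewrite lorentzE -expr2 subr_le0 => nn; rewrite lorentzE subr_lt0.
have xx := future_sp fx; have [_ x0] := fx.
have xn : 0 < tm x * tm n by exact: mulr_gt0.
have := dot_sqr_le (sp x) (sp n).
have h : dot (sp x) (sp x) * dot (sp n) (sp n) < (tm x * tm n) ^+ 2.
  rewrite exprMn; apply: (@le_lt_trans _ _ (dot (sp x) (sp x) * tm n ^+ 2)).
    by rewrite ler_wpM2l// dot_ge0.
  by rewrite ltr_pM2r// exprn_gt0.
move=> /le_lt_trans /(_ h) => {}h; rewrite ltNge; apply/negP => le.
by move: h; rewrite ltNge ler_pXn2r ?le// nnegrE ?ltW//; exact: lt_le_trans le.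
Qed.

Lemma future_lt0 x y : future x -> future y -> lorentz x y < 0.
Proof. by move=> fx [yy y0]; apply: future_causal_lt0 => //; exact: ltW. Qed.

Lemma causal_tm_gt0 x n : future x -> lorentz n n <= 0 -> lorentz x n < 0 ->
  0 < tm n.
Proof.
move=> fx nn xn; rewrite ltNge; apply/negP => n0.
move: n0; rewrite le_eqVlt => /orP[/eqP n0|n0].
  move: nn; rewrite lorentzE n0 mulr0 subr0 => nn.
  have {}nn : sp n = 0 by apply: dot_eq0; apply/eqP; rewrite eq_le nn dot_ge0.
  by move: xn; rewrite lorentzE n0 nn dotC dot0l mulr0 subr0 ltxx.
have := @future_causal_lt0 x (- n) fx.
rewrite lorentzNl !lorentzNr opprK /tm linearN/= mxE -/(tm n) oppr_gt0 n0.
by move=> /(_ isT nn); rewrite oppr_lt0 ltNge ltW.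
Qed.

(** A causal vector pairs with one sign against the whole future cone, so a sign found at a facet
    point can be moved to the origin in [normal_dichotomy]. *)
Lemma causal_future x o n : future x -> future o -> lorentz n n <= 0 ->
  lorentz x n < 0 -> lorentz o n < 0.
Proof.
move=> fx fo nn xn; apply: future_causal_lt0 => //; exact: causal_tm_gt0 xn.
Qed.

Lemma futureP x y : future x -> lorentz y y < 0 -> lorentz x y < 0 -> future y.
Proof. by move=> fx yy xy; split=> //; apply: (causal_tm_gt0 fx) => //; exact: ltW. Qed.

(** The form has a single negative direction, and [x] uses it up. *)
Lemma future_orth x v : future x -> lorentz x v = 0 -> 0 <= lorentz v v.
Proof.
move=> fx; rewrite !lorentzE => /eqP; rewrite subr_eq0 => /eqP xv.
have xx := future_sp fx; have [_ x0] := fx.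
have := dot_sqr_le (sp x) (sp v); rewrite xv exprMn => h.
rewrite -expr2 subr_ge0 -(@ler_pM2l _ (tm x ^+ 2)) ?exprn_gt0//.
apply: le_trans h _; rewrite ler_wpM2r ?dot_ge0//; exact: ltW.
Qed.

Lemma future_orth_eq0 x v : future x -> lorentz x v = 0 -> lorentz v v = 0 ->
  v = 0.
Proof.
move=> fx xv vv; have xx := future_sp fx; have [_ x0] := fx.
move: xv vv; rewrite !lorentzE => /eqP; rewrite subr_eq0 => /eqP xv.
rewrite -expr2 => /eqP; rewrite subr_eq0 => /eqP vv.
have := dot_sqr_le (sp x) (sp v); rewrite xv exprMn vv => h.
have tv : tm v = 0.
  apply/eqP; rewrite -[_ == _](sqrf_eq0) eq_le sqr_ge0 andbT leNgt.
  apply/negP => v0; move: h.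
  by rewrite ler_pM2r// leNgt xx.
have sv : sp v = 0 by apply: dot_eq0; rewrite vv tv expr0n.
rewrite -(vsubmxK v) -/(sp v) sv (_ : dsubmx v = 0) ?col_mx0//.
by apply/matrixP => i j; rewrite !ord1 [RHS]mxE.
Qed.

(** A combination of [x] and [v] orthogonal to [x] has nonnegative square by [future_orth]; dividing
    by the negative number [lorentz x x] reverses the usual inequality. *)
Lemma reverse_CS x v : future x ->
  lorentz x x * lorentz v v <= lorentz x v ^+ 2.
Proof.
move=> fx; have [xx _] := fx.
have := @future_orth x (lorentz x x *: v - lorentz x v *: x) fx.
rewrite !lorentzL (lorentzC v x) mulrC subrr => /(_ erefl).
set a := lorentz x x in xx *; set b := lorentz x v; set c := lorentz v v.
rewrite (_ : _ - _ = a * (a * c - b ^+ 2)); last by ring.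
by rewrite nmulr_rge0// subr_le0.
Qed.

Lemma futureD x y : future x -> future y -> future (x + y).
Proof.
move=> fx fy; have xy := future_lt0 fx fy; have [xx x0] := fx; have [yy y0] := fy.
split; first by rewrite !lorentzL (lorentzC y); lra.
by rewrite /tm linearD/= mxE addr_gt0.
Qed.

Lemma futureZ a x : 0 < a -> future x -> future (a *: x).
Proof.
move=> a0 [xx x0]; split; last by rewrite /tm linearZ/= mxE mulr_gt0.
by rewrite !lorentzL mulrA nmulr_llt0 ?mulr_gt0.
Qed.

Lemma reflection_mxE e x : reflection_mx e *m x = x - 2 * lorentz x e *: e.
Proof.
rewrite /reflection_mx mulmxBl mul1mx -scalemxAl -scalerA; congr (_ - _ *: _).
rewrite -!mulmxA (mx11_scalar (e^T *m _)) mul_mx_scalar; congr (_ *: _).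
by rewrite lorentzC /lorentz mulmxA.
Qed.

Lemma lorentz_reflection e x y : lorentz e e = 1 ->
  lorentz (reflection_mx e *m x) (reflection_mx e *m y) = lorentz x y.
Proof.
by move=> ee; rewrite !reflection_mxE !lorentzL ee (lorentzC e y); ring.
Qed.

Lemma reflectionK e : lorentz e e = 1 -> reflection_mx e *m reflection_mx e = 1%:M.
Proof.
move=> ee; have E x : reflection_mx e *m (reflection_mx e *m x) = x.
  rewrite !reflection_mxE !lorentzL ee mulr1 -addrA -opprD -scalerDl.
  have -> : 2 * lorentz x e + 2 * (lorentz x e - 2 * lorentz x e) = 0 by ring.
  by rewrite scale0r subr0.
apply/matrixP => i j.
have := congr1 (fun A : 'cV_(d + 1) => A i 0) (E (delta_mx j 0)).
by rewrite mulmxA -colE !mxE eq_sym andbT.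
Qed.

Lemma reflection_future e x : lorentz e e = 1 -> future x ->
  future (reflection_mx e *m x).
Proof.
move=> ee fx; have [xx _] := fx; apply: (futureP fx).
  by rewrite lorentz_reflection.
rewrite reflection_mxE !lorentzL -mulrA -expr2.
by have := sqr_ge0 (lorentz x e); lra.
Qed.

End lorentz.

(** * Hyperbolic cosine and sine *)

Section hyperbolic_functions.
Variable R : realType.

Definition ch (t : R) : R := (expR t + expR (- t)) / 2.
Definition sh (t : R) : R := (expR t - expR (- t)) / 2.

Lemma ch_ge1 t : 1 <= ch t.
Proof.
rewrite /ch expRN; have t0 := expR_gt0 t.
rewrite ler_pdivlMr// mul1r -(ler_pM2r t0) [leRHS]mulrDl mulVf ?gt_eqF//.
by have := sqr_ge0 (expR t - 1); rewrite sqrrB expr1n mulr1 -expr2; lra.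
Qed.

Lemma ch_sh t : ch t ^+ 2 - sh t ^+ 2 = 1.
Proof.
rewrite /ch /sh expRN; have := expR_gt0 t => t0; field; exact: lt0r_neq0.
Qed.

Lemma ch0 : ch 0 = 1.
Proof. by rewrite /ch oppr0 expR0; lra. Qed.

Lemma chD a b : ch (a + b) = ch a * ch b + sh a * sh b.
Proof. by rewrite /ch /sh opprD !expRD; field. Qed.

Lemma shD a b : sh (a + b) = sh a * ch b + ch a * sh b.
Proof. by rewrite /ch /sh opprD !expRD; field. Qed.

Lemma chN a : ch (- a) = ch a.
Proof. by rewrite /ch opprK addrC. Qed.

Lemma shN a : sh (- a) = - sh a.
Proof. by rewrite /sh opprK; field. Qed.

Lemma sh_ge0 t : 0 <= t -> 0 <= sh t.
Proof.
move=> t0; rewrite /sh divr_ge0// subr_ge0 ler_expR; lra.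
Qed.

Lemma sh_gt0 t : 0 < t -> 0 < sh t.
Proof.
move=> t0; rewrite /sh divr_gt0// subr_gt0 ltr_expR; lra.
Qed.

Lemma ch_homo a b : 0 <= a -> a < b -> ch a < ch b.
Proof.
move=> a0 ab; rewrite -(subrK a b) addrC chD.
have h : 0 < b - a by lra.
have := sh_gt0 h; have := sh_ge0 a0.
have : 1 < ch (b - a).
  rewrite -(@ltr_pXn2r _ 2)// ?nnegrE ?ch_ge0//; last by rewrite (le_trans ler01)// ch_ge1.
  rewrite expr1n -(ch_sh (b - a)) ltrBlDr ltrDl exprn_gt0//; exact: sh_gt0.
have := ch_ge1 a; set u := ch a; set v := ch _; set s := sh a; set r := sh _; nra.
Qed.

Lemma ch_le a b : 0 <= b -> ch a <= ch b -> a <= b.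
Proof.
move=> b0 h; rewrite leNgt; apply/negP => ba.
by have := ch_homo b0 ba; rewrite ltNge h.
Qed.

Lemma ch_mono a b : 0 <= a -> a <= b -> ch a <= ch b.
Proof. by move=> a0; rewrite le_eqVlt => /orP[/eqP->//|/(ch_homo a0)/ltW]. Qed.

Lemma expR_ch t : expR t <= 2 * ch t.
Proof. by rewrite /ch; have := expR_ge0 (- t); lra. Qed.

Lemma ch_expR t : 0 <= t -> ch t <= expR t.
Proof.
move=> t0; have : expR (- t) <= expR t by rewrite ler_expR; lra.
by rewrite /ch; lra.
Qed.

Lemma arcosh_ge0 (c : R) : 1 <= c -> 0 <= arcosh c.
Proof.
move=> c1; rewrite /arcosh ln_ge0//; have := sqrtr_ge0 (c ^+ 2 - 1); lra.
Qed.

Lemma arcoshK (c : R) : 1 <= c -> ch (arcosh c) = c.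
Proof.
move=> c1; rewrite /ch expRN /arcosh.
have h : 0 <= c ^+ 2 - 1 by rewrite subr_ge0 expr_ge1//; lra.
have := sqrtr_ge0 (c ^+ 2 - 1); have := sqr_sqrtr h; set s := Num.sqrt _ => ss s0.
have p : 0 < c + s by lra.
rewrite lnK ?posrE//; apply: (mulIf (lt0r_neq0 p)).
rewrite mulrAC mulrDl mulVf ?gt_eqF//.
apply: (@mulfI _ 2); rewrite ?pnatr_eq0//.
rewrite mulrC divfK ?pnatr_eq0//.
suff : s * s = c * c - 1 by move=> e; rewrite mulrDr !mulrDl e; ring.
by rewrite -!expr2.
Qed.

Lemma chK (t : R) : 0 <= t -> arcosh (ch t) = t.
Proof.
move=> t0; have c1 := ch_ge1 t; have a0 := arcosh_ge0 c1.
by apply/eqP; rewrite eq_le; apply/andP; split; apply: ch_le; rewrite ?arcoshK.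
Qed.

End hyperbolic_functions.

(** * The distance on the hyperboloid *)

Section hyperbolic_distance.
Variables (R : realType) (d : nat).
Local Notation vec := 'cV[R]_(d + 1).
Implicit Types x y z e n : vec.
Local Notation H := (hyperboloid (R := R) (d := d)).

Lemma hyperboloid_future x : H x -> future x.
Proof. by case=> xx x0; split=> //; rewrite xx oppr_lt0. Qed.

Lemma hyperboloid_ge1 x y : H x -> H y -> 1 <= - lorentz x y.
Proof.
move=> Hx Hy; have [xx _] := Hx; have [yy _] := Hy.
have fx := hyperboloid_future Hx; have fy := hyperboloid_future Hy.
have := reverse_CS y fx; have := future_lt0 fx fy.
by rewrite xx yy mulN1r opprK; set c := lorentz x y => c0 cc; nra.
Qed.

Lemma hyp_dist_ge0 x y : H x -> H y -> 0 <= hyp_dist x y.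
Proof. by move=> Hx Hy; apply: arcosh_ge0; exact: hyperboloid_ge1. Qed.

Lemma ch_hyp_dist x y : H x -> H y -> ch (hyp_dist x y) = - lorentz x y.
Proof. by move=> Hx Hy; rewrite /hyp_dist arcoshK// hyperboloid_ge1. Qed.

Lemma hyp_distC x y : hyp_dist x y = hyp_dist y x.
Proof. by rewrite /hyp_dist lorentzC. Qed.

Lemma hyp_dist_id x : H x -> hyp_dist x x = 0.
Proof. by case=> xx _; rewrite /hyp_dist xx opprK -ch0 chK. Qed.

Lemma hyp_dist_triangle x y z : H x -> H y -> H z ->
  hyp_dist x z <= hyp_dist x y + hyp_dist y z.
Proof.
move=> Hx Hy Hz; have xy0 := hyp_dist_ge0 Hx Hy; have yz0 := hyp_dist_ge0 Hy Hz.
apply: ch_le; first exact: addr_ge0.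
rewrite chD !ch_hyp_dist//; set a := hyp_dist x y in xy0 *; set b := hyp_dist y z in yz0 *.
have ax : ch a = - lorentz x y by exact: ch_hyp_dist.
have bz : ch b = - lorentz y z by exact: ch_hyp_dist.
have fy := hyperboloid_future Hy.
(* The components of [x] and [z] orthogonal to [y], with squares [sh a ^+ 2] and [sh b ^+ 2]. The
   form is positive semidefinite there, and Cauchy-Schwarz for [u] and [v] turns the addition
   formula for [ch] into the inequality. *)
pose u := x - ch a *: y; pose v := z - ch b *: y.
have [xx _] := Hx; have [yy _] := Hy; have [zz _] := Hz.
have uy : lorentz y u = 0 by rewrite /u !lorentzL yy ax (lorentzC y x); ring.
have vy : lorentz y v = 0 by rewrite /v !lorentzL yy bz; ring.
have uu : lorentz u u = sh a ^+ 2.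
  rewrite /u !lorentzL xx yy (lorentzC y x).
  have -> : lorentz x y = - ch a by rewrite ax opprK.
  have -> : sh a ^+ 2 = ch a ^+ 2 - 1 by rewrite -(ch_sh a); ring.
  ring.
have vv : lorentz v v = sh b ^+ 2.
  rewrite /v !lorentzL zz yy (lorentzC z y).
  have -> : lorentz y z = - ch b by rewrite bz opprK.
  have -> : sh b ^+ 2 = ch b ^+ 2 - 1 by rewrite -(ch_sh b); ring.
  ring.
have uv : lorentz u v = lorentz x z + ch a * ch b.
  rewrite /u /v !lorentzL yy.
  have -> : lorentz x y = - ch a by rewrite ax opprK.
  have -> : lorentz y z = - ch b by rewrite bz opprK.
  ring.
have sa := sh_ge0 xy0; have sb := sh_ge0 yz0.
clearbody u v.
suff : - lorentz u v <= sh a * sh b.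
  by rewrite uv -ax -bz opprD lerBlDl addrC.
apply: ler_sqr_pos; first exact: mulr_ge0.
rewrite sqrrN exprMn -uu -vv.
have uu0 : 0 <= lorentz u u by exact: future_orth uy.
have vv0 : 0 <= lorentz v v by exact: future_orth vy.
have [u0|un] := eqVneq (lorentz u u) 0.
  by rewrite (future_orth_eq0 fy uy u0) !lorentz0l expr0n mul0r.
have := @future_orth _ _ y (lorentz u u *: v - lorentz u v *: u) fy.
rewrite !lorentzL uy vy !mulr0 subrr (lorentzC v u) => /(_ erefl).
move: un uu0; set p := lorentz u u; set q := lorentz u v; set r := lorentz v v.
move=> pn p0; have {pn}p0 : 0 < p by rewrite lt_neqAle eq_sym pn.
rewrite (_ : _ - _ = p * (p * r - q ^+ 2)); last by ring.
by rewrite pmulr_rge0// subr_ge0.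
Qed.

(** In the plane of [p] and [q] the two pieces have hyperbolic sines [b * sh (hyp_dist p q)] and
    [a * sh (hyp_dist p q)], so the addition formula for [ch] gives the inequality opposite to the
    triangle inequality. *)
Lemma segment_split (p q r : vec) (a b : R) : H p -> H q -> H r ->
  0 <= a -> 0 <= b -> r = a *: p + b *: q ->
  hyp_dist p r + hyp_dist r q = hyp_dist p q.
Proof.
move=> Hp Hq Hr a0 b0 E.
have [pp _] := Hp; have [qq _] := Hq; have [rr _] := Hr.
have h1 := hyp_dist_ge0 Hp Hr; have h2 := hyp_dist_ge0 Hr Hq.
have h3 := hyp_dist_ge0 Hp Hq.
apply/eqP; rewrite eq_le hyp_dist_triangle// andbT; apply: ch_le => //.
rewrite chD !ch_hyp_dist//.
set c := - lorentz p q; have c1 : 1 <= c by exact: hyperboloid_ge1.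
have pr : - lorentz p r = a + b * c by rewrite E !lorentzL pp /c; ring.
have rq : - lorentz r q = a * c + b by rewrite E !lorentzL qq /c; ring.
have rE : a ^+ 2 + b ^+ 2 + 2 * a * b * c = 1.
  move: rr; rewrite E !lorentzL pp qq (lorentzC q p) /c; lra.
have s1 : sh (hyp_dist p r) ^+ 2 = b ^+ 2 * (c ^+ 2 - 1).
  have := ch_sh (hyp_dist p r); rewrite ch_hyp_dist// pr => h.
  have -> : sh (hyp_dist p r) ^+ 2 = (a + b * c) ^+ 2 - (a ^+ 2 + b ^+ 2 + 2 * a * b * c).
    by rewrite rE -h; ring.
  by ring.
have s2 : sh (hyp_dist r q) ^+ 2 = a ^+ 2 * (c ^+ 2 - 1).
  have := ch_sh (hyp_dist r q); rewrite ch_hyp_dist// rq => h.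
  have -> : sh (hyp_dist r q) ^+ 2 = (a * c + b) ^+ 2 - (a ^+ 2 + b ^+ 2 + 2 * a * b * c).
    by rewrite rE -h; ring.
  by ring.
have : sh (hyp_dist p r) * sh (hyp_dist r q) <= a * b * (c ^+ 2 - 1).
  apply: ler_sqr_pos; first by rewrite !mulr_ge0// subr_ge0 expr_ge1//; lra.
  rewrite exprMn s1 s2 le_eqVlt; apply/orP; left; apply/eqP; ring.
rewrite pr rq => h; rewrite -[leRHS]mulr1 -rE.
set s := sh _ * sh _ in h *; nra.
Qed.

End hyperbolic_distance.

(** * Right-angled polytopes *)

Section small_perturbations.
Variable R : realType.

Lemma fin_small (F : finType) (Q : F -> R -> Prop) :
  (forall u, exists2 t, 0 < t & forall s, 0 < s <= t -> Q u s) ->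
  exists2 t, 0 < t & forall u s, 0 < s <= t -> Q u s.
Proof.
move=> h; suff [t t0 ht] : exists2 t : R, 0 < t &
    forall u, u \in enum F -> forall s, 0 < s <= t -> Q u s.
  by exists t => // u; apply: ht; rewrite mem_enum.
elim: (enum F) => [|v l [t t0 ht]]; first by exists 1.
have [t' t'0 ht'] := h v; exists (Num.min t t'); first by rewrite lt_min t0.
move=> u; rewrite inE => /orP[/eqP ->|ul] s; rewrite le_min => /and3P[s0 st st'].
  by apply: ht'; rewrite s0.
by apply: ht => //; rewrite s0.
Qed.

Lemma affine_small (a b : R) : a < 0 ->
  exists2 t, 0 < t & forall s, 0 < s <= t -> a + s * b < 0.
Proof.
move=> a0; have b1 : 0 < `|b| + 1 by rewrite ltr_wpDl.
exists (- a / 2 / (`|b| + 1)); first by rewrite !divr_gt0 ?oppr_gt0.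
move=> s /andP[s0]; rewrite ler_pdivlMr// => h.
have := ler_norm b; nra.
Qed.

Lemma geometric_small (r K e : R) : 0 <= r -> r < 1 -> 0 < e ->
  exists k, r ^+ k * K < e.
Proof.
move=> r0 r1 e0.
have [N hN] : exists N : nat, forall k, (N <= k)%N -> `|r ^+ k| < e / (`|K| + 1).
  have h0 : 0 < e / (`|K| + 1) by rewrite divr_gt0// ltr_wpDl.
  have := @cvg_geometric R 1 r.
  rewrite ger0_norm// => /(_ r1) /cvgr0Pnorm_lt /(_ _ h0) [N _ hN].
  by exists N => k Nk; have := hN k Nk; rewrite /geometric/= mul1r.
exists N; have := hN N (leqnn _); rewrite ger0_norm ?exprn_ge0//.
rewrite ltr_pdivlMr ?ltr_wpDl// => h; apply: le_lt_trans h.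
rewrite ler_wpM2l ?exprn_ge0//; have := ler_norm K; lra.
Qed.

End small_perturbations.

Section lorentz_perturbation.
Variables (R : realType) (d : nat).
Local Notation vec := 'cV[R]_(d + 1).
Implicit Types x y z m : vec.

Lemma lorentz_nondeg m : (forall y, lorentz y m = 0) -> m = 0.
Proof.
move=> h; have Jm : lorentz_mx R d *m m = 0.
  apply/colP => i; have := h (delta_mx i 0).
  rewrite /lorentz trmx_delta -mulmxA -rowE mxE => ->; by rewrite mxE.
have JJ : lorentz_mx R d *m lorentz_mx R d = 1%:M.
  rewrite /lorentz_mx mulmx_block !mulmx0 !mul0mx !addr0 !add0r mulmx1.
  by rewrite mulNmx mulmxN opprK mulmx1 -scalar_mx_block.
by rewrite -(mul1mx m) -JJ -mulmxA Jm mulmx0.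
Qed.

Lemma future_small x y : future x ->
  exists2 t, 0 < t & forall s : R, 0 < s <= t -> future (x + s *: y).
Proof.
move=> [xx x0].
have [t1 t10 h1] := affine_small (2 * lorentz x y + `|lorentz y y|) xx.
have x0' : - tm x < 0 by rewrite oppr_lt0.
have [t2 t20 h2] := affine_small (- tm y) x0'.
exists (Num.min 1 (Num.min t1 t2)); first by rewrite !lt_min ltr01 t10 t20.
move=> s; rewrite !le_min => /and4P[s0 s1 st1 st2]; split.
  have := h1 s; rewrite s0 st1 => /(_ isT); rewrite !lorentzL (lorentzC y x).
  have := ler_norm (lorentz y y); set a := lorentz y y; set b := lorentz x y.
  move=> ab; have : s * (s * a) <= s * `|a|.
    rewrite ler_wpM2l ?(ltW s0)//; have := normr_ge0 a; nra.
  by rewrite !mulrDr; set sa := s * (s * a); set t := s * `|a|; lra.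
have := h2 s; rewrite s0 st2 => /(_ isT).
have -> : tm (x + s *: y) = tm x + s * tm y.
  by rewrite /tm linearD linearZ/= mxE [X in _ + X]mxE.
lra.
Qed.

(** General position: a point of the hyperplane of [e] is moved off the zero sets of the functionals
    [ms], one after the other, by steps so small that the open conditions already obtained
    persist. *)
Lemma generic_perturbation (F : finType) (n : F -> vec) (Q : pred F) (e : vec)
    (ms : seq vec) x0 :
  future x0 -> lorentz x0 e = 0 -> (forall u, Q u -> lorentz x0 (n u) < 0) ->
  (forall m, m \in ms -> exists2 y, lorentz y e = 0 & lorentz y m <> 0) ->
  exists x, [/\ future x, lorentz x e = 0,
    forall u, Q u -> lorentz x (n u) < 0 &
    forall m, m \in ms -> lorentz x m <> 0].
Proof.
move=> fx0 x0e x0n; elim: ms => [|m ms IH] hm; first by exists x0; split.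
have [x [fx xe xn xm]] : exists x, [/\ future x, lorentz x e = 0,
    forall u, Q u -> lorentz x (n u) < 0 &
    forall m, m \in ms -> lorentz x m <> 0].
  by apply: IH => m' m'ms; apply: hm; rewrite inE m'ms orbT.
have [y ye ym] := hm m (mem_head _ _).
have [E|/eqP nE] := eqVneq (lorentz x m) 0; last first.
  by exists x; split=> // m'; rewrite inE => /orP[/eqP->//|/xm].
have [t1 t10 h1] := future_small y fx.
have [t2 t20 h2] : exists2 t : R, 0 < t & forall u s, 0 < s <= t ->
    Q u -> lorentz x (n u) + s * lorentz y (n u) < 0.
  apply: fin_small => u; have [Qu|_] := boolP (Q u); last by exists 1.
  have [t t0 ht] := affine_small (lorentz y (n u)) (xn _ Qu).
  by exists t => // s /ht.
have [t3 t30 h3] : exists2 t : R, 0 < t & forall (u : 'I_(size ms)) s,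
    0 < s <= t -> lorentz x (nth 0 ms u) + s * lorentz y (nth 0 ms u) <> 0.
  apply: fin_small => u; have /xm/eqP := mem_nth 0 (ltn_ord u).
  rewrite neq_lt => /orP[a0|a0].
    have [t t0 ht] := affine_small (lorentz y (nth 0 ms u)) a0.
    by exists t => // s /ht h E'; move: h; rewrite E' ltxx.
  have a0' : - lorentz x (nth 0 ms u) < 0 by rewrite oppr_lt0.
  have [t t0 ht] := affine_small (- lorentz y (nth 0 ms u)) a0'.
  by exists t => // s /ht; rewrite mulrN -opprD oppr_lt0 => h E'; move: h; rewrite E' ltxx.
pose t := Num.min t1 (Num.min t2 t3).
have tt : 0 < t by rewrite !lt_min t10 t20.
have tt1 : 0 < t <= t1 by rewrite tt ge_min lexx.
have tt2 : 0 < t <= t2 by rewrite tt !ge_min lexx orbT.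
have tt3 : 0 < t <= t3 by rewrite tt !ge_min lexx !orbT.
exists (x + t *: y); split; first exact: h1.
- by rewrite !lorentzL xe ye mulr0 addr0.
- by move=> u Qu; rewrite !lorentzL; exact: h2.
- move=> m'; rewrite inE => /orP[/eqP->|m'ms].
    rewrite !lorentzL E add0r => /eqP; rewrite mulf_eq0 gt_eqF//= => /eqP; exact: ym.
  rewrite !lorentzL.
  have im : (index m' ms < size ms)%N by rewrite index_mem.
  by have := h3 (Ordinal im) t tt3; rewrite /= nth_index.
Qed.

Lemma future_normalize x : future x ->
  exists2 a : R, 0 < a & hyperboloid (a *: x).
Proof.
move=> [xx x0]; have p : 0 < Num.sqrt (- lorentz x x) by rewrite sqrtr_gt0 oppr_gt0.
exists (Num.sqrt (- lorentz x x))^-1; first by rewrite invr_gt0.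
split; last by rewrite linearZ/= mxE mulr_gt0 ?invr_gt0.
rewrite !lorentzL mulrA -invfM -expr2 sqr_sqrtr ?oppr_ge0 ?ltW//.
by rewrite invrN mulNr mulVf// lt_eqF.
Qed.

End lorentz_perturbation.

Lemma acos_pi2 (R : realType) (c : R) : acos c = pi / 2 -> c = 0.
Proof.
move=> h; have p := pi_gt0 R.
have [c1|c1] := boolP (-1 <= c <= 1).
  by rewrite -(acosK c1) h cos_pihalf.
(* Outside [[-1, 1]] no angle has cosine [c], and [acos] takes its default value 0, which is not
   [pi / 2]. *)
move: h; rewrite unlock; case: xgetP => [y _ [/= y1 y2]|_].
  move: c1; rewrite -y2 cos_geN1 cos_le1//.
by move=> /eqP; rewrite eq_sym mulf_eq0 invr_eq0 gt_eqF//= pnatr_eq0.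
Qed.

Section polytope_normals.
Variables (R : realType) (d : nat) (P : right_angled_polytope R d).
Local Notation vec := 'cV[R]_(d + 1).
Local Notation e := (normal (r := P)).
Implicit Types x y z : vec.

Definition cone z := future z /\ forall u, lorentz z (e u) <= 0.

Definition adjacent (s t : facet P) := exists2 x, polytope_set P x &
  forall u, wall (e u) x <-> u = s \/ u = t.

Lemma adjacent_orth s t : s <> t -> adjacent s t -> lorentz (e s) (e t) = 0.
Proof.
move=> st ad; have := right_angles st ad; rewrite /dihedral_angle => /acos_pi2.
by move=> /eqP; rewrite oppr_eq0 => /eqP.
Qed.

Lemma cone_polytope z : cone z -> exists2 a, 0 < a & polytope_set P (a *: z).
Proof.
move=> [fz hz]; have [a a0 Ha] := future_normalize fz; exists a => //.
split=> // u _; rewrite /half_space/= lorentzZl pmulr_rle0//; exact: hz.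
Qed.

Lemma polytope_cone z : polytope_set P z -> cone z.
Proof.
move=> [Hz hz]; split; first exact: hyperboloid_future.
by move=> u; exact: (hz u I).
Qed.

Lemma future_origin : future (origin R d).
Proof.
split; last by rewrite /tm /origin col_mxKd mxE eqxx.
by rewrite lorentzE /sp /tm /origin col_mxKu col_mxKd dot0l !mxE eqxx !mulr1n mulr1 sub0r ltrN10.
Qed.

Lemma facet_point s : exists x, [/\ future x, lorentz x (e s) = 0 &
  forall u, u != s -> lorentz x (e u) < 0].
Proof.
have [x /polytope_cone[fx hx] hw] := facet_codim1 s; exists x; split=> //.
  by apply/(hw s).
move=> u us; rewrite lt_neqAle hx andbT; apply: contra us => /eqP.
by move/(hw u)/eqP.
Qed.

Lemma orth_nondeg s (m : vec) : (forall y, lorentz y (e s) = 0 -> lorentz y m = 0) ->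
  m = lorentz m (e s) *: e s.
Proof.
move=> h; apply/eqP; rewrite -subr_eq0; apply/eqP/lorentz_nondeg => y.
have := h (y - lorentz y (e s) *: e s); rewrite !lorentzL normal_unit mulr1 subrr.
by move=> /(_ erefl); rewrite (lorentzC (e s)) mulrC.
Qed.

(** At a relatively interior point of the facet [u] or [v], chosen by the sign of [c], the two sides
    have incompatible signs. *)
Lemma normal_indep s u v (a b c : R) : 0 < a -> 0 < b -> u != v ->
  u != s -> v != s -> a *: e u - b *: e v = c *: e s -> False.
Proof.
move=> a0 b0 uv us vs E.
have [c0|c0] := leP 0 c.
  have [y [fy yu yn]] := facet_point u.
  have := congr1 (lorentz y) E; rewrite !lorentzL yu mulr0 add0r.
  have := yn v; rewrite eq_sym uv => /(_ isT).
  have := yn s; rewrite eq_sym us => /(_ isT); nra.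
have [y [fy yu yn]] := facet_point v.
have := congr1 (lorentz y) E; rewrite !lorentzL yu mulr0 subr0.
have := yn u uv; have := yn s; rewrite eq_sym vs => /(_ isT); nra.
Qed.

(** Inside its wall a facet is cut out by its neighbours. If [z] violated another condition, the way
    to [z] from a generic point of the facet would first leave the polytope through a single further
    wall; the exit point shows that this wall is adjacent to [s], where [z] was assumed to be on the
    right side. *)
Lemma facet_cone s z : future z -> lorentz z (e s) = 0 ->
  (forall u, u != s -> adjacent s u -> lorentz z (e u) <= 0) -> cone z.
Proof.
move=> fz zs hz; split=> // v0; rewrite leNgt; apply/negP => zv0.
have [x0 [fx0 x0s x0n]] := facet_point s.
pose m u v := lorentz z (e v) *: e u - lorentz z (e u) *: e v.
pose ms := [seq m p.1 p.2 | p : facet P * facet P in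
  [pred p | [&& p.1 != p.2, 0 < lorentz z (e p.1) & 0 < lorentz z (e p.2)]]].
have zNs u : 0 < lorentz z (e u) -> u != s.
  by move=> zu; apply/negP => /eqP us; move: zu; rewrite us zs ltxx.
have [|x [fx xs xn xm]] := @generic_perturbation _ _ _ e (predC1 s) (e s) ms x0
    fx0 x0s x0n.
  move=> m' /mapP[[u v]]; rewrite mem_enum => /and3P[/= uv zu zv] ->.
  apply: contrapT => hn.
  have /orth_nondeg : forall y, lorentz y (e s) = 0 -> lorentz y (m u v) = 0.
    by move=> y ys; apply: contrapT => ym; apply: hn; exists y.
  by apply: normal_indep => //; exact: zNs.
(* The wall with the least ratio is the first one crossed between [x] and [z], at the point [p]
   below. By [xm] no second wall is crossed at the same moment. *)
pose r u := - lorentz x (e u) / lorentz z (e u).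
have [u zu umin] : exists2 u, 0 < lorentz z (e u) &
    forall v, 0 < lorentz z (e v) -> r u <= r v.
  by case: (arg_minP (P := [pred u | 0 < lorentz z (e u)]) r zv0) => u zu um; exists u.
have us := zNs _ zu.
have xu : lorentz x (e u) < 0 by exact: xn.
pose p := lorentz z (e u) *: x - lorentz x (e u) *: z.
have fp : future p.
  by rewrite /p -scaleNr; apply: futureD; apply: futureZ => //; rewrite oppr_gt0.
have ps : lorentz p (e s) = 0 by rewrite /p !lorentzL xs zs !mulr0 subrr.
have pu : lorentz p (e u) = 0 by rewrite /p !lorentzL mulrC subrr.
have pn w : w != s -> w != u -> lorentz p (e w) < 0.
  move=> ws wu; have xw : lorentz x (e w) < 0 by exact: xn.
  rewrite /p !lorentzL.
  have [zw|zw] := leP (lorentz z (e w)) 0; first by nra.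
  have /eqP : lorentz x (m w u) <> 0.
    by apply: xm; apply/mapP; exists (w, u) => //=; rewrite mem_enum inE/= wu zw zu.
  rewrite /m !lorentzL => xm0; rewrite lt_neqAle [X in _ - X]mulrC xm0 /=.
  have := umin w zw; rewrite /r ler_pdivrMr// mulrAC ler_pdivlMr//; lra.
have /hz : adjacent s u.
  have [|a a0 Pp] := @cone_polytope p.
    split=> // w; have [->|ws] := eqVneq w s; first by rewrite ps.
    by have [->|wu] := eqVneq w u; [rewrite pu|exact/ltW/pn].
  exists (a *: p) => // w; rewrite /wall/= lorentzZl; split.
    move/eqP; rewrite mulf_eq0 gt_eqF//= => pw.
    have [->|ws] := eqVneq w s; first by left.
    have [->|wu] := eqVneq w u; first by right.
    by move: (pn w ws wu); rewrite lt_neqAle pw.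
  by case=> ->; rewrite ?ps ?pu mulr0.
by move=> /(_ us); rewrite leNgt zu.
Qed.

Definition wproj s y := y - lorentz y (e s) *: e s.

(** Right angles are used here: removing the [e s] component does not change the product with the
    normal of an adjacent facet, and [facet_cone] takes care of the remaining facets. *)
Lemma cone_wproj s y : cone y -> cone (wproj s y).
Proof.
move=> [fy hy]; have [yy _] := fy; have := sqr_ge0 (lorentz y (e s)) => s0.
apply: (@facet_cone s).
- apply: (futureP fy); rewrite /wproj !lorentzL ?normal_unit.
    by rewrite (lorentzC (e s)); nra.
  by nra.
- by rewrite /wproj !lorentzL normal_unit mulr1 subrr.
- move=> u us ad; rewrite /wproj !lorentzL (adjacent_orth _ ad); last exact/nesym/eqP.
  by rewrite mulr0 subr0; exact: hy.
Qed.

(** Points of the facets [s] and [t] force [a] and [b] to be positive, which contradicts a point of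
    the facet [u]. *)
Lemma normal_span s t u (a b : R) : u != s -> u != t -> s != t ->
  e u = a *: e s + b *: e t -> False.
Proof.
move=> us ut st E.
have [x [fx xu xn]] := facet_point u.
have [y [fy ys yn]] := facet_point s.
have [z [fz zt zn]] := facet_point t.
have := congr1 (lorentz x) E; have := congr1 (lorentz y) E.
have := congr1 (lorentz z) E.
have := congr1 (lorentz (origin R d)) E.
rewrite !lorentzL xu ys zt !mulr0 add0r addr0.
have := origin_interior u; have := origin_interior s; have := origin_interior t.
have := yn u us; have := zn u ut; have := xn s; rewrite eq_sym us => /(_ isT).
have := xn t; rewrite eq_sym ut => /(_ isT).
have := yn t; rewrite eq_sym st => /(_ isT).
have := zn s st.
set o1 := lorentz _ _; set o2 := lorentz _ _; set o3 := lorentz _ _.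
set o4 := lorentz _ _; set o5 := lorentz _ _; set o6 := lorentz _ _.
move=> h1 h2 h3 h4 h5 h6 h7 h8 E1 E2 E3 E4.
have a0 : 0 < a by nra.
have b0 : 0 < b by nra.
nra.
Qed.

(** Alternating projections onto the two walls stay in the cone by [cone_wproj] and converge to the
    projection [q y0] onto their intersection, which therefore meets the polytope. *)
Lemma normal_meet s t : s != t -> `|lorentz (e s) (e t)| < 1 -> adjacent s t.
Proof.
move=> st; set c := lorentz (e s) (e t) => c1.
have c2 : 0 < 1 - c ^+ 2.
  rewrite subr_gt0 -real_normK ?num_real// expr_lt1//.
pose al v := (lorentz v (e s) - c * lorentz v (e t)) / (1 - c ^+ 2).
pose be v := (lorentz v (e t) - c * lorentz v (e s)) / (1 - c ^+ 2).
pose q v := v - (al v *: e s + be v *: e t).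
have ss := normal_unit s; have tt := normal_unit t.
have qs v : lorentz (q v) (e s) = 0.
  rewrite /q /al /be !lorentzL ss (lorentzC (e t)) -/c; field; exact: lt0r_neq0.
have qt v : lorentz (q v) (e t) = 0.
  rewrite /q /al /be !lorentzL tt -/c; field; exact: lt0r_neq0.
have qC y v : lorentz (q y) v = lorentz y (q v).
  rewrite /q !lorentzL /al /be (lorentzC v (e s)) (lorentzC v (e t)).
  by field; exact: lt0r_neq0.
(* A generic starting point, so that [q y0] lies on no third wall. The constraint vector is 0, which
   leaves the point free to move in all directions. *)
have [|y0 [fy0 _ y0n y0m]] := @generic_perturbation _ _ _ e predT 0
    [seq q (e u) | u in [pred u | (u != s) && (u != t)]] (origin R d)
    future_origin (lorentz0r _) (fun u _ => origin_interior u).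
  move=> m' /mapP[u]; rewrite mem_enum => /andP[us ut] ->; apply: contrapT => hn.
  have : q (e u) = 0.
    by apply: lorentz_nondeg => y; apply: contrapT => yq; apply: hn; exists y; rewrite ?lorentz0r.
  move/eqP; rewrite subr_eq0 => /eqP; exact: normal_span.
have cy0 : cone y0 by split=> // u; apply/ltW/y0n.
pose b := be y0.
have step x a b' : lorentz x (e s) = 0 -> lorentz x (e t) = 0 ->
    cone (x + a *: e s + b' *: e t) ->
    cone (x + - (c * b') *: e s + (b' * c ^+ 2) *: e t).
  move=> xs xt /(cone_wproj s)/(cone_wproj t); rewrite /wproj.
  rewrite !lorentzL ss tt xs xt (lorentzC (e t)) -/c; congr cone.
  by apply/colP => i; rewrite !mxE; ring.
(* One round of two projections multiplies the offset from [q y0] by [c ^+ 2], which is below 1. *)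
have itr k : cone (q y0 + (- (c * (b * (c ^+ 2) ^+ k))) *: e s + (b * (c ^+ 2) ^+ k.+1) *: e t).
  elim: k => [|k IH]; last by have := step _ _ _ (qs y0) (qt y0) IH; rewrite -mulrA -exprSr.
  rewrite expr0 mulr1 expr1; apply: (step _ (al y0)) => //.
  by have -> : q y0 + al y0 *: e s + b *: e t = y0 by rewrite /q -addrA subrK.
have xle u : lorentz (q y0) (e u) <= 0.
  rewrite leNgt; apply/negP => h.
  pose K := c * b * lorentz (e s) (e u) - b * c ^+ 2 * lorentz (e t) (e u).
  have [k hk] := @geometric_small _ (c ^+ 2) K _ (sqr_ge0 c) (eq_ind _ (fun b => is_true b) c2 _ (subr_gt0 _ _)) h.
  have [_ /(_ u)] := itr k.
  rewrite (lorentzDl (_ + _)) (lorentzDl (q y0)) !lorentzZl (exprS (c ^+ 2) k).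
  move: hk h; rewrite /K; set A := lorentz (q y0) (e u).
  set r := (c ^+ 2) ^+ k; lra.
have fx : future (q y0).
  have [yy _] := fy0.
  have qqE : lorentz (q y0) (q y0) = lorentz (q y0) y0.
    have qq v : q (q v) = q v.
      by rewrite {1}/q /al /be !qs !qt !mulr0 subrr mul0r !scale0r addr0 subr0.
    by rewrite qC qq lorentzC.
  have qq : lorentz (q y0) y0 <= lorentz y0 y0.
    rewrite [q y0]/q lorentzBl lorentzDl !lorentzZl (lorentzC (e s)) (lorentzC (e t)).
    have -> : al y0 * lorentz y0 (e s) + be y0 * lorentz y0 (e t) =
      ((lorentz y0 (e s) - c * lorentz y0 (e t)) ^+ 2 / (1 - c ^+ 2) +
       lorentz y0 (e t) ^+ 2).
      by rewrite /al /be; field; exact: lt0r_neq0.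
    rewrite gerBl addr_ge0 ?sqr_ge0// divr_ge0 ?sqr_ge0//; exact: ltW.
  apply: (futureP fy0); first by rewrite qqE; exact: le_lt_trans qq yy.
  by rewrite lorentzC; exact: le_lt_trans qq yy.
have [a a0 Pq] := @cone_polytope (q y0) (conj fx xle).
exists (a *: q y0) => // u; rewrite /wall/= lorentzZl; split.
  move/eqP; rewrite mulf_eq0 gt_eqF//= => /eqP qu.
  have [->|us] := eqVneq u s; first by left.
  have [->|ut] := eqVneq u t; first by right.
  exfalso; apply: (y0m (q (e u))); last by rewrite -qC.
  by apply/mapP; exists u => //; rewrite mem_enum inE us.
by case=> ->; rewrite ?qs ?qt mulr0.
Qed.

(** A product [c] of at least 1 would nest the half-spaces: [e t - c *: e s] and [e s - c *: e t]
    would both be causal and negative at the origin, which is impossible because the origin is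
    negative on both normals. *)
Lemma normal_dichotomy s t : s != t ->
  lorentz (e s) (e t) = 0 \/ lorentz (e s) (e t) <= -1.
Proof.
move=> st; have [h|h] := ltP `|lorentz (e s) (e t)| 1.
  by left; apply: adjacent_orth (normal_meet st h); exact/eqP.
right; have [//|h'] := leP (lorentz (e s) (e t)) (-1).
have {h h'} : 1 <= lorentz (e s) (e t).
  by move: h; rewrite ler_normr => /orP[//|]; lra.
set c := lorentz (e s) (e t) => c1; exfalso.
have ss := normal_unit s; have tt := normal_unit t.
have [x [fx xs xn]] := facet_point s.
have [y [fy yt yn]] := facet_point t.
have fo := future_origin.
have xt : lorentz x (e t) < 0 by apply: xn; rewrite eq_sym.
have ys : lorentz y (e s) < 0 by exact: yn.
have h1 : lorentz (origin R d) (e t - c *: e s) < 0.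
  apply: (causal_future fx fo).
    by rewrite !lorentzL ss tt (lorentzC (e t)) -/c; nra.
  by rewrite !lorentzL xs mulr0 subr0.
have h2 : lorentz (origin R d) (e s - c *: e t) < 0.
  apply: (causal_future fy fo).
    by rewrite !lorentzL ss tt (lorentzC (e t)) -/c; nra.
  by rewrite !lorentzL yt mulr0 subr0.
move: h1 h2; rewrite !lorentzL.
have := origin_interior s; have := origin_interior t; nra.
Qed.

End polytope_normals.

(** * The Weyl group *)

Section weyl_group_theory.
Variables (R : realType) (d : nat) (P : right_angled_polytope R d).
Local Notation vec := 'cV[R]_(d + 1).
Local Notation mat := 'M[R]_(d + 1).
Local Notation e := (normal (r := P)).
Local Notation ev := (@eval_word R d P).
Local Notation W := (weyl P).
Local Notation len := (word_length P).
Implicit Types (x y z v : vec) (g h w : mat) (s t u : facet P).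

Lemma reflE s x : refl s *m x = x - 2 * lorentz x (e s) *: e s.
Proof. exact: reflection_mxE. Qed.

Lemma reflK s : refl s *m refl s = 1%:M.
Proof. exact/reflectionK/normal_unit. Qed.

Lemma mul_reflK s g : refl s *m (refl s *m g) = g.
Proof. by rewrite mulmxA reflK mul1mx. Qed.

Lemma refl_mulK s g : g *m refl s *m refl s = g.
Proof. by rewrite -mulmxA reflK mulmx1. Qed.

Lemma refl_normal s : refl s *m e s = - e s.
Proof.
by rewrite reflE normal_unit mulr1 (_ : 2 = 1 + 1)// scalerDl scale1r opprD addNKr.
Qed.

Lemma eval_cat a b : ev (a ++ b) = ev a *m ev b.
Proof. by elim: a => [|s a IH] /=; rewrite ?mul1mx// IH mulmxA. Qed.

Lemma eval_rcons a s : ev (rcons a s) = ev a *m refl s.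
Proof. by rewrite -cats1 eval_cat /= mulmx1. Qed.

Lemma weyl_eval a : W (ev a).
Proof. by exists a. Qed.

Lemma weyl1 : W 1%:M.
Proof. by exists [::]. Qed.

Lemma weyl_refl s : W (refl s).
Proof. by exists [:: s] => //=; rewrite mulmx1. Qed.

Lemma weylM g h : W g -> W h -> W (g *m h).
Proof. by move=> [a _ <-] [b _ <-]; exists (a ++ b) => //; rewrite eval_cat. Qed.

Lemma eval_revK a : ev (rev a) *m ev a = 1%:M.
Proof.
elim: a => [|s a IH]; first by rewrite mulmx1.
by rewrite rev_cons eval_rcons /= mulmxA refl_mulK.
Qed.

Lemma weyl_unit g : W g -> g \in unitmx.
Proof. by move=> [a _ <-]; have [] := mulmx1_unit (eval_revK a). Qed.

Lemma eval_rev a : ev (rev a) = invmx (ev a).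
Proof.
have u := weyl_unit (weyl_eval a).
by rewrite -[LHS]mulmx1 -(mulmxV u) mulmxA eval_revK mul1mx.
Qed.

Lemma weylV g : W g -> W (invmx g).
Proof. by move=> [a _ <-]; rewrite -eval_rev; exact: weyl_eval. Qed.

Lemma invmx_refl s : invmx (refl s) = refl s.
Proof.
have u := weyl_unit (weyl_refl s).
by rewrite -[LHS]mulmx1 -(reflK s) mulmxA mulVmx// mul1mx.
Qed.

Lemma invmxM g h : W g -> W h -> invmx (g *m h) = invmx h *m invmx g.
Proof.
move=> Wg Wh; have ug := weyl_unit Wg; have uh := weyl_unit Wh.
have ugh := weyl_unit (weylM Wg Wh).
have E : invmx h *m invmx g *m (g *m h) = 1%:M.
  by rewrite -mulmxA (mulmxA (invmx g)) mulVmx// mul1mx mulVmx.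
by rewrite -[RHS]mulmx1 -(mulmxV ugh) mulmxA E mul1mx.
Qed.

Lemma refl_lorentz s x y : lorentz (refl s *m x) (refl s *m y) = lorentz x y.
Proof. exact/lorentz_reflection/normal_unit. Qed.

Lemma weyl_lorentz g x y : W g -> lorentz (g *m x) (g *m y) = lorentz x y.
Proof.
move=> [a _ <-]; elim: a => [|s a IH] /=; first by rewrite !mul1mx.
by rewrite -!mulmxA refl_lorentz.
Qed.

Lemma weyl_future g x : W g -> future x -> future (g *m x).
Proof.
move=> [a _ <-] fx; elim: a => [|s a IH] /=; first by rewrite mul1mx.
by rewrite -mulmxA; apply: reflection_future => //; exact: normal_unit.
Qed.

Lemma weyl_hyperboloid g x : W g -> hyperboloid x -> hyperboloid (g *m x).
Proof.
move=> Wg Hx; have [_ h] := weyl_future Wg (hyperboloid_future Hx).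
by split=> //; rewrite weyl_lorentz//; case: Hx.
Qed.

Lemma weyl_hyp_dist g x y : W g ->
  hyp_dist (g *m x) (g *m y) = hyp_dist x y.
Proof. by move=> Wg; rewrite /hyp_dist weyl_lorentz. Qed.

Lemma weyl_lorentzVl g x y : W g -> lorentz (invmx g *m x) y = lorentz x (g *m y).
Proof.
by move=> Wg; rewrite -(weyl_lorentz _ _ Wg) mulmxA mulmxV ?weyl_unit// mul1mx.
Qed.

(** Some word represents [g], so a shortest one exists and the [get] in [word_length] never falls
    back on its default. *)
Lemma word_lengthP g : W g ->
  (exists2 a, ev a = g & size a = len g) /\ forall a, ev a = g -> (len g <= size a)%N.
Proof.
move=> [a _ ag]; rewrite /word_length; case: xgetP => [k _ [] //|].
have ex : exists k, `[< exists2 b, ev b = g & size b = k >].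
  by exists (size a); apply/asboolP; exists a.
case: (ex_minnP ex) => k /asboolP hk min /(_ k); case; split=> // b bg.
by apply: min; apply/asboolP; exists b.
Qed.

Lemma reduced_word g : W g -> exists2 a, ev a = g & size a = len g.
Proof. by case/word_lengthP. Qed.

Lemma len_eval a : (len (ev a) <= size a)%N.
Proof. by case: (word_lengthP (weyl_eval a)) => _; exact. Qed.

Lemma len1 : len 1%:M = 0%N.
Proof. by apply/eqP; rewrite -leqn0; exact: (len_eval [::]). Qed.

Lemma len_eq0 g : W g -> len g = 0%N -> g = 1%:M.
Proof.
by move=> /reduced_word[a <- <-] /size0nil ->.
Qed.

Lemma lenM g h : W g -> W h -> (len (g *m h) <= len g + len h)%N.
Proof.
move=> /reduced_word[a <- <-] /reduced_word[b <- <-].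
by rewrite -eval_cat -size_cat len_eval.
Qed.

Lemma lenV g : W g -> len (invmx g) = len g.
Proof.
have le h : W h -> (len (invmx h) <= len h)%N.
  by move=> /reduced_word[a <- <-]; rewrite -eval_rev -size_rev len_eval.
move=> Wg; apply/eqP; rewrite eqn_leq le//= -{1}(invmxK g) le//; exact: weylV.
Qed.

Lemma len_refl_le s : (len (refl s) <= 1)%N.
Proof. by have := len_eval [:: s]; rewrite /= mulmx1. Qed.

Lemma len_mulr_le g s : W g -> (len (g *m refl s) <= (len g).+1)%N.
Proof.
move=> Wg; rewrite -[leqRHS]addn1 (leq_trans (lenM Wg (weyl_refl s)))//.
by rewrite leq_add2l len_refl_le.
Qed.

Lemma len_mulr_ge g s : W g -> (len g <= (len (g *m refl s)).+1)%N.
Proof.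
move=> Wg; rewrite -{1}(refl_mulK s g); apply: len_mulr_le.
exact: weylM (weyl_refl s).
Qed.

(** The analogue of a positive root: such combinations of outward normals are nonpositive on the
    polytope. *)
Definition posroot v := exists2 a : facet P -> R,
  forall u, 0 <= a u & v = \sum_u a u *: e u.

Lemma posroot_normal s : posroot (e s).
Proof.
exists (fun u => (u == s)%:R); first by move=> u; exact: ler0n.
rewrite (bigD1 s)//= eqxx scale1r big1 ?addr0// => u /negbTE ->; exact: scale0r.
Qed.

Lemma posroot_lin a b v v' : 0 <= a -> 0 <= b -> posroot v -> posroot v' ->
  posroot (a *: v + b *: v').
Proof.
move=> a0 b0 [f f0 ->] [f' f'0 ->]; exists (fun u => a * f u + b * f' u).
  by move=> u; rewrite addr_ge0// mulr_ge0.
rewrite !scaler_sumr -big_split; apply: eq_bigr => u _.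
by rewrite scalerDl !scalerA.
Qed.

Lemma posroot_le0 x v : (forall u, lorentz x (e u) <= 0) -> posroot v ->
  lorentz x v <= 0.
Proof.
move=> hx [a a0 ->]; rewrite lorentz_sumr; apply: sumr_le0 => u _.
by rewrite lorentzZr mulr_ge0_le0.
Qed.

Lemma posroot_lt0 v : posroot v -> v != 0 -> lorentz (origin R d) v < 0.
Proof.
have o0 u : lorentz (origin R d) (e u) <= 0 by exact/ltW/origin_interior.
move=> [a a0 ->] v0; rewrite lt_neqAle posroot_le0 ?andbT//; last by exists a.
apply: contra_neq v0; rewrite lorentz_sumr => /eqP.
have h u : 0 <= - lorentz (origin R d) (a u *: e u).
  by rewrite oppr_ge0 lorentzZr mulr_ge0_le0// ltW// origin_interior.
rewrite -oppr_eq0 -sumrN psumr_eq0// => /allP z.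
apply: big1 => u _; have := z u (mem_index_enum u).
rewrite /= oppr_eq0 lorentzZr mulf_eq0 => /orP[/eqP ->|]; first by rewrite scale0r.
by rewrite lt_eqF// origin_interior.
Qed.

(* The alternating word of length [k] in [s] and [t] that ends with [t]. *)
Fixpoint alt t s (k : nat) : seq (facet P) :=
  if k is k'.+1 then (if odd k' then s else t) :: alt t s k' else [::].

Lemma size_alt t s k : size (alt t s k) = k.
Proof. by elim: k => //= k ->. Qed.

Lemma alt_suffix t s k : exists2 a, alt t s k.+2 = a ++ [:: s; t] & size a = k.
Proof.
elim: k => [|k [a E sa]]; first by exists [::].
exists ((if odd k.+2 then s else t) :: a); last by rewrite /= sa.
by rewrite -[LHS]/((if odd k.+2 then s else t) :: alt t s k.+2) E.
Qed.

(** The infinite dihedral case. The last clause says that the coefficient changed last is the larger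
    one; with a product of at most -1 the next reflection then keeps both nonnegative. *)
Lemma alt_root t s k : lorentz (e s) (e t) <= -1 ->
  exists a b, [/\ 0 <= a, 0 <= b, ev (alt t s k) *m e s = a *: e s + b *: e t &
    if odd k then a <= b else b <= a].
Proof.
move=> c1; elim: k => [|k [a [b [a0 b0 E le]]]].
  by exists 1, 0; split; rewrite ?ler01// mul1mx scale1r scale0r addr0.
rewrite /= -mulmxA E reflE; case: (odd k) le => /= le.
  exists (- a - 2 * lorentz (e s) (e t) * b), b; split=> //; [nra| |nra].
  rewrite ?lorentzL ?normal_unit ?(lorentzC (e t)).
  by apply/colP => i; rewrite !mxE; ring.
exists a, (- b - 2 * lorentz (e s) (e t) * a); split=> //; [nra| |nra].
rewrite !lorentzL normal_unit.
by apply/colP => i; rewrite !mxE; ring.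
Qed.

(** Induction on the length, as for root systems of Coxeter groups. The element [w] is split as [v']
    times an alternating word in [s] and [t], where neither letter shortens [v']. The induction
    hypothesis applies to [v'] with both letters, and a computation in rank two remains. *)
Lemma len_posroot_le w s : W w -> (len w <= len (w *m refl s))%N ->
  posroot (w *m e s).
Proof.
have [n] := ubnP (len w); elim: n w s => // n IH w s wn Ww ws.
have [w0|w0] := eqVneq (len w) 0%N.
  by rewrite (len_eq0 Ww w0) mul1mx; exact: posroot_normal.
have [t [v Wv [wE lv]]] : exists t, exists2 v, W v & w = v *m refl t /\ (len v).+1 = len w.
  have [a ag sa] := reduced_word Ww; case/lastP: a ag sa => [|a t ag sa].
    by move=> _ /= sa; move: w0; rewrite -sa.
  exists t, (ev a); first exact: weyl_eval.
  rewrite -ag eval_rcons; split=> //; apply/eqP; rewrite eqn_leq.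
  rewrite len_mulr_le ?andbT; last exact: weyl_eval.
  by rewrite -eval_rcons ag -sa size_rcons ltnS len_eval.
have st : s != t.
  apply/negP => /eqP st; move: ws.
  by rewrite [in X in (_ <= X)%N]wE -st refl_mulK -lv ltnn.
(* Possible lengths of an alternating suffix with additive lengths. A reduced word of [w] ending in
   [t] gives [Q 1], and maximality of [k] is what prevents [s] and [t] from shortening [v']. *)
pose Q k := `[< exists2 v, W v & w = v *m ev (alt t s k) /\ (len v + k = len w)%N >].
have Q1 : Q 1%N by apply/asboolP; exists v => //; rewrite /= mulmx1 (addn1 (len _)).
have Qb k : Q k -> (k <= len w)%N by move=> /asboolP[v' _ [_ <-]]; exact: leq_addl.
case: (ex_maxnP (ex_intro (fun k => is_true (Q k)) 1%N Q1) Qb) => k /asboolP[v' Wv' [wv' lv']] kmax.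
have k0 : (0 < k)%N by exact: kmax.
pose f j := if odd j then s else t.
have fk : (len v' <= len (v' *m refl (f k)))%N.
  rewrite leqNgt; apply/negP => lt.
  have : Q k.+1.
    apply/asboolP; exists (v' *m refl (f k)); first exact: weylM (weyl_refl _).
    rewrite /= -/(f k) mulmxA refl_mulK; split=> //; rewrite -lv' addnS -addSn.
    congr addn; apply/eqP; rewrite eqn_leq lt/=; exact: len_mulr_ge.
  by move/kmax; rewrite ltnn.
have fk1 : (len v' <= len (v' *m refl (f k.-1)))%N.
  rewrite leqNgt; apply/negP => lt.
  have : w = v' *m refl (f k.-1) *m ev (alt t s k.-1).
    by rewrite wv' -(prednK k0) /= mulmxA.
  move=> E; have := lenM (weylM Wv' (weyl_refl (f k.-1))) (weyl_eval (alt t s k.-1)).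
  rewrite -E; have := len_eval (alt t s k.-1); rewrite size_alt; lia.
have lv'w : (len v' < n)%N.
  by lia.
have [vs vt] : posroot (v' *m e s) /\ posroot (v' *m e t).
  have h1 : posroot (v' *m e (f k)) by exact: IH.
  have h2 : posroot (v' *m e (f k.-1)) by exact: IH.
  by move: h1 h2; rewrite /f -{1}(prednK k0) /=; case: odd.
rewrite wv' -mulmxA; have [c0|c1] := normal_dichotomy st; last first.
  have [a [b [a0 b0 -> _]]] := alt_root k c1.
  by rewrite mulmxDr -!scalemxAr; exact: posroot_lin.
have [k1|k2] : k = 1%N \/ (1 < k)%N.
  by case: (k) k0 => // -[|j]; [left|right].
  by rewrite k1 /= mulmx1 reflE c0 mulr0 scale0r subr0.
(* When the reflections commute, a suffix of length at least two ends in [s t]; since [s t s] equals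
   [t], the element [w *m refl s] would be shorter than [w]. *)
exfalso; have [a E sa] := alt_suffix t s k.-2.
have {}E : alt t s k = a ++ [:: s; t].
  by rewrite -E; case: (k) k2 => // -[].
have com : refl s *m refl t *m refl s = refl t.
  have ext A B : (forall x, A *m x = B *m x) -> A = B :> mat.
    move=> h; apply/matrixP => i j.
    by have := congr1 (fun M : vec => M i 0) (h (delta_mx j 0)); rewrite -!colE !mxE.
  apply: ext => x; rewrite -!mulmxA !reflE !lorentzL normal_unit (lorentzC (e t)) c0.
  by apply/colP => i; rewrite !mxE; ring.
move: ws; rewrite wv' E eval_cat /= mulmx1 -!mulmxA (mulmxA (refl s)) com.
rewrite leqNgt => /negP; apply.
have -> : v' *m (ev a *m (refl s *m refl t)) = w.
  by rewrite wv' E eval_cat /= mulmx1.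
have := lenM Wv' (weylM (weyl_eval a) (weyl_refl t)).
by have := len_eval (rcons a t); rewrite eval_rcons size_rcons sa; lia.
Qed.

Lemma posroot_sign w s : W w -> ~ (posroot (w *m e s) /\ posroot (- (w *m e s))).
Proof.
move=> Ww [h1 h2].
have n0 : w *m e s != 0.
  apply/eqP => E; have := weyl_lorentz (e s) (e s) Ww.
  by rewrite E lorentz0l normal_unit => /eqP; rewrite eq_sym oner_eq0.
have := posroot_lt0 h1 n0; have := posroot_lt0 h2; rewrite oppr_eq0 => /(_ n0).
by rewrite lorentzNr; lra.
Qed.

Lemma len_mulr w s : W w ->
  (len (w *m refl s) = (len w).+1 /\ posroot (w *m e s)) \/
  (len w = (len (w *m refl s)).+1 /\ posroot (- (w *m e s))).
Proof.
move=> Ww; have Wws := weylM Ww (weyl_refl s).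
have E : - (w *m e s) = w *m refl s *m e s.
  by rewrite -mulmxA refl_normal mulmxN.
have [h|h] := ltnP (len (w *m refl s)) (len w).
  right; split.
    by apply/eqP; rewrite eqn_leq h len_mulr_ge.
  by rewrite E; apply: len_posroot_le => //; rewrite refl_mulK ltnW.
have pr := len_posroot_le Ww h.
left; split=> //; apply/eqP; rewrite eqn_leq len_mulr_le//= ltn_neqAle h andbT.
apply/eqP => eq; apply: (posroot_sign Ww); split; first exact: pr.
by rewrite E; apply: len_posroot_le => //; rewrite refl_mulK eq.
Qed.

Lemma len_mull w s : W w ->
  (len (refl s *m w) = (len w).+1 /\ posroot (invmx w *m e s)) \/
  (len w = (len (refl s *m w)).+1 /\ posroot (- (invmx w *m e s))).
Proof.
move=> Ww; have := len_mulr s (weylV Ww).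
have -> : len (invmx w *m refl s) = len (refl s *m w).
  rewrite -{1}(invmx_refl s) -invmxM ?lenV//; last exact: weyl_refl.
  exact: (weylM (weyl_refl s) Ww).
by rewrite lenV.
Qed.

(** The root [invmx w *m e s] is either positive or negative, which puts the whole translate of the
    polytope by [w] on one side of the wall of [s]. The side is recorded by whether [s] shortens
    [w]. *)
Lemma len_side w s : W w ->
  [/\ len (refl s *m w) = (len w).+1, lorentz (w *m origin R d) (e s) < 0 &
      forall x, cone P x -> lorentz (w *m x) (e s) <= 0] \/
  [/\ len w = (len (refl s *m w)).+1, 0 < lorentz (w *m origin R d) (e s) &
      forall x, cone P x -> 0 <= lorentz (w *m x) (e s)].
Proof.
move=> Ww; have E x : lorentz (w *m x) (e s) = lorentz x (invmx w *m e s).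
  by rewrite lorentzC [RHS]lorentzC weyl_lorentzVl.
have n0 : invmx w *m e s != 0.
  apply/eqP => E0; have := weyl_lorentz (e s) (e s) (weylV Ww).
  by rewrite E0 lorentz0l normal_unit => /eqP; rewrite eq_sym oner_eq0.
have [[l pr]|[l pr]] := len_mull s Ww; [left|right]; split=> //.
- by rewrite E; exact: posroot_lt0.
- by move=> x [_ hx]; rewrite E; exact: posroot_le0.
- rewrite E -oppr_lt0 -lorentzNr; apply: posroot_lt0 => //; by rewrite oppr_eq0.
- by move=> x [_ hx]; rewrite E -oppr_le0 -lorentzNr; exact: posroot_le0.
Qed.

End weyl_group_theory.

(** * Geodesics and the tessellation *)

Section hyperbolic_segments.
Variables (R : realType) (d : nat).
Local Notation vec := 'cV[R]_(d + 1).
Implicit Types x y z c p q : vec.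
Local Notation H := (@hyperboloid R d).

Lemma future_lin (a b : R) x y : future x -> future y -> 0 < a -> 0 <= b ->
  future (a *: x + b *: y).
Proof.
move=> fx fy a0; rewrite le_eqVlt => /orP[/eqP <-|b0].
  by rewrite scale0r addr0; exact: futureZ.
by apply: futureD; exact: futureZ.
Qed.

Definition on_segment x y p := exists a b : R, [/\ 0 <= a, 0 <= b & p = a *: x + b *: y].

Lemma on_segment_hyp_dist x y p : H x -> H y -> H p -> on_segment x y p ->
  hyp_dist x p + hyp_dist p y = hyp_dist x y.
Proof. by move=> Hx Hy Hp [a [b [a0 b0 E]]]; exact: segment_split E. Qed.

Lemma expR2_ge4 : 4 <= expR 2 :> R.
Proof.
have -> : expR 2 = expR 1 * expR 1 :> R by rewrite -expRD; congr expR; lra.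
have h : 2 <= expR 1 :> R by apply: le_trans (expR_ge1Dx 1); lra.
by apply: (@le_trans _ _ (2 * 2)); [lra|rewrite ler_pM].
Qed.

Lemma sh_le_expR (a b : R) : 0 <= a -> sh b <= expR (- a) * sh (a + b).
Proof.
move=> a0; rewrite /sh opprD !expRD.
set u := expR a; have u0 : 0 < u by exact: expR_gt0.
have -> : expR (- a) = u^-1 by rewrite expRN.
set v := expR b; set v' := expR (- b); have v'0 : 0 < v' by exact: expR_gt0.
have -> : u^-1 * ((u * v - u^-1 * v') / 2) = (v - u^-1 ^+ 2 * v') / 2.
  by field; exact: lt0r_neq0.
have : u^-1 ^+ 2 <= 1.
  by rewrite expr_le1 ?invr_ge0 ?(ltW u0)// invf_le1// /u -(@expR0 R) ler_expR.
by set w := _ ^+ 2; nra.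
Qed.

Lemma hyp_segment x y (t : R) : H x -> H y -> 0 <= t <= hyp_dist x y ->
  exists p, [/\ H p, on_segment x y p,
    forall c, H c -> hyp_dist c p <= Num.max (hyp_dist c x - t)
      (hyp_dist c y - (hyp_dist x y - t)) + 2,
    hyp_dist x p = t & hyp_dist p y = hyp_dist x y - t].
Proof.
move=> Hx Hy; set L := hyp_dist x y => /andP[t0 tL].
have HL : ch L = - lorentz x y by exact: ch_hyp_dist.
have bound c p a b : H c -> H p -> 0 <= a -> 0 <= b -> a <= expR (- t) ->
    b <= expR (- (L - t)) -> p = a *: x + b *: y ->
    hyp_dist c p <= Num.max (hyp_dist c x - t) (hyp_dist c y - (L - t)) + 2.
  move=> Hc Hp a0 b0 at' bt E; rewrite -ler_expR.
  apply: (le_trans (expR_ch _)); rewrite ch_hyp_dist// E !lorentzL opprD -!mulrN.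
  rewrite -!ch_hyp_dist//; set M := Num.max _ _.
  have h1 : a * ch (hyp_dist c x) <= expR M.
    apply: (@le_trans _ _ (expR (- t) * expR (hyp_dist c x))).
      rewrite ler_pM// ?(le_trans ler01 (ch_ge1 _))//.
      by rewrite ch_expR// hyp_dist_ge0.
    by rewrite -expRD ler_expR addrC /M le_max lexx.
  have h2 : b * ch (hyp_dist c y) <= expR M.
    apply: (@le_trans _ _ (expR (- (L - t)) * expR (hyp_dist c y))).
      rewrite ler_pM// ?(le_trans ler01 (ch_ge1 _))//.
      by rewrite ch_expR// hyp_dist_ge0.
    by rewrite -expRD ler_expR addrC /M le_max lexx orbT.
  have e2 : 4 <= expR 2 :> R.
    exact: expR2_ge4.
  rewrite expRD; apply: (@le_trans _ _ (expR M * 4)).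
    by clear - h1 h2; lra.
  by rewrite ler_pM2l ?expR_gt0.
have L0 : 0 <= L by exact: hyp_dist_ge0.
(* The weights below divide by [sh L], so coinciding end points are treated apart. *)
have [Lz|Lp] := eqVneq L 0.
  have tz : t = 0 by lra.
  exists x; split=> //.
  - by exists 1, 0; rewrite ler01 lexx scale1r scale0r addr0.
  - move=> c Hc; apply: (bound c x 1 0) => //;
      by rewrite ?tz ?oppr0 ?expR0 ?expR_ge0 ?scale1r ?scale0r ?addr0.
  - by rewrite hyp_dist_id.
  - by rewrite tz subr0.
have {Lp}L1 : 0 < L by rewrite lt_neqAle eq_sym Lp.
have sL := sh_gt0 L1.
pose a := sh (L - t) / sh L; pose b := sh t / sh L.
have Lt0 : 0 <= L - t by lra.
have a0 : 0 <= a by rewrite divr_ge0// ?sh_ge0// ltW.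
have b0 : 0 <= b by rewrite divr_ge0// ?sh_ge0// ltW.
have [xx x0] := Hx; have [yy y0] := Hy.
have pp : lorentz (a *: x + b *: y) (a *: x + b *: y) = -1.
  rewrite !lorentzL xx yy (lorentzC y x).
  have -> : lorentz x y = - ch L by rewrite HL opprK.
  have E : sh (L - t) ^+ 2 + sh t ^+ 2 + 2 * sh (L - t) * sh t * ch L = sh L ^+ 2.
    have -> : L = (L - t) + t by lra.
    rewrite (addrK t) (chD (L - t)) (shD (L - t)).
    have := ch_sh (L - t); have := ch_sh t.
    set u := ch (L - t); set u' := sh (L - t); set v := ch t; set v' := sh t.
    move=> h1 h2.
    have -> : (u' * v + u * v') ^+ 2 =
      u' ^+ 2 * (v ^+ 2 - v' ^+ 2 + v' ^+ 2) + (u ^+ 2 - u' ^+ 2 + u' ^+ 2) * v' ^+ 2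
      + 2 * u' * v' * u * v by ring.
    by rewrite h1 h2; ring.
  rewrite /a /b; apply: (@mulIf _ (sh L ^+ 2)); first by rewrite expf_neq0// gt_eqF.
  rewrite mulN1r -[in RHS]E; field; exact: lt0r_neq0.
have fp : future (a *: x + b *: y).
  split; first by rewrite pp; lra.
  have ab : (0 < a) || (0 < b).
    rewrite !lt_neqAle a0 b0 !andbT -negb_and; apply/negP => /andP[/eqP az /eqP bz].
    by move: pp; rewrite -az -bz !scale0r addr0 lorentz0l => /eqP; rewrite eq_sym oppr_eq0 oner_eq0.
  rewrite /tm linearD !linearZ/= mxE [X in X + _]mxE [X in _ + X]mxE.
  have x0' := ltW x0; have y0' := ltW y0.
  case/orP: ab => h; [apply: ltr_wpDr|apply: ltr_wpDl].
  - exact: mulr_ge0.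
  - exact: mulr_gt0.
  - exact: mulr_ge0.
  - exact: mulr_gt0.
have Hp : H (a *: x + b *: y) by split=> //; case: fp.
have xp : hyp_dist x (a *: x + b *: y) = t.
  rewrite /hyp_dist !lorentzL xx; have -> : lorentz x y = - ch L by rewrite HL opprK.
  have -> : - (a * -1 + b * - ch L) = ch t; last by rewrite chK.
  by rewrite /a /b shD chN shN; field; exact: lt0r_neq0.
exists (a *: x + b *: y); split=> //.
- by exists a, b.
- move=> c Hc; apply: (bound c _ a b) => //.
    rewrite /a ler_pdivrMr//; have := @sh_le_expR t (L - t) t0.
    by rewrite (addrC t) subrK.
  rewrite /b ler_pdivrMr//; have := @sh_le_expR (L - t) t Lt0.
  by rewrite subrK.
- have := @segment_split _ _ x y _ a b Hx Hy Hp a0 b0 erefl; rewrite xp -/L; lra.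
Qed.

End hyperbolic_segments.

(** * The Weyl group on hyperbolic space: galleries, cocompactness and discreteness *)

Section weyl_action.
Variables (R : realType) (n : nat) (P : right_angled_polytope R n.+1).
Local Notation d := n.+1.
Local Notation vec := 'cV[R]_(d + 1).
Local Notation mat := 'M[R]_(d + 1).
Local Notation e := (normal (r := P)).
Local Notation W := (weyl P).
Local Notation len := (word_length P).
Local Notation H := (@hyperboloid R d).
Local Notation o := (origin R d).
Local Notation K := (polytope_set P).
Implicit Types (x y z p q a b : vec) (g h : mat) (s : facet P).

Lemma K_origin : K o.
Proof. exact: origin_in_polytope. Qed.

Lemma H_origin : H o.
Proof. by case: K_origin. Qed.

Lemma K_H x : K x -> H x.
Proof. by case. Qed.

Lemma K_le0 x s : K x -> lorentz x (e s) <= 0.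
Proof. by case=> _ /(_ s I). Qed.

Lemma KP x : H x -> (forall s, lorentz x (e s) <= 0) -> K x.
Proof. by move=> Hx h; split=> // s _; exact: h. Qed.

(** [q] is where the segment leaves the polytope, on the wall with the least crossing ratio. The
    last clause keeps [p] on the remaining segment after its start is moved to [q], as the induction
    in [geodesic_gallery] requires. *)
Lemma polytope_exit a p : K a -> H p -> ~ K p ->
  exists s q, [/\ K q, lorentz q (e s) = 0, 0 < lorentz p (e s),
    on_segment a p q & on_segment a p q /\
    forall b, on_segment a b p -> on_segment q b p].
Proof.
move=> Ka Hp nKp.
have [s0 ps0] : exists s, 0 < lorentz p (e s).
  apply: contrapT => h; apply: nKp; apply: KP => // s; rewrite leNgt.
  by apply/negP => ps; apply: h; exists s.
pose r u := - lorentz a (e u) / lorentz p (e u).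
have [u pu umin] : exists2 u, 0 < lorentz p (e u) &
    forall v, 0 < lorentz p (e v) -> r u <= r v.
  by case: (arg_minP (P := [pred u | 0 < lorentz p (e u)]) r ps0) => u zu um; exists u.
have au := K_le0 u Ka.
pose q := lorentz p (e u) *: a - lorentz a (e u) *: p.
have fa := hyperboloid_future (K_H Ka); have fp := hyperboloid_future Hp.
have fq : future q.
  by rewrite /q -scaleNr; apply: future_lin => //; rewrite oppr_ge0.
have qu : lorentz q (e u) = 0 by rewrite /q !lorentzL mulrC subrr.
have qn w : lorentz q (e w) <= 0.
  have aw := K_le0 w Ka; rewrite /q !lorentzL.
  have [pw|pw] := leP (lorentz p (e w)) 0; first by nra.
  have := umin w pw; rewrite /r ler_pdivrMr// mulrAC ler_pdivlMr//; lra.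
have [c c0 Kq] := cone_polytope (conj fq qn).
have seg : on_segment a p (c *: q).
  exists (c * lorentz p (e u)), (c * - lorentz a (e u)); split.
  - by rewrite mulr_ge0// ltW.
  - by rewrite mulr_ge0 ?oppr_ge0// ltW.
  - by rewrite /q scalerBr !scalerA mulrN scaleNr.
exists u, (c *: q); split=> //; first by rewrite lorentzZl qu mulr0.
split=> // b [al [be [al0 be0 E]]].
set A := lorentz p (e u) in pu q fq qu qn Kq seg *; pose B := - lorentz a (e u).
have B0 : 0 <= B by rewrite oppr_ge0.
have AB : 0 < A + al * B by rewrite ltr_wpDr// mulr_ge0.
exists (al / c / (A + al * B)), (be * A / (A + al * B)); split.
- by rewrite !divr_ge0// ltW.
- by rewrite divr_ge0// ?mulr_ge0// ltW.
- have qE : q = A *: a + B *: p by rewrite /q /B scaleNr.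
  have E' : al *: q + (be * A) *: b = (A + al * B) *: p.
    rewrite qE scalerDr !scalerA scalerDl {2}E !scalerDr !scalerA.
    by apply/colP => i; rewrite !mxE; ring.
  rewrite scalerA; have -> : al / c / (A + al * B) * c = (A + al * B)^-1 * al.
    by field; rewrite !gt_eqF.
  have -> : be * A / (A + al * B) = (A + al * B)^-1 * (be * A) by rewrite mulrC.
  rewrite -(scalerA _ al) -(scalerA _ (be * A)) -scalerDr E'.
  by rewrite scalerA mulVf ?gt_eqF// scale1r.
Qed.

Lemma on_segment_mul g a b p : on_segment a b p -> on_segment (g *m a) (g *m b) (g *m p).
Proof.
by move=> [al [be [h1 h2 ->]]]; exists al, be; rewrite mulmxDr !scalemxAr.
Qed.

Lemma on_segment_gt0 a b p s : on_segment a b p -> lorentz a (e s) <= 0 ->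
  0 < lorentz p (e s) -> 0 < lorentz b (e s).
Proof.
move=> [al [be [h1 h2 ->]]] ha; rewrite !lorentzL => hp.
by rewrite ltNge; apply/negP => hb; nra.
Qed.

Lemma refl_fix s q : lorentz q (e s) = 0 -> refl s *m q = q.
Proof. by move=> h; rewrite reflE h mulr0 scale0r subr0. Qed.

(* [u P] is a chamber through the point [p] of the segment from [a] to [w b]. *)
Lemma geodesic_gallery w a b p : W w -> K a -> K b -> H p ->
  on_segment a (w *m b) p ->
  exists u, [/\ W u, K (invmx u *m p) & (len u + len (invmx u *m w) = len w)%N].
Proof.
have [N] := ubnP (len w); elim: N w a p => // N IH w a p wN Ww Ka Kb Hp seg.
have [Kp|nKp] := pselect (K p).
  by exists 1%:M; split; rewrite ?invmx1 ?mul1mx ?len1//; exact: weyl1.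
have [s [q [Kq qs ps _ [_ /(_ _ seg) qseg]]]] := polytope_exit Ka Hp nKp.
have ws := on_segment_gt0 seg (K_le0 s Ka) ps.
have [[_ _ h]|[lw _ _]] := len_side s Ww.
  by have := h b (polytope_cone Kb); rewrite leNgt ws.
have Wsw := weylM (weyl_refl s) Ww.
have Hsp : H (refl s *m p) by apply: weyl_hyperboloid Hp; exact: weyl_refl.
have := on_segment_mul (refl s) qseg; rewrite (refl_fix qs) mulmxA => sseg.
have [|u [Wu Ku lu]] := IH _ q _ _ Wsw Kq Kb Hsp sseg; first by rewrite lw in wN.
have Wsu := weylM (weyl_refl s) Wu.
have E g : invmx (refl s *m u) *m g = invmx u *m (refl s *m g).
  by rewrite (invmxM (weyl_refl s) Wu) invmx_refl mulmxA.
have E' x : invmx (refl s *m u) *m x = invmx u *m (refl s *m x) :> vec.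
  by rewrite (invmxM (weyl_refl s) Wu) invmx_refl mulmxA.
exists (refl s *m u); rewrite E' E; split=> //.
apply/eqP; rewrite eqn_leq; apply/andP; split.
  have := lenM (weyl_refl s) Wu; have := len_refl_le s; rewrite lw -lu; lia.
have := lenM Wsu (weylM (weylV Wu) Wsw); rewrite -!mulmxA (mulmxA u) (mulmxV (weyl_unit Wu)).
by rewrite mul1mx mul_reflK.
Qed.

Lemma origin_margin : exists2 k : R, 0 < k & forall s, k <= - lorentz o (e s).
Proof.
have [|k k0 hk] := @fin_small R (facet P) (fun s (k : R) => k <= - lorentz o (e s)).
  move=> s; exists (- lorentz o (e s)); first by rewrite oppr_gt0 origin_interior.
  by move=> k /andP[].
by exists k => // s; apply: hk; rewrite k0 lexx.
Qed.

Lemma tm_lorentz x : - lorentz o x = tm x.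
Proof.
rewrite lorentzE /sp /origin col_mxKu dot0l sub0r opprK.
by rewrite /tm col_mxKd mxE eqxx mul1r.
Qed.

Lemma tm_ge1 x : H x -> 1 <= tm x.
Proof. by move=> Hx; rewrite -tm_lorentz; apply: hyperboloid_ge1 => //; exact: H_origin. Qed.

Lemma polytope_bounded : exists2 C : R, 1 <= C & forall x, K x -> tm x <= C.
Proof.
have [M [_ hM]] := compact_bounded (polytope_compact (r := P)).
exists (Num.max 1 (M + 1)); first by rewrite le_max lexx.
move=> x Kx; rewrite le_max; apply/orP; right.
have /(_ (M + 1)) := hM; rewrite ltrDl ltr01 => /(_ isT x Kx).
apply: le_trans; apply: le_trans (ler_norm _) _.
rewrite /tm mxE /Num.norm/= mx_normrE.
exact: (le_bigmax _ (fun i => `|x i.1 i.2|) (_, _)).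
Qed.

(** The segment from the origin to [y] leaves the polytope through a wall that [y] lies beyond by a
    definite amount, because the exit point has bounded height. Reflecting in this wall lowers the
    height by a definite amount. *)
Lemma cocompact_step : exists C k : R, [/\ 0 < k, 1 <= C & forall y, H y ->
  C < tm y -> exists s, tm (refl s *m y) <= tm y - k].
Proof.
have [k k0 hk] := origin_margin; have [C C1 hC] := polytope_bounded.
exists (2 * C ^+ 2), (k ^+ 2); split; [by rewrite exprn_gt0|by nra|].
move=> y Hy Cy; have Ko := K_origin.
have nKy : ~ K y by move/hC; nra.
have [s [q [Kq qs ys [a [b [a0 b0 qE]]] _]]] := polytope_exit Ko Hy nKy.
exists s; have [yy _] := Hy; have [oo _] := H_origin; have [Hq _] := Kq.
have [qq _] := Hq; have qC := hC _ Kq.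
have oy : lorentz o y = - tm y by rewrite -tm_lorentz opprK.
have tq : tm q = a + b * tm y by rewrite -tm_lorentz qE !lorentzL oo oy; ring.
have e1 : a ^+ 2 + b ^+ 2 + 2 * a * b * tm y = 1.
  by move: qq; rewrite qE !lorentzL oo yy (lorentzC y) oy; lra.
have e2 : a * - lorentz o (e s) = b * lorentz y (e s).
  by move: qs; rewrite qE !lorentzL; lra.
have ks := hk s.
have b1 : 0 < b.
  rewrite lt_neqAle b0 andbT; apply/eqP => bz; move: e1 e2; rewrite -bz.
  rewrite expr0n/= mul0r mulr0 mul0r !addr0 => a1 /eqP; rewrite mulf_eq0.
  case/orP => [/eqP az|/eqP]; last by lra.
  by move: a1; rewrite az expr0n => /eqP; rewrite eq_sym oner_eq0.
rewrite tq in qC.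
(* The exit point [a *: o + b *: y] has height at most [C], and [y] is higher than [2 * C ^+ 2], so
   [y] cannot outweigh the origin by more than a factor 2. Through [e2] this bounds
   [lorentz y (e s)] below. *)
have ab : b <= 2 * a.
  rewrite leNgt; apply/negP => h; move: (tm y) Cy qC e1 => c Cy qC e1.
  have c0 : 0 < c by nra.
  have h1 : (a + b * c) ^+ 2 <= C ^+ 2 by rewrite lerXn2r ?nnegrE//; nra.
  have h2 : (b * c) ^+ 2 <= C ^+ 2.
    by apply: le_trans h1; rewrite lerXn2r ?nnegrE//; nra.
  have h3 : 1 <= b ^+ 2 * (2 + c).
    have h3 : 0 <= b * c * (b - 2 * a) by rewrite !mulr_ge0 ?(ltW c0)//; lra.
    have h' : a ^+ 2 <= b ^+ 2 by rewrite lerXn2r ?nnegrE//; lra.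
    apply: (@le_trans _ _ (a ^+ 2 + b ^+ 2 + 2 * a * b * c)); first by rewrite e1.
    by clear - h3 h'; lra.
  have h4 : (b * c) ^+ 2 <= C ^+ 2 * (b ^+ 2 * (2 + c)) by nra.
  have b2 : 0 < b ^+ 2 by rewrite exprn_gt0.
  have h5 : c ^+ 2 <= C ^+ 2 * (2 + c).
    by rewrite -(@ler_pM2l _ (b ^+ 2))//; move: h4; rewrite exprMn; lra.
  have C2 : 1 <= C ^+ 2 by rewrite exprn_ege1.
  have h6 : 2 * C ^+ 2 * c < c ^+ 2 by rewrite expr2 ltr_pM2r.
  have : C ^+ 2 * c < C ^+ 2 * 2 by clear - h5 h6; lra.
  rewrite ltr_pM2l; last by clear - C2; lra.
  by clear - C2 Cy; lra.
have ysk : k <= 2 * lorentz y (e s).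
  rewrite -(@ler_pM2l _ b)//; nra.
rewrite -!tm_lorentz reflE !lorentzL; nra.
Qed.

Lemma cocompact : exists C : R, forall y, H y -> exists2 w, W w & tm (w *m y) <= C.
Proof.
have [C [k [k0 C1 st]]] := cocompact_step; exists C => y Hy.
suff : forall N y, H y -> tm y <= C + N%:R * k -> exists2 w, W w & tm (w *m y) <= C.
  move=> /(_ (Num.truncn (`|tm y| / k)).+1 y Hy); apply.
  have := real_truncnS_gt (num_real (`|tm y| / k)); rewrite ltr_pdivrMr// => h.
  by have := ler_norm (tm y); lra.
elim=> [|N IH] {Hy}z Hz hz.
  by exists 1%:M; [exact: weyl1|move: hz; rewrite mul0r addr0 mul1mx].
have [zC|zC] := leP (tm z) C; first by exists 1%:M; [exact: weyl1|rewrite mul1mx].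
have [s hs] := st z Hz zC.
have [||w Ww hw] := IH (refl s *m z).
- by apply: weyl_hyperboloid Hz; exact: weyl_refl.
- by move: hz; rewrite -natr1 mulrDl mul1r; lra.
- by exists (w *m refl s); [exact: weylM (weyl_refl s)|rewrite -mulmxA].
Qed.

(** After a translation one point is the origin, which lies at a definite distance from a wall
    separating the two. The reversed Cauchy-Schwarz inequality for their projections to the wall
    gives the bound, and lying on opposite sides only increases [- lorentz]. *)
Lemma orbit_separated : exists2 k : R, 1 < k &
  forall u v, W u -> W v -> u != v -> k <= - lorentz (u *m o) (v *m o).
Proof.
have [k k0 hk] := origin_margin; exists (Num.sqrt (1 + k ^+ 2)).
  by rewrite -[ltLHS]sqrtr1 ltr_sqrt ?ltrDl ?exprn_gt0// ltr_wpDr// sqr_ge0.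
move=> u v Wu Wv uv; pose w := invmx u *m v.
have Ww : W w by apply: weylM Wv; exact: weylV.
have -> : lorentz (u *m o) (v *m o) = lorentz o (w *m o).
  by rewrite lorentzC -(weyl_lorentzVl _ _ Wu) mulmxA lorentzC.
have [s hs] : exists s, 0 < lorentz (w *m o) (e s).
  have [a ag sa] := reduced_word Ww; case: a ag sa => [|s a] ag sa.
    move: uv; rewrite -(mulmx1 u) [X in u *m X](_ : _ = w) ?ag//.
    by rewrite /w mulmxA (mulmxV (weyl_unit Wu)) mul1mx eqxx.
  exists s; have [[l _ _]|[_ //]] := len_side s Ww.
  move: l; rewrite -{1}ag /= mul_reflK -sa => l.
  by have := len_eval (P := P) a; rewrite l /=; lia.
have Hw : H (w *m o) by exact: (weyl_hyperboloid Ww H_origin).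
move: (w *m o) Hw hs => y Hy ys; have [yy _] := Hy; have [oo _] := H_origin.
have ks := hk s; have ss := normal_unit s.
pose o' := o - lorentz o (e s) *: e s; pose y' := y - lorentz y (e s) *: e s.
have fo : future o by exact: hyperboloid_future H_origin.
have fy : future y by exact: hyperboloid_future.
have oo' : lorentz o' o' = - 1 - lorentz o (e s) ^+ 2.
  by rewrite /o' !lorentzL oo ss (lorentzC (e s)); ring.
have yy' : lorentz y' y' = - 1 - lorentz y (e s) ^+ 2.
  by rewrite /y' !lorentzL yy ss (lorentzC (e s)); ring.
have oy' : lorentz o' y' = lorentz o y - lorentz o (e s) * lorentz y (e s).
  by rewrite /o' /y' !lorentzL ss (lorentzC (e s)); ring.
have fo' : future o'.
  apply: (futureP fo); first by rewrite oo'; have := sqr_ge0 (lorentz o (e s)); lra.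
  by rewrite /o' !lorentzL oo -expr2; have := sqr_ge0 (lorentz o (e s)); lra.
have fy' : future y'.
  apply: (futureP fy); first by rewrite yy'; have := sqr_ge0 (lorentz y (e s)); lra.
  by rewrite /y' !lorentzL yy -expr2; have := sqr_ge0 (lorentz y (e s)); lra.
have := reverse_CS y' fo'; have := future_lt0 fo' fy'.
rewrite oo' yy' oy' => neg rcs.
have le1 : Num.sqrt (1 + k ^+ 2) <= - (lorentz o y - lorentz o (e s) * lorentz y (e s)).
  rewrite -[leRHS]ger0_norm; last by lra.
  rewrite -sqrtr_sqr ler_wsqrtr// sqrrN; apply: le_trans rcs.
  set a := lorentz o (e s) in ks *; set b := lorentz y (e s).
  have : k ^+ 2 <= a ^+ 2 by rewrite -(sqrrN a) lerXn2r ?nnegrE//; lra.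
  have := sqr_ge0 b; nra.
apply: le_trans le1 _; nra.
Qed.

Lemma dot_tm x : H x -> dot (sp x) (sp x) = tm x ^+ 2 - 1.
Proof. by case=> + _; rewrite lorentzE -expr2; lra. Qed.

Lemma orbit_finite (C : R) : finite_set [set w | W w /\ tm (w *m o) <= C].
Proof.
have [k k1 hk] := orbit_separated.
(* The side of the grid cells: two orbit points in one cell would have [- lorentz] at most
   [1 + (k - 1) / 2], which is below [k]. *)
pose eta : R := Num.sqrt ((k - 1) / d%:R).
have eta0 : 0 < eta by rewrite sqrtr_gt0 divr_gt0 ?subr_gt0// ltr0n.
pose N := Num.truncn (2 * C / eta).
pose cell (w : mat) : {ffun 'I_d -> 'I_N.+1} :=
  [ffun i => inord (Num.truncn ((sp (w *m o) i 0 + C) / eta))].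
have coord w i : W w -> tm (w *m o) <= C -> - C <= sp (w *m o) i 0 <= C.
  move=> Ww wC; have Hw : H (w *m o) by exact: (weyl_hyperboloid Ww H_origin).
  have t1 := tm_ge1 Hw; rewrite -ler_norml -(@ler_pXn2r _ 2) ?nnegrE//; last by lra.
  have h : tm (w *m o) ^+ 2 <= C ^+ 2 by rewrite lerXn2r ?nnegrE//; lra.
  rewrite real_normK ?num_real//; apply: le_trans h; have := dot_tm Hw.
  rewrite /dot (bigD1 i)//= -expr2.
  have : 0 <= \sum_(j < d | j != i) sp (w *m o) j 0 * sp (w *m o) j 0.
    by apply: sumr_ge0 => j _; rewrite -expr2 sqr_ge0.
  by set q := \sum_(j < d | _) _; lra.
have cinj : {in [set w | W w /\ tm (w *m o) <= C] &, injective cell}.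
  move=> u v /set_mem/= [Wu uC] /set_mem/= [Wv vC] E; apply: contrapT => /eqP uv.
  have := hk u v Wu Wv uv; apply/negP; rewrite -ltNge.
  have Hu : H (u *m o) by exact: (weyl_hyperboloid Wu H_origin).
  have Hv : H (v *m o) by exact: (weyl_hyperboloid Wv H_origin).
  have [uu _] := Hu; have [vv _] := Hv.
  pose z := u *m o - v *m o.
  have zz : - lorentz (u *m o) (v *m o) = 1 + lorentz z z / 2.
    by rewrite /z !lorentzL uu vv (lorentzC (v *m o)); field.
  have zd : lorentz z z <= dot (sp z) (sp z).
    by rewrite lorentzE gerBl -expr2 sqr_ge0.
  have di i : (sp z i 0) ^+ 2 <= eta ^+ 2.
    have /(congr1 val) := congr1 (fun f : {ffun 'I_d -> 'I_N.+1} => f i) E.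
    have C0 : 0 <= C by have := tm_ge1 Hu; lra.
    have bd w : W w -> tm (w *m o) <= C -> 0 <= (sp (w *m o) i 0 + C) / eta <= 2 * C / eta.
      move=> Ww wC; have /andP[h1 h2] := coord w i Ww wC.
      rewrite divr_ge0 ?(ltW eta0)//=; last by lra.
      by rewrite ler_pM2r ?invr_gt0//; lra.
    have /andP[u0 u1] := bd u Wu uC; have /andP[v0 v1] := bd v Wv vC.
    rewrite !ffunE/= !inordK; last 2 first.
    - by rewrite ltnS le_truncn.
    - by rewrite ltnS le_truncn.
    move=> T; have := truncn_itv u0; have := truncn_itv v0; rewrite T.
    have -> : sp z i 0 = sp (u *m o) i 0 - sp (v *m o) i 0 by rewrite /sp /z !mxE.
    rewrite !ler_pdivlMr// !ltr_pdivrMr// -natr1.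
    set m := (Num.truncn _)%:R => /andP[a1 a2] /andP[b1 b2].
    have : `|sp (u *m o) i 0 - sp (v *m o) i 0| <= eta by rewrite ler_norml; lra.
    by rewrite -(@ler_pXn2r _ 2) ?nnegrE ?(ltW eta0)// real_normK ?num_real.
  have : dot (sp z) (sp z) <= d%:R * eta ^+ 2.
    rewrite /dot (_ : d%:R * eta ^+ 2 = \sum_(i < d) eta ^+ 2); last first.
      by rewrite sumr_const card_ord mulr_natl.
    by apply: ler_sum => i _; rewrite -expr2.
  rewrite sqr_sqrtr; last by rewrite divr_ge0// subr_ge0 ltW.
  by rewrite mulrCA divff ?pnatr_eq0// mulr1 zz; lra.
rewrite -(eq_finite_set (inj_card_eq cinj)).
exact: finite_finset.
Qed.

End weyl_action.

(** * The metric on chambers *)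

Section building_galleries.
Variables (R : realType) (d : nat) (P : right_angled_polytope R d).
Variable X : building P.
Local Notation W := (weyl P).
Local Notation len := (word_length P).
Local Notation ev := (@eval_word R d P).
Implicit Types (x y z : X) (g h u v w : 'M[R]_(d + 1)) (s t : facet P).

Lemma wdistxx x : wdist x x = 1%:M.
Proof. exact/wdist_eq1. Qed.

Lemma len_refl s : len (refl s) = 1%N.
Proof.
have [[]|[]] := len_mulr s (weyl1 P); rewrite !mul1mx len1 //.
Qed.

Lemma wdist_reflC x y s : wdist x y = refl s -> wdist y x = refl s.
Proof.
move=> xy; have [] := @wdist_step _ _ _ X x y x s xy; rewrite wdistxx => -[E|E] _.
  by rewrite -[LHS](mul_reflK s) -E mulmx1.
have yx : y = x by apply/wdist_eq1.
by have := len_refl s; rewrite -xy yx wdistxx len1.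
Qed.

Fixpoint gallery x (a : seq (facet P)) y : Prop :=
  if a is s :: a' then exists2 x', wdist x x' = refl s & gallery x' a' y
  else x = y.

Lemma gallery_rcons x a s y z : gallery x a y -> wdist y z = refl s ->
  gallery x (rcons a s) z.
Proof.
elim: a x => [|t a IH] x /=; first by move=> -> yz; exists z.
by move=> [x' xx' g] yz; exists x' => //; exact: IH.
Qed.

Lemma gallery_rev x a y : gallery x a y -> gallery y (rev a) x.
Proof.
elim: a x => [|s a IH] x //= [x' xx' /IH g]; rewrite rev_cons.
by apply: gallery_rcons g _; exact: wdist_reflC.
Qed.

Lemma wdist_gallery x y a : wdist x y = ev a -> size a = len (ev a) ->
  gallery x a y.
Proof.
elim: a x => [|s a IH] x; first by move=> /wdist_eq1.
rewrite /= => xy sa; have [x' x'x x'y] := wdist_ex x y s.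
exists x'; first exact: wdist_reflC.
have W1 := weyl_eval (P := P) a; apply: IH; first by rewrite x'y xy mul_reflK.
have := lenM (weyl_refl s) W1; rewrite len_refl -sa.
by have := len_eval (P := P) a; lia.
Qed.

Lemma gallery_wdist x y a : gallery x a y -> size a = len (ev a) ->
  wdist x y = ev a.
Proof.
elim: a x => [|s a IH] x; first by move=> -> _; rewrite wdistxx.
rewrite /= => -[x' xx' g] sa.
have sa' : size a = len (ev a).
  have := lenM (weyl_refl s) (weyl_eval (P := P) a); rewrite len_refl -sa.
  by have := len_eval (P := P) a; lia.
have E := IH _ g sa'; have [_] := @wdist_step _ _ _ X x x' y s xx'.
by rewrite E => ->//; rewrite -sa sa'.
Qed.

Lemma wdistC x y : wdist y x = invmx (wdist x y).
Proof.
have [a ag sa] := reduced_word (wdist_weyl x y).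
have g : gallery x a y by apply: wdist_gallery; rewrite ?ag.
rewrite -ag -eval_rev; apply: gallery_wdist; first exact: gallery_rev.
by rewrite eval_rev lenV ?size_rev ?ag//; exact: wdist_weyl.
Qed.

Lemma wdist_step_right x y y' s : wdist y y' = refl s ->
  (wdist x y' = wdist x y *m refl s \/ wdist x y' = wdist x y) /\
  (len (wdist x y *m refl s) = (len (wdist x y)).+1 ->
   wdist x y' = wdist x y *m refl s).
Proof.
move=> yy'; have y'y := wdist_reflC yy'.
have [h1 h2] := @wdist_step _ _ _ X y' y x s y'y.
have E : invmx (refl s *m wdist y x) = wdist x y *m refl s.
  by rewrite (invmxM (weyl_refl s) (wdist_weyl y x)) invmx_refl -wdistC.
rewrite (wdistC y' x); split.
  by case: h1 => ->; [left|right; rewrite -wdistC].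
rewrite -E lenV; last by apply: weylM (wdist_weyl y x); exact: weyl_refl.
have -> : len (wdist x y) = len (wdist y x).
  by rewrite (wdistC y x) (lenV (wdist_weyl y x)).
by move=> /h2 ->.
Qed.

Lemma wdist_split x y u v : W u -> W v -> wdist x y = u *m v ->
  len (u *m v) = (len u + len v)%N -> exists2 z, wdist x z = u & wdist z y = v.
Proof.
have [N] := ubnP (len u); elim: N u x => // N IH u x uN Wu Wv xy uv.
have [a ag sa] := reduced_word Wu; case: a ag sa => [|s a] ag sa.
  exists x; first by rewrite wdistxx -ag.
  by rewrite xy -ag mul1mx.
have [x' x'x x'y] := wdist_ex x y s.
have Wa := weyl_eval (P := P) a.
have uE : refl s *m u = ev a by rewrite -ag mul_reflK.
have lu : len u = (len (ev a)).+1.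
  apply/eqP; rewrite eqn_leq -{2}sa /= ltnS len_eval andbT.
  by rewrite -ag /= (leq_trans (lenM (weyl_refl s) Wa))// len_refl.
rewrite xy mulmxA uE in x'y.
have [||z x'z zy] := IH _ x' _ Wa Wv x'y; first by rewrite lu in uN.
  apply/eqP; rewrite eqn_leq lenM//=.
  have := lenM (weyl_refl s) (weylM Wa Wv); rewrite len_refl mulmxA.
  by have := uv; rewrite -{1}ag /= lu => ->; rewrite addSn add1n ltnS.
exists z => //; have [_] := @wdist_step _ _ _ X x x' z s (wdist_reflC x'x).
by rewrite x'z -[refl s *m ev a]/(ev (s :: a)) ag lu => ->.
Qed.

End building_galleries.

Section building_metric.
Variables (R : realType) (n : nat) (P : right_angled_polytope R n.+1).
Variable X : building P.
Local Notation d := n.+1.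
Local Notation vec := 'cV[R]_(d + 1).
Local Notation e := (normal (r := P)).
Local Notation W := (weyl P).
Local Notation len := (word_length P).
Local Notation H := (@hyperboloid R d).
Local Notation o := (origin R d).
Local Notation K := (polytope_set P).
Implicit Types (x y z c : X) (a b p q : vec) (g h u v w : 'M[R]_(d + 1)) (s : facet P).

Lemma H_wdist x y a : K a -> H (wdist x y *m a).
Proof. by move=> Ka; apply: weyl_hyperboloid (wdist_weyl x y) (K_H Ka). Qed.

(** If the segment leaves the polytope, take its exit point. If [w *m b] still lies in the polytope,
    the first letter of a reduced word of [w] has its wall through [w *m b], by [len_side], and that
    point itself serves. *)
Lemma descent_point w a b : W w -> K a -> K b -> (0 < len w)%N ->
  exists s q, [/\ K q, lorentz q (e s) = 0, len w = (len (refl s *m w)).+1 &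
    hyp_dist a q + hyp_dist q (w *m b) = hyp_dist a (w *m b)].
Proof.
move=> Ww Ka Kb w0.
have Hwb : H (w *m b) by exact: weyl_hyperboloid Ww (K_H Kb).
have [Kwb|nKwb] := pselect (K (w *m b)); last first.
  have [s [q [Kq qs ps seg _]]] := polytope_exit Ka Hwb nKwb.
  exists s, q; split=> //; last exact: on_segment_hyp_dist (K_H Ka) Hwb (K_H Kq) seg.
  have [[_ _ h]|[] //] := len_side s Ww.
  by have := h b (polytope_cone Kb); rewrite leNgt ps.
have [r rw sr] := reduced_word Ww; case: r rw sr => [|s r] rw sr.
  by rewrite -sr in w0.
exists s, (w *m b).
have [[l _ _]|[l _ h]] := len_side s Ww.
  move: l; rewrite -{1}rw /= mul_reflK -sr => l.
  by have := len_eval (P := P) r; rewrite l /=; lia.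
split=> //; last by rewrite hyp_dist_id// addr0.
by apply/eqP; rewrite eq_le (K_le0 s Kwb) h//; exact: polytope_cone.
Qed.

(* Follow the segment from [a] to [wdist x y *m b] through the chambers it
   meets; folding keeps each piece isometric and the pieces connected. *)
Lemma folding_contracts z x y a b : K a -> K b ->
  hyp_dist (wdist z x *m a) (wdist z y *m b) <= hyp_dist a (wdist x y *m b).
Proof.
have [N] := ubnP (len (wdist x y)); elim: N x a => // N IH x a lN Ka Kb.
have [w0|w0] := posnP (len (wdist x y)).
  have /wdist_eq1 -> := len_eq0 (wdist_weyl x y) w0.
  by rewrite (weyl_hyp_dist _ _ (wdist_weyl z y)) wdistxx mul1mx.
have [s [q [Kq qs lw E]]] := descent_point (wdist_weyl x y) Ka Kb w0.
have [x' x'x x'y] := wdist_ex x y s.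
have zq : wdist z x' *m q = wdist z x *m q.
  have [[->|->] _] := wdist_step_right z (wdist_reflC x'x) => //.
  by rewrite -mulmxA refl_fix.
have Hq := H_wdist z x Kq; have Ha := H_wdist z x Ka; have Hb := H_wdist z y Kb.
apply: (le_trans (hyp_dist_triangle Ha Hq Hb)); rewrite -E; apply: lerD.
  by rewrite (weyl_hyp_dist _ _ (wdist_weyl z x)).
rewrite -zq; apply: le_trans (IH x' q _ Kq Kb) _.
  by rewrite x'y; move: lN; rewrite lw.
by rewrite x'y -mulmxA -{1}(refl_fix qs) (weyl_hyp_dist _ _ (weyl_refl s)).
Qed.

(** The distance in |X| between the centres of the chambers, measured in an apartment containing
    both. *)
Definition cdist x y : R := hyp_dist o (wdist x y *m o).

Lemma H_orbit x y : H (wdist x y *m o).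
Proof. exact: H_wdist (K_origin P). Qed.

Lemma cdist_ge0 x y : 0 <= cdist x y.
Proof. exact: hyp_dist_ge0 (H_origin P) (H_orbit x y). Qed.

Lemma cdistxx x : cdist x x = 0.
Proof. by rewrite /cdist wdistxx mul1mx hyp_dist_id//; exact: H_origin P. Qed.

Lemma cdistC x y : cdist x y = cdist y x.
Proof.
rewrite /cdist (wdistC x y) -[RHS](weyl_hyp_dist _ _ (wdist_weyl x y)) mulmxA.
by rewrite (mulmxV (weyl_unit (wdist_weyl x y))) mul1mx hyp_distC.
Qed.

Lemma cdist_fold z x y : hyp_dist (wdist z x *m o) (wdist z y *m o) <= cdist x y.
Proof. exact: folding_contracts (K_origin P) (K_origin P). Qed.

(** Folding based at [x] preserves distances from [x] and does not increase the others, so the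
    inequality comes from the hyperboloid. *)
Lemma cdist_triangle x y z : cdist x z <= cdist x y + cdist y z.
Proof.
apply: le_trans (hyp_dist_triangle (H_origin P) (H_orbit x y) (H_orbit x z)) _.
by rewrite lerD2l cdist_fold.
Qed.

Lemma polytope_radius : exists2 C : R, 0 <= C & forall a, K a -> hyp_dist o a <= C.
Proof.
have [C C1 hC] := polytope_bounded P; exists (arcosh C); first exact: arcosh_ge0.
move=> a Ka; apply: ch_le; first exact: arcosh_ge0.
by rewrite (ch_hyp_dist (H_origin P) (K_H Ka)) arcoshK// tm_lorentz hC.
Qed.

(* A chamber met by the geodesic from [x] to [y] at distance [t]. *)
Lemma cdist_geodesic : exists2 D : R, 0 <= D & forall x y t, 0 <= t <= cdist x y ->
  exists z, [/\ `|cdist x z - t| <= D, `|cdist z y - (cdist x y - t)| <= D,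
    (forall c, cdist c z <= Num.max (cdist c x - t) (cdist c y - (cdist x y - t)) + D),
    wdist x y = wdist x z *m wdist z y &
    len (wdist x y) = (len (wdist x z) + len (wdist z y))%N].
Proof.
have [C C0 hC] := polytope_radius; exists (C + 2); first by rewrite addr_ge0.
move=> x y t tb; have Ho := H_origin P; have Hy := H_orbit x y.
have [p [Hp seg pm xp py]] := hyp_segment Ho Hy tb.
have Ww := wdist_weyl x y.
have [u [Wu Kp lu]] := geodesic_gallery Ww (K_origin P) (K_origin P) Hp seg.
have Wv := weylM (weylV Wu) Ww.
have wE : wdist x y = u *m (invmx u *m wdist x y).
  by rewrite mulmxA (mulmxV (weyl_unit Wu)) mul1mx.
have [z xz zy] : exists2 z, wdist x z = u & wdist z y = invmx u *m wdist x y.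
  by apply: wdist_split => //; rewrite -wE.
have up : u *m (invmx u *m p) = p by rewrite mulmxA (mulmxV (weyl_unit Wu)) mul1mx.
have Huo : H (u *m o) by rewrite -xz; exact: H_orbit.
have pz : hyp_dist p (u *m o) <= C.
  by rewrite -up (weyl_hyp_dist _ _ Wu) hyp_distC hC.
have pz' : hyp_dist (u *m o) p <= C by rewrite hyp_distC.
exists z; split; last 2 first.
- by rewrite xz zy -wE.
- by rewrite xz zy lu.
- have := hyp_dist_triangle Ho Hp Huo; have := hyp_dist_triangle Ho Huo Hp.
  have -> : hyp_dist o (u *m o) = cdist x z by rewrite /cdist xz.
  by rewrite xp ler_norml => h1 h2; apply/andP; split; lra.
- have zyE : cdist z y = hyp_dist (u *m o) (wdist x y *m o).
    by rewrite /cdist zy -(weyl_hyp_dist _ _ Wu) !mulmxA (mulmxV (weyl_unit Wu)) mul1mx.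
  have := hyp_dist_triangle Hp Huo Hy; have := hyp_dist_triangle Huo Hp Hy.
  rewrite py -zyE ler_norml -/(cdist x y) => h1 h2; apply/andP; split; lra.
(* Folding based at [z], followed by [u], places [c] in the model. The distance from [c] to [z] is
   kept and those to [x] and [y] do not grow, so the bound of [hyp_segment] carries over. *)
- move=> c; set w := wdist z c.
  have Hc : H (w *m o) by exact: H_orbit.
  have Huc : H (u *m (w *m o)) by exact: (weyl_hyperboloid Wu Hc).
  have := pm _ Huc.
  have e1 : hyp_dist (u *m (w *m o)) o <= cdist c x.
    apply: le_trans (cdist_fold z c x); rewrite -/w.
    rewrite -[X in _ <= X](weyl_hyp_dist _ _ Wu) (wdistC x z) xz.
    by rewrite (mulmxA u (invmx u)) (mulmxV (weyl_unit Wu)) mul1mx.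
  have e2 : hyp_dist (u *m (w *m o)) (wdist x y *m o) <= cdist c y.
    apply: le_trans (cdist_fold z c y); rewrite -/w.
    rewrite -[X in _ <= X](weyl_hyp_dist _ _ Wu) zy.
    by rewrite !mulmxA (mulmxV (weyl_unit Wu)) mul1mx.
  have e3 : cdist c z <= hyp_dist (u *m (w *m o)) p + C.
    rewrite cdistC /cdist -/w -(weyl_hyp_dist _ _ Wu) hyp_distC.
    by apply: le_trans (hyp_dist_triangle Huc Hp Huo) _; rewrite lerD2l.
  rewrite -/(cdist x y) => e4; set M := Num.max _ _ in e4.
  have : M <= Num.max (cdist c x - t) (cdist c y - (cdist x y - t)).
    by rewrite /M ge_max !le_max; apply/andP; split; apply/orP; [left|right]; rewrite lerD2r.
  by move=> h; set M' := Num.max _ _ in h *; clear - e3 e4 h; lra.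
Qed.

Lemma cdist_hyperbolic : exists2 D : R, 0 <= D & forall x y z c,
  cdist x z + cdist y c <=
    Num.max (cdist x y + cdist z c) (cdist y z + cdist x c) + D.
Proof.
have [D D0 hD] := cdist_geodesic; exists (2 * D); first by rewrite mulr_ge0.
move=> x y z c.
pose t := (cdist x y + cdist y c - cdist x c) / 2.
have tb : 0 <= t <= cdist y c.
  have := cdist_triangle x y c; have := cdist_triangle x c y.
  by rewrite (cdistC c y) /t; clear; lra.
have [p [_ _ hp _ _]] := hD y c t tb.
have := hp x; have := hp z.
have -> : cdist x c - (cdist y c - t) = cdist x y - t by rewrite /t; field.
rewrite maxxx => h1 h2; have := cdist_triangle x p z; rewrite (cdistC p z) => h3.
have {h1 h2 h3} : cdist x z <= cdist x y - t +
    Num.max (cdist z y - t) (cdist z c - (cdist y c - t)) + 2 * D.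
  by move: h1 h2 h3; clear; set M := Num.max _ _; lra.
have tE : cdist x y - t + (cdist z y - t) = cdist y z + cdist x c - cdist y c.
  by rewrite /t (cdistC z y); field.
rewrite !maxElt; case: ifP => _; case: ifPn; rewrite -?leNgt;
  by move: tE; clear; set a := cdist x y; set b := cdist y c; lra.
Qed.

End building_metric.

(** * Apartments and spheres of chambers *)

Section chamber_choice.
Variables (R : realType) (d : nat) (P : right_angled_polytope R d) (X : building P).
HB.instance Definition _ := gen_eqMixin (chamber X).
HB.instance Definition _ := gen_choiceMixin (chamber X).
End chamber_choice.

Section apartments.
Variables (R : realType) (d : nat) (P : right_angled_polytope R d).
Variable X : building P.
Local Notation e := (normal (r := P)).
Local Notation W := (weyl P).
Local Notation len := (word_length P).
Local Notation ev := (@eval_word R d P).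
Local Notation o := (origin R d).
Implicit Types (x y z c : X) (g h u v w : 'M[R]_(d + 1)) (s t : facet P).

(** A relatively interior point of the facet [s] is fixed by [refl s] and negative on all other
    normals. Testing both hypotheses there leaves only multiples of [e s]. *)
Lemma posroot_refl_neg (v : 'cV[R]_(d + 1)) s : posroot P v -> posroot P (- (refl s *m v)) ->
  lorentz v v = 1 -> v = e s.
Proof.
move=> [a a0 av] [b b0 bv] v1.
have [x [fx xs xn]] := facet_point s.
have h (u : facet P) : 0 <= - (a u * lorentz x (e u)).
  have [->|us] := eqVneq u s; first by rewrite xs mulr0 oppr0.
  by rewrite oppr_ge0 mulr_ge0_le0// ltW// xn.
have xv : lorentz x v = 0.
  apply/eqP; rewrite eq_le; apply/andP; split.
    rewrite av lorentz_sumr; apply: sumr_le0 => u _.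
    by rewrite lorentzZr -oppr_ge0.
  have -> : lorentz x v = lorentz x (refl s *m v).
    by rewrite reflE !lorentzL xs !mulr0 subr0.
  rewrite -oppr_le0 -lorentzNr bv lorentz_sumr; apply: sumr_le0 => u _.
  have [->|us] := eqVneq u s; first by rewrite lorentzZr xs mulr0.
  by rewrite lorentzZr mulr_ge0_le0// ltW// xn.
have au (u : facet P) : u != s -> a u = 0.
  move=> us; move: xv; rewrite av lorentz_sumr => /eqP.
  rewrite -oppr_eq0 -sumrN psumr_eq0; last by move=> w _; rewrite lorentzZr.
  move=> /allP /(_ u (mem_index_enum u)); rewrite /= lorentzZr oppr_eq0 mulf_eq0.
  by rewrite (lt_eqF (xn u us)) orbF => /eqP.
have vs : v = a s *: e s.
  rewrite av (bigD1 s)//= big1 ?addr0// => u /au ->; exact: scale0r.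
move: v1; rewrite vs !lorentzL normal_unit mulr1 => /eqP.
rewrite -expr2 sqrf_eq1 => /orP[/eqP ->|/eqP as1]; first by rewrite scale1r.
by have := a0 s; rewrite as1 oppr_ge0 ler10.
Qed.

(** Each letter of a gallery folds either to the same letter or to nothing. *)
Lemma fold_len c x y : (len (invmx (wdist c x) *m wdist c y) <= len (wdist x y))%N.
Proof.
have [a ag sa] := reduced_word (wdist_weyl x y); rewrite -sa.
have : gallery x a y by apply: wdist_gallery; rewrite ?ag.
elim: a x {ag sa} => [|s a IH] x /=.
  by move=> ->; rewrite mulVmx ?len1//; exact: weyl_unit (wdist_weyl c y).
move=> [x' xx' /IH]; have [[->|->] _] := wdist_step_right c xx'; last first.
  by move/leq_trans; exact.
rewrite (invmxM (wdist_weyl c x) (weyl_refl s)) invmx_refl -mulmxA => h.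
have Wx := weylM (weylV (wdist_weyl c x)) (wdist_weyl c y).
have := lenM (weyl_refl s) (weylM (weyl_refl s) Wx).
by rewrite mul_reflK len_refl => /leq_trans; apply.
Qed.

(** The chamber of [g] lies beyond the wall of [s]. The condition is put in terms of lengths because
    the axioms of a building are; [behindP] is the geometric form. *)
Definition behind s g := len g = (len (refl s *m g)).+1.

Lemma behindP s g : W g -> behind s g <-> 0 < lorentz (g *m o) (e s).
Proof.
move=> Wg; rewrite /behind; have [[-> l _]|[-> l _]] := len_side s Wg; split=> //.
- by lia.
- by move=> l'; move: l; rewrite ltNge ltW.
Qed.

(** Half-spaces are convex. If a step towards [g'] left the far side, the wall crossed would be that
    of [s] itself, and [g'] would lie on the near side. *)
Lemma behind_step s t g g' : W g -> W g' -> behind s g -> behind s g' ->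
  len (invmx g *m g') = (len (refl t *m (invmx g *m g'))).+1 ->
  behind s (g *m refl t).
Proof.
move=> Wg Wg' bg bg' lt; apply: contrapT => nb.
have Wgt := weylM Wg (weyl_refl t).
have neg : posroot P (- (invmx g *m e s)).
  have [[l _]|[_ //]] := len_mull s Wg.
  by move: bg; rewrite /behind l; lia.
have pos : posroot P (- (refl t *m (- (invmx g *m e s)))).
  rewrite mulmxN opprK mulmxA -{1}(invmx_refl t) -(invmxM Wg (weyl_refl t)).
  by have [[_ //]|[]] := len_mull s Wgt.
have := posroot_refl_neg neg pos; rewrite lorentzNl lorentzNr opprK.
rewrite (weyl_lorentz _ _ (weylV Wg)) normal_unit => /(_ erefl) E.
have Wv := weylM (weylV Wg) Wg'.
have /(behindP t Wv) : behind t (invmx g *m g') by [].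
rewrite -E lorentzNr oppr_gt0 -mulmxA (weyl_lorentz _ _ (weylV Wg)).
by have /(behindP s Wg') := bg' => h; rewrite ltNge ltW.
Qed.

(* The chamber of a panel nearest to [z] is also the nearest one to [z']. *)
Lemma same_projection c x z z' s g g' : wdist c x = refl s ->
  wdist c z = g -> wdist c z' = g' -> wdist z z' = invmx g *m g' ->
  behind s g -> behind s g' -> wdist x z = refl s *m g ->
  wdist x z' = refl s *m g'.
Proof.
move=> cx; have [N] := ubnP (len (wdist z z')).
elim: N z g => // N IH z g lN cz cz' zz' bg bg' xz.
have Wg : W g by rewrite -cz; exact: wdist_weyl.
have Wg' : W g' by rewrite -cz'; exact: wdist_weyl.
have Wv := weylM (weylV Wg) Wg'.
have [a ag sa] := reduced_word Wv; case: a ag sa => [|t a] ag sa.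
  have E : wdist z z' = 1%:M by rewrite zz' -ag.
  by move/wdist_eq1: E => E; rewrite -cz' -E cz.
have ta : refl t *m (invmx g *m g') = ev a by rewrite -ag mul_reflK.
have lt : len (invmx g *m g') = (len (refl t *m (invmx g *m g'))).+1.
  rewrite ta -sa /=; congr S; apply/eqP; rewrite eqn_leq len_eval andbT.
  have := lenM (weyl_refl t) (weyl_eval (P := P) a); rewrite len_refl.
  by rewrite -[X in (len X <= _)%N]/(ev (t :: a)) ag -sa.
have bgt := behind_step Wg Wg' bg bg' lt.
have [z1 z1z z1z'] := wdist_ex z z' t; have zz1 := wdist_reflC z1z.
have cz1 : wdist c z1 = g *m refl t.
  have [[->|E] _] := wdist_step_right c zz1; first by rewrite cz.
  have := fold_len c z1 z'; rewrite E cz cz' z1z' zz' lt; lia.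
have Wgt := weylM Wg (weyl_refl t).
have z1z'E : wdist z1 z' = invmx (g *m refl t) *m g'.
  by rewrite z1z' zz' (invmxM Wg (weyl_refl t)) invmx_refl mulmxA.
apply: (IH z1 (g *m refl t)) => //.
  by rewrite z1z' zz' -ltnS -lt -zz'.
have [[E1|E1] _] := wdist_step_right x zz1; first by rewrite E1 xz mulmxA.
have [[E2|E2] _] := wdist_step z1 (wdist_reflC cx); first by rewrite E2 cz1.
exfalso; move: bgt; rewrite -cz1 -E2 E1 xz /behind mul_reflK.
by move: bg; rewrite /behind; lia.
Qed.

(** Partial isometries from [W] to the building are handled as graphs, so that Zorn's lemma applies
    to inclusion. *)
Definition isometric (A : set ('M[R]_(d + 1) * X)) := forall p q, A p -> A q ->
  [/\ W p.1, W q.1 & wdist p.2 q.2 = invmx p.1 *m q.1].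

(** If part of the domain lies beyond the wall to be crossed, the new chamber must be the one of the
    panel nearest to that part, and [same_projection] shows that one choice serves all of it.
    Otherwise any other chamber of the panel works. *)
Lemma isometric_step A u c s : isometric A -> A (u, c) ->
  (forall y, ~ A (u *m refl s, y)) ->
  exists x, forall q, A q -> wdist x q.2 = invmx (u *m refl s) *m q.1.
Proof.
move=> iA Auc nA; have [Wu _ _] := iA _ _ Auc Auc; rewrite /= in Wu.
have cE q : A q -> wdist c q.2 = invmx u *m q.1 by move=> Aq; have [] := iA _ _ Auc Aq.
have Wq q : A q -> W q.1 by move=> Aq; have [] := iA _ _ Aq Aq.
have WE q : A q -> W (invmx u *m q.1) by move=> /Wq; exact: weylM (weylV Wu).
have E g : invmx (u *m refl s) *m g = refl s *m (invmx u *m g).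
  by rewrite (invmxM Wu (weyl_refl s)) invmx_refl mulmxA.
have [[p Ap bp]|nb] := pselect (exists2 p, A p & behind s (invmx u *m p.1)); last first.
  have [x xc _] := wdist_ex c c s; exists x => q Aq; rewrite E -cE//.
  have [_] := wdist_step q.2 xc; apply; rewrite cE//.
  have [[l _]|[l _]] := len_mull s (WE _ Aq) => //.
  by exfalso; apply: nb; exists q.
have [x xc xp] := wdist_ex c p.2 s; exists x => q Aq; rewrite E.
have [[l _]|[l _]] := len_mull s (WE _ Aq).
  by have [_] := wdist_step q.2 xc; rewrite cE//; exact.
apply: (same_projection (wdist_reflC xc) (cE _ Ap) (cE _ Aq) _ bp) => //.
  have [_ _ ->] := iA _ _ Ap Aq; rewrite (invmxM (weylV Wu) (Wq _ Ap)) invmxK.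
  by rewrite -mulmxA (mulmxA u) (mulmxV (weyl_unit Wu)) mul1mx.
by rewrite xp cE.
Qed.

Lemma isometric_extension A0 u0 c : isometric A0 -> A0 (u0, c) ->
  exists2 alpha : 'M[R]_(d + 1) -> X, forall p, A0 p -> alpha p.1 = p.2 &
    forall u v, W u -> W v -> wdist (alpha u) (alpha v) = invmx u *m v.
Proof.
move=> iA0 A0c.
(* The union with [A0] is part of the property, so that the empty chain has an admissible upper
   bound too. *)
have [|A [iA Amax]] := @Zorn_bigcup _ (fun A => isometric (A `|` A0)).
  move=> F FP Ftot p q Fp Fq.
  have [[B FB [Bp Bq]]|nB] := pselect (exists2 B, F B &
      (B `|` A0) p /\ (B `|` A0) q); first exact: FP Bp Bq.
  case: Fp Fq => [[B FB Bp]|Ap] [[B' FB' Bq]|Aq].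
  - exfalso; have [BB|BB] := Ftot _ _ FB FB'; apply: nB.
      by exists B' => //; split; left => //; exact: BB.
    by exists B => //; split; left => //; exact: BB.
  - by exfalso; apply: nB; exists B => //; split; [left|right].
  - by exfalso; apply: nB; exists B' => //; split; [right|left].
  - exact: iA0.
pose A' := A `|` A0.
have Wuc := iA _ _ (or_intror A0c) (or_intror A0c).
have closed u x s : A' (u, x) -> exists y, A' (u *m refl s, y).
  move=> Aux; apply: contrapT => nA.
  have [|z hz] := @isometric_step A' u x s iA Aux.
    by move=> y Ay; apply: nA; exists y.
  have [Wu _ _] := iA _ _ Aux Aux; rewrite /= in Wu.
  have Wus := weylM Wu (weyl_refl s).
  apply: (Amax (A `|` [set (u *m refl s, z)])).
    split; first by move=> p Ap; left.
    move=> sub; apply: nA; exists z; left; exact: (sub _ (or_intror erefl)).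
  have st p q : A' p -> q = (u *m refl s, z) -> [/\ W p.1, W q.1 & wdist p.2 q.2 = invmx p.1 *m q.1].
    move=> Ap ->; have [Wp _ _] := iA _ _ Ap Ap; split=> //=.
    rewrite wdistC hz// (invmxM (weylV Wus) Wp) invmxK //.
  have st' p q : A' p -> q = (u *m refl s, z) -> [/\ W q.1, W p.1 & wdist q.2 p.2 = invmx q.1 *m p.1].
    by move=> Ap ->; have [Wp _ _] := iA _ _ Ap Ap; split=> //=; exact: hz.
  have zz p q : p = (u *m refl s, z) -> q = (u *m refl s, z) -> [/\ W p.1, W q.1 & wdist p.2 q.2 = invmx p.1 *m q.1].
    by move=> -> ->; split=> //=; rewrite wdistxx mulVmx//; exact: weyl_unit Wus.
  move=> p q [[Ap|Ap]|Ap] [[Aq|Aq]|Aq]; try exact: zz; try exact: iA.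
  - by apply: iA; left.
  - by apply: st => //; left.
  - by apply: iA; [left|right].
  - by apply: st' => //; left.
  - by apply: st' => //; right.
  - by apply: iA; [right|left].
  - by apply: st => //; right.
  - by apply: iA; right.
have Wu0 : W u0 by case: Wuc.
have total u : W u -> exists x, A' (u, x).
  move=> Wu; have [a _ au] := weylM (weylV Wu0) Wu.
  have -> : u = u0 *m ev a by rewrite au mulmxA (mulmxV (weyl_unit Wu0)) mul1mx.
  elim/last_ind: a {au} => [|a s [x /(closed _ _ s)[y Ay]]].
    by exists c; rewrite mulmx1; right.
  by exists y; rewrite eval_rcons mulmxA.
have : forall u, exists x, W u -> A' (u, x).
  move=> u; have [/total[x Ax]|nW] := pselect (W u); first by exists x.
  by exists c.
move=> /choice[alpha ha]; exists alpha; last first.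
  by move=> u v Wu Wv; have [] := iA _ _ (ha u Wu) (ha v Wv).
move=> p A0p; have A'p : A' p by right.
have [Wp _ _] := iA _ _ A'p A'p.
have [_ _ /=] := iA _ _ (ha _ Wp) A'p.
by rewrite mulVmx; [move/wdist_eq1|exact: weyl_unit Wp].
Qed.

Lemma apartment_through c x : exists2 alpha : 'M[R]_(d + 1) -> X,
    alpha 1%:M = c /\ alpha (wdist c x) = x &
    forall u v, W u -> W v -> wdist (alpha u) (alpha v) = invmx u *m v.
Proof.
have Wx := wdist_weyl c x.
have [||alpha h1 h2] := @isometric_extension [set (1%:M, c); (wdist c x, x)] 1%:M c.
- have W1 := weyl1 P.
  move=> p q [->|->] [->|->]; split=> //=.
  + by rewrite invmx1 mul1mx wdistxx.
  + by rewrite invmx1 mul1mx.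
  + by rewrite mulmx1 wdistC.
  + by rewrite wdistxx mulVmx//; exact: weyl_unit Wx.
- by left.
exists alpha => //; split; first exact: (h1 (1%:M, c) (or_introl erefl)).
exact: (h1 (wdist c x, x) (or_intror erefl)).
Qed.

Lemma apartment_at A c : is_apartment A -> A c -> exists2 alpha : 'M[R]_(d + 1) -> X,
    alpha 1%:M = c /\ A = alpha @` W &
    forall u v, W u -> W v -> wdist (alpha u) (alpha v) = invmx u *m v.
Proof.
move=> [al [hal ->]] [w Ww wc]; exists (fun u => al (w *m u)).
  rewrite mulmx1; split=> //; apply/seteqP; split=> y [u Wu <-].
    exists (invmx w *m u); first exact: weylM (weylV Ww) Wu.
    by rewrite mulmxA (mulmxV (weyl_unit Ww)) mul1mx.
  by exists (w *m u) => //; exact: weylM.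
move=> u v Wu Wv; rewrite hal; [|exact: weylM..].
rewrite (invmxM Ww Wu) -mulmxA (mulmxA (invmx w)) mulVmx ?mul1mx//.
exact: weyl_unit Ww.
Qed.

End apartments.

(** * Transitivity on chambers and on pairs of chambers *)

Section transitivity.
Variables (R : realType) (d : nat) (P : right_angled_polytope R d).
Variables (X : building P) (G : groupType) (act : G -> aut X).
Hypothesis act_trans : strongly_transitive act.
Local Notation W := (weyl P).

Lemma transitive_chambers (c c' : X) : exists g, act g c = c'.
Proof.
have ap (x : X) : exists2 A : set X, is_apartment A & A x.
  have [al [a1 _] h] := apartment_through x x; exists (al @` W).
    by exists al.
  by exists 1%:M => //; exact: weyl1.
have [A apA Ac] := ap c; have [A' apA' Ac'] := ap c'.
by have [g [gc _]] := act_trans apA Ac apA' Ac'; exists g.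
Qed.

(** Inside an apartment a chamber is determined by its [W]-distance from [c'], so matching the first
    chambers and the apartments also matches the second chambers. *)
Lemma transitive_pairs (c x c' x' : X) : wdist c x = wdist c' x' ->
  exists g, act g c = c' /\ act g x = x'.
Proof.
move=> E.
have ap (a b : X) : exists A : set X, [/\ is_apartment A, A a, A b &
    forall y y', A y -> A y' -> wdist a y = wdist a y' -> y = y'].
  have [al [a1 ab] h] := apartment_through a b; exists (al @` W); split.
  - by exists al.
  - by exists 1%:M => //; exact: weyl1.
  - by exists (wdist a b) => //; exact: wdist_weyl.
  - move=> _ _ [u Wu <-] [v Wv <-]; rewrite -a1 !h//; try exact: weyl1.
    by rewrite invmx1 !mul1mx => ->.
have [A [apA Ac Ax _]] := ap c x; have [A' [apA' Ac' Ax' inj]] := ap c' x'.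
have [g [gc gA]] := act_trans apA Ac apA' Ac'; exists g; split=> //.
apply: inj => //; first by rewrite -gA; exists x.
by rewrite -{1}gc aut_wdist E.
Qed.

End transitivity.

(** * Numbers of chambers at a given [W]-distance *)

Section counting.
Variables (R : realType) (d : nat) (P : right_angled_polytope R d).
Variables (X : building P) (q : facet P -> nat).
Hypothesis q_gt0 : forall s, (0 < q s)%N.
Hypothesis q_card : forall s (x : X), (panel s x #= `I_(q s).+1)%card.
Local Notation W := (weyl P).
Local Notation len := (word_length P).
Local Notation ev := (@eval_word R d P).
Implicit Types (x y z c : X) (g h u v w : 'M[R]_(d + 1)) (s t : facet P).

Definition sphere_at x w : set X := [set y | wdist x y = w].

Lemma panel_enum s x : exists l : seq X, [/\ uniq l, size l = q s &
  forall y, y \in l <-> wdist x y = refl s].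
Proof.
have fin : finite_set (panel s x) by exists (q s).+1; exact: q_card.
have cd : size (fset_set (panel s x)) = (q s).+1 by exact: card_fset_set.
exists (rem x (fset_set (panel s x))); split.
- exact/rem_uniq/fset_uniq.
- rewrite size_rem ?cd//; rewrite in_fset_set//; apply/mem_set; left; exact: wdistxx.
- move=> y; rewrite mem_rem_uniq ?fset_uniq// inE in_fset_set//; split.
    case/andP => /eqP yx /set_mem[/wdist_eq1 E|//]; by case: yx.
  move=> E; apply/andP; split; last by apply/mem_set; right.
  apply/eqP => yx; have := len_refl s; rewrite -E yx wdistxx len1 //.
Qed.

(** A chamber at reduced distance [s :: a] is reached through a unique [s]-neighbour of [x]: two
    such neighbours are [s]-adjacent to each other, and their distances to it would have different
    lengths. *)
Lemma sphere_enum a x : size a = len (ev a) -> exists l : seq X,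
  [/\ uniq l, size l = (\prod_(s <- a) q s)%N & forall y, y \in l <-> wdist x y = ev a].
Proof.
elim: a x => [|s a IH] x sa.
  exists [:: x]; split; rewrite ?big_nil// => y; rewrite inE; split.
    by move/eqP->; exact: wdistxx.
  by move/wdist_eq1->.
have Wa := weyl_eval (P := P) a.
have sa' : size a = len (ev a).
  have := lenM (weyl_refl s) Wa; rewrite len_refl -[refl s *m _]/(ev (s :: a)) -sa.
  by have := len_eval (P := P) a; rewrite /=; lia.
have lsa : len (refl s *m ev a) = (len (ev a)).+1.
  by rewrite -[refl s *m _]/(ev (s :: a)) -sa -sa'.
have /choice[E hE] : forall x' : X, exists l : seq X, [/\ uniq l,
    size l = (\prod_(s <- a) q s)%N & forall y, y \in l <-> wdist x' y = ev a].
  by move=> x'; exact: IH.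
have [l0 [ul0 sl0 hl0]] := panel_enum s x.
exists [seq y | x' <- l0, y <- E x']; split.
- apply: allpairs_uniq_dep => //; first by move=> x' _; have [] := hE x'.
  move=> [x1 y1] [x2 y2] /allpairsPdep[x1' [y1' [h1 h2 [-> ->]]]].
  move=> /allpairsPdep[x2' [y2' [h3 h4 [-> ->]]]] /= yy.
  rewrite -yy in h4 *; suff -> : x1' = x2' by [].
  have /hl0 e1 := h1; have /hl0 e2 := h3.
  have [_ _ /(_ y1')[/(_ h2) e3 _]] := hE x1'.
  have [_ _ /(_ y1')[/(_ h4) e4 _]] := hE x2'.
  have [[e5|e5] _] := wdist_step x2' (wdist_reflC e1).
    by move: e5; rewrite e2 reflK => /wdist_eq1.
  rewrite e2 in e5; have [_] := wdist_step y1' e5; rewrite e4 => /(_ lsa).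
  rewrite e3 => e6; move: lsa; rewrite -e6; lia.
- rewrite size_allpairs_dep big_cons -sl0.
  by elim: (l0) => //= x' l ->; have [_ -> _] := hE x'; rewrite mulSn.
- move=> y; split.
    move=> /allpairsPdep[x' [y' [/hl0 h1 h2 ->]]].
    have [_ _ /(_ y')[/(_ h2) e3 _]] := hE x'.
    by have [_] := wdist_step y' h1; rewrite e3 => ->.
  rewrite /= => xy; have [||x' xx' x'y] := wdist_split _ Wa xy.
  + exact: weyl_refl.
  + by rewrite lsa len_refl.
  apply/allpairsPdep; exists x', y; split=> //; first exact/hl0.
  by have [_ _ /(_ y)[_]] := hE x'; exact.
Qed.

Lemma sphere_finite x w : finite_set (sphere_at x w).
Proof.
have [Ww|nW] := pselect (W w); last first.
  rewrite (_ : sphere_at x w = set0)//; apply/seteqP; split=> // y yw.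
  by apply: nW; rewrite -yw; exact: wdist_weyl.
have [a <- sa] := reduced_word Ww; rewrite /sphere_at.
have [l [_ _ hl]] := sphere_enum x sa.
have -> : [set y | wdist x y = ev a] = [set` l].
  by apply/seteqP; split=> y /hl.
exact: finite_seq.
Qed.

Definition nsphere x w : nat := size (fset_set (sphere_at x w)).

Lemma nsphere_eval x a : size a = len (ev a) ->
  nsphere x (ev a) = (\prod_(s <- a) q s)%N.
Proof.
move=> sa; have [l [ul <- hl]] := sphere_enum x sa; rewrite /nsphere.
apply: perm_size; apply: uniq_perm => //.
move=> y; rewrite in_fset_set; last exact: sphere_finite.
by apply/idP/idP => [/set_mem/hl//|/hl h]; exact/mem_set.
Qed.

Lemma nsphere_base x y w : W w -> nsphere x w = nsphere y w.
Proof. by move=> /reduced_word[a <- sa]; rewrite !nsphere_eval. Qed.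

Lemma nsphere_gt0 x w : W w -> (0 < nsphere x w)%N.
Proof.
move=> /reduced_word[a <- sa]; rewrite nsphere_eval//.
by elim: a {sa} => [|s a IH]; rewrite ?big_nil// big_cons muln_gt0 q_gt0.
Qed.

Lemma nsphereV x w : W w -> nsphere x (invmx w) = nsphere x w.
Proof.
move=> Ww; have [a aw sa] := reduced_word Ww; rewrite -aw -eval_rev !nsphere_eval.
- by apply: perm_big; rewrite perm_rev.
- by rewrite aw.
- by rewrite eval_rev size_rev lenV aw.
Qed.

Lemma nsphereM x u v : W u -> W v -> len (u *m v) = (len u + len v)%N ->
  nsphere x (u *m v) = (nsphere x u * nsphere x v)%N.
Proof.
move=> /reduced_word[a <- sa] /reduced_word[b <- sb]; rewrite -eval_cat => l.
by rewrite !nsphere_eval ?size_cat ?sa ?sb// big_cat.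
Qed.

Lemma nsphere_mulr x u s : W u ->
  (nsphere x (u *m refl s) <= nsphere x u * nsphere x (refl s))%N.
Proof.
move=> Wu; have Ws := weyl_refl s.
have [[l _]|[l _]] := len_mulr s Wu.
  by rewrite nsphereM// l len_refl addn1.
have Wus := weylM Wu Ws.
have := @nsphereM x (u *m refl s) (refl s) Wus Ws; rewrite refl_mulK len_refl l.
rewrite (addn1 (len _)) => /(_ erefl) ->; rewrite -mulnA leq_pmulr// muln_gt0.
by rewrite nsphere_gt0.
Qed.

End counting.

(** * The boundary and shadows *)

Ltac glra := repeat match goal with
  | |- context [@cdist ?R ?n ?P ?X ?a ?b] => move: (@cdist R n P X a b) => ?
  end; clear; lra.

Section boundary_geometry.
Variables (R : realType) (n : nat) (P : right_angled_polytope R n.+1).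
Variable X : building P.
Local Notation d := n.+1.
Local Notation H := (@hyperboloid R d).
Local Notation o := (origin R d).
Local Notation K := (polytope_set P).
Local Notation dist := (@cdist R n P X).
Implicit Types (x y z c p : X) (omega eta zeta : boundary X).
Implicit Types (u v w : nat -> realization X).

Definition gp c x y : R := (dist c x + dist c y - dist x y) / 2.

Lemma gpC c x y : gp c x y = gp c y x.
Proof. by rewrite /gp (addrC (dist c x)) (cdistC x y). Qed.

Lemma rdist_cdist : exists2 C : R, 0 <= C & forall a b : realization X,
  `|rdist a b - dist a.1 b.1| <= C.
Proof.
have [C C0 hC] := polytope_radius P; exists (2 * C); first by rewrite mulr_ge0.
move=> [x [p Kp]] [y [q Kq]]; rewrite /rdist /=.
have Hp := K_H Kp; have Hq := K_H Kq; have Ho := H_origin P.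
have Hxq := H_wdist x y Kq; have Hxo := H_orbit x y.
have e1 : hyp_dist (wdist x y *m o) (wdist x y *m q) <= C.
  by rewrite (weyl_hyp_dist _ _ (wdist_weyl x y)) hC.
have e2 := hC _ Kp.
have := hyp_dist_triangle Hp Ho Hxq; have := hyp_dist_triangle Ho Hxo Hxq.
have := hyp_dist_triangle Ho Hp Hxo; have := hyp_dist_triangle Hp Hxq Hxo.
rewrite (hyp_distC p o) (hyp_distC (wdist x y *m q)) -/(dist x y) ler_norml.
by move: e1 e2; clear => e1 e2 h1 h2 h3 h4; apply/andP; split; lra.
Qed.

Lemma gromov_product_gp : exists2 C : R, 0 <= C & forall z a b : realization X,
  `|gromov_product z a b - gp z.1 a.1 b.1| <= C.
Proof.
have [C C0 hC] := rdist_cdist; exists (2 * C); first by rewrite mulr_ge0.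
move=> z a b; rewrite /gromov_product /gp.
have := hC z a; have := hC z b; have := hC a b; rewrite !ler_norml.
by clear => /andP[h1 h2] /andP[h3 h4] /andP[h5 h6]; apply/andP; split; lra.
Qed.

Definition conv_to_infty u v := forall c (M : R), exists N, forall i j,
  (N <= i)%N -> (N <= j)%N -> M <= gp c (u i).1 (v j).1.

Lemma asymptoticP u v : asymptotic u v <-> conv_to_infty u v.
Proof.
have [C C0 hC] := gromov_product_gp; split=> h.
  move=> c M; have [N hN] := h (centre c) (M + C); exists N => i j Ni Nj.
  have := hN i j Ni Nj; have := hC (centre c) (u i) (v j); rewrite ler_norml /=.
  by clear => /andP[h1 h2]; lra.
move=> z M; have [N hN] := h z.1 (M + C); exists N => i j Ni Nj.
have := hN i j Ni Nj; have := hC z (u i) (v j); rewrite ler_norml.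
by clear => /andP[h1 h2]; lra.
Qed.

Lemma gp_hyperbolic : exists2 D : R, 0 <= D & forall c x y z,
  Num.min (gp c x y) (gp c y z) - D <= gp c x z.
Proof.
have [D D0 hD] := cdist_hyperbolic X; exists D => // c x y z.
have := hD x y z c; rewrite /gp (cdistC z c) (cdistC x c) (cdistC y c).
by rewrite maxElt minElt; case: ifPn => _; case: ifPn; rewrite -?leNgt;
  move: D0; clear; lra.
Qed.

Lemma gp_lip c c' x y : gp c x y <= gp c' x y + dist c c'.
Proof.
have := cdist_triangle c c' x; have := cdist_triangle c c' y.
by rewrite /gp; clear; lra.
Qed.

Definition between a p b (r : R) := dist a p + dist p b <= dist a b + r.

(** One representing sequence is enough: by [between_far] every other one satisfies the condition
    with a larger constant. *)
Definition shadow c p (r : R) : set (boundary X) :=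
  [set omega | exists2 u, sval omega u &
    exists N, forall i, (N <= i)%N -> between c p (u i).1 r].

Lemma boundary_ex omega : exists2 u, to_infinity u & sval omega = boundary_class u.
Proof. by case: omega. Qed.

Lemma boundary_asym omega u v : sval omega u -> sval omega v -> conv_to_infty u v.
Proof.
have [w winf ->] := boundary_ex omega.
move=> [_ /asymptoticP wu] [_ /asymptoticP wv] c M.
have [D D0 hD] := gp_hyperbolic.
have [N1 h1] := wu c (M + D); have [N2 h2] := wv c (M + D).
exists (maxn N1 N2) => i j; rewrite !geq_max => /andP[i1 i2] /andP[j1 j2].
have := hD c (u i).1 (w (maxn N1 N2)).1 (v j).1; rewrite (gpC c (u i).1).
have := h1 (maxn N1 N2) i (leq_maxl _ _) i1.
have := h2 (maxn N1 N2) j (leq_maxr _ _) j2.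
by rewrite minElt; case: ifP => _; clear; lra.
Qed.

Lemma boundary_nonempty omega : exists u, sval omega u.
Proof. by have [u uinf ->] := boundary_ex omega; exists u. Qed.

(* Far away and close to each other as seen from [c0], two chambers are on the
   same side of the chambers near [c0]. *)
Lemma between_far : exists2 D : R, 0 <= D & forall c0 c p x y (M r : R),
  dist c0 c <= M -> dist c0 p <= M -> 2 * M + D <= gp c0 x y ->
  between c p x r -> between c p y (r + D).
Proof.
have [D D0 hD] := cdist_hyperbolic X; exists (D + 1); first by rewrite addr_ge0.
move=> c0 c p x y M r cM pM; rewrite /gp /between => g h.
have := hD p c y x; have := cdist_triangle p c0 c; have := cdist_triangle c0 c x.
have := cdist_triangle c0 p y; rewrite (cdistC p c0) (cdistC y x) maxElt.
case: ifPn => _; move: cM pM g h D0; rewrite (cdistC p c); glra.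
Qed.

(** A single far chamber [u] stands in for the ideal point in all questions at scale [M], which
    reduces statements about shadows to the four-point inequality for chambers. *)
Lemma shadow_approx : exists2 D : R, 0 <= D & forall c0 omega (M : R),
  exists u : X, M <= dist c0 u /\
    forall c p r, dist c0 c <= M -> dist c0 p <= M ->
      (shadow c p r omega -> between c p u (r + D)) /\
      (between c p u r -> shadow c p (r + D) omega).
Proof.
have [D D0 hD] := between_far; exists (2 * D); first by rewrite mulr_ge0.
move=> c0 omega M; have [w ow] := boundary_nonempty omega.
have [N hN] := boundary_asym ow ow c0 (2 * `|M| + D).
exists (w N).1; split.
  have := hN N N (leqnn _) (leqnn _); rewrite /gp cdistxx.
  by have := ler_norm M; move: D0 (normr_ge0 M); clear; lra.
have MM := ler_norm M.
move=> c p r cM pM; split.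
  move=> [u ou [N1 h1]].
  have [N2 h2] := boundary_asym ou ow c0 (2 * `|M| + D).
  pose i := maxn N1 N2; pose j := maxn N N2.
  have e1 : between c p (w j).1 (r + D).
    apply: (hD c0 c p (u i).1 (w j).1 `|M| r); try lra.
      by apply: h2; [exact: leq_maxr|exact: leq_maxr].
    by apply: h1; exact: leq_maxl.
  rewrite (_ : r + 2 * D = r + D + D); last by lra.
  apply: (hD c0 c p (w j).1 (w N).1 `|M|) e1; try lra.
  by apply: hN; rewrite // leq_maxl.
move=> b; exists w => //; exists N => i Ni.
have : between c p (w i).1 (r + D).
  by apply: (hD c0 c p (w N).1 (w i).1 `|M| r); try lra; by [apply: hN|].
by rewrite /between; move: D0; clear; lra.
Qed.

Lemma shadow_mono c p r r' : r <= r' -> shadow c p r `<=` shadow c p r'.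
Proof.
move=> rr omega [u ou [N hN]]; exists u => //; exists N => i /hN.
by rewrite /between; move: rr; clear; lra.
Qed.

(** Two ideal points in the shadow of [p] have a Gromov product of at least about [dist c0 p], so
    far shadows are small. *)
Lemma open_shadow U c0 omega (r : R) : boundary_open U -> U omega ->
  exists M : R, forall p, M <= dist c0 p -> shadow c0 p r omega ->
    shadow c0 p r `<=` U.
Proof.
move=> oU Uo; have [M0 hM0] := oU _ Uo (centre c0).
have [C C0 hC] := gromov_product_gp; have [D D0 hD] := gp_hyperbolic.
exists (M0 + C + D + `|r|) => p Mp [u ou [N1 h1]] eta [v ev [N2 h2]].
apply: hM0; exists u, v; split=> //; exists (maxn N1 N2) => i j.
rewrite !geq_max => /andP[i1 _] /andP[_ j2].
have := hC (centre c0) (u i) (v j); have := hD c0 (u i).1 p (v j).1.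
have := h1 _ i1; have := h2 _ j2; rewrite /between /= ler_norml.
have := ler_norm r; rewrite (gpC c0 (u i).1 p) [gp c0 p (u i).1]/gp [gp c0 p (v j).1]/gp.
move=> rr h2' h1'; rewrite minElt => h /andP[h3 h4].
by move: h; case: ifP => _; move: Mp C0 D0 rr (normr_ge0 r) h1' h2' h3 h4; glra.
Qed.

Lemma nbhd_gp : exists2 C : R, 0 <= C & forall c omega (M : R) eta,
  (boundary_nbhd (centre c) M omega eta -> exists u v, [/\ sval omega u, sval eta v &
     exists N, forall i j, (N <= i)%N -> (N <= j)%N -> M - C <= gp c (u i).1 (v j).1]) /\
  (forall u v, sval omega u -> sval eta v ->
     (exists N, forall i j, (N <= i)%N -> (N <= j)%N -> M + C <= gp c (u i).1 (v j).1) ->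
     boundary_nbhd (centre c) M omega eta).
Proof.
have [C C0 hC] := gromov_product_gp; exists C => // c omega M eta; split.
  move=> [u [v [ou ev [N hN]]]]; exists u, v; split=> //; exists N => i j Ni Nj.
  have := hN i j Ni Nj; have := hC (centre c) (u i) (v j); rewrite ler_norml /=.
  by clear => /andP[h1 h2]; lra.
move=> u v ou ev [N hN]; exists u, v; split=> //; exists N => i j Ni Nj.
have := hN i j Ni Nj; have := hC (centre c) (u i) (v j); rewrite ler_norml /=.
by clear => /andP[h1 h2]; lra.
Qed.

Lemma nbhd_trans : exists2 D : R, 0 <= D & forall c omega eta zeta (M : R),
  boundary_nbhd (centre c) (M + D) omega eta ->
  boundary_nbhd (centre c) (M + D) eta zeta ->
  boundary_nbhd (centre c) M omega zeta.
Proof.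
have [C C0 hC] := nbhd_gp; have [D D0 hD] := gp_hyperbolic.
exists (2 * C + 2 * D); first by rewrite addr_ge0 ?mulr_ge0.
move=> c omega eta zeta M.
move=> /(hC _ _ _ _).1[u [v [ou ev [N1 h1]]]] /(hC _ _ _ _).1[v' [w [ev' zw [N2 h2]]]].
have [N3 h3] := boundary_asym ev ev' c (M + C + 2 * D).
apply: ((hC c omega M zeta).2 u w) => //.
pose N := maxn N1 (maxn N2 N3); exists N => i j; rewrite /N !geq_max.
move=> /and3P[i1 i2 i3] /and3P[j1 j2 j3].
have NN1 : (N1 <= N)%N by rewrite /N leq_maxl.
have NN2 : (N2 <= N)%N by rewrite /N !leq_max leqnn orbT.
have NN3 : (N3 <= N)%N by rewrite /N !leq_max leqnn !orbT.
have := h1 i N i1 NN1; have := h2 N j NN2 j2; have := h3 N N NN3 NN3.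
have := hD c (u i).1 (v N).1 (v' N).1; have := hD c (u i).1 (v' N).1 (w j).1.
rewrite !minElt; case: ifP => _; case: ifP => _; move: C0 D0; clear; lra.
Qed.

Lemma nbhd_base : exists2 C : R, 0 <= C & forall c (z : realization X) omega (M : R),
  boundary_nbhd z (M + dist c z.1 + C) omega `<=` boundary_nbhd (centre c) M omega.
Proof.
have [C C0 hC] := gromov_product_gp; exists (2 * C); first by rewrite mulr_ge0.
move=> c z omega M eta [u [v [ou ev [N hN]]]]; exists u, v; split=> //.
exists N => i j Ni Nj; have := hN i j Ni Nj.
have := hC (centre c) (u i) (v j); have := hC z (u i) (v j).
have := gp_lip z.1 c (u i).1 (v j).1; rewrite (cdistC z.1 c) /= !ler_norml.
by clear => h /andP[h1 h2] /andP[h3 h4]; lra.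
Qed.

Lemma nbhd_self c omega (M : R) : boundary_nbhd (centre c) M omega omega.
Proof.
have [C C0 hC] := nbhd_gp; have [w ow] := boundary_nonempty omega.
apply: ((hC c omega M omega).2 w w) => //; exact: (boundary_asym ow ow).
Qed.

Lemma nbhd_sym c omega eta (M : R) : boundary_nbhd (centre c) M omega eta ->
  boundary_nbhd (centre c) M eta omega.
Proof.
move=> [u [v [ou ev [N hN]]]]; exists v, u; split=> //; exists N => i j Ni Nj.
have := hN j i Nj Ni; rewrite /gromov_product /rdist.
have := cdistC; set z := centre c.
have E : hyp_dist (sval (u j).2) (wdist (u j).1 (v i).1 *m sval (v i).2) =
    hyp_dist (sval (v i).2) (wdist (v i).1 (u j).1 *m sval (u j).2).
  rewrite (wdistC (u j).1) -[RHS](weyl_hyp_dist _ _ (wdist_weyl (u j).1 (v i).1)).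
  by rewrite mulmxA (mulmxV (weyl_unit (wdist_weyl _ _))) mul1mx hyp_distC.
by rewrite E => _; set a := hyp_dist _ _; set b := hyp_dist _ _; clear; lra.
Qed.

(** Shadows are not claimed to be Borel sets. These interiors are open by the quasi-ultrametric
    inequality [nbhd_trans] and serve as measurable substitutes, at the cost of a constant in the
    radius. *)
Definition binterior c (A : set (boundary X)) : set (boundary X) :=
  [set omega | exists M : R, boundary_nbhd (centre c) M omega `<=` A].

Lemma binterior_sub c A : binterior c A `<=` A.
Proof. by move=> omega [M hM]; apply: hM; exact: nbhd_self. Qed.

Lemma nbhd_le c omega (M M' : R) : M' <= M ->
  boundary_nbhd (centre c) M omega `<=` boundary_nbhd (centre c) M' omega.
Proof.
move=> MM eta [u [v [ou ev [N hN]]]]; exists u, v; split=> //.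
by exists N => i j Ni Nj; apply: le_trans MM _; exact: hN.
Qed.

Lemma binterior_open c A : boundary_open (binterior c A).
Proof.
move=> omega [M hM] z; have [D D0 hD] := nbhd_trans; have [C C0 hC] := nbhd_base.
exists (M + D + dist c z.1 + C) => eta /hC oe.
by exists (M + D) => zeta ez; apply: hM; exact: hD oe ez.
Qed.

Lemma shadow_interior : exists2 D : R, 0 <= D & forall c p r,
  shadow c p r `<=` binterior c (shadow c p (r + D)).
Proof.
have [D D0 hD] := between_far; have [C C0 hC] := nbhd_gp.
exists (2 * D); first by rewrite mulr_ge0.
move=> c p r omega [u ou [N1 h1]].
exists (2 * dist c p + D + C) => eta /(hC _ _ _ _).1[u' [v [ou' ev [N2 h2]]]].
have [N3 h3] := boundary_asym ou ou' c (2 * dist c p + D).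
pose N := maxn N1 (maxn N2 N3).
have NN1 : (N1 <= N)%N by rewrite /N leq_maxl.
have NN2 : (N2 <= N)%N by rewrite /N !leq_max leqnn orbT.
have NN3 : (N3 <= N)%N by rewrite /N !leq_max leqnn !orbT.
have d0 : dist c c <= dist c p by rewrite cdistxx cdist_ge0.
exists v => //; exists N2 => i N2i.
have e1 : between c p (u' N).1 (r + D).
  apply: (hD c c p (u N).1 (u' N).1 (dist c p)) => //; first exact: h3.
  exact: h1.
rewrite (_ : r + 2 * D = r + D + D); last by lra.
apply: (hD c c p (u' N).1 (v i).1 (dist c p)) e1 => //.
by have := h2 N i NN2 N2i; clear; lra.
Qed.

Lemma boundary_eq omega eta : sval omega = sval eta -> omega = eta.
Proof.
by case: omega eta => a pa [b pb] /= ab; subst b; congr exist; exact: Prop_irrelevance.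
Qed.

Lemma shadow_act (g : aut X) c p r omega :
  shadow (g c) (g p) r (boundary_act g omega) <-> shadow c p r omega.
Proof.
split=> [[u [v ov <-] [N hN]]|[u ou [N hN]]].
  exists v => //; exists N => i /hN.
  by rewrite /between /cdist /= !aut_wdist.
exists (real_act g \o u); first by exists u.
by exists N => i /hN; rewrite /between /cdist /= !aut_wdist.
Qed.

Lemma boundary_open_act (g : aut X) U : boundary_open U ->
  boundary_open (boundary_act g @^-1` U).
Proof.
move=> oU omega Uo z; have [M hM] := oU _ Uo (real_act g z).
exists M => eta [u [v [ou ev [N hN]]]]; apply: hM.
exists (real_act g \o u), (real_act g \o v); split; [by exists u|by exists v|].
by exists N => i j Ni Nj; rewrite /gromov_product /= !rdist_act; exact: hN.
Qed.

Lemma boundary_act_comp (g h k : aut X) : (forall x, k x = g (h x)) ->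
  forall omega, boundary_act k omega = boundary_act g (boundary_act h omega).
Proof.
move=> E omega; apply: boundary_eq => /=.
have F u : real_act k \o u = real_act g \o (real_act h \o u).
  by apply/funext => i; rewrite /real_act /= E.
apply/seteqP; split=> [_ [u ou <-]|_ [_ [u ou <-] <-]].
  by rewrite F; exists (real_act h \o u) => //; exists u.
by rewrite -F; exists u.
Qed.

Lemma boundary_act_id (g : aut X) : (forall x, g x = x) ->
  forall omega, boundary_act g omega = omega.
Proof.
move=> E omega; apply: boundary_eq => /=.
have F u : real_act g \o u = u.
  by apply/funext => i; rewrite /real_act /= E; case: (u i).
apply/seteqP; split=> [_ [u ou <-]|u ou]; first by rewrite F.
by exists u.
Qed.

End boundary_geometry.

(** * Surface measure of spherical balls *)

Section nonmeasurable_integral.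
Context (disp : measure_display) (T : measurableType disp) (R : realType).
Variable mu : {measure set T -> \bar R}.

(** Monotonicity read off from the definition as a supremum over simple functions. It is meant for
    the iterated integrals in [volume] and for sections under [spread], whose measurability is not
    established. *)
Lemma ge0_le_integralT (f g : T -> \bar R) : (forall x, (0 <= f x)%E) ->
  (forall x, (f x <= g x)%E) -> (\int[mu]_x f x <= \int[mu]_x g x)%E.
Proof.
move=> f0 fg; have g0 x : (0 <= g x)%E by exact: le_trans (f0 x) (fg x).
rewrite !ge0_integralTE//; apply: le_ereal_sup => _ [h hf <-]; exists h => // x.
exact: le_trans (hf x) (fg x).
Qed.

End nonmeasurable_integral.

Section boxes.
Variable R : realType.

Definition cubeb k (c : 'cV[R]_k) (s : R) (x : 'cV[R]_k) : bool :=
  [forall i, c i 0 - s < x i 0 <= c i 0 + s].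

Lemma volume_ge0 k (A : set 'cV[R]_k) : (0 <= volume A)%E.
Proof.
elim: k A => [|k IH] A /=; first by rewrite lee_fin.
by apply: integral_ge0 => x _; exact: IH.
Qed.

Definition ctail k (c : 'cV[R]_k.+1) : 'cV[R]_k := dsubmx (c : 'cV_(1 + k)).

Lemma col_mx_head k (x : R) (y : 'cV[R]_k) :
  (col_mx (x%:M : 'cV_1) y : 'cV_k.+1) 0 0 = x.
Proof.
have -> : 0 = lshift k (0 : 'I_1) :> 'I_(1 + k) by exact: val_inj.
by rewrite (col_mxEu (x%:M : 'cV_1) y) mxE eqxx mulr1n.
Qed.

Lemma col_mx_tail k (x : R) (y : 'cV[R]_k) i :
  (col_mx (x%:M : 'cV_1) y : 'cV_k.+1) (lift 0 i) 0 = y i 0.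
Proof.
have -> : lift 0 i = rshift 1 i :> 'I_(1 + k) by exact: val_inj.
by rewrite (col_mxEd (x%:M : 'cV_1) y).
Qed.

Lemma ctailE k (c : 'cV[R]_k.+1) i : ctail c i 0 = c (lift 0 i) 0.
Proof.
by rewrite /ctail mxE; congr (c _ _); exact: val_inj.
Qed.

Lemma cubeb_col k (c : 'cV[R]_k.+1) s (x : R) (y : 'cV[R]_k) :
  cubeb c s (col_mx (x%:M : 'cV_1) y) =
  (c 0 0 - s < x <= c 0 0 + s) && cubeb (ctail c) s y.
Proof.
apply/forallP/andP => [h|[h0 /forallP h] i].
  split; first by have := h 0; rewrite col_mx_head.
  by apply/forallP => i; have := h (lift 0 i); rewrite col_mx_tail ctailE.
case: (unliftP 0 i) => [j|] ->; last by rewrite col_mx_head.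
by have := h j; rewrite col_mx_tail ctailE.
Qed.

Lemma integral_intervals (l : seq R) (s b : R) : 0 <= s -> 0 <= b ->
  (\int[lebesgue_measure]_x (\sum_(c <- l) (\1_(`]c - s, c + s]%classic) x * b)%:E) =
   ((size l)%:R * (2 * s * b))%:E)%E.
Proof.
move=> s0 b0.
pose F (c : R) : measurableTypeR R -> \bar R :=
  EFin \o (fun x => \1_(`]c - s, c + s]%classic) x * b).
have m c : measurable_fun setT (F c).
  by apply/measurable_EFinP; apply: measurable_funM.
rewrite (ge0_integral_sum _ (measurableT) m); last first.
  by move=> c x _; rewrite lee_fin mulr_ge0.
transitivity (\sum_(c <- l) (2 * s * b)%:E)%E.
  apply: eq_bigr => c _.
  rewrite (_ : (fun x => _) = (fun x => (b%:E * (\1_(`]c - s, c + s]%classic) x)%:E)%E)); last first.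
    by apply/funext => x; rewrite -EFinM mulrC.
  rewrite ge0_integralZl_EFin//; last exact/measurable_EFinP.
  rewrite integral_indic// setIT.
  transitivity (b%:E * (2 * s)%:E)%E; last by rewrite -EFinM mulrC.
  congr (_ * _)%E.
  transitivity (@lebesgue_measure R [set` `](c - s)%R, (c + s)%R]]) => //.
  rewrite lebesgue_measure_itv/=.
  case: ifPn => [_|]; first by rewrite -EFinB; congr EFin; ring.
  rewrite lte_fin -leNgt => h; have -> : s = 0 by lra.
  by rewrite mulr0.
elim: l => [|c l IH]; first by rewrite big_nil mul0r.
by rewrite big_cons IH -EFinD; congr EFin; rewrite /= -natr1; ring.
Qed.

(** A section of a family of cubes is again such a family, with one cube for each centre whose first
    coordinate is near [x]. Both inductions on the dimension rest on this. *)
Lemma section_count k (l : seq 'cV[R]_k.+1) s (x b : R) :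
  (\sum_(c <- [seq (c : 'cV[R]_k.+1) 0%R 0%R | c <- l])
     (\1_(`](c - s)%R, (c + s)%R]%classic) x * b)%:E)%E =
  ((size [seq ctail c | c : 'cV[R]_k.+1 <- l & (c 0%R 0%R - s < x <= c 0%R 0%R + s)%R])%:R * b)%:E.
Proof.
elim: l => [|c l IH]; first by rewrite /= big_nil mul0r.
rewrite /= big_cons IH indicE.
have -> : (x \in `]c 0 0 - s, c 0 0 + s]%classic) = (c 0 0 - s < x <= c 0 0 + s).
  by apply/idP/idP => [/set_mem|h]; [|apply/mem_set]; rewrite /= in_itv.
case: ifP => _; rewrite -EFinD; congr EFin; rewrite /= -?natr1; ring.
Qed.

Lemma volume_le_cubes k (A : set 'cV[R]_k) (l : seq 'cV[R]_k) s : 0 <= s ->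
  (forall x, A x -> has (fun c => cubeb c s x) l) ->
  (volume A <= ((size l)%:R * (2 * s) ^+ k)%:E)%E.
Proof.
move=> s0; elim: k A l => [|k IH] A l hA /=.
  rewrite expr0 mulr1 lee_fin indicE; have [/set_mem A0|_] := boolP (0 \in A); last first.
    exact: ler0n.
  by have := hA _ A0; case: l {hA} => //= c l _; rewrite ler1n.
apply: (@le_trans _ _ (\int[lebesgue_measure]_x (\sum_(c <- [seq (c : 'cV[R]_k.+1) 0%R 0%R | c <- l])
    (\1_(`](c - s)%R, (c + s)%R]%classic) x * (2 * s) ^+ k)%:E))%E).
  apply: ge0_le_integralT => x; first exact: volume_ge0.
  rewrite section_count; apply: IH => y /hA.
  move=> /hasP[c cl]; rewrite cubeb_col => /andP[cx cy]; apply/hasP.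
  by exists (ctail c) => //; apply/mapP; exists c => //; rewrite mem_filter cx.
rewrite integral_intervals ?exprn_ge0 ?mulr_ge0// size_map.
by rewrite lee_fin (exprS _ k) !mulrA.
Qed.

Lemma volume_ge_cubes k (A : set 'cV[R]_k) (l : seq 'cV[R]_k) s : 0 <= s ->
  (forall x, (count (fun c => cubeb c s x) l <= 1)%N) ->
  (forall x, has (fun c => cubeb c s x) l -> A x) ->
  (((size l)%:R * (2 * s) ^+ k)%:E <= volume A)%E.
Proof.
move=> s0; elim: k A l => [|k IH] A l hc hA /=.
  rewrite expr0 mulr1 lee_fin indicE.
  have E x (c : 'cV[R]_0) : cubeb c s x by apply/forallP => -[].
  have := hc 0; rewrite (eq_count (a2 := predT)) ?count_predT; last by move=> c; rewrite /= E.
  case: l hA {hc} => [|c [|//]] hA _; first exact: ler0n.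
  by rewrite mem_set//; apply: hA; rewrite /= E.
apply: (@le_trans _ _ (\int[lebesgue_measure]_x (\sum_(c <- [seq (c : 'cV[R]_k.+1) 0%R 0%R | c <- l])
    (\1_(`](c - s)%R, (c + s)%R]%classic) x * (2 * s) ^+ k)%:E))%E).
  rewrite integral_intervals ?exprn_ge0 ?mulr_ge0// size_map.
  by rewrite lee_fin (exprS _ k) !mulrA.
apply: ge0_le_integralT => x.
  by apply: sume_ge0 => c _; rewrite lee_fin mulr_ge0// exprn_ge0// mulr_ge0.
rewrite section_count; apply: IH => y.
  apply: leq_trans (hc (col_mx (x%:M : 'cV_1) y)).
  rewrite count_map count_filter leq_eqVlt; apply/orP; left; apply/eqP.
  by apply: eq_count => c; rewrite /= cubeb_col andbC.
move=> /hasP[c' /mapP[c]]; rewrite mem_filter => /andP[cx cl] -> cy.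
by apply: hA; apply/hasP; exists c => //; rewrite cubeb_col cx.
Qed.

End boxes.

Section sphere_balls.
Variables (R : realType) (k : nat).
Local Notation vec := 'cV[R]_k.+1.
Implicit Types (x y al : vec).

Lemma enorm_ge0 x : 0 <= enorm x.
Proof. exact: sqrtr_ge0. Qed.

Lemma enormZ (a : R) x : enorm (a *: x) = `|a| * enorm x.
Proof.
apply/eqP; rewrite -(@eqrXn2 _ 2) ?enorm_ge0 ?mulr_ge0 ?enorm_ge0//.
by rewrite exprMn !dot_enorm dotZl dotZr real_normK ?num_real// mulrA expr2.
Qed.

Lemma enorm_coord x i : `|x i 0| <= enorm x.
Proof.
rewrite -(@ler_pXn2r _ 2) ?nnegrE ?enorm_ge0// dot_enorm real_normK ?num_real//.
rewrite /dot (bigD1 i)//= expr2 lerDl; apply: sumr_ge0 => j _.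
by rewrite -expr2 sqr_ge0.
Qed.

Lemma enorm_le_coord x (s : R) : (forall i, `|x i 0| <= s) -> enorm x <= k.+1%:R * s.
Proof.
move=> h; have s0 : 0 <= s by apply: le_trans (h 0).
rewrite -(@ler_pXn2r _ 2) ?nnegrE ?enorm_ge0 ?mulr_ge0// dot_enorm exprMn.
apply: (@le_trans _ _ (\sum_(i < k.+1) s ^+ 2)).
  apply: ler_sum => i _; rewrite -expr2 -real_normK ?num_real//.
  by rewrite lerXn2r ?nnegrE.
rewrite sumr_const card_ord -[s ^+ 2 *+ _]mulr_natl ler_wpM2r ?sqr_ge0//.
by rewrite -natrX ler_nat leq_pmull.
Qed.

Lemma enormD x y : enorm (x + y) <= enorm x + enorm y.
Proof.
rewrite -(@ler_pXn2r _ 2) ?nnegrE ?addr_ge0 ?enorm_ge0// sqrrD !dot_enorm.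
rewrite dotDl !dotDr (dotC y x).
have : dot x y <= enorm x * enorm y.
  apply: ler_sqr_pos; first by rewrite mulr_ge0 ?enorm_ge0.
  by rewrite exprMn !dot_enorm dot_sqr_le.
by set a := dot x y; set b := _ * _ => ab; rewrite mulr2n; lra.
Qed.

Lemma enormN x : enorm (- x) = enorm x.
Proof. by rewrite -scaleN1r enormZ normrN1 mul1r. Qed.

Definition sball al (rho : R) : set (sphere R k) :=
  [set xi | enorm (sval xi - al) <= rho].

Lemma sphere_measure_ge0 (E : set (sphere R k)) : (0 <= @sphere_measure R k E)%E.
Proof. by rewrite /sphere_measure mule_ge0// ?lee_fin//; exact: volume_ge0. Qed.

Lemma sphere_measure_ball_le (al : vec) (rho : R) (E : set (sphere R k)) :
  enorm al = 1 -> 0 < rho <= 2 -> E `<=` sball al rho ->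
  (@sphere_measure R k E <= (k.+1%:R * (5 * 6 ^+ k.+1) * rho ^+ k)%:E)%E.
Proof.
move=> al1 /andP[r0 r2] hE.
(* In each coordinate the cone over the ball stays within [2 * rho] of a multiple of [rho] along the
   segment from 0 to [al], so about [rho^-1] cubes of half side [3 * rho] cover it. *)
pose N := Num.truncn rho^-1.
pose l : seq vec := [seq (i%:R * rho) *: al | i <- iota 0 N.+1].
have sl : (size l)%:R <= rho^-1 + 1 :> R.
  rewrite size_map size_iota -natr1 lerD2r.
  by have /andP[] := truncn_itv (ltW (eq_ind _ (fun b => is_true b) r0 _ (esym (invr_gt0 rho)))).
have cov x : Defs.cone E x -> has (fun c => cubeb c (3 * rho) x) l.
  move=> [xi Exi [t /andP[t0 t1] ->]]; apply/hasP.
  pose i := Num.truncn (t / rho).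
  have tr0 : 0 <= t / rho by rewrite divr_ge0// ltW.
  have /andP[i1 i2] := truncn_itv tr0; rewrite -/i in i1 i2.
  rewrite ler_pdivlMr// in i1; rewrite ltr_pdivrMr// -natr1 mulrDl mul1r in i2.
  exists ((i%:R * rho) *: al).
    apply/mapP; exists i => //; rewrite mem_iota add0n ltnS /= le_truncn//.
    by rewrite ler_pdivrMr// mulVf ?gt_eqF.
  apply/forallP => j.
  have h1 : enorm (t *: (sval xi - al)) <= rho.
    rewrite enormZ (ger0_norm (ltW t0)).
    have h : enorm (sval xi - al) <= rho by exact: hE.
    apply: le_trans h.
    by rewrite ler_piMl// enorm_ge0.
  have h2 := le_trans (enorm_coord _ j) h1.
  have h3 : `|(t - i%:R * rho) * al j 0| <= rho.
    rewrite normrM; have := enorm_coord al j; rewrite al1 => h.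
    have h' : `|t - i%:R * rho| <= rho by rewrite ler_norml; apply/andP; split; lra.
    by rewrite -[leRHS]mulr1 ler_pM.
  move: h2 h3; rewrite !mxE !ler_norml; move: (al j 0) ((sval xi) j 0) => a b.
  by move: r0; clear => r0 /andP[h1 h2] /andP[h3 h4]; apply/andP; split; lra.
have r30 : 0 <= 3 * rho by lra.
rewrite /sphere_measure; apply: (@le_trans _ _ (k.+1%:R%:E * ((size l)%:R * (2 * (3 * rho)) ^+ k.+1)%:E)%E).
  by rewrite lee_wpmul2l ?lee_fin//; exact: volume_le_cubes.
rewrite -EFinM lee_fin -!mulrA ler_wpM2l//.
rewrite (_ : 2 * (3 * rho) = 6 * rho); last by ring.
rewrite exprMn (exprS rho); set q := 6 ^+ k.+1; set p := rho ^+ k.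
have qp : 0 <= q * p by rewrite mulr_ge0// exprn_ge0// ltW.
have : (size l)%:R * rho <= (rho^-1 + 1) * rho by rewrite ler_wpM2r// ltW.
rewrite mulrDl mulVf ?gt_eqF// mul1r => h.
have : (size l)%:R * rho * (q * p) <= 5 * (q * p) by rewrite ler_wpM2r//; lra.
by rewrite !mulrA -![_ * q]mulrC !mulrA; lra.
Qed.

(** Along this coordinate the multiples of [al] spread out, which keeps the cubes of the next lower
    bound disjoint. *)
Lemma big_coord (al : vec) : enorm al = 1 -> exists i, k.+1%:R^-1 <= `|al i 0|.
Proof.
move=> al1; apply: contrapT => h.
have {}h i : `|al i 0| < k.+1%:R^-1.
  by rewrite ltNge; apply/negP => hi; apply: h; exists i.
have : enorm al ^+ 2 < 1; last by rewrite al1 expr1n ltxx.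
rewrite dot_enorm; apply: (@lt_le_trans _ _ (\sum_(i < k.+1) k.+1%:R^-1)).
  rewrite /dot; apply: ltr_sum; first by apply/hasP; exists 0; rewrite ?mem_index_enum.
  move=> i _; rewrite -expr2 -real_normK ?num_real//.
  have hi := h i; apply: le_lt_trans hi; rewrite expr2 -[leRHS]mulr1 ler_wpM2l//.
  by apply: le_trans (ltW (h i)) _; rewrite invf_le1 ?ltr0n// ler1n.
by rewrite sumr_const card_ord -[X in X <= _]mulr_natl divff// pnatr_eq0.
Qed.

Lemma sphere_measure_ball_ge : exists2 c : R, 0 < c & forall (al : vec) (rho : R)
    (E : set (sphere R k)), enorm al = 1 -> 0 < rho <= 1 -> sball al rho `<=` E ->
  ((c * rho ^+ k)%:E <= @sphere_measure R k E)%E.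
Proof.
set D : R := k.+1%:R; have D1 : 1 <= D by rewrite ler1n.
have D0 : 0 < D by lra.
exists (1 / 2 * (4 * D)^-1 ^+ k.+1).
  by rewrite mulr_gt0// ?exprn_gt0// ?invr_gt0; lra.
move=> al rho E al1 /andP[r0 r1] hE.
(* About [rho^-1] centres [t i *: al], with [t i] between 1/2 and 3/4 and spacing [eta]. In a
   coordinate where [al] has size at least [D^-1] they differ by at least [2 * s], so the cubes are
   disjoint, and each of them lies in the cone over the ball. *)
pose s := rho / (8 * D); pose eta := rho / 4.
have s0 : 0 < s by rewrite divr_gt0//; lra.
have eta0 : 0 < eta by rewrite divr_gt0.
have sD : s * D = rho / 8 by rewrite /s; field; rewrite gt_eqF//=; lra.
pose N := Num.truncn rho^-1.
have ri1 : 1 <= rho^-1 by rewrite invf_ge1.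
have /andP[N1 N2] := truncn_itv (le_trans ler01 ri1); rewrite -/N in N1 N2.
have N0 : (0 < N)%N by rewrite /N truncn_gt0.
pose t (i : nat) : R := 1 / 2 + i%:R * eta.
pose l : seq vec := [seq t i *: al | i <- iota 0 N].
have Nr : N%:R * rho <= 1 by rewrite -ler_pdivlMr// div1r.
have tb i : (i < N)%N -> 1 / 2 <= t i <= 3 / 4.
  move=> iN; have : i%:R * rho <= N%:R * rho by rewrite ler_wpM2r ?(ltW r0)// ler_nat ltnW.
  have : 0 <= i%:R * rho by rewrite mulr_ge0// ltW.
  by rewrite /t /eta; move: Nr; clear => *; apply/andP; split; lra.
have [i0 hi0] := big_coord al1.
have uniq_cube x i j : cubeb (t i *: al) s x -> cubeb (t j *: al) s x -> i = j.
  move=> /forallP/(_ i0) + /forallP/(_ i0); rewrite !mxE => /andP[a1 a2] /andP[b1 b2].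
  have lt2 : `|(i%:R - j%:R) * eta * al i0 0| < 2 * s.
    have -> : (i%:R - j%:R) * eta * al i0 0 = t i * al i0 0 - t j * al i0 0.
      by rewrite /t; ring.
    by rewrite ltr_norml; apply/andP; split; lra.
  have : `|i%:R - j%:R : R| < 1.
    rewrite ltNge; apply/negP => ge1; move: lt2; apply/negP; rewrite -leNgt.
    rewrite 2!normrM (ger0_norm (ltW eta0)).
    have -> : 2 * s = 1 * eta * D^-1 by rewrite /s /eta; field; rewrite gt_eqF//=; lra.
    apply: ler_pM => //; rewrite ?invr_ge0 ?(ltW D0)//.
      by rewrite mul1r ltW.
    by rewrite ler_wpM2r// ltW.
  clear; case: (ltngtP i j) => // ij.
    rewrite distrC -natrB ?(ltnW ij)// normr_nat -[1]/(1%:R) ltr_nat ltnS leqn0 subn_eq0.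
    by rewrite leqNgt ij.
  rewrite -natrB ?(ltnW ij)// normr_nat -[1]/(1%:R) ltr_nat ltnS leqn0 subn_eq0.
  by rewrite leqNgt ij.
have cnt x : (count (fun c => cubeb c s x) l <= 1)%N.
  rewrite count_map; have := iota_uniq 0 N; elim: (iota 0 N) => //= i q IH /andP[iq uq].
  have [ci|nci] := boolP (cubeb (t i *: al) s x); last exact: IH.
  rewrite (_ : count _ q = 0%N)//; apply/eqP; rewrite -leqn0 leqNgt -has_count.
  apply/negP => /hasP[j jq /= cj]; move: iq; rewrite (uniq_cube _ _ _ ci cj).
  by rewrite jq.
have sub x : has (fun c => cubeb c s x) l -> Defs.cone E x.
  rewrite /l has_map => /hasP[m].
  rewrite mem_iota add0n => /= iN /forallP cx.
  have /andP[t1 t2] := tb _ iN.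
  have h1 : enorm (x - t m *: al) <= rho / 8.
    rewrite -sD mulrC; apply: enorm_le_coord => j; have := cx j.
    rewrite !mxE ler_norml; set a := t m * _; set b := x j 0; clear.
    by move=> /andP[? ?]; apply/andP; split; lra.
  have tal : enorm (t m *: al) = t m by rewrite enormZ al1 mulr1 ger0_norm; lra.
  have h2 : enorm x <= t m + rho / 8.
    by have := enormD (t m *: al) (x - t m *: al); rewrite addrC subrK tal; lra.
  have h3 : t m - rho / 8 <= enorm x.
    have := enormD x (- (x - t m *: al)); rewrite enormN opprB addrC subrK tal; lra.
  have x0 : 0 < enorm x by lra.
  have xi1 : enorm ((enorm x)^-1 *: x) = 1.
    by rewrite enormZ ger0_norm ?invr_ge0 ?(ltW x0)// mulVf// gt_eqF.
  exists (exist (fun x : vec => enorm x = 1) ((enorm x)^-1 *: x) xi1).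
    apply: hE; rewrite /sball/=.
    have -> : (enorm x)^-1 *: x - al = (enorm x)^-1 *: (x - enorm x *: al).
      by rewrite scalerBr scalerA mulVf ?gt_eqF// scale1r.
    rewrite enormZ ger0_norm ?invr_ge0 ?(ltW x0)// mulrC ler_pdivrMr//.
    have -> : x - enorm x *: al = (x - t m *: al) + (t m - enorm x) *: al.
      by rewrite scalerBl addrA subrK.
    apply: le_trans (enormD _ _) _; rewrite enormZ al1 mulr1.
    have : `|t m - enorm x| <= rho / 8 by rewrite ler_norml; apply/andP; split; lra.
    have : rho * (3 / 8) <= rho * enorm x by rewrite ler_wpM2l ?(ltW r0)//; lra.
    lra.
  exists (enorm x); first by rewrite x0; lra.
  by rewrite /= scalerA divff ?gt_eqF// scale1r.
rewrite /sphere_measure.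
apply: (@le_trans _ _ (D%:E * ((size l)%:R * (2 * s) ^+ k.+1)%:E)%E); last first.
  by rewrite lee_wpmul2l ?lee_fin ?(ltW D0)//; apply: volume_ge_cubes => //; exact: ltW.
rewrite -EFinM lee_fin size_map size_iota.
have -> : 2 * s = rho * (4 * D)^-1 by rewrite /s; field; rewrite gt_eqF//=; lra.
rewrite exprMn (exprS rho); set q := (4 * D)^-1 ^+ _; set p := rho ^+ k.
have q0 : 0 <= q by rewrite exprn_ge0// invr_ge0; lra.
have p0 : 0 <= p by rewrite exprn_ge0// ltW.
have : 1 / 2 <= N%:R * rho.
  have : (1 : R) <= N%:R by rewrite ler1n.
  move: N2; rewrite -natr1 -(ltr_pM2r r0) mulVf ?gt_eqF//; nra.
have qp : 0 <= q * p by exact: mulr_ge0.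
have Nr0 : 0 <= N%:R * rho * (q * p) by rewrite !mulr_ge0// ltW.
move=> h; have : 1 / 2 * (q * p) <= N%:R * rho * (q * p) by rewrite ler_wpM2r.
have : N%:R * rho * (q * p) <= D * (N%:R * rho * (q * p)) by rewrite ler_peMl.
lra.
Qed.

End sphere_balls.

(** * Busemann functions *)

Section ideal_points.
Variables (R : realType) (n : nat) (P : right_angled_polytope R n.+1).
Local Notation d := n.+1.
Local Notation vec := 'cV[R]_(d + 1).
Local Notation H := (@hyperboloid R d).
Local Notation o := (origin R d).
Implicit Types (y z : vec) (al xi : 'cV[R]_d).

(* [horo y xi] is the exponential of the Busemann function at [xi], based at the origin. *)
Definition horo y xi : R := tm y - dot (sp y) xi.

Lemma to_ballE y : to_ball y = (1 + tm y)^-1 *: sp y.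
Proof. by []. Qed.

Lemma dot_to_ball y : H y -> dot (to_ball y) (to_ball y) = 1 - 2 / (1 + tm y).
Proof.
move=> Hy; have t1 := tm_ge1 P Hy; rewrite to_ballE dotZl dotZr dot_tm//.
by field; rewrite gt_eqF//; lra.
Qed.

Lemma lorentz_to_ball y z : H y -> H z ->
  - lorentz y z = 1 + dot (to_ball y - to_ball z) (to_ball y - to_ball z) *
    ((1 + tm y) * (1 + tm z)) / 2.
Proof.
move=> Hy Hz; have t1 := tm_ge1 P Hy; have t2 := tm_ge1 P Hz.
rewrite dotBl !dotBr (dotC (to_ball z)) !dot_to_ball// !to_ballE dotZl dotZr lorentzE.
by field; rewrite !gt_eqF//; lra.
Qed.

Lemma horo_to_ball y xi : H y -> dot xi xi = 1 ->
  dot (to_ball y - xi) (to_ball y - xi) = 2 * horo y xi / (1 + tm y).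
Proof.
move=> Hy x1; have t1 := tm_ge1 P Hy.
rewrite dotBl !dotBr (dotC xi) x1 dot_to_ball// !to_ballE dotZl /horo.
by field; rewrite !gt_eqF//; lra.
Qed.

Lemma horo_ge0 y xi : H y -> dot xi xi = 1 -> 0 <= horo y xi.
Proof.
move=> Hy x1; have t1 := tm_ge1 P Hy; have := dot_ge0 (to_ball y - xi).
rewrite horo_to_ball// pmulr_lge0 ?invr_gt0; last by lra.
by rewrite pmulr_rge0.
Qed.

Lemma polar y : H y -> exists al, [/\ dot al al = 1, tm y = ch (hyp_dist o y) &
  sp y = sh (hyp_dist o y) *: al].
Proof.
move=> Hy.
have Ho := H_origin P.
have tE : tm y = ch (hyp_dist o y) by rewrite ch_hyp_dist// tm_lorentz.
have r0 := hyp_dist_ge0 Ho Hy.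
have sE : dot (sp y) (sp y) = sh (hyp_dist o y) ^+ 2.
  by rewrite dot_tm// tE; have := ch_sh (hyp_dist o y); lra.
have s0 := sh_ge0 r0; move: s0; rewrite le_eqVlt => /orP[/eqP s0|s0].
  exists (delta_mx 0 0); split => //.
    have := dot_enorm (delta_mx 0 0 : 'cV[R]_d); rewrite enorm_pole expr1n.
    by move->.
  by rewrite -s0 scale0r; apply: dot_eq0; rewrite sE -s0 expr0n.
exists ((sh (hyp_dist o y))^-1 *: sp y); split => //.
  by rewrite dotZl dotZr sE; field; rewrite gt_eqF.
by rewrite scalerA divff ?gt_eqF// scale1r.
Qed.

(** The value is its minimum [expR (- r)], attained in the direction of [y], plus a multiple of the
    squared chord from that direction. Both estimates of shadows by balls come from this formula. *)
Lemma horo_polar y al xi (r : R) : dot al al = 1 -> dot xi xi = 1 -> tm y = ch r ->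
  sp y = sh r *: al -> horo y xi = expR (- r) + sh r * dot (xi - al) (xi - al) / 2.
Proof.
move=> a1 x1 tE sE; rewrite /horo tE sE dotZl dotBl !dotBr a1 x1 (dotC xi) /ch /sh.
by field.
Qed.

Section convergence.
Variables (z : nat -> vec) (xi : 'cV[R]_d).
Hypothesis Hz : forall k, H (z k).
Hypothesis xi1 : dot xi xi = 1.
Hypothesis z_xi : to_ball (z k) @[k --> \oo] --> xi.

Lemma cvg_dot (a b : nat -> 'cV[R]_d) (a0 b0 : 'cV[R]_d) : a @ \oo --> a0 -> b @ \oo --> b0 ->
  dot (a k) (b k) @[k --> \oo] --> dot a0 b0.
Proof.
move=> aa bb; rewrite /dot; apply: cvg_big => [|i _]; first exact: add_continuous.
have c (u : nat -> 'cV[R]_d) (u0 : 'cV[R]_d) : u @ \oo --> u0 -> u k i 0 @[k --> \oo] --> u0 i 0.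
  by move=> uu; apply: (@cvg_comp _ _ _ u (fun M : 'cV[R]_d => M i 0) _ _ _ uu); exact: coord_continuous.
by apply: cvgM; exact: c.
Qed.

Lemma tm_infty : (1 + tm (z k))^-1 @[k --> \oo] --> (0 : R).
Proof.
have h : (1 - dot (to_ball (z k)) (to_ball (z k))) / 2 @[k --> \oo] --> ((1 - 1) / 2 : R).
  apply: cvgM; last exact: cvg_cst.
  by apply: cvgB; [exact: cvg_cst|rewrite -xi1; exact: cvg_dot].
rewrite subrr mul0r in h; apply: cvg_trans h; apply: near_eq_cvg.
apply: nearW => k; rewrite dot_to_ball//; have t1 := tm_ge1 P (Hz k).
by field; rewrite gt_eqF//; lra.
Qed.

Lemma lorentz_horo y : - lorentz y (z k) / (1 + tm (z k)) @[k --> \oo] --> horo y xi.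
Proof.
have h : tm y * (1 - (1 + tm (z k))^-1) - dot (sp y) (to_ball (z k)) @[k --> \oo] -->
    tm y * (1 - 0) - dot (sp y) xi.
  apply: cvgB; last by apply: cvg_dot => //; exact: cvg_cst.
  apply: cvgM; first exact: cvg_cst.
  by apply: cvgB; [exact: cvg_cst|exact: tm_infty].
rewrite subr0 mulr1 in h; apply: cvg_trans h; apply: near_eq_cvg.
apply: nearW => k; have t1 := tm_ge1 P (Hz k).
by rewrite to_ballE dotZr lorentzE; field; rewrite gt_eqF//; lra.
Qed.

End convergence.
End ideal_points.

(** * Shadows on the sphere at infinity compared with balls *)

Section shadows_of_orbit_points.
Variables (R : realType) (n : nat) (P : right_angled_polytope R n.+1).
Local Notation d := n.+1.
Local Notation vec := 'cV[R]_(d + 1).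
Local Notation H := (@hyperboloid R d).
Local Notation o := (origin R d).
Implicit Types (y z : vec) (al xi : 'cV[R]_d).

Lemma hyp_dist_expR y z : H y -> H z ->
  - lorentz y z <= expR (hyp_dist y z) /\ expR (hyp_dist y z) <= 2 * - lorentz y z.
Proof.
move=> Hy Hz; rewrite -ch_hyp_dist//; split; last exact: expR_ch.
by apply: ch_expR; exact: hyp_dist_ge0.
Qed.

(** A chord of length at most [expR (- r)] gives [horo y xi < 2 * expR (- r)], and [lorentz_horo]
    turns this into a bound on distances. The 4 collects the constants through
    [4 * expR 2 <= expR 4]. *)
Lemma horo_small y al xi (z : nat -> vec) : H y -> (forall k, H (z k)) ->
  dot al al = 1 -> dot xi xi = 1 ->
  to_ball (z k) @[k --> \oo] --> xi ->
  sp y = sh (hyp_dist o y) *: al ->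
  dot (xi - al) (xi - al) <= expR (- hyp_dist o y) ^+ 2 ->
  \forall k \near \oo, hyp_dist o y + hyp_dist y (z k) <= hyp_dist o (z k) + 4.
Proof.
move=> Hy Hz a1 x1 zx sE near_al; have Ho := H_origin P.
have r0 := hyp_dist_ge0 Ho Hy.
have tE : tm y = ch (hyp_dist o y) by rewrite ch_hyp_dist// tm_lorentz.
set r := hyp_dist o y in sE near_al tE r0 *.
have hQ : horo y xi < 2 * expR (- r).
  rewrite (horo_polar a1 x1 tE sE) /sh.
  set E := expR (- r) in near_al *; have E0 : 0 < E by exact: expR_gt0.
  have EE : expR r * E = 1 by rewrite -expRD subrr expR0.
  have e0 : 0 < expR r by exact: expR_gt0.
  set q := dot _ _ in near_al *.
  have q0 : 0 <= q by exact: dot_ge0.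
  have h1 : expR r * q <= E.
    apply: (@le_trans _ _ (expR r * E ^+ 2)); first by rewrite ler_wpM2l// ltW.
    by rewrite expr2 mulrA EE mul1r.
  have h2 : 0 <= E * q by rewrite mulr_ge0// ltW.
  by clear - h1 h2 E0; lra.
have /cvgr_lt/(_ _ hQ) := @lorentz_horo R n P z xi Hz x1 zx y.
apply: filterS => k; have t1 := tm_ge1 P (Hz k).
rewrite ltr_pdivrMr; last by lra.
move=> h; have [_ h1] := hyp_dist_expR Hy (Hz k); have [h2 _] := hyp_dist_expR Ho (Hz k).
rewrite tm_lorentz in h2.
rewrite -ler_expR expRD [leRHS]expRD (mulrC (expR (hyp_dist o (z k)))).
have h3 : expR (hyp_dist y (z k)) <= 4 * expR 2 * expR (- r) * expR (hyp_dist o (z k)) .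
  have e4 := @expR2_ge4 R.
  apply: (le_trans h1); apply: (@le_trans _ _ (4 * expR (- r) * (1 + tm (z k)))).
    by move: h; move: (lorentz _ _) (tm _) (expR _); clear => *; lra.
  apply: (@le_trans _ _ (4 * expR (- r) * (2 * expR (hyp_dist o (z k))))).
    by rewrite ler_wpM2l ?mulr_ge0 ?expR_ge0//; move: t1 h2; move: (tm _) (expR _); clear => *; lra.
  have p : 0 <= expR (- r) * expR (hyp_dist o (z k)) by rewrite mulr_ge0 ?expR_ge0.
  move: e4 p; set a := expR 2; set b := expR (- r); set c := expR (hyp_dist _ _).
  by clear => e4 p; nra.
have -> : expR 4 = expR 2 * expR 2 :> R.
  by rewrite -expRD -natrD.
apply: (@le_trans _ _ (expR r * (4 * expR 2 * expR (- r) * expR (hyp_dist o (z k))))).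
  by rewrite ler_wpM2l ?expR_ge0.
rewrite (_ : expR r * _ = (expR r * expR (- r)) * (4 * expR 2 * expR (hyp_dist o (z k)))); last first.
  by move: (expR r) (expR (- r)) (expR 2) (expR _); clear=> *; ring.
rewrite -expRD subrr expR0 mul1r ler_wpM2r ?expR_ge0// ler_wpM2r ?expR_ge0//.
exact: expR2_ge4.
Qed.

Lemma horo_large y al xi (z : nat -> vec) (K : R) : H y -> (forall k, H (z k)) ->
  dot al al = 1 -> dot xi xi = 1 ->
  to_ball (z k) @[k --> \oo] --> xi ->
  sp y = sh (hyp_dist o y) *: al ->
  (\forall k \near \oo, hyp_dist o y + hyp_dist y (z k) <= hyp_dist o (z k) + K) ->
  dot (xi - al) (xi - al) <= (16 * expR K + 4 * expR 2) * expR (- hyp_dist o y) ^+ 2.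
Proof.
move=> Hy Hz a1 x1 zx sE btw; have Ho := H_origin P.
have r0 := hyp_dist_ge0 Ho Hy.
have tE : tm y = ch (hyp_dist o y) by rewrite ch_hyp_dist// tm_lorentz.
set r := hyp_dist o y in sE btw tE r0 *.
have : horo y xi <= 2 * expR (K - r).
  rewrite leNgt; apply/negP => hQ.
  have /cvgr_gt/(_ _ hQ) far := @lorentz_horo R n P z xi Hz x1 zx y.
  have [k [/= h1 h2]] := @filter_ex _ _ _ _ (filterI far btw).
  have t1 := tm_ge1 P (Hz k).
  rewrite ltr_pdivlMr in h1; last by lra.
  have [h3 _] := hyp_dist_expR Hy (Hz k); have [_ h4] := hyp_dist_expR Ho (Hz k).
  rewrite tm_lorentz in h4.
  have : expR (hyp_dist y (z k)) <= expR (K - r) * expR (hyp_dist o (z k)).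
    by rewrite -expRD ler_expR; clear - h2; lra.
  have h5 : expR (K - r) * expR (hyp_dist o (z k)) <= expR (K - r) * (2 * tm (z k)).
    by rewrite ler_wpM2l ?expR_ge0.
  have := expR_gt0 (K - r); move: h1 h3 h5.
  move: (expR (hyp_dist y (z k))) (expR (hyp_dist o (z k))) (expR (K - r)) (lorentz _ _) (tm _).
  by clear => *; lra.
rewrite (horo_polar a1 x1 tE sE) expRD.
set q := dot _ _; have q0 : 0 <= q by exact: dot_ge0.
have q4 : q <= 4.
  rewrite /q dotBl !dotBr a1 x1 (dotC al).
  have := dot_ge0 (xi + al); rewrite dotDl !dotDr a1 x1 (dotC al); clear; lra.
set E := expR (- r); have E0 : 0 < E by exact: expR_gt0.
have K0 : 0 < expR K by exact: expR_gt0.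
have EE : expR r * E = 1 by rewrite -expRD subrr expR0.
(* For radius below 1 the factor [sh r] is too small to divide by, but a squared chord is at most 4.
   This is the origin of the term [4 * expR 2]. *)
have [r1|r1] := leP 1 r; last first.
  move=> _; have : 1 <= expR 2 * E ^+ 2.
    rewrite /E -expRM_natl -expRD -[X in X <= _]expR0 ler_expR.
    by move: r1; move: (r) => r'; clear; lra.
  have : 0 <= 16 * expR K * E ^+ 2 by rewrite !mulr_ge0 ?sqr_ge0//; exact: ltW.
  by move: q4; move: (expR 2) (E ^+ 2) (expR K) (q); clear => *; lra.
have s4 : expR r <= 4 * sh r.
  rewrite /sh -/E.
  have e2 : 4 <= expR r ^+ 2.
    rewrite -expRM_natl; apply: le_trans (@expR2_ge4 R) _; rewrite ler_expR; clear - r1; lra.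
  have : 2 * E <= expR r.
    have : 4 * E <= expR r ^+ 2 * E by rewrite ler_wpM2r// ltW.
    by rewrite expr2 -mulrA EE mulr1; clear - E0; lra.
  clear; lra.
move=> h; have h1 : sh r * q / 2 <= 2 * (expR K * E) by clear - h E0; lra.
have h2 : expR r * q <= 16 * expR K * E.
  have : expR r * q <= 4 * sh r * q by rewrite ler_wpM2r.
  by move: h1; move: (sh r) (expR r) (expR K) (q) (E); clear => a b c q' E' *; lra.
have : expR r * q * E <= 16 * expR K * E * E by rewrite ler_wpM2r// ltW.
rewrite mulrAC EE mul1r; have : 0 <= expR 2 * E ^+ 2 by rewrite mulr_ge0 ?sqr_ge0 ?expR_ge0.
by rewrite expr2; move: (expR 2) (expR K) (E) (q); clear => *; lra.
Qed.

Lemma cvg_enorm (u : nat -> 'cV[R]_d) (xi : 'cV[R]_d) (e : nat -> R) :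
  (forall k, enorm (u k - xi) ^+ 2 <= e k) -> e @ \oo --> 0 -> u @ \oo --> xi.
Proof.
move=> ue e0; apply/cvgrPdist_lt => eps eps0.
have eps20 : 0 < eps ^+ 2 by rewrite exprn_gt0.
move/cvgr0Pnorm_lt: e0 => /(_ _ eps20); apply: filterS => k ek.
rewrite /Num.norm/= mx_normrE; apply: bigmax_lt => // -[i j] _ /=.
rewrite (ord1 j); apply: (@le_lt_trans _ _ (enorm (u k - xi))).
  by apply: le_trans (enorm_coord _ i); rewrite !mxE distrC.
rewrite -(@ltr_pXn2r _ 2) ?nnegrE ?enorm_ge0 ?(ltW eps0)//.
by apply: le_lt_trans (ue k) _; apply: le_lt_trans (ler_norm _) ek.
Qed.

Lemma sh_ge_half (t : R) : 0 <= t -> t / 2 <= sh t.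
Proof.
move=> t0; rewrite /sh; have := expR_ge1Dx t.
have : expR (- t) <= 1 by rewrite -expR0 ler_expR; lra.
by move: (expR t) (expR (- t)); clear => *; lra.
Qed.

Lemma sh_infty (C : R) : C * (sh k.+1%:R)^-1 @[k --> \oo] --> (0 : R).
Proof.
rewrite -[X in _ --> X](mulr0 C); apply: cvgM; first exact: cvg_cst.
apply: (@squeeze_cvgr _ _ _ _ (fun=> 0) (fun k => 2 * k.+1%:R^-1)).
- apply: nearW => k; have k0 : 0 < k.+1%:R :> R by rewrite ltr0n.
  rewrite invr_ge0 (ltW (sh_gt0 k0)) /=.
  have := sh_ge_half (ltW k0); have := sh_gt0 k0; move: (sh _) => S S0 kS.
  rewrite -[2]invrK -invfM lef_pV2 ?posrE// ?mulr_gt0 ?invr_gt0//.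
  by rewrite mulrC.
- exact: cvg_cst.
- rewrite -[X in _ --> X](mulr0 2); apply: cvgM; first exact: cvg_cst.
  exact: cvg_harmonic.
Qed.

Lemma orbit_converges xi : dot xi xi = 1 -> exists w : nat -> 'M[R]_(d + 1),
  [/\ forall k, weyl P (w k),
      to_ball (w k *m o) @[k --> \oo] --> xi &
      forall M : R, exists N, forall i j, (N <= i)%N -> (N <= j)%N ->
        M <= hyp_dist o (w i *m o) + hyp_dist o (w j *m o) -
             hyp_dist (w i *m o) (w j *m o)].
Proof.
move=> x1; have [C hC] := cocompact P; have Ho := H_origin P.
(* Points on the ray towards [xi], starting at distance 1 so that [sh] never vanishes. Cocompactness
   supplies an orbit point near each of them. *)
pose z k : vec := col_mx (sh k.+1%:R *: xi) (ch k.+1%:R)%:M.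
have spz k : sp (z k) = sh k.+1%:R *: xi by rewrite /sp /z col_mxKu.
have tmz k : tm (z k) = ch k.+1%:R by rewrite /tm /z col_mxKd mxE eqxx.
have Hz k : H (z k).
  split; last by change (0 < tm (z k)); rewrite tmz; have := ch_ge1 (k.+1%:R : R); lra.
  rewrite lorentzE spz tmz dotZl dotZr x1; have := ch_sh (k.+1%:R : R).
  by move: (ch _) (sh _); clear => a b h; lra.
have {hC}[w hw] : {w : nat -> 'M[R]_(d + 1) & forall k, weyl P (w k) /\ tm (w k *m z k) <= C}.
  apply: (@choice _ _ (fun k v => weyl P v /\ tm (v *m z k) <= C)) => k.
  by have [v] := hC _ (Hz k); exists v.
have Ww k : weyl P (invmx (w k)) by apply: weylV; exact: (hw k).1.
have Hw k : H (invmx (w k) *m o) by exact: weyl_hyperboloid.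
(* An orbit point at bounded distance from [z k] has [horo] at most a constant over [sh]; by
   [horo_to_ball] this forces convergence in the ball. *)
have hq k : horo (invmx (w k) *m o) xi * sh k.+1%:R <= C.
  have : - lorentz (invmx (w k) *m o) (z k) <= C.
    by rewrite (weyl_lorentzVl _ _ (hw k).1) tm_lorentz; exact: (hw k).2.
  apply: le_trans; rewrite lorentzE spz tmz dotZr /horo.
  set y := _ *m _; have : 0 < tm y by have := tm_ge1 P (Hw k); rewrite -/y; lra.
  have : 0 < expR (- k.+1%:R : R) by exact: expR_gt0.
  have -> : ch k.+1%:R = sh k.+1%:R + expR (- k.+1%:R) :> R by rewrite /ch /sh; field.
  move: (tm y) (dot _ _) (expR _) (sh _); clear => t D E s E0 t0.
  by have h : 0 < t * E; [exact: mulr_gt0|lra].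
have nb k : enorm (to_ball (invmx (w k) *m o) - xi) ^+ 2 <= C * (sh k.+1%:R)^-1.
  rewrite dot_enorm horo_to_ball// ler_pdivlMr ?sh_gt0 ?ltr0n//.
  have q0 := horo_ge0 P (Hw k) x1; have t1 := tm_ge1 P (Hw k).
  apply: le_trans (hq k); rewrite ler_wpM2r ?sh_ge0// ler_pdivrMr; last by lra.
  by move: q0 t1; move: (horo _ _) (tm _); clear => *; nra.
have cv : to_ball (invmx (w k) *m o) @[k --> \oo] --> xi by exact: cvg_enorm nb (@sh_infty C).
exists (fun k => invmx (w k)); split => // M.
have M0 : 0 < expR (- M) / 24 by rewrite divr_gt0 ?expR_gt0.
have /cvgr_lt/(_ _ M0)[N1 _ h1] := @tm_infty R n P _ xi Hw x1 cv.
have /cvgr_lt/(_ _ M0)[N2 _ h2] := @sh_infty C.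
exists (maxn N1 N2) => i j; rewrite !geq_max => /andP[i1 i2] /andP[j1 j2].
have {}h1 := h1 _ i1.
have q1 := le_lt_trans (nb i) (h2 _ i2); have q2 := le_lt_trans (nb j) (h2 _ j2).
have t1 := tm_ge1 P (Hw i); have t2 := tm_ge1 P (Hw j).
have [e1 _] := hyp_dist_expR Ho (Hw i); have [e2 _] := hyp_dist_expR Ho (Hw j).
have [_ e3] := hyp_dist_expR (Hw i) (Hw j).
rewrite tm_lorentz in e1; rewrite tm_lorentz in e2.
rewrite (lorentz_to_ball P)// in e3; rewrite !dot_enorm in q1 q2.
set b1 := to_ball _ in q1 e3; set b2 := to_ball _ in q2 e3.
have bb : dot (b1 - b2) (b1 - b2) <= 2 * dot (b1 - xi) (b1 - xi) + 2 * dot (b2 - xi) (b2 - xi).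
  have -> : b1 - b2 = (b1 - xi) - (b2 - xi) by rewrite opprB addrA subrK.
  move: (b1 - xi) (b2 - xi) => a b; have := dot_ge0 (a + b).
  have -> : dot (a - b) (a - b) = dot a a - dot a b - (dot a b - dot b b).
    by rewrite dotBl !dotBr (dotC b).
  rewrite dotDl !dotDr (dotC b).
  by move: (dot a a) (dot a b) (dot b b); clear => *; lra.
set y1 := invmx (w i) *m o in h1 t1 e1 e3 *; set y2 := invmx (w j) *m o in t2 e2 e3 *.
rewrite -[M]opprK lerNl opprD opprK.
have : expR (hyp_dist y1 y2) <= expR (- M + (hyp_dist o y1 + hyp_dist o y2)).
  rewrite !expRD; move: M0 h1 q1 q2 t1 t2 e1 e2 e3 bb.
  move: (expR (hyp_dist y1 y2)) (expR (hyp_dist o y1)) (expR (hyp_dist o y2)) (expR (- M)).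
  move: (tm y1) (tm y2) (dot _ _) (dot (b1 - xi) _) (dot (b2 - xi) _); clear.
  move=> t1 t2 q q1 q2 E E1 E2 eM M0 h1 q1M q2M t11 t21 e1 e2 e3 bb.
  rewrite -div1r ltr_pdivrMr in h1; last by lra.
  have T4 : 0 <= (1 + t1) * (1 + t2) by apply: mulr_ge0; lra.
  have f1 : q * ((1 + t1) * (1 + t2)) <= 4 * (eM / 24) * ((1 + t1) * (1 + t2)).
    by rewrite ler_wpM2r//; lra.
  have f2 : 2 <= eM / 24 * ((1 + t1) * (1 + t2)).
    rewrite mulrA; apply: (@le_trans _ _ (1 * (1 + t2))); first lra.
    by rewrite ler_wpM2r ?ltW//; lra.
  have f3 : (1 + t1) * (1 + t2) <= (2 * E1) * (2 * E2) by apply: ler_pM; lra.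
  have f4 : eM * ((1 + t1) * (1 + t2)) <= eM * ((2 * E1) * (2 * E2)).
    by rewrite ler_wpM2l//; lra.
  lra.
by rewrite ler_expR; move: (hyp_dist _ _) (hyp_dist _ _) (hyp_dist _ _); clear => a b c h; lra.
Qed.

End shadows_of_orbit_points.

(** * Weights of chambers *)

Ltac glra2 := repeat match goal with
  | |- context [@cdist ?R ?n ?P ?X ?a ?b] => move: (@cdist R n P X a b) => ?
  end; intros; lra.

(* [lra] on the goal alone, with distances generalized and the inequalities of
   the context dropped. *)
Ltac glra3 := repeat match goal with
  | |- context [@cdist ?R ?n ?P ?X ?a ?b] => move: (@cdist R n P X a b) => ?
  end; repeat match goal with
  | H : is_true _ |- _ => clear H
  | H : _ = _ |- _ => clear H
  end; intros; lra.

Section weights.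
Variables (R : realType) (n : nat) (P : right_angled_polytope R n.+2).
Variables (X : building P) (q : facet P -> nat).
Hypothesis q_gt0 : forall s, (0 < q s)%N.
Hypothesis q_card : forall s (x : X), (panel s x #= `I_(q s).+1)%card.
Local Notation o := (origin R n.+2).
Local Notation W := (weyl P).
Local Notation len := (word_length P).
Local Notation dist := (@cdist R n.+1 P X).
Local Notation nsph := (nsphere (X := X)).
Implicit Types (x y z c p : X) (s : facet P).

Definition nchambers x y : nat := nsph x (wdist x y).

Lemma nchambers_gt0 x y : (0 < nchambers x y)%N.
Proof. exact: (nsphere_gt0 q_gt0 q_card x (wdist_weyl x y)). Qed.

Lemma nchambersC x y : nchambers x y = nchambers y x.
Proof.
rewrite /nchambers (wdistC x y) (nsphereV q_card _ (wdist_weyl x y)).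
by apply: (nsphere_base q_card); exact: wdist_weyl.
Qed.

Lemma nchambersxx x : nchambers x x = 1%N.
Proof.
by rewrite /nchambers wdistxx (nsphere_eval q_card x (a := [::])) ?big_nil// len1.
Qed.

Lemma nchambers_step c x y s : wdist x y = refl s ->
  (nchambers c y <= nchambers c x * nsph c (refl s))%N.
Proof.
move=> xy; have [[E|E] _] := wdist_step_right c xy; rewrite /nchambers E.
  by apply: (nsphere_mulr q_gt0 q_card); exact: wdist_weyl.
by rewrite leq_pmulr// (nsphere_gt0 q_gt0 q_card)//; exact: weyl_refl.
Qed.

Lemma nchambers_triangle x y z : (nchambers x z <= nchambers x y * nchambers y z)%N.
Proof.
have [a ay sa] := reduced_word (wdist_weyl y z).
have /(wdist_gallery (esym ay)) g : size a = len (eval_word a) by rewrite sa ay.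
have -> : nchambers y z = (\prod_(s <- a) nsph x (refl s))%N.
  rewrite /nchambers -ay (nsphere_eval q_card y) ?ay//; apply: eq_bigr => s _.
  rewrite -[refl s]mulmx1 (nsphere_eval q_card x (a := [:: s])) ?big_seq1//.
  by rewrite /= mulmx1 len_refl.
elim: a {ay sa} y g => [|s a IH] y /=; first by move=> ->; rewrite big_nil muln1.
move=> [y' yy' /IH h]; apply: leq_trans h _; rewrite big_cons mulnA leq_mul2r.
by rewrite nchambers_step ?orbT.
Qed.

Lemma ball_seq (r : R) : exists B : nat, forall c, exists l : seq X,
  [/\ uniq l, (size l <= B)%N & forall y, y \in l <-> dist c y <= r].
Proof.
pose S := [set w | W w /\ tm (w *m o) <= ch r].
have fS : finite_set S by exact: orbit_finite.
have [c0|nX] := pselect (exists c : X, True); last first.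
  by exists 0%N => c; case: nX; exists c.
have {c0}[c0 _] := c0.
exists (\sum_(w <- fset_set S) nsph c0 w)%N => c.
have distE y : dist c y <= r <-> 0 <= r /\ S (wdist c y).
  have H1 := H_orbit c y; have H0 := H_origin P.
  have E : tm (wdist c y *m o) = ch (dist c y) by rewrite /cdist ch_hyp_dist// tm_lorentz.
  split=> [h|[r0 [_ h]]].
    have r0 : 0 <= r by apply: le_trans h; exact: cdist_ge0.
    by split=> //; split; [exact: wdist_weyl|rewrite E ch_mono ?cdist_ge0].
  by apply: ch_le => //; rewrite -E.
have [r0|r0] := leP 0 r; last first.
  exists [::]; split=> // y; split=> // h; have := cdist_ge0 c y; lra.
pose l := flatten [seq enum_fset (fset_set (sphere_at c w)) | w <- fset_set S].
exists (undup l); split; first exact: undup_uniq.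
- apply: leq_trans (size_undup l) _; rewrite /l size_flatten /shape -map_comp sumnE big_map.
  rewrite !big_seq; apply: leq_sum => w; rewrite in_fset_set// => /set_mem[Ww _] /=.
  by rewrite -(nsphere_base q_card c).
- move=> y; rewrite mem_undup distE; split=> [/flattenP[s /mapP[w]]|[_ Sy]].
    rewrite in_fset_set// => /set_mem Sw ->; rewrite in_fset_set; last exact: (sphere_finite q_card).
    by move=> /set_mem /= ->.
  apply/flattenP; exists (enum_fset (fset_set (sphere_at c (wdist c y)))).
    by apply/mapP; exists (wdist c y) => //; rewrite in_fset_set//; exact: mem_set.
  by rewrite in_fset_set; [exact/mem_set|exact: (sphere_finite q_card)].
Qed.

(** The two factors have different origins: a shadow in one apartment is a ball of radius about
    [expR (- dist x y)] in a sphere of dimension [n.+1], and Haar measure of the stabilizer spreads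
    it evenly over the chambers at this [W]-distance. *)
Definition weight x y : R := expR (- dist x y) ^+ n.+1 / (nchambers x y)%:R.

Lemma weight_gt0 x y : 0 < weight x y.
Proof. by rewrite divr_gt0 ?exprn_gt0 ?expR_gt0// ltr0n nchambers_gt0. Qed.

Lemma weightC x y : weight x y = weight y x.
Proof. by rewrite /weight cdistC nchambersC. Qed.

Lemma weightxx x : weight x x = 1.
Proof. by rewrite /weight cdistxx nchambersxx oppr0 expR0 expr1n divr1. Qed.

Lemma weight_le_expR x y : weight x y <= expR (- dist x y).
Proof.
rewrite /weight ler_pdivrMr ?ltr0n ?nchambers_gt0// exprS ler_pM ?expR_ge0 ?exprn_ge0 ?expR_ge0//.
apply: (@le_trans _ _ 1); last by rewrite ler1n nchambers_gt0.
by rewrite exprn_ile1 ?expR_ge0// -expR0 ler_expR oppr_le0 cdist_ge0.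
Qed.

Lemma weight_superM x y z : weight x y * weight y z <= weight x z.
Proof.
have gen (a b N1 N2 : R) : a ^+ n.+1 / N1 * (b ^+ n.+1 / N2) = (a * b) ^+ n.+1 / (N1 * N2).
  by rewrite mulf_div exprMn.
rewrite /weight gen; apply: ler_pM.
- by rewrite exprn_ge0 ?mulr_ge0 ?expR_ge0.
- by rewrite invr_ge0 mulr_ge0.
- rewrite lerXn2r ?nnegrE ?mulr_ge0 ?expR_ge0// -expRD ler_expR -opprD lerN2; exact: cdist_triangle.
- by rewrite -natrM lef_pV2 ?posrE ?ltr0n ?muln_gt0 ?nchambers_gt0// ler_nat nchambers_triangle.
Qed.

Lemma weight_near (r : R) : exists2 C : R, 1 <= C & forall a x y, dist x y <= r ->
  weight a x <= C * weight a y.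
Proof.
have [B hB] := ball_seq r; pose C : R := expR r ^+ n.+1 * B.+1%:R.
have near x y : dist x y <= r -> (nchambers x y <= B)%N.
  move=> xy; have [l [ul sl hl]] := hB x; apply: leq_trans sl.
  rewrite /nchambers /Defs.chamber /nsphere; apply: uniq_leq_size => // z.
  rewrite in_fset_set; last exact: (sphere_finite q_card).
  by move=> /set_mem E; apply/hl; rewrite /cdist E.
exists (Num.max 1 C); first by rewrite le_max lexx.
move=> a x y xy; apply: (@le_trans _ _ (C * weight a y)); last first.
  by rewrite ler_wpM2r ?(ltW (weight_gt0 _ _))// le_max lexx orbT.
rewrite /weight /C mulrACA -exprMn; apply: ler_pM.
- by rewrite exprn_ge0 ?expR_ge0.
- by rewrite invr_ge0.
- rewrite lerXn2r ?nnegrE ?mulr_ge0 ?expR_ge0// -expRD ler_expR.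
  by have := cdist_triangle a x y; move: xy; glra2.
- rewrite -div1r ler_pdivrMr ?ltr0n ?nchambers_gt0// mulrAC ler_pdivlMr ?ltr0n ?nchambers_gt0//.
  rewrite mul1r -natrM ler_nat; apply: leq_trans (nchambers_triangle a x y) _.
  by rewrite mulnC leq_mul// ltnW// ltnS near.
Qed.

(* A chamber coarsely between two others is near one that splits their
   [wdist] into a reduced product, along which [nchambers] is multiplicative. *)
Lemma weight_subM (r : R) : exists2 C : R, 1 <= C & forall a p b, between a p b r ->
  weight a b <= C * (weight a p * weight p b).
Proof.
have [D D0 hD] := cdist_geodesic X; have [C C1 hC] := weight_near (`|r| + D).
pose K := expR (2 * D) ^+ n.+1.
have K1 : 1 <= K by rewrite exprn_ege1// -[leLHS]expR0 ler_expR mulr_ge0.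
exists (K * C ^+ 2).
  by apply: (le_trans K1); rewrite ler_peMr ?exprn_ege1//; lra.
move=> a p b apb; have ab0 := cdist_ge0 a b; have ap0 := cdist_ge0 a p.
pose t := Num.min (dist a p) (dist a b).
have t0 : 0 <= t <= dist a b by rewrite le_min ap0 ab0 ge_min lexx orbT.
have [z [h1 h2 h3 h4 h5]] := hD a b t t0.
have pz : dist z p <= `|r| + D.
  rewrite cdistC; apply: le_trans (h3 p) _; rewrite lerD2r ge_max (cdistC p a).
  have := ler_norm r; have := cdist_ge0 p b; move: apb; rewrite /between /t minElt.
  have := cdist_triangle a p b.
  by case: ifPn; rewrite -?leNgt => h e1 e2 e3 e4; apply/andP; split; move: h e1 e2 e3 e4; glra2.
have zp : dist p z <= `|r| + D by rewrite cdistC.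
apply: (@le_trans _ _ (K * (weight a z * weight z b))); last first.
  rewrite -mulrA ler_wpM2l//; first by lra.
  have -> : C ^+ 2 * (weight a p * weight p b) = (C * weight a p) * (C * weight p b) by ring.
  apply: ler_pM; rewrite ?(ltW (weight_gt0 _ _))//; first exact: hC pz.
  by rewrite (weightC z) (weightC p); exact: hC pz.
have gen (a' b' c' N1 N2 : R) : a' ^+ n.+1 * (b' ^+ n.+1 / N1 * (c' ^+ n.+1 / N2)) =
    (a' * (b' * c')) ^+ n.+1 / (N1 * N2).
  by rewrite mulf_div !exprMn !mulrA.
rewrite /weight /K gen -natrM.
have -> : nchambers a b = (nchambers a z * nchambers z b)%N.
  rewrite /nchambers (nsphere_base q_card z a (wdist_weyl z b)) h4.
  by apply: (nsphereM q_card); [exact: wdist_weyl|exact: wdist_weyl|rewrite -h4].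
rewrite ler_wpM2r ?invr_ge0// lerXn2r ?nnegrE ?mulr_ge0 ?expR_ge0// -!expRD ler_expR.
move: h1 h2; rewrite !ler_norml => /andP[_ h1] /andP[_ h2]; move: h1 h2; glra2.
Qed.

End weights.

(** * Levels, overlaps and branching of shadows *)

Section coarse_levels.
Variables (R : realType) (n : nat) (P : right_angled_polytope R n.+1).
Variables (X : building P).
Local Notation dist := (@cdist R n P X).
Implicit Types (x y z c p : X) (omega : boundary X).

Lemma shadow_level : exists2 D : R, 0 <= D & forall c omega t, 0 <= t ->
  exists2 x, `|dist c x - t| <= D & shadow c x D omega.
Proof.
have [D1 D10 h1] := shadow_approx X; have [D2 D20 h2] := cdist_geodesic X.
exists (D1 + 2 * D2); first by rewrite addr_ge0 ?mulr_ge0.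
move=> c omega t t0; have [u [cu hu]] := h1 c omega (t + D2).
have tu : 0 <= t <= dist c u by rewrite t0 /=; lra.
have [z [e1 e2 _ _ _]] := h2 c u t tu; exists z; first by apply: le_trans e1 _; lra.
move: e1 e2; rewrite !ler_norml => /andP[e1 e1'] /andP[e2 e2'].
have cc : dist c c <= t + D2 by rewrite cdistxx addr_ge0.
have cz : dist c z <= t + D2 by lra.
by rewrite addrC; apply: (hu c z (2 * D2) cc cz).2; rewrite /between; lra.
Qed.

Lemma shadow_overlap (r s : R) : exists C : R, forall c x y omega,
  shadow c x r omega -> shadow c y r omega -> `|dist c x - dist c y| <= s ->
  dist x y <= C.
Proof.
have [D1 D10 h1] := shadow_approx X; have [D D0 hD] := cdist_hyperbolic X.
exists (2 * `|r| + 2 * D1 + `|s| + D) => c x y omega ox oy xy.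
have [u [_ hu]] := h1 c omega (dist c x + dist c y).
have d1 := cdist_ge0 c x; have d2 := cdist_ge0 c y.
have [/(_ ox) bx _] := hu c x r ltac:(rewrite cdistxx; lra) ltac:(lra).
have [/(_ oy) by_ _] := hu c y r ltac:(rewrite cdistxx; lra) ltac:(lra).
have := hD x c y u; move: bx by_; rewrite /between.
have := ler_norm r; have := ler_norm s; have := normr_ge0 r.
move: xy; rewrite ler_norml (cdistC x c) maxElt.
by case: ifP => _ /andP[]; glra2.
Qed.

Lemma shadow_sub c y x (r s : R) : between c y x r -> shadow c x s `<=` shadow c y (r + s).
Proof.
move=> yx omega [u ou [N hN]]; exists u => //; exists N => i /hN; move: yx.
by rewrite /between; have := cdist_triangle y x (u i).1; glra2.
Qed.

Lemma shadow_base c y x (r s : R) : between c y x r -> shadow c x s `<=` shadow y x (r + s).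
Proof.
move=> yx omega [u ou [N hN]]; exists u => //; exists N => i /hN; move: yx.
by rewrite /between; have := cdist_triangle c y (u i).1; glra2.
Qed.

Lemma shadow_lip c x y (r : R) : shadow c x r `<=` shadow c y (r + 2 * dist x y).
Proof.
move=> omega [u ou [N hN]]; exists u => //; exists N => i /hN.
rewrite /between; have := cdist_triangle y x (u i).1; have := cdist_triangle c x y.
by rewrite (cdistC y x); glra2.
Qed.

Lemma shadow_all c omega : shadow c c 0 omega.
Proof.
have [u ou] := boundary_nonempty omega; exists u => //; exists 0%N => i _.
by rewrite /between cdistxx; glra2.
Qed.

(* Tripod: an ideal point branches off a geodesic near one of its chambers. *)
Lemma branch_chamber (r s : R) : exists C : R, forall c x omega, exists2 t,
  0 <= t <= dist c x & forall p, between c p x r -> `|dist c p - t| <= s ->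
    shadow c p C omega /\ shadow x p C omega.
Proof.
have [D1 D10 h1] := shadow_approx X; have [D D0 hD] := cdist_hyperbolic X.
exists (2 * `|r| + 2 * `|s| + D + D1) => c x omega.
have [u [_ hu]] := h1 c omega (dist c x + `|s|).
exists (gp c x u).
  have := cdist_triangle c x u; have := cdist_triangle x c u; have := cdist_triangle c u x.
  by rewrite /gp (cdistC x c) (cdistC u x) => h1' h2' h3'; apply/andP; split; move: h1' h2' h3'; glra2.
move=> p; rewrite /between => cpx; rewrite ler_norml => /andP[p1 p2].
have s0 := normr_ge0 s; have r0 := normr_ge0 r; have ss := ler_norm s; have rr := ler_norm r.
have cc : dist c c <= dist c x + `|s| by rewrite cdistxx addr_ge0 ?cdist_ge0.
have cx : dist c x <= dist c x + `|s| by rewrite lerDl.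
have cp : dist c p <= dist c x + `|s|.
  move: p2; rewrite /gp; have := cdist_triangle c x u; glra2.
have hp : dist p u <= dist c u - gp c x u + `|r| + `|s| + D.
  have := hD p c u x; move: cpx p1 p2; rewrite /gp maxElt (cdistC p c) (cdistC u x).
  by case: ifP => _; glra2.
split.
  apply: (@shadow_mono _ _ _ _ c p (2 * `|r| + 2 * `|s| + D + D1)) => //.
  by apply: (hu c p _ cc cp).2; rewrite /between; move: p1 p2 hp; rewrite /gp; glra2.
apply: (hu x p _ cx cp).2; rewrite /between (cdistC x p).
by move: p1 p2 hp cpx; rewrite /gp; glra2.
Qed.

End coarse_levels.

(** * The measure of shadows *)

Section stabilizer_measure.
Variables (R : realType) (n : nat) (P : right_angled_polytope R n.+2).
Variables (X : building P) (q : facet P -> nat).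
Hypothesis q_gt0 : forall s, (0 < q s)%N.
Hypothesis q_card : forall s (x : X), (panel s x #= `I_(q s).+1)%card.
Variable c0 : X.
Variables (nu : probability (borel_stab c0) R) (nu_haar : is_haar_probability nu).
Variables (G : groupType) (act : G -> aut X).
Hypothesis act_trans : strongly_transitive act.
Implicit Types (x y z : X).

Definition carries z y : set (borel_stab c0) := [set h | stab_fun h z = y].

Lemma carries_measurable z y : measurable (carries z y).
Proof.
apply: sub_sigma_algebra => h /= hz; exists [set z]; first exact: finite_set1.
by move=> h' /= /(_ z erefl) E; rewrite /carries /= E.
Qed.

(** The stabilizer is transitive on the chambers at this [W]-distance, so by invariance each of them
    is the image of [z] with equal probability. *)
Lemma carries_prob z y : wdist c0 z = wdist c0 y ->
  nu (carries z y) = ((nchambers c0 y)%:R^-1)%:E.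
Proof.
move=> zy; set w := wdist c0 y; pose S := sphere_at c0 w.
have fS : finite_set S by exact: (sphere_finite q_card).
have eqv y1 : S y1 -> nu (carries z y1) = nu (carries z y).
  move=> Sy1; have [g [gc gy]] := transitive_pairs act_trans (etrans Sy1 (esym (erefl w))).
  pose k : stabilizer c0 := exist (fun g : aut X => g c0 = c0) (act g) gc.
  rewrite -(nu_haar k (carries_measurable z y)); congr (nu _).
  have inj := bij_inj (aut_bij (act g)).
  apply/seteqP; split=> h /=; rewrite /carries /= /stab_fun /=; first by move->.
  by move=> hz; apply: inj; rewrite gy.
have cover : setT = \bigcup_(y1 in S) carries z y1.
  apply/seteqP; split=> // h _; exists (stab_fun h z) => //.
  by rewrite /S /sphere_at /= -[X in wdist X _](svalP h) aut_wdist.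
have := probability_setT nu; rewrite cover measure_fin_bigcup//.
- rewrite fsbig_finite//= (eq_big_seq (fun=> nu (carries z y))); last first.
    by move=> y1; rewrite in_fset_set// => /set_mem/eqv.
  rewrite big_const_seq count_predT -[size _]/(nchambers c0 y).
  have fin : nu (carries z y) \is a fin_num by apply: fin_num_measure; exact: carries_measurable.
  rewrite -(fineK fin); set a := fine _.
  have -> (N : nat) : iter N (fun e => a%:E + e)%E 0%E = (N%:R * a)%:E.
    elim: N => [|N IH]; first by rewrite mul0r.
    by rewrite iterS IH -EFinD -natr1; congr EFin; ring.
  move=> [] E; congr EFin; rewrite -[a]mul1r.
  have N0 : (nchambers c0 y)%:R != 0 :> R by rewrite pnatr_eq0 -lt0n (nchambers_gt0 q_gt0 q_card).
  by apply: (mulfI N0); rewrite mulfV// mul1r.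
- apply/trivIsetP => y1 y2 _ _ y12; apply/seteqP; split=> h //= [h1 h2].
  by move: y12; rewrite -h1 -h2 eqxx.
- by move=> y1 _; exact: carries_measurable.
Qed.

End stabilizer_measure.

Section apartment_sphere.
Variables (R : realType) (n : nat) (P : right_angled_polytope R n.+2).
Variables (X : building P) (xi0 : boundary X) (c0 : X) (A : set X).
Variable alpha : 'M[R]_(n.+2 + 1) -> X.
Local Notation o := (origin R n.+2).
Local Notation W := (weyl P).
Local Notation dist := (@cdist R n.+1 P X).
Hypothesis alpha1 : alpha 1%:M = c0.
Hypothesis alphaA : A = alpha @` W.
Hypothesis alpha_iso : forall u v, W u -> W v -> wdist (alpha u) (alpha v) = invmx u *m v.
Local Notation apb := (apartment_boundary xi0 c0 A).
Implicit Types (x y z p : X) (omega : boundary X).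

Lemma wdist_alpha w : W w -> wdist c0 (alpha w) = w.
Proof. by move=> Ww; rewrite -alpha1 alpha_iso//; [rewrite (invmx1 R) mul1mx|exact: weyl1]. Qed.

Lemma dist_alpha u v : W u -> W v -> dist (alpha u) (alpha v) = hyp_dist (u *m o) (v *m o).
Proof.
move=> Wu Wv; rewrite /cdist alpha_iso// -(weyl_hyp_dist o _ Wu) mulmxA mulmxA.
by rewrite (mulmxV (weyl_unit Wu)) mul1mx.
Qed.

Lemma dist_alpha0 w : W w -> dist c0 (alpha w) = hyp_dist o (w *m o).
Proof. by move=> Ww; rewrite /cdist wdist_alpha. Qed.

Lemma sphere_dot (xi : sphere R n.+1) : dot (sval xi) (sval xi) = 1.
Proof. by rewrite -dot_enorm (svalP xi) expr1n. Qed.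

(** The set under [get] in [apartment_boundary] is inhabited by [orbit_converges], so the chosen
    ideal point is represented by a sequence inside the apartment. *)
Lemma apartment_boundaryP (xi : borel_sphere R n.+1) : exists w : nat -> 'M[R]_(n.+2 + 1),
  [/\ forall k, W (w k), to_ball (w k *m o) @[k --> \oo] --> sval xi &
      sval (apb xi) (fun k => centre (alpha (w k)))].
Proof.
have : [set eta : pointed_boundary xi0 | exists x : nat -> X,
    [/\ forall k, A (x k),
        to_ball (wdist c0 (x k) *m origin R n.+2) @[k --> \oo] --> sval xi &
        sval eta (fun k => centre (x k))]] (apb xi).
  apply: getPex; have [w [Ww cv inf]] := orbit_converges P (sphere_dot xi).
  have tinf : to_infinity (fun k => centre (alpha (w k))).
    apply/asymptoticP => c M; have [N hN] := inf (2 * (M + dist c0 c)).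
    exists N => i j Ni Nj /=; have := hN i j Ni Nj.
    rewrite -!dist_alpha0// -dist_alpha//.
    have := gp_lip c0 c (alpha (w i)) (alpha (w j)); rewrite /gp; glra2.
  exists (exist _ (boundary_class (fun k => centre (alpha (w k)))) (ex_intro2 _ _ _ tinf erefl)).
  exists (fun k => alpha (w k)); split=> //=.
  - by move=> k; rewrite alphaA; exists (w k).
  - by under eq_fun do rewrite wdist_alpha//.
move=> [x [Ax cv etax]].
have {}Ax k : exists w, W w /\ alpha w = x k by have := Ax k; rewrite alphaA => -[w Ww <-]; exists w.
have [w hw] := choice Ax.
have xE : x = fun k => alpha (w k) by apply/funext => k; rewrite (hw k).2.
rewrite xE in cv etax; exists w; split=> //; first by move=> k; exact: (hw k).1.
by move: cv; under eq_fun do rewrite (wdist_alpha (hw _).1).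
Qed.

Lemma apartment_shadow_low w (al : 'cV[R]_n.+2) (xi : borel_sphere R n.+1) : W w ->
  enorm al = 1 -> sp (w *m o) = sh (hyp_dist o (w *m o)) *: al ->
  sball al (expR (- hyp_dist o (w *m o))) xi -> shadow c0 (alpha w) 4 (apb xi).
Proof.
move=> Ww al1 sE near_al; have [x [Wx cv ax]] := apartment_boundaryP xi.
have al1' : dot al al = 1 by rewrite -dot_enorm al1 expr1n.
exists (fun k => centre (alpha (x k))) => //.
have Hx k : hyperboloid (x k *m o) by apply: (weyl_hyperboloid (Wx k)); exact: H_origin.
have Hw : hyperboloid (w *m o) by apply: (weyl_hyperboloid Ww); exact: H_origin.
have [] := @horo_small R n.+1 P _ al _ _ Hw Hx al1' (sphere_dot xi) cv sE.
  by rewrite -dot_enorm lerXn2r ?nnegrE ?enorm_ge0 ?expR_ge0.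
move=> N _ hN; exists N => i /hN /=.
by rewrite /between dist_alpha0// dist_alpha0// dist_alpha.
Qed.

Lemma apartment_shadow_up (K : R) : exists2 C : R, 0 < C & forall w (al : 'cV[R]_n.+2) (xi : borel_sphere R n.+1),
  W w -> enorm al = 1 -> sp (w *m o) = sh (hyp_dist o (w *m o)) *: al ->
  shadow c0 (alpha w) K (apb xi) -> sball al (C * expR (- hyp_dist o (w *m o))) xi.
Proof.
have [D D0 hD] := between_far X.
pose C : R := 16 * expR (K + D) + 4 * expR 2.
have C1 : 1 <= C.
  have := expR_ge0 (K + D); have : 1 <= expR 2 :> R by rewrite -[leLHS]expR0 ler_expR.
  by rewrite /C; lra.
exists C; first by lra.
move=> w al xi Ww al1 sE [u ou [N1 hN1]]; have [x [Wx cv ax]] := apartment_boundaryP xi.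
have al1' : dot al al = 1 by rewrite -dot_enorm al1 expr1n.
have Hx k : hyperboloid (x k *m o) by apply: (weyl_hyperboloid (Wx k)); exact: H_origin.
have Hw : hyperboloid (w *m o) by apply: (weyl_hyperboloid Ww); exact: H_origin.
have [N2 hN2] := boundary_asym ou ax c0 (2 * dist c0 (alpha w) + D).
have btw : \forall k \near \oo, hyp_dist o (w *m o) + hyp_dist (w *m o) (x k *m o) <=
    hyp_dist o (x k *m o) + (K + D).
  exists N2 => // k N2k; have := hD c0 c0 (alpha w) (u (maxn N1 N2)).1 (alpha (x k)) (dist c0 (alpha w)) K.
  rewrite cdistxx cdist_ge0 lexx => /(_ isT isT (hN2 _ _ (leq_maxr _ _) N2k)).
  move=> /(_ (hN1 _ (leq_maxl _ _))).
  by rewrite /between dist_alpha0// dist_alpha0// dist_alpha.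
have := @horo_large R n.+1 P _ al _ _ _ Hw Hx al1' (sphere_dot xi) cv sE btw.
rewrite -dot_enorm -/C /sball /= => h.
rewrite -(@ler_pXn2r _ 2) ?nnegrE ?enorm_ge0 ?mulr_ge0 ?expR_ge0//; last by lra.
apply: le_trans h _; rewrite exprMn ler_wpM2r ?sqr_ge0//.
by rewrite expr2 ler_peMl//; lra.
Qed.

(** A chamber [z] on a geodesic towards [x k] may lie outside the apartment. Folded from [c0] into
    the apartment, it keeps its distance to [x k]. *)
Lemma apartment_sequence (xi : borel_sphere R n.+1) : exists2 x : nat -> X,
  sval (apb xi) (fun k => centre (x k)) &
  forall k z, wdist c0 (x k) = wdist c0 z *m wdist z (x k) ->
    dist (alpha (wdist c0 z)) (x k) = dist z (x k).
Proof.
have [w [Ww _ aw]] := apartment_boundaryP xi; exists (fun k => alpha (w k)) => //.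
move=> k z; rewrite wdist_alpha// => E.
have Wz := wdist_weyl c0 z; rewrite /cdist alpha_iso// {1}E mulmxA.
by rewrite (mulVmx (weyl_unit Wz)) mul1mx.
Qed.

End apartment_sphere.

Lemma le_sum_term (R : realType) (T : eqType) (l : seq T) (F : T -> \bar R) a :
  (forall x, 0 <= F x)%E -> a \in l -> (F a <= \sum_(x <- l) F x)%E.
Proof.
move=> F0; elim: l => // b l IH; rewrite inE big_cons => /orP[/eqP->|/IH h].
  by rewrite leeDl// sume_ge0.
by apply: (le_trans h); rewrite leeDr.
Qed.

(** The arithmetic of [mu_upper]: [z] is the chamber at the level of [p] on a geodesic from [c] to
    [x], and the four-point inequality puts it near [p]. *)
Lemma fellow_travel (R : realType) (cp px cx cz zx pz r D1 D2 D3 : R) :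
  0 <= px -> 0 <= D1 -> 0 <= D2 -> cx <= cp + px -> cp + px <= cx + (r + D1) ->
  `|cz - Num.min cp cx| <= D2 -> `|zx - (cx - Num.min cp cx)| <= D2 ->
  pz + cx <= Num.max (cp + zx) (cz + px) + D3 ->
  pz <= 2 * `|r| + 2 * D1 + 3 * D2 + D3.
Proof.
have := ler_norm r; have := normr_ge0 r; rewrite !ler_norml minElt maxElt.
by case: ifPn; case: ifPn; rewrite -?leNgt => + + + + + + + + + /andP[+ +] /andP[+ +]; lra.
Qed.

(** * The measure of a shadow is comparable to the weight of its chamber *)

Section boundary_measure_bounds.
Variables (R : realType) (n : nat) (P : right_angled_polytope R n.+2).
Variables (X : building P) (q : facet P -> nat).
Hypothesis q_gt0 : forall s, (0 < q s)%N.
Hypothesis q_card : forall s (x : X), (panel s x #= `I_(q s).+1)%card.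
Variables (xi0 : boundary X) (c0 : X).
Variables (nu : probability (borel_stab c0) R) (nu_haar : is_haar_probability nu).
Variable mu : {measure set (borel_boundary xi0) -> \bar R}.
Hypothesis mu_def : is_boundary_measure nu mu.
Variables (G : groupType) (act : G -> aut X).
Hypothesis act_trans : strongly_transitive act.
Local Notation o := (origin R n.+2).
Local Notation W := (weyl P).
Local Notation dist := (@cdist R n.+1 P X).
Local Notation weight := (@weight R n P X).
Implicit Types (x y z p : X) (omega : boundary X).

Lemma unit_direction w : W w -> exists2 al : 'cV[R]_n.+2,
  enorm al = 1 & sp (w *m o) = sh (hyp_dist o (w *m o)) *: al.
Proof.
move=> Ww; have Hw : hyperboloid (w *m o) by apply: (weyl_hyperboloid Ww); exact: H_origin.
have [al [al1 _ sE]] := polar P Hw; exists al => //.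
by rewrite /enorm (_ : (_ *m _) 0 0 = 1) ?sqrtr1// -[RHS]al1 mxE; apply: eq_bigr => i _; rewrite mxE.
Qed.

(** Keep only the stabilizer elements that carry [alpha w] to [p], which have probability
    [(nchambers c0 p)%:R^-1]. For each of them a ball of directions of radius [expR (- dist c0 p)]
    leads into the shadow. *)
Lemma mu_lower : exists2 c : R, 0 < c & forall p (E : set (borel_boundary xi0)),
  measurable E -> shadow c0 p 4 `<=` E -> ((c * weight c0 p)%:E <= mu E)%E.
Proof.
have [c c_gt0 hc] := @sphere_measure_ball_ge R n.+1; exists c => // p E mE pE.
have [A [Aapt Ac] muE] := mu_def; have [alpha [alpha1 alphaA] iso] := apartment_at Aapt Ac.
rewrite muE// /pushforward /product_measure1.
have Wp := wdist_weyl c0 p; set w := wdist c0 p in Wp.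
have [al al1 sE] := unit_direction Wp.
have zp : wdist c0 (alpha w) = wdist c0 p by rewrite (wdist_alpha alpha1 iso).
have prob := carries_prob q_gt0 q_card nu_haar act_trans zp.
set b : R := c * expR (- dist c0 p) ^+ n.+1.
have b0 : 0 <= b by rewrite mulr_ge0 ?exprn_ge0 ?expR_ge0 ?(ltW c_gt0).
apply: (@le_trans _ _ (\int[nu]_h (b%:E * (\1_(carries (alpha w) p) h)%:E))%E).
  rewrite ge0_integralZl_EFin//; last first.
    by apply/measurable_EFinP; apply: measurable_indic; exact: carries_measurable.
  rewrite integral_indic ?setIT//; last exact: carries_measurable.
  by rewrite [X in (b%:E * X)%E]prob -EFinM lee_fin /b !/(weight _ _) mulrA.
apply: ge0_le_integralT => h; first by rewrite mule_ge0 ?lee_fin.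
rewrite indicE; have [/set_mem hz|_] := boolP (h \in _); last first.
  by rewrite mule0; exact: sphere_measure_ge0.
rewrite mule1 /=; apply: (hc al) => //.
  rewrite expR_gt0 /= -[leRHS]expR0 ler_expR oppr_le0; exact: cdist_ge0.
move=> xi near_al; apply/mem_set; rewrite /= /spread /=; apply: pE.
have := apartment_shadow_low xi0 alpha1 alphaA iso Wp al1 sE near_al.
move/(shadow_act (sval h)); rewrite (svalP h).
by rewrite (_ : sval h (alpha w) = p)//; exact: hz.
Qed.

(** A stabilizer element and a direction that lead into the shadow of [p] must carry a chamber of
    the apartment at the level of [p] to within [C1] of [p]. The integrand is bounded by a sum over
    the boundedly many possible images. *)
Lemma mu_upper (r : R) : exists2 C : R, 0 < C & forall p (E : set (borel_boundary xi0)),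
  measurable E -> E `<=` shadow c0 p r -> (mu E <= (C * weight c0 p)%:E)%E.
Proof.
have [A [Aapt Ac] muE] := mu_def; have [alpha [alpha1 alphaA] iso] := apartment_at Aapt Ac.
have [D1 D10 hD1] := between_far X; have [D2 D20 hD2] := cdist_geodesic X.
have [D3 D30 hD3] := cdist_hyperbolic X.
pose C1 := 2 * `|r| + 2 * D1 + 3 * D2 + D3.
have [C2 C20 hC2] := apartment_shadow_up xi0 alpha1 alphaA iso (r + 2 * C1).
have [B hB] := ball_seq q_card C1; have [C3 C31 hC3] := weight_near q_gt0 q_card C1.
pose C4 : R := n.+2%:R * (5 * 6 ^+ n.+2) * C2 ^+ n.+1.
have C40 : 0 < C4.
  apply: mulr_gt0; last exact: exprn_gt0.
  by apply: mulr_gt0; [rewrite ltr0n|apply: mulr_gt0 => //; exact: exprn_gt0].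
exists (B.+1%:R * (C4 * C3)) => [|p E mE pE].
  by apply: mulr_gt0; [rewrite ltr0n|apply: mulr_gt0 => //; lra].
have [l [ul sl hl]] := hB p.
rewrite muE// /pushforward /product_measure1.
pose b x : R := C4 * expR (- dist c0 x) ^+ n.+1.
have b0 x : 0 <= b x by rewrite mulr_ge0 ?exprn_ge0 ?expR_ge0 ?(ltW C40).
pose S x := carries (c0 := c0) (alpha (wdist c0 x)) x.
have mS x : measurable (S x) by exact: carries_measurable.
apply: (@le_trans _ _ (\int[nu]_h (\sum_(x <- l) (b x)%:E * (\1_(S x) h)%:E))%E); last first.
  rewrite (ge0_integral_sum _ measurableT); last 2 first.
  - by move=> x; apply/measurable_EFinP; apply: measurable_funM => //; exact: measurable_indic.
  - by move=> x h _; rewrite mule_ge0 ?lee_fin.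
  apply: (@le_trans _ _ (\sum_(x <- l) (C4 * C3 * weight c0 p)%:E)%E).
    rewrite big_seq [leRHS]big_seq; apply: lee_sum => x xl.
    rewrite ge0_integralZl_EFin//; last first.
      by apply/measurable_EFinP; exact: measurable_indic.
    rewrite integral_indic ?setIT//.
    have pr : nu (S x) = ((nchambers c0 x)%:R^-1)%:E.
      apply: (carries_prob q_gt0 q_card nu_haar act_trans).
      by rewrite (wdist_alpha alpha1 iso)//; exact: wdist_weyl.
    rewrite [X in ((b x)%:E * X)%E]pr.
    rewrite -EFinM lee_fin /b -mulrA -/(weight c0 x) -mulrA ler_wpM2l ?(ltW C40)//.
    by apply: hC3; rewrite cdistC; exact/hl.
  rewrite sumEFin lee_fin big_const_seq count_predT iter_addr_0 -[_ *+ _]mulr_natl.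
  rewrite -[leRHS]mulrA ler_wpM2r//; last by rewrite ler_nat ltnW// ltnS.
  have w0 := weight_gt0 q_gt0 q_card c0 p.
  by apply: mulr_ge0 (ltW w0); apply: mulr_ge0 (ltW C40) _; lra.
apply: ge0_le_integralT => h; first exact: sphere_measure_ge0.
rewrite /=; set Y := xsection _ h.
have YE (xi : borel_sphere R n.+1) : Y xi -> shadow c0 p r (boundary_act (sval h) (apartment_boundary xi0 c0 A xi)).
  by move=> /set_mem; exact: pE.
have [[xi Yxi]|Y0] := pselect (exists xi, Y xi); last first.
  have -> : Y = set0 by apply/seteqP; split=> // xi Yxi; case: Y0; exists xi.
  rewrite /sphere_measure (_ : volume _ = 0%E) ?mule0 ?sume_ge0//.
    by move=> x _; rewrite mule_ge0 ?lee_fin.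
  apply/eqP; rewrite eq_le volume_ge0 andbT.
  have := @volume_le_cubes R n.+2 (Defs.cone set0) [::] 0 (lexx _); rewrite /= mul0r; apply.
  by move=> x [].
have hc : sval h c0 = c0 := svalP h.
have [x ax xz] := apartment_sequence xi0 alpha1 alphaA iso xi.
have hax : sval (boundary_act (sval h) (apartment_boundary xi0 c0 A xi))
    (real_act (sval h) \o (fun k => centre (x k))) by exists (fun k => centre (x k)).
have [u ou [N1 hN1]] := YE _ Yxi.
have [N2 hN2] := boundary_asym ou hax c0 (2 * dist c0 p + D1).
pose k := maxn N1 N2.
have bp : between c0 p (sval h (x k)) (r + D1).
  apply: (hD1 c0 c0 p (u k).1 (sval h (x k)) (dist c0 p)) => //.
  - by rewrite cdistxx cdist_ge0.
  - by apply: hN2; exact: leq_maxr.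
  - by apply: hN1; exact: leq_maxl.
have dh a a' : dist (sval h a) (sval h a') = dist a a' by rewrite /cdist aut_wdist.
have dhx a : dist c0 (sval h a) = dist c0 a by rewrite -{1}hc dh.
pose t := Num.min (dist c0 p) (dist c0 (x k)).
have t0 : 0 <= t <= dist c0 (x k) by rewrite le_min !cdist_ge0 ge_min lexx orbT.
have [z0 [e1 e2 _ e4 _]] := hD2 c0 (x k) t t0.
have dz := xz k z0 e4; pose z := alpha (wdist c0 z0); rewrite -/z in dz.
have Wz := wdist_weyl c0 z0.
have wz : wdist c0 z = wdist c0 z0 by rewrite /z (wdist_alpha alpha1 iso).
have dz0 : dist c0 z = dist c0 z0 by rewrite /cdist wz.
have zp : dist p (sval h z) <= C1.
  have := hD3 p c0 (sval h z) (sval h (x k)); rewrite (cdistC p c0) !dhx dh dz dz0.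
  move: bp e1 e2; rewrite /between dhx.
  have := cdist_triangle c0 p (sval h (x k)); rewrite dhx => f1 f2 f3 f4 f5.
  exact: (fellow_travel (cdist_ge0 p (sval h (x k))) D10 D20 f1 f2 f3 f4 f5).
have hz : sval h z \in l by apply/hl.
have hS : h \in S (sval h z).
  by apply/mem_set; rewrite /S /carries /= -[X in wdist X _]hc aut_wdist wz.
apply: (@le_trans _ _ (b (sval h z))%:E); last first.
  have one : (\1_(S (sval h z)) h)%:E = 1%E :> \bar R by rewrite indicE hS.
  pose F x' : \bar R := ((b x')%:E * (\1_(S x') h)%:E)%E.
  apply: (@le_trans _ _ (F (sval h z))); first by rewrite /F one mule1.
  by apply: le_sum_term => // x'; rewrite /F mule_ge0 ?lee_fin.
have [al al1 sE] := unit_direction Wz.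
(* The sphere has diameter 2, so the minimum loses nothing and meets the hypothesis of
   [sphere_measure_ball_le]. *)
pose rho : R := Num.min 2 (C2 * expR (- dist c0 z)).
have Cz0 : 0 < C2 * expR (- dist c0 z) by apply: mulr_gt0 => //; exact: expR_gt0.
have rho0 : 0 < rho by rewrite lt_min Cz0 andbT.
have rho2 : rho <= 2 by rewrite ge_min lexx.
apply: (@le_trans _ _ (n.+2%:R * (5 * 6 ^+ n.+2) * rho ^+ n.+1)%:E).
  apply: (sphere_measure_ball_le al1); first by rewrite rho0 rho2.
  move=> xi' /YE yxi'; rewrite /sball /= le_min; apply/andP; split.
    apply: le_trans (enormD _ _) _; rewrite enormN al1 (svalP xi'); lra.
  rewrite dz0; apply: hC2 => //.
  apply/(shadow_act (sval h)); rewrite hc -/z.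
  apply: (@shadow_mono _ _ _ _ _ _ (r + 2 * dist p (sval h z))); last exact: shadow_lip.
  by rewrite lerD2l ler_wpM2l.
rewrite lee_fin /b dhx /C4; set a : R := _%:R * _; rewrite -[leRHS]mulrA ler_wpM2l//.
  by apply: mulr_ge0; [exact: ler0n|apply: mulr_ge0 => //; exact: exprn_ge0].
rewrite -exprMn lerXn2r ?nnegrE ?(ltW rho0) ?mulr_ge0 ?expR_ge0 ?(ltW C20)//.
by rewrite ge_min lexx orbT.
Qed.

End boundary_measure_bounds.

(** * Outer regularity and translates *)

Lemma ereal_cvg_lt (R : realType) (u : nat -> \bar R) (l b : \bar R) :
  u @ \oo --> l -> (l < b)%E -> \forall k \near \oo, (u k < b)%E.
Proof.
by move=> ul lb; apply: (ul [set y | (y < b)%E]); apply: open_nbhs_nbhs; split; [exact: open_ereal_lt_ereal|].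
Qed.

Section regularity.
Context (disp : measure_display) (T : measurableType disp) (R : realType).
Variable mu : {measure set T -> \bar R}.
Hypothesis mu_fin : (mu setT < +oo)%E.
Variable op : set (set T).
Hypothesis op_gen : @measurable _ T `<=` <<s op >>.
Hypothesis op_meas : op `<=` @measurable _ T.
Hypothesis op0 : op set0.
Hypothesis opT : op setT.
Hypothesis opI : forall U V, op U -> op V -> op (U `&` V).
Hypothesis opU : forall F : nat -> set T, (forall k, op (F k)) -> op (\bigcup_k F k).
Hypothesis op_Fsigma : forall U, op U -> exists K : nat -> set T,
  [/\ forall k, op (~` K k), nondecreasing_seq K & U = \bigcup_k K k].

(** Approximation from both sides, so that the property passes to complements. *)
Definition regular (E : set T) := forall e : R, 0 < e -> exists U K,
  [/\ op U, op (~` K), K `<=` E, E `<=` U & (mu (U `\` K) <= e%:E)%E].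

Lemma closed_measurable K : op (~` K) -> measurable K.
Proof. by move=> /op_meas; rewrite -{2}[K]setCK; exact: measurableC. Qed.

Lemma regular_open U : op U -> regular U.
Proof.
move=> oU e e0; have [K [cK ndK UK]] := op_Fsigma oU.
have mU := op_meas oU; have mK k := closed_measurable (cK k).
have lim : mu \o (fun k => U `\` K k) @ \oo --> mu (\bigcap_k (U `\` K k)).
  apply: nonincreasing_cvg_mu.
  - by apply: (le_lt_trans _ mu_fin); apply: le_measure; [exact/mem_set/measurableD|exact/mem_set|].
  - by move=> k; exact: measurableD.
  - by apply: bigcap_measurable => // k _; exact: measurableD.
  - by move=> i j ij; apply/subsetPset => x [Ux Kx]; split=> // Kix; apply: Kx; exact: (subsetPset _ _ (ndK _ _ ij)).
have emp : \bigcap_k (U `\` K k) = set0.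
  apply/seteqP; split=> // x h; have [Ux _] := h 0%N I.
  by move: Ux; rewrite UK => -[k _ Kx]; have [_] := h k I.
rewrite emp measure0 in lim.
have [|N _ hN] := ereal_cvg_lt (b := e%:E) lim; first by rewrite lte_fin.
exists U, (K N); split=> //; first by rewrite UK => x Kx; exists N.
by apply: ltW; apply: (hN N) => /=.
Qed.

Lemma regularC E : regular E -> regular (~` E).
Proof.
move=> rE e e0; have [U [K [oU cK KE EU h]]] := rE e e0.
exists (~` K), (~` U); split=> //; first by rewrite setCK.
- exact: subsetC.
- exact: subsetC.
by rewrite setDE setCK setIC -setDE.
Qed.

Lemma regular_bigcup (F : nat -> set T) : (forall k, regular (F k)) -> regular (\bigcup_k F k).
Proof.
move=> rF e e0; have e20 : 0 < e / 2 by rewrite divr_gt0.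
have ek k : 0 < e / 2 / (2 ^ k.+1)%:R by rewrite divr_gt0// ltr0n expn_gt0.
have /choice[UK hUK] k : exists UK : set T * set T, [/\ op UK.1, op (~` UK.2), UK.2 `<=` F k,
    F k `<=` UK.1 & (mu (UK.1 `\` UK.2) <= (e / 2 / (2 ^ k.+1)%:R)%:E)%E].
  by have [U [K hU]] := rF k _ (ek k); exists (U, K).
pose U := \bigcup_k (UK k).1; pose K := \bigcup_k (UK k).2.
have oU : op U by apply: opU => k; case: (hUK k).
have cK k : op (~` (UK k).2) by case: (hUK k).
have mU := op_meas oU; have mKk k := closed_measurable (cK k).
have mUk k : measurable (UK k).1 by apply: op_meas; case: (hUK k).
(* Finite unions keep the inner sets closed; by continuity from above one of them replaces the
   infinite union [K] with total error still below [e]. *)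
pose KN N := \bigcup_(k in `I_N) (UK k).2.
have cKN N : op (~` KN N).
  elim: N => [|N IH]; first by rewrite /KN II0 bigcup_set0 setC0.
  have -> : KN N.+1 = KN N `|` (UK N).2.
    apply/seteqP; split=> x.
      by move=> [k /=]; rewrite ltnS leq_eqVlt => /orP[/eqP->|kN] Kx; [right|left; exists k].
    by move=> [[k /= kN Kx]|Kx]; [exists k => //=; exact: ltnW|exists N => /=].
  by rewrite setCU; apply: opI.
have mK N := closed_measurable (cKN N).
have h1 : (mu (U `\` K) <= (e / 2)%:E)%E.
  apply: le_trans (@epsilon_trick0 R (e / 2) xpredT (ltW e20)).
  apply: (@le_trans _ _ (\sum_(k <oo) mu ((UK k).1 `\` (UK k).2))%E); last first.
    by apply: lee_nneseries => [k _ _|k _]; [exact: measure_ge0|case: (hUK k)].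
  apply: measure_sigma_subadditive.
  - by move=> k; exact: measurableD.
  - by apply: measurableD => //; exact: bigcup_measurable.
  - by move=> x [[k _ Ux] Kx]; exists k => //; split=> // Kkx; apply: Kx; exists k.
have lim : mu \o (fun N => U `\` KN N) @ \oo --> mu (\bigcap_N (U `\` KN N)).
  apply: nonincreasing_cvg_mu.
  - by apply: (le_lt_trans _ mu_fin); apply: le_measure; [exact/mem_set/measurableD|exact/mem_set|].
  - by move=> k; exact: measurableD.
  - by apply: bigcap_measurable => // k _; exact: measurableD.
  - move=> i j ij; apply/subsetPset => x [Ux Kx]; split=> // -[k /= ki Kkx].
    by apply: Kx; exists k => //=; exact: leq_trans ij.
have capE : \bigcap_N (U `\` KN N) = U `\` K.
  apply/seteqP; split=> x.
    by move=> h; split; [have [] := h 0%N I|move=> [k _ Kx]; have [_] := h k.+1 I; apply; exists k => /=].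
  by move=> [Ux Kx] N _; split=> // -[k _ Kkx]; apply: Kx; exists k.
rewrite capE in lim.
have lt_e : (mu (U `\` K) < e%:E)%E.
  by apply: le_lt_trans h1 _; rewrite lte_fin ltr_pdivrMr// ltr_pMr// ltr1n.
have [N _ hN] := ereal_cvg_lt lim lt_e.
exists U, (KN N); split=> //.
- by move=> x [k _ Kx]; exists k => //; have [_ _ h _ _] := hUK k; exact: h.
- by move=> x [k _ Fx]; exists k => //; have [_ _ _ h _] := hUK k; exact: h.
by apply: ltW; apply: (hN N) => /=.
Qed.

Lemma outer_regular E (e : R) : measurable E -> 0 < e -> exists U,
  [/\ op U, E `<=` U & (mu (U `\` E) <= e%:E)%E].
Proof.
move=> mE e0; have : regular E.
  have := op_gen mE; apply => {E mE}; split; last exact: regular_open; split.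
  - exact: regular_open.
  - by move=> A /regularC; rewrite setTD.
  - exact: regular_bigcup.
move=> /(_ e e0)[U [K [oU cK KE EU h]]]; exists U; split=> //.
have mU := op_meas oU; have mK := closed_measurable cK.
apply: le_trans h; apply: le_measure; [exact/mem_set/measurableD|exact/mem_set/measurableD|].
exact: setDS.
Qed.

End regularity.

Section far_shadows.
Variables (R : realType) (n : nat) (P : right_angled_polytope R n.+1).
Variables (X : building P).
Local Notation dist := (@cdist R n P X).
Implicit Types (x y z c p : X) (omega : boundary X).

Lemma shadow_between (r : R) : exists2 C : R, 0 <= C & forall c z y omega,
  shadow c z r omega -> shadow c y r omega -> dist c z <= dist c y -> between c z y C.
Proof.
have [D1 D10 h1] := shadow_approx X; have [D D0 hD] := cdist_hyperbolic X.
exists (`|r| + D1 + D); first by rewrite !addr_ge0.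
move=> c z y omega oz oy zy; have [u [_ hu]] := h1 c omega (dist c y).
have cc : dist c c <= dist c y by rewrite cdistxx cdist_ge0.
have [/(_ oz) bz _] := hu c z r cc zy; have [/(_ oy) by_ _] := hu c y r cc (lexx _).
have := hD z c y u; have := ler_norm r; have := normr_ge0 r.
move: bz by_ zy; rewrite /between (cdistC z c) maxElt.
by case: ifP => _; glra2.
Qed.

(** Only the threshold [N] depends on [x]. The loss [D] does not, which keeps the constant of
    [translate_density] uniform in the group element. *)
Lemma shadow_rebase_far : exists2 D : R, 0 <= D & forall c x (r : R), exists N : R,
  forall y, N <= dist c y -> shadow c y r `<=` shadow x y (r + D).
Proof.
have [D D0 hD] := cdist_hyperbolic X; exists D => // c x r.
exists (dist c x + `|r| + D + 1) => y far omega [u ou [N hN]].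
exists u => //; exists N => i /hN; have := hD c x (u i).1 y.
have := cdist_triangle c x y; have := ler_norm r; have := normr_ge0 r; move: far.
rewrite /between (cdistC (u i).1 y) maxElt.
by case: ifP => _; glra2.
Qed.

End far_shadows.

(** * Translates of the boundary measure and its outer regularity *)

Section translates.
Variables (R : realType) (n : nat) (P : right_angled_polytope R n.+2).
Variables (X : building P) (q : facet P -> nat).
Hypothesis q_gt0 : forall s, (0 < q s)%N.
Hypothesis q_card : forall s (x : X), (panel s x #= `I_(q s).+1)%card.
Variables (xi0 : boundary X) (c0 : X).
Variables (nu : probability (borel_stab c0) R) (nu_haar : is_haar_probability nu).
Variable mu : {measure set (borel_boundary xi0) -> \bar R}.
Hypothesis mu_def : is_boundary_measure nu mu.
Variables (G : groupType) (act : G -> aut X).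
Hypothesis act_action : is_aut_action act.
Hypothesis act_trans : strongly_transitive act.
Local Notation dist := (@cdist R n.+1 P X).
Local Notation weight := (@weight R n P X).
Local Notation Omega := (borel_boundary xi0).
Implicit Types (x y z p c : X) (omega : boundary X) (g h : G).

Definition gact g : Omega -> Omega := borel_act (act g).

Lemma actK g x : act g^-1%g (act g x) = x.
Proof. by rewrite -act_action.2 mulVg act_action.1. Qed.

Lemma actVK g x : act g (act g^-1%g x) = x.
Proof. by rewrite -act_action.2 mulgV act_action.1. Qed.

Lemma dist_act g x y : dist (act g x) (act g y) = dist x y.
Proof. by rewrite /cdist aut_wdist. Qed.

Lemma weight_act g x y : weight (act g x) (act g y) = weight x y.
Proof.
rewrite !/(weight _ _) dist_act /nchambers aut_wdist.
by rewrite (nsphere_base q_card (act g x) x (wdist_weyl x y)).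
Qed.

Lemma gactM g h omega : gact (g * h)%g omega = gact g (gact h omega).
Proof. by apply: boundary_act_comp => x; exact: act_action.2. Qed.

Lemma gact1 omega : gact 1%g omega = omega.
Proof. by apply: boundary_act_id; exact: act_action.1. Qed.

Lemma gactK g omega : gact g^-1%g (gact g omega) = omega.
Proof. by rewrite -gactM mulVg gact1. Qed.

Lemma gactVK g omega : gact g (gact g^-1%g omega) = omega.
Proof. by rewrite -gactM mulgV gact1. Qed.

Lemma shadow_gact g c p (r : R) omega :
  shadow (act g c) (act g p) r (gact g omega) <-> shadow c p r omega.
Proof. exact: shadow_act. Qed.

Lemma shadow_gactV g c p (r : R) omega :
  shadow (act g c) p r (gact g omega) <-> shadow c (act g^-1%g p) r omega.
Proof. by rewrite -{1}(actVK g p); exact: shadow_gact. Qed.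

Lemma boundary_open_measurable (U : set Omega) : boundary_open U -> measurable U.
Proof. by move=> oU; exact: sub_sigma_algebra. Qed.

Lemma gact_measurable g : measurable_fun setT (gact g).
Proof.
apply: (@measurability _ _ Omega Omega setT (gact g) (@boundary_open R n.+2 P X)) => //.
move=> _ [U oU <-]; rewrite setTI; apply: boundary_open_measurable.
exact: boundary_open_act.
Qed.

Lemma gact_preimage_measurable g (E : set Omega) : measurable E -> measurable (gact g @^-1` E).
Proof. by move=> mE; rewrite -[X in measurable X]setTI; apply: gact_measurable. Qed.

Lemma translate_upper (r : R) : exists2 C : R, 0 < C & forall g p (E : set Omega), measurable E ->
  E `<=` shadow (act g c0) p r -> (mu (gact g @^-1` E) <= (C * weight (act g c0) p)%:E)%E.
Proof.
have [C C0 hC] := mu_upper q_gt0 q_card nu_haar mu_def act_trans r.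
exists C => // g p E mE Ep; rewrite -(actVK g p) weight_act; apply: hC.
  exact: gact_preimage_measurable.
by move=> omega /= /Ep /shadow_gactV.
Qed.

Lemma mu_finite : (mu setT < +oo)%E.
Proof.
have [C C0 hC] := mu_upper q_gt0 q_card nu_haar mu_def act_trans 0.
apply: le_lt_trans (hC c0 setT measurableT _) (ltry _).
by move=> omega _; exact: shadow_all.
Qed.

Lemma boundary_open_setT : boundary_open (@setT (boundary X)).
Proof. by move=> xi _ z; exists 0. Qed.

Lemma boundary_openI (U V : set (boundary X)) : boundary_open U -> boundary_open V ->
  boundary_open (U `&` V).
Proof.
move=> oU oV xi [Ux Vx] z; have [M1 h1] := oU _ Ux z; have [M2 h2] := oV _ Vx z.
exists (Num.max M1 M2) => eta [u [v [ou ev [N hN]]]].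
split; [apply: h1|apply: h2]; exists u, v; split=> //; exists N => i j Ni Nj;
  apply: le_trans (hN i j Ni Nj); by rewrite le_max lexx ?orbT.
Qed.

(** The points whose neighbourhood of scale [k] lies in [U] exhaust [U], and by the
    quasi-ultrametric inequality the closure of the set of these points stays in [U]. *)
Lemma boundary_open_Fsigma (U : set (boundary X)) : boundary_open U ->
  exists K : nat -> set (boundary X),
  [/\ forall k, boundary_open (~` K k), nondecreasing_seq K & U = \bigcup_k K k].
Proof.
move=> oU; have [D D0 hD] := nbhd_trans X.
pose F (M : R) := [set omega : boundary X | boundary_nbhd (centre c0) M omega `<=` U].
have Fmono M M' : M <= M' -> F M `<=` F M'.
  by move=> MM omega h eta /(nbhd_le MM) /h.
exists (fun k => ~` binterior c0 (~` F k%:R)); split.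
- by move=> k; rewrite setCK; exact: binterior_open.
- move=> i j ij; apply/subsetPset; apply: subsetC => omega [M hM]; exists M => eta /hM Fe Fi.
  by apply: Fe; apply: Fmono Fi; rewrite ler_nat.
apply/seteqP; split=> omega.
  move=> Uo; have [M hM] := oU _ Uo (centre c0).
  exists (Num.truncn `|M|).+1 => // /binterior_sub; apply.
  apply: (Fmono M) => //; apply: le_trans (ler_norm _) _; apply: ltW.
  by have /andP[] := truncn_itv (normr_ge0 M).
move=> [k _ nb]; apply: contrapT => nU; apply: nb; exists (k%:R + D) => eta oe Fe.
apply: nU; apply: Fe; apply: hD; first exact: nbhd_sym oe.
exact: nbhd_self.
Qed.

Lemma boundary_outer_regular (E : set Omega) (e : R) : measurable E -> 0 < e ->
  exists U : set Omega, [/\ boundary_open U, E `<=` U & (mu (U `\` E) <= e%:E)%E].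
Proof.
refine (@outer_regular _ Omega R mu mu_finite (@boundary_open R n.+2 P X) _ _ _ _ _ _ _ E e) => //.
- exact: boundary_open_measurable.
- exact: boundary_open_setT.
- exact: boundary_openI.
- move=> F oF omega [k _ Fk] z; have [M hM] := oF k _ Fk z.
  by exists M => eta /hM; exists k.
- exact: boundary_open_Fsigma.
Qed.

End translates.

(** * Annuli of chambers *)

Lemma ereal_cvg_le (R : realType) (u : nat -> \bar R) (l b : \bar R) :
  u @ \oo --> l -> (forall k, (u k <= b)%E) -> (l <= b)%E.
Proof.
move=> ul ub; rewrite leNgt; apply/negP => bl.
have : \forall k \near \oo, (b < u k)%E.
  apply: (ul [set y | (b < y)%E]); apply: open_nbhs_nbhs; split; last exact: bl.
  exact: open_ereal_gt_ereal.
by move=> [N _ /(_ N (leqnn _))] /=; rewrite ltNge ub.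
Qed.

Section overlapping_families.
Context (disp : measure_display) (T : measurableType disp) (R : realType).
Variable mu : {measure set T -> \bar R}.

Lemma measure_bigsetU_le (I : Type) (l : seq I) (F : I -> set T) :
  (forall i, measurable (F i)) ->
  (mu (\big[setU/set0]_(i <- l) F i) <= \sum_(i <- l) mu (F i))%E.
Proof.
move=> mF; elim: l => [|i l IH]; first by rewrite !big_nil measure0.
rewrite !big_cons; apply: le_trans (measureU2 _ _ _) _; rewrite ?leeD2l//.
exact: bigsetU_measurable.
Qed.

Lemma weighted_sum_integral_le (I : eqType) (l : seq I) (c : I -> R) (F : I -> set T)
    (U : set T) (psi : T -> \bar R) (C : R) :
  (forall i, 0 <= c i) ->
  (forall i, measurable (F i)) -> measurable U -> measurable_fun setT psi ->
  (forall x, (0 <= psi x)%E) -> (forall i, i \in l -> F i `<=` U) ->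
  0 <= C -> (forall x, \sum_(i <- l | x \in F i) c i <= C) ->
  (\sum_(i <- l) (c i)%:E * \int[mu]_(x in F i) psi x <= C%:E * \int[mu]_(x in U) psi x)%E.
Proof.
move=> c0 mF mU mpsi psi0 FU C0 cnt.
have mres (A : set T) : measurable A -> measurable_fun setT (psi \_ A).
  by move=> mA; apply/(measurable_restrictT psi mA); exact: measurable_funTS.
have res0 (A : set T) x : (0 <= (psi \_ A) x)%E by rewrite patchE; case: ifP.
rewrite (eq_bigr (fun i => \int[mu]_x ((c i)%:E * (psi \_ (F i)) x))%E); last first.
  by move=> i _; rewrite integral_mkcond ge0_integralZl_EFin//; exact: mres.
rewrite -ge0_integral_sum//; first last.
- by move=> i x _; rewrite mule_ge0 ?lee_fin.
- by move=> i; apply: emeasurable_funM => //; exact: mres.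
rewrite [in leRHS]integral_mkcond -ge0_integralZl_EFin//; last exact: mres.
apply: ge0_le_integralT => x; first by apply: sume_ge0 => i _; rewrite mule_ge0 ?lee_fin.
have [Ux|nUx] := boolP (x \in U); last first.
  rewrite big_seq big1; first by rewrite mule_ge0 ?lee_fin.
  move=> i il; rewrite patchE ifF ?mule0//; apply/negbTE; apply: contra nUx => /set_mem xF.
  by apply/mem_set; exact: FU xF.
rewrite [in leRHS]patchE Ux.
apply: (@le_trans _ _ ((\sum_(i <- l | x \in F i) c i)%:E * psi x)%E); last first.
  by rewrite lee_wpmul2r// lee_fin.
rewrite -sumEFin ge0_sume_distrl; last by move=> i _; rewrite lee_fin.
by rewrite [leRHS]big_mkcond; apply: lee_sum => i _; rewrite patchE; case: ifP; rewrite ?mule0.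
Qed.

Lemma sum_integral_le (I : eqType) (l : seq I) (F : I -> set T) (U : set T)
    (psi : T -> \bar R) (B : nat) :
  (forall i, measurable (F i)) -> measurable U -> measurable_fun setT psi ->
  (forall x, (0 <= psi x)%E) -> (forall i, i \in l -> F i `<=` U) ->
  (forall x, (count (fun i => x \in F i) l <= B)%N) ->
  (\sum_(i <- l) \int[mu]_(x in F i) psi x <= B%:R%:E * \int[mu]_(x in U) psi x)%E.
Proof.
move=> mF mU mpsi psi0 FU cnt.
rewrite (eq_bigr (fun i => 1%:E * \int[mu]_(x in F i) psi x)%E); last by move=> i _; rewrite mul1e.
apply: weighted_sum_integral_le => // x.
by apply: le_trans (_ : (count (fun i => x \in F i) l)%:R <= _); rewrite ?ler_nat// -sum1_count natr_sum.
Qed.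

End overlapping_families.

Section annuli.
Variables (R : realType) (n : nat) (P : right_angled_polytope R n.+2).
Variables (X : building P) (q : facet P -> nat).
Hypothesis q_gt0 : forall s, (0 < q s)%N.
Hypothesis q_card : forall s (x : X), (panel s x #= `I_(q s).+1)%card.
Variables (xi0 : boundary X) (c0 : X).
Variables (nu : probability (borel_stab c0) R) (nu_haar : is_haar_probability nu).
Variable mu : {measure set (borel_boundary xi0) -> \bar R}.
Hypothesis mu_def : is_boundary_measure nu mu.
Variables (G : groupType) (act : G -> aut X).
Hypothesis act_action : is_aut_action act.
Hypothesis act_trans : strongly_transitive act.
Local Notation dist := (@cdist R n.+1 P X).
Local Notation weight := (@weight R n P X).
Local Notation Omega := (borel_boundary xi0).
Local Notation gact := (@gact R n P X xi0 G act).
Implicit Types (x y z p c : X) (omega : boundary X) (g h : G).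

Definition open_shadow_at c p (r : R) : set Omega := binterior c (shadow c p r).

Definition shadow_gap : R := sval (cid2 (shadow_interior X)).
Lemma shadow_gap_ge0 : 0 <= shadow_gap.
Proof. by rewrite /shadow_gap; case: cid2. Qed.
Lemma sub_open_shadow c p (r s : R) : r + shadow_gap <= s -> shadow c p r `<=` open_shadow_at c p s.
Proof.
rewrite /shadow_gap; case: cid2 => D D0 h /= rs omega /h.
by move=> [M hM]; exists M => eta /hM; exact: shadow_mono.
Qed.
Lemma open_shadow_sub c p r : open_shadow_at c p r `<=` shadow c p r.
Proof. exact: binterior_sub. Qed.
Lemma open_shadow_open c p r : boundary_open (open_shadow_at c p r).
Proof. exact: binterior_open. Qed.
Lemma open_shadow_measurable c p r : measurable (open_shadow_at c p r).
Proof. by apply: boundary_open_measurable; exact: open_shadow_open. Qed.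

Definition level_gap : R := sval (cid2 (shadow_level X)).
(** The first term makes the tiles of an annulus cover the boundary, the 4 makes a tile contain the
    shadow measured in [mu_lower], and the last term pays for passing to interiors. *)
Definition tile_radius : R := level_gap + 4 + shadow_gap.
Definition tile x : set Omega := open_shadow_at c0 x tile_radius.

Lemma ex_annulus (k : nat) : exists l : seq X, uniq l /\
  forall x, x \in l <-> `|dist c0 x - k%:R| <= level_gap.
Proof.
have [B hB] := ball_seq q_card (k%:R + level_gap); have [l [ul _ hl]] := hB c0.
exists [seq x <- l | `|dist c0 x - k%:R| <= level_gap]; split; first exact: filter_uniq.
move=> x; rewrite mem_filter; split=> [/andP[]//|h]; rewrite h /=; apply/hl.
by move: h; rewrite ler_norml => /andP[_]; lra.
Qed.

Definition annulus k : seq X := sval (cid (ex_annulus k)).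
Lemma annulus_uniq k : uniq (annulus k).
Proof. by rewrite /annulus; case: cid => l []. Qed.
Lemma annulusP k x : x \in annulus k <-> `|dist c0 x - k%:R| <= level_gap.
Proof. by rewrite /annulus; case: cid => l []. Qed.

Lemma level_gap_ge0 : 0 <= level_gap.
Proof. by rewrite /level_gap; case: cid2. Qed.

Lemma annulus_cover k omega : exists2 x, x \in annulus k & shadow c0 x level_gap omega.
Proof.
suff [x h1 h2] : exists2 x, `|dist c0 x - k%:R| <= level_gap & shadow c0 x level_gap omega.
  by exists x => //; exact/annulusP.
by rewrite /level_gap; case: cid2 => D D0 h; apply: h.
Qed.

Lemma tile_cover k omega : exists2 x, x \in annulus k & tile x omega.
Proof.
have [x xk sx] := annulus_cover k omega; exists x => //.
by apply: sub_open_shadow sx; rewrite /tile_radius; lra.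
Qed.

Lemma shadow4_tile x : shadow c0 x 4 `<=` tile x.
Proof. by apply: sub_open_shadow; rewrite /tile_radius; have := level_gap_ge0; lra. Qed.

Lemma tile_measurable x : measurable (tile x).
Proof. exact: open_shadow_measurable. Qed.

(** Chambers of one annulus whose shadows meet stay within a fixed distance of each other, whatever
    the level. *)
Lemma annulus_overlap (r : R) : exists B : nat, forall k (a : pred X) omega,
  (forall x, a x -> shadow c0 x r omega) -> (count a (annulus k) <= B)%N.
Proof.
have [C hC] := shadow_overlap X r (2 * level_gap); have [B hB] := ball_seq q_card C.
exists B => k a omega ha; rewrite -size_filter.
case E : [seq x <- annulus k | a x] => [//|x l0].
have : x \in [seq x <- annulus k | a x] by rewrite E mem_head.
rewrite mem_filter => /andP[/ha sx /annulusP xk]; rewrite -E.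
have [l [_ sl hl]] := hB x; apply: leq_trans sl.
apply: uniq_leq_size; first exact/filter_uniq/annulus_uniq.
move=> y; rewrite mem_filter => /andP[/ha sy /annulusP yk]; apply/hl.
apply: hC sx sy _; move: xk yk; rewrite !ler_norml => /andP[h1 h2] /andP[h3 h4].
by apply/andP; split; lra.
Qed.

Lemma tile_mass_lower : exists2 c : R, 0 < c & forall x, ((c * weight c0 x)%:E <= mu (tile x))%E.
Proof.
have [c cpos hc] := mu_lower q_gt0 q_card nu_haar mu_def act_trans.
by exists c => // x; apply: hc; [exact: tile_measurable|exact: shadow4_tile].
Qed.

Lemma tile_mass_upper : exists2 c : R, 0 < c & forall x, (mu (tile x) <= (c * weight c0 x)%:E)%E.
Proof.
have [c cpos hc] := mu_upper q_gt0 q_card nu_haar mu_def act_trans tile_radius.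
by exists c => // x; apply: hc; [exact: tile_measurable|exact: open_shadow_sub].
Qed.

Lemma annulus_total : exists2 c : R, 0 < c & forall k, c <= \sum_(x <- annulus k) weight c0 x.
Proof.
have [c cpos hc] := mu_lower q_gt0 q_card nu_haar mu_def act_trans.
have [C Cpos hC] := tile_mass_upper; exists (c / C) => [|k]; first exact: divr_gt0.
rewrite ler_pdivrMr// mulrC mulr_sumr -lee_fin -sumEFin.
have h1 : (c%:E <= mu setT)%E.
  by rewrite -[c]mulr1 -(weightxx q_card c0); apply: hc.
apply: (le_trans h1); apply: (@le_trans _ _ (\sum_(x <- annulus k) mu (tile x))%E); last first.
  by apply: lee_sum => x _.
apply: le_trans (measure_bigsetU_le _ _ tile_measurable); apply: le_measure.
- exact/mem_set/measurableT.
- by apply/mem_set; apply: bigsetU_measurable => x _; exact: tile_measurable.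
by move=> omega _; have [x xk tx] := tile_cover k omega; rewrite -bigcup_seq; exists x.
Qed.

(** Up to constants the left side is the total mass of tiles that overlap boundedly and lie in one
    shadow of [p]. *)
Lemma annulus_sum (r : R) : exists2 C : R, 0 < C & forall k p,
  \sum_(x <- annulus k | `[< between c0 p x r >]) weight c0 x <= C * weight c0 p.
Proof.
have [c cpos hc] := tile_mass_lower.
have [C Cpos hC] := mu_upper q_gt0 q_card nu_haar mu_def act_trans (r + tile_radius + shadow_gap).
have [B hB] := annulus_overlap tile_radius.
exists (B.+1%:R * C / c) => [|k p]; first by rewrite divr_gt0// mulr_gt0// ltr0n.
set a := fun x => `[< between c0 p x r >].
rewrite mulrAC ler_pdivlMr// mulrC mulr_sumr -lee_fin -sumEFin.
apply: (@le_trans _ _ (\sum_(x <- annulus k | a x) mu (tile x))%E).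
  by apply: lee_sum => x _.
pose U := open_shadow_at c0 p (r + tile_radius + shadow_gap).
have := @sum_integral_le _ Omega R mu X [seq x <- annulus k | a x] tile U (cst 1%E) B
  tile_measurable (open_shadow_measurable _ _ _) (measurable_cst _) (fun=> lee01).
rewrite big_filter (eq_bigr (fun x => mu (tile x))); last first.
  by move=> x _; rewrite integral_cst ?mul1e//; exact: tile_measurable.
rewrite integral_cst ?mul1e; last exact: open_shadow_measurable.
move=> h; apply: le_trans (h _ _) _ => {h}.
- move=> x; rewrite mem_filter => /andP[/asboolP bx _] omega /open_shadow_sub sx.
  by apply: sub_open_shadow; last exact: shadow_sub bx _ sx.
- move=> omega; rewrite count_filter; apply: (hB k _ omega) => x /= /andP[/set_mem + _].
  exact: open_shadow_sub.
apply: (@le_trans _ _ (B%:R%:E * (C * weight c0 p)%:E)%E).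
  by rewrite lee_wpmul2l ?lee_fin//; apply: hC; [exact: open_shadow_measurable|exact: open_shadow_sub].
rewrite -EFinM lee_fin mulrA ler_wpM2r ?(ltW (weight_gt0 q_gt0 q_card _ _))//.
by rewrite ler_wpM2r ?(ltW Cpos)// ler_nat.
Qed.

(* Every point of an open set eventually lies in tiles contained in it. *)
Lemma cover_compare (rho : R) : tile_radius <= rho -> exists B : nat,
  forall (T : Omega -> Omega) (psi : Omega -> \bar R) (K N0 : R) (U : set Omega),
  measurable_fun setT T -> measurable_fun setT psi -> (forall w, (0 <= psi w)%E) ->
  0 <= K -> boundary_open U ->
  (forall y, N0 <= dist c0 y -> shadow c0 y rho `<=` U ->
     (mu (T @^-1` tile y) <= K%:E * \int[mu]_(w in open_shadow_at c0 y rho) psi w)%E) ->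
  (mu (T @^-1` U) <= (K * B%:R)%:E * \int[mu]_(w in U) psi w)%E.
Proof.
move=> tr; have [B hB] := annulus_overlap rho; exists B => T psi K N0 U mT mpsi psi0 K0 oU hyp.
have mpre (E : set Omega) : measurable E -> measurable (T @^-1` E).
  by move=> mE; rewrite -[X in measurable X]setTI; exact: mT.
pose Y k := [seq y <- annulus k | `[< shadow c0 y rho `<=` U >] && (N0 <= dist c0 y)].
pose Uk k := \big[setU/set0]_(y <- Y k) (T @^-1` tile y).
have mUk k : measurable (Uk k).
  by apply: bigsetU_measurable => y _; apply: mpre; exact: tile_measurable.
have tileU y k : y \in Y k -> open_shadow_at c0 y rho `<=` U.
  rewrite mem_filter => /andP[/andP[/asboolP sU _] _] omega /open_shadow_sub.
  exact: sU.
have mU : measurable U by exact: boundary_open_measurable.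
have bound k : (mu (Uk k) <= (K * B%:R)%:E * \int[mu]_(w in U) psi w)%E.
  apply: le_trans (measure_bigsetU_le _ _ _) _; first by move=> y; apply: mpre; exact: tile_measurable.
  apply: (@le_trans _ _ (\sum_(y <- Y k) K%:E * \int[mu]_(w in open_shadow_at c0 y rho) psi w)%E).
    rewrite big_seq [leRHS]big_seq; apply: lee_sum => y; rewrite mem_filter => /andP[/andP[/asboolP sU far] _].
    exact: hyp.
  rewrite -ge0_sume_distrr; last by move=> y _; apply: integral_ge0.
  rewrite EFinM -muleA lee_wpmul2l ?lee_fin//.
  apply: sum_integral_le => //; first by move=> y; exact: open_shadow_measurable.
    by move=> y; exact: tileU.
  move=> omega; rewrite count_filter; apply: (hB k _ omega) => x /= /andP[/set_mem + _].
  exact: open_shadow_sub.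
(* A point of the preimage of [U] lies in a selected tile at every large enough level, so the
   preimage is the increasing union of these tail intersections. *)
pose Uinf k := \bigcap_(j in [set j | (k <= j)%N]) Uk j.
have mUinf k : measurable (Uinf k) by apply: bigcap_measurable => //; exists k => /=.
have cov : T @^-1` U = \bigcup_k Uinf k.
  apply/seteqP; split=> [omega Uo|omega [k _ /(_ k (leqnn _))]]; last first.
    rewrite /Uk -bigcup_seq => -[y yk [M hM]]; apply: (tileU _ _ yk).
    by exists M => eta /hM; exact: shadow_mono.
  have [M hM] := open_shadow c0 rho oU Uo.
  exists (Num.truncn (Num.max `|M| `|N0| + level_gap)).+1 => // j /= kj.
  have [y yj ty] := tile_cover j (T omega); rewrite /Uk -bigcup_seq; exists y => //=.
  have : Num.max `|M| `|N0| + level_gap < j%:R.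
    have /truncn_itv/andP[_ h] : 0 <= Num.max `|M| `|N0| + level_gap.
      by rewrite addr_ge0 ?level_gap_ge0// le_max normr_ge0.
    by apply: lt_le_trans h _; rewrite ler_nat.
  have /annulusP := yj; rewrite ler_norml => /andP[h1 h2] h3.
  have h4 : Num.max `|M| `|N0| <= dist c0 y by move: h1 h3; lra.
  rewrite mem_filter yj andbT; apply/andP; split.
    apply/asboolP; apply: hM.
      by apply: le_trans h4; rewrite le_max ler_norm.
    by apply: shadow_mono tr _ _; exact: open_shadow_sub.
  by apply: le_trans h4; rewrite le_max ler_norm orbT.
rewrite cov; apply: (ereal_cvg_le (u := mu \o Uinf)).
  apply: nondecreasing_cvg_mu => //; first exact: bigcup_measurable.
  by move=> i j ij; apply/subsetPset => omega h k /= jk; apply: h => /=; exact: leq_trans jk.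
move=> k /=; apply: le_trans (bound k); apply: le_measure; [exact/mem_set|exact/mem_set|].
by move=> omega; apply => /=.
Qed.

Lemma tile_nonempty y : exists omega : Omega, tile y omega.
Proof.
have [c cpos hc] := tile_mass_lower; apply: contrapT => h.
have t0 : tile y = set0 by apply/seteqP; split=> // omega ty; case: h; exists omega.
have := hc y; rewrite t0 measure0 lee_fin leNgt mulr_gt0//.
exact: weight_gt0.
Qed.

(** Open sets are compared tile by tile: for a far [y] beyond [z], the number [weight x y] is at
    most a constant times [weight x z / weight c0 z * weight c0 y]. Outer regularity extends the
    estimate to Borel sets. *)
Lemma translate_density (r : R) : exists2 C : R, 0 < C & forall g z (E : set Omega),
  measurable E -> E `<=` shadow c0 z r -> E `<=` shadow (act g c0) z r ->
  (mu (gact g @^-1` E) <= (C * weight (act g c0) z / weight c0 z)%:E * mu E)%E.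
Proof.
have [Dr Dr0 hDr] := shadow_rebase_far X.
pose r1 := Num.max (r + shadow_gap) (tile_radius + Dr).
have [C1 C10 hC1] := shadow_between X r1.
have [C2 C21 hC2] := weight_subM q_gt0 q_card C1.
have [C3 C30 hC3] := translate_upper q_gt0 q_card nu_haar mu_def act_action act_trans (tile_radius + Dr).
have [c4 c40 hc4] := tile_mass_lower.
have [B hB] := cover_compare (lexx tile_radius).
exists (C3 * C2 / c4 * B.+1%:R) => [|g z E mE E1 E2].
  by rewrite !mulr_gt0 ?invr_gt0 ?ltr0n//; lra.
set x := act g c0; have wz0 := weight_gt0 q_gt0 q_card c0 z; have wxz0 := weight_gt0 q_gt0 q_card x z.
pose K := C3 * C2 / c4 * (weight x z / weight c0 z).
have K0 : 0 <= K by rewrite !mulr_ge0 ?invr_ge0//; lra.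
have fE : mu E \is a fin_num.
  rewrite ge0_fin_numE//; apply: (le_lt_trans _ (mu_finite q_gt0 q_card nu_haar mu_def act_trans)).
  by apply: le_measure; [exact/mem_set|exact/mem_set|].
have [N1 hN1] := hDr c0 x tile_radius.
have mg : measurable_fun setT (gact g) by exact: gact_measurable.
have key (U : set Omega) : boundary_open U -> U `<=` shadow c0 z (r + shadow_gap) ->
    U `<=` shadow x z (r + shadow_gap) -> (mu (gact g @^-1` U) <= (K * B%:R)%:E * mu U)%E.
  move=> oU U1 U2; have mU : measurable U by exact: boundary_open_measurable.
  have := hB (gact g) (cst 1%E) K (Num.max N1 (dist c0 x + dist x z)) U mg
    (measurable_cst _) (fun=> lee01) K0 oU.
  rewrite integral_cst// mul1e; apply=> y; rewrite ge_max => /andP[far1 far2] yU.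
  rewrite integral_cst ?mul1e; last exact: tile_measurable.
  have [omega ty] := tile_nonempty y.
  have sy : tile y `<=` shadow x y (tile_radius + Dr).
    by move=> eta /open_shadow_sub; exact: hN1.
  have bt : between x z y C1.
    apply: (hC1 x z y omega).
    - apply: shadow_mono (U2 _ (yU _ (open_shadow_sub ty))); by rewrite le_max lexx.
    - apply: shadow_mono (sy _ ty); by rewrite le_max lexx orbT.
    - by move: far2; have := cdist_triangle c0 x y; lra.
  apply: le_trans (hC3 g y (tile y) (tile_measurable y) sy) _.
  have wy : ((weight c0 y)%:E <= (c4^-1)%:E * mu (tile y))%E.
    apply: (@le_trans _ _ ((c4^-1)%:E * (c4 * weight c0 y)%:E)%E).
      by rewrite -EFinM mulrA mulVf ?gt_eqF// mul1r.
    by rewrite lee_wpmul2l// lee_fin invr_ge0 ltW.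
  have step : C3 * weight x y <= C3 * C2 * (weight x z / weight c0 z) * weight c0 y.
    have zy : weight z y <= weight c0 y / weight c0 z.
      by rewrite ler_pdivlMr// mulrC; exact: (weight_superM q_gt0 q_card).
    have -> : C3 * C2 * (weight x z / weight c0 z) * weight c0 y =
        C3 * (C2 * (weight x z * (weight c0 y / weight c0 z))).
      by move: (weight x z) (weight c0 z) (weight c0 y) => *; ring.
    rewrite ler_wpM2l ?(ltW C30)//; apply: le_trans (hC2 _ _ _ bt) _.
    by rewrite ler_wpM2l ?ler_wpM2l ?(ltW wxz0)//; lra.
  apply: (@le_trans _ _ ((C3 * C2 * (weight x z / weight c0 z))%:E * (weight c0 y)%:E)%E).
    by rewrite -EFinM lee_fin.
  apply: le_trans (lee_wpmul2l _ wy) _.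
    by rewrite lee_fin !mulr_ge0 ?invr_ge0 ?(ltW wxz0) ?(ltW wz0)//; lra.
  by rewrite muleA -EFinM /K [_ * c4^-1]mulrAC.
apply/lee_addgt0Pr => e e0.
have KB0 : 0 <= K * B.+1%:R by rewrite mulr_ge0.
have e1 : 0 < e / (K * B.+1%:R + 1) by rewrite divr_gt0//; lra.
have [U [oU EU hU]] := boundary_outer_regular q_gt0 q_card nu_haar mu_def act_trans mE e1.
have mU : measurable U by exact: boundary_open_measurable.
(* Cutting with two open shadows keeps the approximating set in the region where [key] applies. *)
pose U' := U `&` (open_shadow_at c0 z (r + shadow_gap) `&` open_shadow_at x z (r + shadow_gap)).
have oU' : boundary_open U'.
  by do 2!apply: boundary_openI => //; exact: open_shadow_open.
have mU' : measurable U' by exact: boundary_open_measurable.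
have EU' : E `<=` U'.
  move=> omega Eo; split; [exact: EU|split].
    by apply: sub_open_shadow (E1 _ Eo).
  by apply: sub_open_shadow (E2 _ Eo).
have U'_le : (mu U' <= mu E + (e / (K * B.+1%:R + 1))%:E)%E.
  apply: (@le_trans _ _ (mu U)); first by apply: le_measure; [exact/mem_set|exact/mem_set|move=> ? []].
  rewrite -{1}(setDUK EU); apply: le_trans (measureU2 _ _ _) _ => //; first exact: measurableD.
  by rewrite leeD2l.
apply: (@le_trans _ _ (mu (gact g @^-1` U'))).
  apply: le_measure; [apply/mem_set; exact: gact_preimage_measurable|apply/mem_set; exact: gact_preimage_measurable|].
  by move=> omega /= /EU'.
apply: le_trans (key U' oU' _ _) _.
- by move=> omega [_ [/open_shadow_sub]].
- by move=> omega [_ [_ /open_shadow_sub]].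
apply: (@le_trans _ _ ((K * B.+1%:R)%:E * (mu E + (e / (K * B.+1%:R + 1))%:E))%E).
  apply: (@le_trans _ _ ((K * B.+1%:R)%:E * mu U')%E); last by rewrite lee_wpmul2l// lee_fin.
  by rewrite lee_wpmul2r// lee_fin ler_wpM2l// ler_nat.
rewrite -(fineK fE) -EFinD -!EFinM -EFinD lee_fin mulrDr.
have -> : C3 * C2 / c4 * B.+1%:R * weight x z / weight c0 z = K * B.+1%:R.
  by rewrite /K; ring.
rewrite lerD2l mulrA ler_pdivrMr; last by lra.
by rewrite mulrC ler_wpM2l ?(ltW e0)//; lra.
Qed.

End annuli.

(** * Square roots of densities *)

Section densities.
Context (disp : measure_display) (T : measurableType disp) (R : realType).
Variable mu : {measure set T -> \bar R}.
Variables (phi : T -> T) (D : T -> R).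
Hypothesis mphi : measurable_fun setT phi.
Hypothesis mD : measurable_fun setT D.
Hypothesis D0 : forall x, 0 <= D x.
Hypothesis densityE : forall E, measurable E -> mu (phi @^-1` E) = (\int[mu]_(x in E) (D x)%:E)%E.

Import HBNNSimple.

Let mDE : measurable_fun setT (EFin \o D). Proof. exact/measurable_EFinP. Qed.

Lemma density_integral_simple (h : {nnsfun T >-> R}) :
  (\int[mu]_x ((h x)%:E * (D x)%:E) = \int[mu]_x (h (phi x))%:E)%E.
Proof.
have term r : measurable (h @^-1` [set r]) by [].
have pos r x : (0 <= (r * \1_(h @^-1` [set r]) x)%:E)%E by exact: nnfun_muleindic_ge0.
transitivity (\int[mu]_x (\sum_(r \in range h) (r * \1_(h @^-1` [set r]) x)%:E * (D x)%:E)%E)%E.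
  apply: eq_integral => x _; rewrite [h x]fimfunE -fsumEFin// ge0_mule_fsuml//.
rewrite ge0_integral_fsum//; last 2 first.
- move=> r; apply: emeasurable_funM => //; apply/measurable_EFinP; exact: measurable_funM.
- by move=> r x _; rewrite mule_ge0 ?lee_fin//; exact: pos.
transitivity (\int[mu]_x (\sum_(r \in range h) (r * \1_(h @^-1` [set r]) (phi x))%:E)%E)%E; last first.
  by apply: eq_integral => x _; rewrite [h (phi x)]fimfunE -fsumEFin.
rewrite ge0_integral_fsum//; last first.
  move=> r; apply/measurable_EFinP; apply: measurable_funM => //.
  by apply: (measurableT_comp _ mphi); exact: measurable_indic.
apply: eq_fsbigr => r /set_mem [x0 _ rE].
have r0 : 0 <= r by rewrite -rE.
under eq_integral do rewrite EFinM -muleA.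
under [RHS]eq_integral do rewrite EFinM.
rewrite ge0_integralZl_EFin//; last 2 first.
- by move=> x _; rewrite mule_ge0 ?lee_fin.
- by apply: emeasurable_funM => //; apply/measurable_EFinP; exact: measurable_indic.
rewrite ge0_integralZl_EFin//; last first.
  by apply/measurable_EFinP; apply: (measurableT_comp _ mphi); exact: measurable_indic.
congr (_ * _)%E.
have -> : (fun x => (\1_(h @^-1` [set r]) (phi x))%:E) = (fun x => (\1_(phi @^-1` (h @^-1` [set r])) x)%:E) :> (T -> \bar R).
  by apply/funext => x; rewrite !indicE; congr (_%:R)%:E; apply/idP/idP => /set_mem ?; apply/mem_set.
rewrite integral_indic ?setIT//; last by rewrite -[X in measurable X]setTI; exact: mphi.
rewrite densityE// [in RHS]integral_mkcond; apply: eq_integral => x _.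
by rewrite patchE indicE; case: ifP => _; rewrite ?mul1e ?mul0e.
Qed.

Lemma density_integral (psi : T -> \bar R) : measurable_fun setT psi -> (forall x, 0 <= psi x)%E ->
  (\int[mu]_x (psi x * (D x)%:E) = \int[mu]_x psi (phi x))%E.
Proof.
move=> mpsi psi0; pose h := nnsfun_approx measurableT mpsi.
have cv x : EFin \o h^~ x @ \oo --> psi x by apply: cvg_nnsfun_approx.
have mono x : {homo (fun k => h k x) : a b / (a <= b)%N >-> a <= b}.
  by move=> a b ab; exact/lefP/nd_nnsfun_approx.
have c1 : (\int[mu]_x ((h k x)%:E * (D x)%:E))%E @[k --> \oo] --> (\int[mu]_x (psi x * (D x)%:E))%E.
  have -> : (\int[mu]_x (psi x * (D x)%:E) = \int[mu]_x limn (fun k => ((h k x)%:E * (D x)%:E)))%E.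
    by apply: eq_integral => x _; apply/esym/cvg_lim => //; apply: cvgeZr => //; exact: cv.
  apply: cvg_monotone_convergence => //.
  - by move=> k; apply: emeasurable_funM => //; exact/measurable_EFinP.
  - by move=> k x _; rewrite mule_ge0 ?lee_fin.
  - by move=> x _ a b ab; rewrite lee_wpmul2r ?lee_fin//; exact: mono.
have c2 : (\int[mu]_x (h k (phi x))%:E)%E @[k --> \oo] --> (\int[mu]_x psi (phi x))%E.
  have -> : (\int[mu]_x psi (phi x) = \int[mu]_x limn (fun k => (h k (phi x))%:E))%E.
    by apply: eq_integral => x _; apply/esym/cvg_lim => //; exact: cv.
  apply: cvg_monotone_convergence => //.
  - by move=> k; apply/measurable_EFinP; exact: (measurableT_comp _ mphi).
  - by move=> k x _; rewrite lee_fin.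
  - by move=> x _ a b ab; rewrite lee_fin; exact: mono.
rewrite -(cvg_lim _ c1)// -(cvg_lim _ c2)//; congr (limn _).
by apply/funext => k; exact: density_integral_simple.
Qed.

(* Where the density is at most [2 K], it is at most [sqrt (2 K)] times its
   square root; the remaining set is null. *)
Lemma sqrt_density_lower (A : set T) (K : R) : measurable A -> 0 < K -> (mu A < +oo)%E ->
  (forall E, measurable E -> E `<=` A -> (mu (phi @^-1` E) <= K%:E * mu E)%E) ->
  (mu (phi @^-1` A) <= (Num.sqrt (2 * K))%:E * \int[mu]_(x in A) (Num.sqrt (D x))%:E)%E.
Proof.
move=> mA K0 fA bound; pose N := A `&` [set x | 2 * K < D x].
have mN : measurable N.
  rewrite /N; have := @measurable_lte _ _ R A mA (cst (2 * K)%:E) (EFin \o D).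
  by rewrite (_ : [set x | _] = [set x | 2 * K < D x]); [apply; [exact: measurable_cst|exact: measurable_funTS]|apply/seteqP; split=> x; rewrite /= lte_fin].
have NA : N `<=` A by move=> x [].
have msq : measurable_fun setT (fun x => Num.sqrt (D x)).
  by apply: (measurableT_comp _ mD); apply: continuous_measurable_fun; exact: sqrt_continuous.
have fN : mu N \is a fin_num.
  rewrite ge0_fin_numE//; apply: le_lt_trans fA.
  by apply: le_measure; [exact/mem_set|exact/mem_set|].
(* On [N] the density exceeds [2 * K], while the hypothesis bounds its integral by [K%:E * mu N]. *)
have muN : mu N = 0%E.
  have h1 : ((2 * K)%:E * mu N <= K%:E * mu N)%E.
    apply: le_trans (bound N mN NA); rewrite densityE// -integral_cst//.
    by apply: ge0_le_integral => //; [move=> x _; rewrite lee_fin; lra|exact: measurable_funTS|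
      move=> x [_ /ltW]; rewrite lee_fin].
  move: h1; rewrite -(fineK fN) -!EFinM lee_fin => h1; congr EFin.
  have : 0 <= fine (mu N) by exact: fine_ge0.
  by move: h1; move: (fine _) => a h1 a0; nra.
have phiN : mu (phi @^-1` N) = 0%E.
  by apply/eqP; rewrite eq_le measure_ge0 andbT; have := bound N mN NA; rewrite muN mule0.
have mAN : measurable (A `\` N) by exact: measurableD.
have mpre E : measurable E -> measurable (phi @^-1` E).
  by move=> mE; rewrite -[X in measurable X]setTI; exact: mphi.
apply: (@le_trans _ _ (mu (phi @^-1` (A `\` N)))).
  rewrite -[leRHS]adde0 -phiN; apply: le_trans (measureU2 _ _ _); [|exact: mpre|exact: mpre].
  apply: le_measure; [exact/mem_set/mpre|by apply/mem_set/measurableU; exact: mpre|].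
  by move=> x /= Ax; have [Nx|Nx] := pselect (N (phi x)); [right|left; split].
rewrite densityE// -ge0_integralZl_EFin ?sqrtr_ge0//; last first.
  by apply/measurable_EFinP; exact: measurable_funTS.
apply: (@le_trans _ _ (\int[mu]_(x in A `\` N) ((Num.sqrt (2 * K))%:E * (Num.sqrt (D x))%:E))%E).
  apply: ge0_le_integral => //.
  - by move=> x _; rewrite lee_fin.
  - exact: measurable_funTS.
  - by apply: emeasurable_funM; apply/measurable_EFinP; apply: measurable_funTS => //; exact: measurable_cst.
  move=> x [Ax Nx]; rewrite -EFinM lee_fin -{1}[D x]sqr_sqrtr// expr2.
  rewrite ler_wpM2r ?sqrtr_ge0// ler_sqrt ?mulr_ge0 ?(ltW K0)//.
  by rewrite leNgt; apply/negP => KD; apply: Nx.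
apply: ge0_subset_integral => //.
by apply: emeasurable_funM; apply/measurable_EFinP; apply: measurable_funTS => //; exact: measurable_cst.
Qed.

End densities.

Section turning.
Variables (R : realType) (n : nat) (P : right_angled_polytope R n.+1).
Variables (X : building P).
Local Notation dist := (@cdist R n P X).
Implicit Types (x y z c p a : X) (omega : boundary X).

(* Seen from [p], a chamber that [p] does not separate from [a] lies in the
   direction of [a]. *)
Lemma between_turn : exists2 C : R, 0 <= C & forall L a p, 0 <= L -> L <= dist a p ->
  exists u, `|dist p u - L| <= C /\
    forall v, ~ between a p v (2 * L + C) -> between p u v C.
Proof.
have [D2 D20 h2] := cdist_geodesic X; have [D3 D30 h3] := cdist_hyperbolic X.
exists (2 * D2 + D3); first by rewrite !addr_ge0 ?mulr_ge0.
move=> L a p L0 La; have t0 : 0 <= L <= dist p a by rewrite L0 cdistC.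
have [u [e1 e2 _ _ _]] := h2 p a L t0; exists u; split.
  by apply: le_trans e1 _; lra.
move=> v /negP; rewrite /between -ltNge => far.
have := h3 u a v p; move: e1 e2 far; rewrite !ler_norml (cdistC a p) (cdistC v p) (cdistC u p).
rewrite maxElt => /andP[e1 e1'] /andP[e2 e2'] far.
by case: ifP => _; move: e1 e1' e2 e2' far; glra2.
Qed.

Lemma shadow_turn : exists2 C : R, 0 <= C & forall L a p, 0 <= L -> L <= dist a p ->
  exists u, `|dist p u - L| <= C /\
    forall omega, ~ shadow a p (2 * L + C) omega -> shadow p u C omega.
Proof.
have [D1 D10 h1] := shadow_approx X; have [D2 D20 h2] := between_turn.
exists (D1 + D2); first by rewrite addr_ge0.
move=> L a p L0 La; have [u [e1 e2]] := h2 L a p L0 La; exists u; split.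
  by apply: le_trans e1 _; lra.
move=> omega nsh; have [v [_ hv]] := h1 p omega (dist p a + dist p u).
have d1 := cdist_ge0 p a; have d2 := cdist_ge0 p u.
have pp : dist p p <= dist p a + dist p u by rewrite cdistxx; lra.
have pa : dist p a <= dist p a + dist p u by lra.
have pu : dist p u <= dist p a + dist p u by lra.
rewrite (addrC D1); apply: (hv p u _ pp pu).2; apply: e2 => far; apply: nsh.
by rewrite (addrC D1) addrA; exact: (hv a p _ pa pp).2.
Qed.

End turning.

(** Here [a] and [b] are the weights of [p] seen from [c0] and from [act g c0], and [w] is that of
    [act g c0] seen from [c0]. Dividing by the square root of the density bound [C4 * b / a] leaves
    a geometric mean, which near-multiplicativity compares with the square root of [w]. *)
Lemma sqrt_mass_arith (R : rcfType) (c C4 C2 a b w : R) : 0 < c -> 0 < C4 -> 0 < C2 ->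
  0 < a -> 0 < b -> w <= C2 * (a * b) ->
  c / Num.sqrt (2 * C4) / Num.sqrt C2 * Num.sqrt w * Num.sqrt (2 * (C4 * b / a)) <= c * b.
Proof.
move=> c0 C40 C20 a0 b0 h.
have s1 : Num.sqrt w <= Num.sqrt C2 * (Num.sqrt a * Num.sqrt b).
  by rewrite -!sqrtrM ?(ltW C20) ?(ltW a0)//; exact: ler_wsqrtr.
have s2 : Num.sqrt (2 * (C4 * b / a)) = Num.sqrt (2 * C4) * (Num.sqrt b / Num.sqrt a).
  rewrite (_ : 2 * (C4 * b / a) = (2 * C4) * (b * a^-1)); last by field; rewrite gt_eqF.
  rewrite sqrtrM; last by rewrite mulr_ge0// ltW.
  by rewrite [Num.sqrt (b * _)]sqrtrM ?(ltW b0)// sqrtrV // ltW.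
rewrite s2; set u := Num.sqrt (2 * C4); set v := Num.sqrt C2 in s1 *.
set al := Num.sqrt a in s1 *; set be := Num.sqrt b in s1 *.
have u0 : 0 < u by rewrite sqrtr_gt0 mulr_gt0.
have v0 : 0 < v by rewrite sqrtr_gt0.
have al0 : 0 < al by rewrite sqrtr_gt0.
have be0 : 0 < be by rewrite sqrtr_gt0.
rewrite -[in leRHS](sqr_sqrtr (ltW b0)) -/be.
have -> : c / u / v * Num.sqrt w * (u * (be / al)) = c * be * (Num.sqrt w / (v * al)).
  by field; rewrite !gt_eqF.
rewrite expr2 (mulrA c be) ler_wpM2l//; first by rewrite mulr_ge0 ?ltW.
by rewrite ler_pdivrMr ?mulr_gt0//; apply: le_trans s1 _; rewrite [leRHS]mulrC mulrA.
Qed.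

Section square_roots_of_densities.
Variables (R : realType) (n : nat) (P : right_angled_polytope R n.+2).
Variables (X : building P) (q : facet P -> nat).
Hypothesis q_gt0 : forall s, (0 < q s)%N.
Hypothesis q_card : forall s (x : X), (panel s x #= `I_(q s).+1)%card.
Variables (xi0 : boundary X) (c0 : X).
Variables (nu : probability (borel_stab c0) R) (nu_haar : is_haar_probability nu).
Variable mu : {measure set (borel_boundary xi0) -> \bar R}.
Hypothesis mu_def : is_boundary_measure nu mu.
Variables (G : groupType) (act : G -> aut X).
Hypothesis act_action : is_aut_action act.
Hypothesis act_trans : strongly_transitive act.
Variable D : G -> borel_boundary xi0 -> R.
Hypothesis D_density : forall g : G,
  is_density mu (pushforward mu (borel_act (act g))) (D g).
Local Notation dist := (@cdist R n.+1 P X).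
Local Notation weight := (@weight R n P X).
Local Notation Omega := (borel_boundary xi0).
Local Notation gact := (@gact R n P X xi0 G act).
Local Notation osh := (@open_shadow_at R n P X xi0).
Implicit Types (x y z p c : X) (omega : boundary X) (g h : G).

Definition both_sides g p (r : R) : set Omega := osh c0 p r `&` osh (act g c0) p r.

Lemma both_sides_measurable g p r : measurable (both_sides g p r).
Proof. by apply: measurableI; exact: open_shadow_measurable. Qed.

Lemma both_sides_mono g p r s : r <= s -> both_sides g p r `<=` both_sides g p s.
Proof.
by move=> rs omega [[M1 h1] [M2 h2]]; split; [exists M1|exists M2];
  move=> eta; [move/h1|move/h2]; exact: shadow_mono.
Qed.

(** Seen from [p], an ideal point outside one of the two shadows lies in the shadow of one of two
    chambers at distance about [L] from [p]. These have mass of order [expR (- L)], so for large [L]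
    a definite part of the boundary remains. *)
Lemma both_sides_mass : exists L r c : R, [/\ 0 <= L, 0 < c & forall g h p, act h c0 = p ->
  L <= dist c0 p -> L <= dist (act g c0) p -> (c%:E <= mu (gact h @^-1` both_sides g p r))%E].
Proof.
have [C1 C10 hC1] := shadow_turn X.
pose gap := shadow_gap X; have gap0 : 0 <= gap := shadow_gap_ge0 X.
have [C2 C20 hC2] := translate_upper q_gt0 q_card nu_haar mu_def act_action act_trans (C1 + gap).
have [c cpos hc] := mu_lower q_gt0 q_card nu_haar mu_def act_trans.
(* The logarithm solves [2 * C2 * expR (C1 - L) = c / 2]; the maximum keeps [L] nonnegative. *)
have [L [L0 hL]] : exists L : R, 0 <= L /\ 2 * C2 * expR (C1 - L) <= c / 2.
  exists (Num.max 0 (C1 - ln (c / (4 * C2)))); rewrite le_max lexx; split=> //.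
  have h : expR (C1 - Num.max 0 (C1 - ln (c / (4 * C2)))) <= c / (4 * C2).
    rewrite -[leRHS]lnK ?posrE ?divr_gt0 ?mulr_gt0// ler_expR.
    have : C1 - ln (c / (4 * C2)) <= Num.max 0 (C1 - ln (c / (4 * C2))) by rewrite le_max lexx orbT.
    lra.
  apply: le_trans (ler_wpM2l _ h) _; first by rewrite mulr_ge0// ltW.
  by rewrite le_eqVlt; apply/orP; left; apply/eqP; field; rewrite gt_eqF.
exists L, (2 * L + C1 + gap), (c / 2); split=> //; first by rewrite divr_gt0.
move=> g h p hp Lc Lx; set A := both_sides _ _ _.
have [u [pu hu]] := hC1 L c0 p L0 Lc; have [u' [pu' hu']] := hC1 L (act g c0) p L0 Lx.
have mA : measurable A by exact: both_sides_measurable.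
pose B v := osh p v (C1 + gap).
have mB v : measurable (B v) by exact: open_shadow_measurable.
have cover : setT `<=` gact h @^-1` A `|` (gact h @^-1` B u `|` gact h @^-1` B u').
  move=> omega _; have [s1|s1] := pselect (shadow c0 p (2 * L + C1) (gact h omega)); last first.
    by right; left; apply: (sub_open_shadow _ (lexx _)); exact: hu.
  have [s2|s2] := pselect (shadow (act g c0) p (2 * L + C1) (gact h omega)); last first.
    by right; right; apply: (sub_open_shadow _ (lexx _)); exact: hu'.
  by left; split; apply: (sub_open_shadow _ (lexx _)).
have pre E : measurable E -> measurable (gact h @^-1` E) by exact: gact_preimage_measurable.
have smallB v : `|dist p v - L| <= C1 -> (mu (gact h @^-1` B v) <= (C2 * expR (C1 - L))%:E)%E.
  move=> pv; apply: (@le_trans _ _ (C2 * weight p v)%:E).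
    by rewrite -hp; apply: hC2 => //; rewrite hp; exact: open_shadow_sub.
  rewrite lee_fin ler_wpM2l ?(ltW C20)//; apply: le_trans (weight_le_expR q_gt0 q_card _ _) _.
  by rewrite ler_expR; move: pv; rewrite ler_norml => /andP[h1 h2]; lra.
have total : (c%:E <= mu (gact h @^-1` A) + ((c / 2)%:E))%E.
  apply: (@le_trans _ _ (mu setT)).
    by rewrite -[c]mulr1 -(weightxx q_card c0); apply: hc.
  have mAB : measurable (gact h @^-1` B u `|` gact h @^-1` B u').
    by apply: measurableU; [exact: (pre _ (mB u))|exact: (pre _ (mB u'))].
  apply: (@le_trans _ _ (mu (gact h @^-1` A `|` (gact h @^-1` B u `|` gact h @^-1` B u')))).
    apply: le_measure => //; [exact/mem_set/measurableT|].
    by apply/mem_set; exact: (measurableU _ _ (pre _ mA) mAB).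
  apply: le_trans (measureU2 _ (pre _ mA) mAB) _; rewrite leeD2l//.
  apply: le_trans (measureU2 _ (pre _ (mB u)) (pre _ (mB u'))) _.
  apply: le_trans (leeD (smallB u pu) (smallB u' pu')) _.
  by rewrite -EFinD lee_fin; lra.
have fin : mu (gact h @^-1` A) \is a fin_num.
  rewrite ge0_fin_numE//; apply: (le_lt_trans _ (mu_finite q_gt0 q_card nu_haar mu_def act_trans)).
  by apply: le_measure; [apply/mem_set; exact: (pre _ mA)|exact/mem_set|].
by move: total; rewrite -(fineK fin) -EFinD !lee_fin; lra.
Qed.

(** The mass of the region seen from [p] is bounded below, and [translate_density] converts this
    into a bound for its mass seen from [act g c0]. The same lemma bounds the density above, so
    [sqrt_density_lower] passes to the square root. *)
Lemma sqrt_density_mass (r : R) : exists L r0 : R, 0 <= L /\ forall s, r0 <= s ->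
  exists2 c : R, 0 < c & forall g p, between c0 p (act g c0) r ->
    L <= dist c0 p -> L <= dist (act g c0) p ->
    ((c * Num.sqrt (weight c0 (act g c0)))%:E <=
      \int[mu]_(w in both_sides g p s) (Num.sqrt (D g w))%:E)%E.
Proof.
have [L [r0 [c1 [L0 c10 hc1]]]] := both_sides_mass.
have [C2 C21 hC2] := weight_subM q_gt0 q_card r.
exists L, r0; split=> // s rs.
(* The maximum with 0 allows [shadow_all], which has radius 0, to be used as one of the two
   shadows. *)
have [C3 C30 hC3] := translate_density q_gt0 q_card nu_haar mu_def act_action act_trans (Num.max s 0).
have [C4 C40 hC4] := translate_density q_gt0 q_card nu_haar mu_def act_action act_trans s.
have W0 := weight_gt0 q_gt0 q_card.
exists (c1 / C3 / Num.sqrt (2 * C4) / Num.sqrt C2).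
  by rewrite !divr_gt0 ?sqrtr_gt0 ?mulr_gt0//; lra.
move=> g p bt Lc Lx; set x := act g c0 in bt Lx *; set A := both_sides g p s.
have mA : measurable A by exact: both_sides_measurable.
have [h hp] := transitive_chambers act_trans c0 p.
have fA (E : set Omega) : measurable E -> (mu E < +oo)%E.
  move=> mE; apply: (le_lt_trans _ (mu_finite q_gt0 q_card nu_haar mu_def act_trans)).
  by apply: le_measure; [exact/mem_set|exact/mem_set|].
have pre g' E : measurable E -> measurable (gact g' @^-1` E) by exact: gact_preimage_measurable.
have low : ((c1 / C3 * weight x p)%:E <= mu (gact g @^-1` A))%E.
  have e1 : (c1%:E <= mu (gact h @^-1` A))%E.
    apply: (le_trans (hc1 g h p hp Lc Lx)); apply: le_measure.
    - by apply/mem_set; apply: (pre h (both_sides g p r0)); exact: both_sides_measurable.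
    - by apply/mem_set; exact: pre.
    - by move=> w; exact: both_sides_mono.
  pose k := (g^-1 * h)%g; pose z := act g^-1%g p.
  have kz : act k c0 = z by rewrite /k act_action.2 hp.
  have e2 : gact k @^-1` (gact g @^-1` A) = gact h @^-1` A.
    by apply/seteqP; split=> w /=; rewrite -(gactM xi0 act_action) /k mulgA mulgV mul1g.
  have e3 := hC3 k z (gact g @^-1` A) (pre _ _ mA).
  have sub1 : gact g @^-1` A `<=` shadow c0 z (Num.max s 0).
    move=> w [_ /open_shadow_sub sw]; have : shadow x p (Num.max s 0) (gact g w).
      by apply: shadow_mono sw; rewrite le_max lexx.
    by move/(@shadow_gactV R n P X xi0 G act act_action g c0 p).
  have sub2 : gact g @^-1` A `<=` shadow (act k c0) z (Num.max s 0).
    move=> w _; rewrite kz; apply: shadow_mono (shadow_all z w).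
    by rewrite le_max lexx orbT.
  have := e3 sub1 sub2; rewrite e2 kz (weightxx q_card) mulr1 => e4.
  have zx : weight c0 z = weight x p by rewrite /z -(weight_act q_card act g) (actVK act_action).
  rewrite zx in e4; have e5 := le_trans e1 e4.
  have fin : mu (gact g @^-1` A) \is a fin_num by rewrite ge0_fin_numE//; exact: (fA _ (pre _ _ mA)).
  move: e5; rewrite -(fineK fin) -EFinM !lee_fin mulrAC ler_pdivlMr// => e6.
  by rewrite mulrAC ler_pdivrMr// [leRHS]mulrC.
have [mD D0 dE] := D_density g.
have a0 := W0 c0 p; have b0 := W0 x p.
have K0 : 0 < C4 * weight x p / weight c0 p by rewrite divr_gt0// mulr_gt0.
have up := @sqrt_density_lower _ Omega R mu (gact g) (D g) (@gact_measurable R n P X xi0 G act g)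
  mD D0 dE A _ mA K0 (fA _ mA).
set I := (\int[mu]_(x in A) (Num.sqrt (D g x))%:E)%E.
have lowI : ((c1 / C3 * weight x p)%:E <= (Num.sqrt (2 * (C4 * weight x p / weight c0 p)))%:E * I)%E.
  apply: (le_trans low); apply: up => E mE EA.
  apply: hC4 => //.
  - by move=> w /EA[/open_shadow_sub].
  - by move=> w /EA[_ /open_shadow_sub].
have sab := hC2 _ _ _ bt; rewrite (weightC q_card p x) in sab.
have C20 : 0 < C2 by apply: lt_le_trans C21.
have key := sqrt_mass_arith (divr_gt0 c10 C30) C40 C20 a0 b0 sab.
have S0 : 0 < Num.sqrt (2 * (C4 * weight x p / weight c0 p)) by rewrite sqrtr_gt0 mulr_gt0.
have I0 : (0 <= I)%E by apply: integral_ge0 => w _; rewrite lee_fin sqrtr_ge0.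
have [fI|] := boolP (I \is a fin_num); last first.
  by rewrite ge0_fin_numE// -leNgt leye_eq => /eqP ->; rewrite leey.
move: lowI; rewrite -(fineK fI) -EFinM !lee_fin => lowI.
by rewrite -(ler_pM2r S0); apply: le_trans key _; rewrite [leRHS]mulrC.
Qed.

End square_roots_of_densities.

(** * Sums over pairs of chambers *)

Section amgm.
Context (disp : measure_display) (T : measurableType disp) (R : realType).
Variable mu : {measure set T -> \bar R}.
Variables (phi theta : T -> T) (D : T -> R).
Hypothesis mphi : measurable_fun setT phi.
Hypothesis mtheta : measurable_fun setT theta.
Hypothesis phiK : cancel phi theta.
Hypothesis mD : measurable_fun setT D.
Hypothesis D0 : forall x, 0 <= D x.
Hypothesis densityE : forall E, measurable E -> mu (phi @^-1` E) = (\int[mu]_(x in E) (D x)%:E)%E.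

(** Pointwise [a * b * d <= t * (a * d) ^+ 2 + t^-1 * b ^+ 2]. With [d] the square root of the
    density, [d ^+ 2] is exactly the factor that the change of variables by [phi] absorbs. *)
Lemma density_amgm (A : set T) (f h : T -> R) (t : R) : measurable A -> 0 < t ->
  measurable_fun setT f -> measurable_fun setT h -> (forall x, 0 <= f x) -> (forall x, 0 <= h x) ->
  (\int[mu]_(x in A) (f (theta x) * h x * Num.sqrt (D x))%:E <=
   t%:E * \int[mu]_(x in phi @^-1` A) (f x ^+ 2)%:E + t^-1%:E * \int[mu]_(x in A) (h x ^+ 2)%:E)%E.
Proof.
move=> mA t0 mf mh f0 h0.
have mpA : measurable (phi @^-1` A) by rewrite -[X in measurable X]setTI; exact: mphi.
have mft : measurable_fun setT (f \o theta) by exact: measurableT_comp.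
pose F : T -> \bar R := (fun x => (f (theta x) ^+ 2)%:E) \_ A.
have F0 x : (0 <= F x)%E by rewrite /F patchE; case: ifP => _//; rewrite lee_fin sqr_ge0.
have mF : measurable_fun setT F.
  by apply/(measurable_restrictT _ mA)/measurable_funTS/measurable_EFinP/measurable_funX.
have -> : (\int[mu]_(x in phi @^-1` A) (f x ^+ 2)%:E = \int[mu]_x (F x * (D x)%:E))%E.
  rewrite (density_integral mphi mD D0 densityE mF F0) integral_mkcond; apply: eq_integral => x _.
  have E : (x \in phi @^-1` A) = (phi x \in A) by apply/idP/idP => /set_mem Ax; exact/mem_set.
  by rewrite /F !patchE phiK E.
have mFD : measurable_fun setT (fun x => (F x * (D x)%:E)%E).
  by apply: emeasurable_funM => //; exact/measurable_EFinP.
pose H : T -> \bar R := (fun x => (h x ^+ 2)%:E) \_ A.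
have H0 x : (0 <= H x)%E by rewrite /H patchE; case: ifP => _//; rewrite lee_fin sqr_ge0.
have mH : measurable_fun setT H.
  by apply/(measurable_restrictT _ mA)/measurable_funTS/measurable_EFinP/measurable_funX.
rewrite !(integral_mkcond A) -!ge0_integralZl_EFin ?invr_ge0 ?(ltW t0)//; last first.
  by move=> x _; rewrite mule_ge0 ?lee_fin.
rewrite -ge0_integralD//; first last.
- by apply: measurable_funeM.
- by move=> x _; rewrite mule_ge0 ?lee_fin ?invr_ge0 ?(ltW t0).
- by apply: measurable_funeM.
- by move=> x _; rewrite mule_ge0 ?lee_fin ?(ltW t0)// mule_ge0 ?lee_fin.
apply: ge0_le_integralT => x.
  by rewrite patchE; case: ifP => _//; rewrite lee_fin !mulr_ge0 ?sqrtr_ge0.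
rewrite /F /H !patchE; case: ifP => _; last by rewrite mul0e !mule0 adde0.
rewrite -!EFinM -EFinD lee_fin -[X in _ * (_ * X)](sqr_sqrtr (D0 x)).
move: (f (theta x)) (h x) (Num.sqrt (D x)) => a b d.
have : 0 <= t * (a * d - t^-1 * b / 2) ^+ 2 by rewrite mulr_ge0 ?sqr_ge0 ?ltW.
have -> : t * (a * d - t^-1 * b / 2) ^+ 2 = t * (a ^+ 2 * d ^+ 2) - a * b * d + t^-1 * b ^+ 2 / 4.
  by field; rewrite gt_eqF.
have : 0 <= t^-1 * b ^+ 2 by rewrite mulr_ge0 ?sqr_ge0 ?invr_ge0 ?ltW.
move: (t^-1 * b ^+ 2) (t * _) (a * b * d) => u v w; lra.
Qed.

End amgm.

Section pairs_of_chambers.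
Variables (R : realType) (n : nat) (P : right_angled_polytope R n.+2).
Variables (X : building P) (q : facet P -> nat).
Hypothesis q_gt0 : forall s, (0 < q s)%N.
Hypothesis q_card : forall s (x : X), (panel s x #= `I_(q s).+1)%card.
Variables (xi0 : boundary X) (c0 : X).
Variables (nu : probability (borel_stab c0) R) (nu_haar : is_haar_probability nu).
Variable mu : {measure set (borel_boundary xi0) -> \bar R}.
Hypothesis mu_def : is_boundary_measure nu mu.
Variables (G : groupType) (act : G -> aut X).
Hypothesis act_action : is_aut_action act.
Hypothesis act_trans : strongly_transitive act.
Variable D : G -> borel_boundary xi0 -> R.
Hypothesis D_density : forall g : G,
  is_density mu (pushforward mu (borel_act (act g))) (D g).
Local Notation dist := (@cdist R n.+1 P X).
Local Notation weight := (@weight R n P X).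
Local Notation annulus := (@annulus R n P X q q_card c0).
Local Notation Omega := (borel_boundary xi0).
Local Notation gact := (@gact R n P X xi0 G act).
Local Notation osh := (@open_shadow_at R n P X xi0).
Local Notation both_sides := (@both_sides R n P X xi0 c0 G act).
Implicit Types (x y z c : X) (p : X * X) (omega : boundary X) (g h : G) (a : pred (X * X)).

(* The pairs [(g c0, g^-1 c0)], with both chambers in the annulus. *)
Definition pairs (k : nat) : seq (X * X) :=
  [seq p <- [seq (x, y) | x <- annulus k, y <- annulus k] | wdist c0 p.2 == wdist p.1 c0].

Lemma pairsP k p : p \in pairs k ->
  [/\ p.1 \in annulus k, p.2 \in annulus k & wdist c0 p.2 = wdist p.1 c0].
Proof.
by rewrite mem_filter => /andP[/eqP h /allpairsP[[x y] /= [xk yk E]]]; rewrite E in h *.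
Qed.

(** Each first chamber has [nchambers c0 p.1] partners, so both marginals of this weight on an
    annulus are [weight c0]; see [pairs_sum1] and [pairs_sum2]. *)
Definition pair_weight p : R := weight c0 p.1 / (nchambers c0 p.1)%:R.

Lemma pair_weight_ge0 p : 0 <= pair_weight p.
Proof. by rewrite divr_ge0// ltW// (weight_gt0 q_gt0 q_card). Qed.

Lemma count_opposite k x : x \in annulus k ->
  count (fun y => wdist c0 y == wdist x c0) (annulus k) = nchambers c0 x.
Proof.
move=> /annulusP xk; rewrite (nchambersC q_card) /nchambers (nsphere_base q_card x c0 (wdist_weyl x c0)).
rewrite /nsphere -size_filter; apply: perm_size; apply: uniq_perm => //.
- exact/filter_uniq/annulus_uniq.
- exact: fset_uniq.
move=> y; rewrite mem_filter in_fset_set; last exact: (sphere_finite q_card).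
apply/andP/idP => [[/eqP h _]|/set_mem h]; first exact/mem_set.
by split; [exact/eqP|apply/annulusP; rewrite /cdist h -/(dist x c0) cdistC].
Qed.

Lemma pairs_sum1 k (b : pred X) :
  \sum_(p <- pairs k | b p.1) pair_weight p = \sum_(x <- annulus k | b x) weight c0 x.
Proof.
rewrite /pairs big_filter_cond big_mkcond big_allpairs_dep /= [RHS]big_mkcond.
apply: eq_big_seq => x xk; rewrite -big_mkcond /=.
case: (b x); last by rewrite big_pred0// => y; rewrite andbF.
rewrite /pair_weight /= (eq_bigl (fun y => wdist c0 y == wdist x c0)); last by move=> y; rewrite andbT.
rewrite big_const_seq iter_addr_0 (count_opposite xk) -[_ *+ nchambers _ _]mulr_natr divfK//.
by rewrite pnatr_eq0 -lt0n; exact: (nchambers_gt0 q_gt0 q_card).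
Qed.

Lemma pairs_sum2 k (b : pred X) :
  \sum_(p <- pairs k | b p.2) pair_weight p = \sum_(x <- annulus k | b x) weight c0 x.
Proof.
rewrite -pairs_sum1 /pairs !big_filter_cond big_mkcond [RHS]big_mkcond !big_allpairs_dep /=.
rewrite exchange_big /=; apply: eq_bigr => x _; apply: eq_bigr => y _.
have E u v : wdist c0 u = wdist v c0 -> wdist c0 v = wdist u c0.
  by move=> h; rewrite (wdistC v c0) -h -wdistC.
rewrite /pair_weight /=; have [h|h] := eqVneq (wdist c0 x) (wdist y c0); last first.
  by rewrite andFb ifF//; apply/negbTE; apply: contra h => /andP[/eqP/E->].
have E2 := E _ _ h; rewrite E2 eqxx /=; case: (b x) => //.
have dE : dist c0 x = dist c0 y by rewrite [RHS]cdistC /cdist h.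
have nE : nchambers c0 x = nchambers c0 y.
  by rewrite [RHS](nchambersC q_card) /nchambers h (nsphere_base q_card y c0 (wdist_weyl y c0)).
by rewrite !/(weight _ _) dE nE.
Qed.

(** [e] stands for [fst] or [snd]. The chambers [Q p] at one level with [omega] in their shadows are
    close to each other, so all contributing end points lie beyond a single chamber, and
    [annulus_sum] applies. *)
Lemma pairs_multiplicity (r : R) : exists2 C : R, 0 < C &
  forall (e : X * X -> X), (forall k (b : pred X),
    \sum_(p <- pairs k | b (e p)) pair_weight p = \sum_(x <- annulus k | b x) weight c0 x) ->
  forall k (Q : X * X -> X) (t : R) a omega,
  (forall p, a p -> between c0 (Q p) (e p) r /\ `|dist c0 (Q p) - t| <= r) ->
  \sum_(p <- pairs k | a p && `[< shadow c0 (Q p) r omega >]) pair_weight p / weight c0 (Q p) <= C.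
Proof.
have [C1 hC1] := shadow_overlap X r (2 * r); have [C2 C21 hC2] := weight_near q_gt0 q_card C1.
have [C3 C30 hC3] := annulus_sum q_gt0 q_card nu_haar mu_def act_trans (r + 2 * C1).
have C20 : 0 < C2 by apply: lt_le_trans C21.
exists (C2 * C3); first exact: mulr_gt0.
move=> e me k Q t a omega ha; set b := fun p => a p && `[< shadow c0 (Q p) r omega >].
have [/hasP[p0 _ /andP[a0 /asboolP s0]]|no] := boolP (has b (pairs k)); last first.
  by rewrite (eq_bigl b)// big_hasC// mulr_ge0 ?(ltW C20) ?(ltW C30).
have W0 := weight_gt0 q_gt0 q_card c0.
have near p : b p -> dist (Q p0) (Q p) <= C1.
  move=> /andP[ap /asboolP sp]; apply: hC1 s0 sp _.
  have [_] := ha _ a0; have [_] := ha _ ap.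
  by rewrite !ler_norml => /andP[h1 h2] /andP[h3 h4]; apply/andP; split; lra.
apply: (@le_trans _ _ (\sum_(p <- pairs k | b p) pair_weight p * (C2 / weight c0 (Q p0)))).
  apply: ler_sum => p bp; rewrite ler_wpM2l ?pair_weight_ge0//.
  by rewrite ler_pdivlMr// mulrC ler_pdivrMr//; exact: hC2 (near p bp).
rewrite -mulr_suml; apply: (@le_trans _ _ (C3 * weight c0 (Q p0) * (C2 / weight c0 (Q p0)))).
  rewrite ler_wpM2r ?divr_ge0 ?(ltW C20) ?(ltW (W0 _))//; apply: le_trans (hC3 k (Q p0)).
  rewrite -me big_mkcond [leRHS]big_mkcond; apply: ler_sum => p _.
  case: ifP => [bp|_]; last by case: ifP => _//; exact: pair_weight_ge0.
  rewrite ifT//; apply/asboolP; have := near p bp; move: bp => /andP[/ha[+ _] _].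
  rewrite /between; have := cdist_triangle c0 (Q p) (Q p0); have := cdist_triangle (Q p0) (Q p) (e p).
  rewrite (cdistC (Q p)  (Q p0)); move: (dist _ _) (dist _ _) (dist _ _) (dist _ _) (dist _ _) (dist _ _).
  by move=> *; lra.
rewrite le_eqVlt; apply/orP; left; apply/eqP; have := gt_eqF (W0 (Q p0)).
by move: (weight c0 (Q p0)) => w w0; field; rewrite w0.
Qed.

(* [g1 * gam p * g2^-1] moves [act g2 c0] close to [act g1 c0] through the
   chamber [Q p], which lies at distance [t] from [c0]. *)
Definition through g1 g2 k (gam : X * X -> G) (Q : X * X -> X) (t r : R) p :=
  [/\ p \in pairs k,
      act (gam p) c0 = p.1 /\ act (gam p)^-1%g c0 = p.2,
      between c0 (Q p) p.1 r /\ `|dist c0 (Q p) - t| <= r,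
      between c0 (act g1 c0) (act g1 (Q p)) r &
      between c0 (act g2 c0) (act g2 (act (gam p)^-1%g (Q p))) r].

(** The inequality of means is applied to each pair with a parameter adapted to the weights, and
    [pairs_multiplicity] gathers the pieces into integrals over the shadows of [act g2 c0] and
    [act g1 c0]. The factor [lam] is left free to balance [f] against [h]. *)
Lemma shell_bound (r : R) : 0 <= r -> exists2 C : R, 0 < C &
  forall g1 g2 k gam Q t a (f h : Omega -> R) (lam : R), 0 < lam ->
  measurable_fun setT f -> measurable_fun setT h -> (forall w, 0 <= f w) -> (forall w, 0 <= h w) ->
  (forall p, a p -> through g1 g2 k gam Q t r p) ->
  (\sum_(p <- pairs k | a p)
     (pair_weight p / Num.sqrt (weight c0 (act (g1 * gam p * g2^-1)%g c0)))%:E *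
     \int[mu]_(w in both_sides (g1 * gam p * g2^-1)%g (act g1 (Q p)) r)
       (f (gact (g1 * gam p * g2^-1)^-1%g w) * h w * Num.sqrt (D (g1 * gam p * g2^-1)%g w))%:E <=
   (C * lam / weight c0 (act g2 c0))%:E *
     \int[mu]_(w in osh c0 (act g2 c0) (2 * r + shadow_gap X)) (f w ^+ 2)%:E +
   (C * lam^-1 / weight c0 (act g1 c0))%:E *
     \int[mu]_(w in osh c0 (act g1 c0) (2 * r + shadow_gap X)) (h w ^+ 2)%:E)%E.
Proof.
move=> r0; have gap0 := level_gap_ge0 X; pose rs := 2 * r + level_gap X.
have [C C0 hC] := pairs_multiplicity rs.
exists C => // g1 g2 k gam Q t a f h lam lam0 mf mh f0 h0 ha.
have W0 x y := weight_gt0 q_gt0 q_card x y.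
pose gt p := (g1 * gam p * g2^-1)%g; pose A p := both_sides (gt p) (act g1 (Q p)) r.
pose Q' p := act (gam p)^-1%g (Q p).
pose sm p := Num.sqrt (weight c0 (act (gt p) c0)).
have mA p : measurable (A p) by exact: both_sides_measurable.
pose c1 p := lam / weight c0 (act g2 c0) * (pair_weight p / weight c0 (Q' p)).
pose c2 p := lam^-1 / weight c0 (act g1 c0) * (pair_weight p / weight c0 (Q p)).
have sm0 p : 0 < sm p by rewrite sqrtr_gt0.
have c10 p : 0 <= c1 p by rewrite !mulr_ge0 ?invr_ge0 ?(ltW lam0) ?(ltW (W0 _ _)) ?pair_weight_ge0.
have c20 p : 0 <= c2 p by rewrite !mulr_ge0 ?invr_ge0 ?(ltW lam0) ?(ltW (W0 _ _)) ?pair_weight_ge0.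
pose I1 p := (\int[mu]_(w in gact (gt p) @^-1` A p) (f w ^+ 2)%:E)%E.
pose I2 p := (\int[mu]_(w in A p) (h w ^+ 2)%:E)%E.
have gtV p : act (gt p)^-1%g (act g1 (Q p)) = act g2 (Q' p).
  by rewrite /gt !invgM invgK !act_action.2 (actK act_action).
have gtc p : act (gt p) c0 = act g1 (act (gam p) (act g2^-1%g c0)) by rewrite /gt !act_action.2.
apply: (@le_trans _ _ (\sum_(p <- pairs k | a p) ((c1 p)%:E * I1 p + (c2 p)%:E * I2 p))%E).
  (* With this parameter [tp] the factor [sm p] cancels in the term of [h]; in the term of [f] its
     square is bounded below by a product of weights, through [weight_superM]. *)
  apply: lee_sum => p ap; rewrite -/(gt p) -/(sm p); pose tp := lam * weight c0 (act g1 (Q p)) / sm p.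
  have tp0 : 0 < tp.
    by apply: divr_gt0 (sm0 p); apply: mulr_gt0 lam0 (W0 _ _).
  have [mD D0 dE] := D_density (gt p).
  have am := @density_amgm _ Omega R mu (gact (gt p)) (gact (gt p)^-1%g) (D (gt p))
    (@gact_measurable R n P X xi0 G act (gt p)) (@gact_measurable R n P X xi0 G act (gt p)^-1%g)
    (gactK xi0 act_action (gt p)) mD D0 dE (A p) f h tp (mA p) tp0 mf mh f0 h0.
  have ks0 : 0 <= pair_weight p / sm p by rewrite divr_ge0 ?pair_weight_ge0 ?ltW.
  apply: le_trans (lee_wpmul2l _ am) _; first by rewrite lee_fin.
  rewrite ge0_muleDr ?mule_ge0 ?lee_fin ?invr_ge0 ?(ltW tp0)//; try by apply: integral_ge0 => w _; rewrite lee_fin sqr_ge0.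
  rewrite !muleA -!EFinM; have w1 := W0 c0 (act g1 (Q p)); have w3 := W0 c0 (act g1 c0).
  have w2 := W0 c0 (act g2 c0); have w4 := W0 c0 (Q p); have w5 := W0 c0 (Q' p).
  apply: leeD; apply: lee_wpmul2r; try by apply: integral_ge0 => w _; rewrite lee_fin sqr_ge0.
  - have e1 : weight c0 (act g1 (Q p)) * weight (act g1 (Q p)) (act (gt p) c0) <= sm p ^+ 2.
      by rewrite sqr_sqrtr ?(ltW (W0 _ _))//; exact: (weight_superM q_gt0 q_card).
    have e2 : weight (act g1 (Q p)) (act (gt p) c0) = weight (act g2 (Q' p)) c0.
      by rewrite -gtV -(weight_act q_card act (gt p)^-1%g) (actK act_action).
    have e3 : weight c0 (act g2 c0) * weight c0 (Q' p) <= weight (act g2 (Q' p)) c0.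
      rewrite (weightC q_card (act g2 (Q' p))) -(weight_act q_card act g2 c0 (Q' p)).
      exact: (weight_superM q_gt0 q_card).
    rewrite e2 in e1; have w6 := W0 (act g2 (Q' p)) c0; have kp := pair_weight_ge0 p.
    rewrite lee_fin /c1 /tp; have := sm0 p; move: w1 w2 w5 e1 e3 w6 kp lam0.
    move: (weight _ _) (weight _ _) (weight _ _) (weight _ _) (sm p) (pair_weight p) => W6 W5 W2 W1 s kp.
    move=> W10 W20 W50 e1 e3 W60 kp0 l0 s0.
    have -> : kp / s * (lam * W1 / s) = lam * kp * (W1 / s ^+ 2) by field; rewrite gt_eqF.
    have -> : lam / W2 * (kp / W5) = lam * kp * (W2 * W5)^-1 by field; rewrite !gt_eqF.
    rewrite ler_wpM2l ?mulr_ge0 ?(ltW l0)// ler_pdivrMr ?exprn_gt0// mulrC ler_pdivlMr ?mulr_gt0//.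
    by apply: le_trans e1; rewrite ler_wpM2l// ltW.
  - have e3 : weight c0 (act g1 c0) * weight c0 (Q p) <= weight c0 (act g1 (Q p)).
      by rewrite -(weight_act q_card act g1 c0 (Q p)); exact: (weight_superM q_gt0 q_card).
    have kp := pair_weight_ge0 p; rewrite lee_fin /c2 /tp; have := sm0 p; move: w1 w3 w4 e3 kp lam0.
    move: (weight _ _) (weight _ _) (weight _ _) (sm p) (pair_weight p) => W4 W3 W1 s kp.
    move=> W10 W30 W40 e3 kp0 l0 s0.
    have -> : kp / s * (lam * W1 / s)^-1 = lam^-1 * kp * W1^-1 by field; rewrite !gt_eqF.
    have -> : lam^-1 / W3 * (kp / W4) = lam^-1 * kp * (W3 * W4)^-1 by field; rewrite !gt_eqF.
    rewrite ler_wpM2l ?mulr_ge0 ?invr_ge0 ?(ltW l0)//.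
    by rewrite lef_pV2 ?posrE ?mulr_gt0.
have I10 p : (0 <= I1 p)%E by apply: integral_ge0 => w _; rewrite lee_fin sqr_ge0.
have I20 p : (0 <= I2 p)%E by apply: integral_ge0 => w _; rewrite lee_fin sqr_ge0.
rewrite big_split /=.
have msq (u : Omega -> R) : measurable_fun setT u -> measurable_fun setT (fun w => (u w ^+ 2)%:E).
  by move=> mu'; apply/measurable_EFinP; exact: measurable_funX.
have sq0 (u : Omega -> R) w : (0 <= (u w ^+ 2)%:E)%E by rewrite lee_fin sqr_ge0.
apply: leeD; rewrite -big_filter.
- apply: weighted_sum_integral_le => //.
  + by move=> p; apply: (@gact_preimage_measurable R n P X xi0 G act (gt p) (A p)); exact: mA.
  + exact: open_shadow_measurable.
  + exact: msq.
  + move=> p; rewrite mem_filter => /andP[/ha[_ _ _ _ b2] _] w [_ /open_shadow_sub].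
    move=> /(@shadow_gactV R n P X xi0 G act act_action (gt p) c0); rewrite gtV => sw.
    by apply: (@sub_open_shadow R n P X xi0 _ _ (r + r)); [lra|exact: (shadow_sub b2 sw)].
  + by rewrite !mulr_ge0 ?invr_ge0 ?(ltW lam0) ?(ltW (W0 _ _)) ?(ltW C0).
  move=> w; rewrite big_filter_cond -mulr_sumr.
  rewrite (_ : C * lam / _ = lam / weight c0 (act g2 c0) * C); last by rewrite -mulrA mulrC.
  rewrite ler_wpM2l ?divr_ge0 ?(ltW lam0) ?(ltW (W0 _ _))//.
  (* Since [gam p] carries [p.2] and [c0] to [c0] and [p.1], the chamber [Q' p] lies on the way from
     [c0] to [p.2], at level about [k - t]. *)
  apply: le_trans (hC snd pairs_sum2 k Q' (k%:R - t) a (gact g2^-1%g w) _).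
    rewrite big_mkcond [leRHS]big_mkcond; apply: ler_sum => p _.
    have wp0 : 0 <= pair_weight p / weight c0 (Q' p) by rewrite divr_ge0 ?pair_weight_ge0 ?(ltW (W0 _ _)).
    case: ifP => [/andP[ap wA]|_]; last by case: ifP.
    rewrite ap ifT//; apply/asboolP; have [_ _ _ _ b2] := ha _ ap.
    have [_ /open_shadow_sub] := set_mem wA.
    move=> /(@shadow_gactV R n P X xi0 G act act_action (gt p) c0); rewrite gtV => sw.
    have := shadow_base b2 sw; rewrite -[w in shadow _ _ _ w](gactVK xi0 act_action g2).
    move=> /(@shadow_gact R n P X xi0 G act g2); apply: shadow_mono.
    by rewrite /rs; lra.
  move=> p /ha[/pairsP[/annulusP pk _ _] [e1 e2] [b0 d0] _ _].
  have E1 : dist c0 (Q' p) = dist p.1 (Q p) by rewrite -(dist_act act (gam p)) /Q' (actVK act_action) e1.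
  have E2 : dist (Q' p) p.2 = dist (Q p) c0 by rewrite -(dist_act act (gam p)) /Q' -e2 !(actVK act_action).
  have E3 : dist c0 p.2 = dist p.1 c0 by rewrite -(dist_act act (gam p)) -e2 (actVK act_action) e1.
  move: b0 d0 pk; rewrite /between E1 E2 E3 (cdistC p.1 (Q p)) (cdistC p.1 c0) (cdistC (Q p) c0).
  rewrite !ler_norml => b0 /andP[h1 h2] /andP[h3 h4].
  rewrite /rs; have := cdist_triangle c0 (Q p) p.1; move: h1 h2 h3 h4 b0 gap0 r0.
  move: (dist _ _) (dist _ _) (dist _ _) (level_gap X) => d1 d2 d3 lg.
  by move=> h1 h2 h3 h4 b0 g0 r0 h5; split; [|apply/andP; split];
    move: h1 h2 h3 h4 b0 g0 r0 h5; glra3.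
- apply: weighted_sum_integral_le => //.
  + exact: open_shadow_measurable.
  + exact: msq.
  + move=> p; rewrite mem_filter => /andP[/ha[_ _ _ b1 _] _] w [/open_shadow_sub sw _].
    by apply: (@sub_open_shadow R n P X xi0 _ _ (r + r)); [lra|exact: (shadow_sub b1 sw)].
  + by rewrite !mulr_ge0 ?invr_ge0 ?(ltW lam0) ?(ltW (W0 _ _)) ?(ltW C0).
  move=> w; rewrite big_filter_cond -mulr_sumr.
  rewrite (_ : C * lam^-1 / _ = lam^-1 / weight c0 (act g1 c0) * C); last by rewrite -mulrA mulrC.
  rewrite ler_wpM2l ?divr_ge0 ?invr_ge0 ?(ltW lam0) ?(ltW (W0 _ _))//.
  apply: le_trans (hC fst pairs_sum1 k Q t a (gact g1^-1%g w) _).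
    rewrite big_mkcond [leRHS]big_mkcond; apply: ler_sum => p _.
    have wp0 : 0 <= pair_weight p / weight c0 (Q p) by rewrite divr_ge0 ?pair_weight_ge0 ?(ltW (W0 _ _)).
    case: ifP => [/andP[ap wA]|_]; last by case: ifP.
    rewrite ap ifT//; apply/asboolP; have [_ _ _ b1 _] := ha _ ap.
    have [/open_shadow_sub sw _] := set_mem wA.
    have := shadow_base b1 sw; rewrite -[w in shadow _ _ _ w](gactVK xi0 act_action g1).
    move=> /(@shadow_gact R n P X xi0 G act g1); apply: shadow_mono.
    by rewrite /rs; lra.
  move=> p /ha[_ _ [b0 d0] _ _]; move: b0 d0; rewrite /between !ler_norml /rs => b0 /andP[h1 h2].
  by split; [|apply/andP; split]; move: b0 h1 h2 r0 gap0; glra3.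
Qed.

End pairs_of_chambers.

(** * Shells along a geodesic *)

Lemma integral_cover_le (disp : measure_display) (T : measurableType disp) (R : realType)
    (mu : {measure set T -> \bar R}) (I : eqType) (l : seq I) (F : I -> set T) (S : set T)
    (psi : T -> \bar R) :
  (forall i, measurable (F i)) -> measurable_fun setT psi -> (forall x, (0 <= psi x)%E) ->
  (forall x, S x -> exists2 i, i \in l & F i x) ->
  (\int[mu]_(x in S) psi x <= \sum_(i <- l) \int[mu]_(x in F i) psi x)%E.
Proof.
move=> mF mpsi psi0 cov.
have res0 (A : set T) x : (0 <= (psi \_ A) x)%E by rewrite patchE; case: ifP.
rewrite integral_mkcond (eq_bigr (fun i => \int[mu]_x (psi \_ (F i)) x)%E); last first.
  by move=> i _; rewrite integral_mkcond.
rewrite -ge0_integral_sum//; last first.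
  by move=> i; apply/(measurable_restrictT psi (mF i)); exact: measurable_funTS.
apply: ge0_le_integralT => // x; rewrite [leLHS]patchE; case: ifPn => [/set_mem Sx|_]; last exact: sume_ge0.
have [i il Fx] := cov x Sx; rewrite (big_rem i)//= [X in (_ <= X + _)%E]patchE mem_set//.
by rewrite leeDl// sume_ge0.
Qed.

Section chains.
Variables (R : realType) (n : nat) (P : right_angled_polytope R n.+1).
Variables (X : building P).
Local Notation dist := (@cdist R n P X).
Implicit Types (x y z c p a : X).

(** Coarse geodesics sharing a segment longer than the constants fit together: [key] says that the
    four chambers are coarsely aligned. *)
Lemma between_chain : exists2 D : R, 0 <= D & forall (rho r : R) x y z w q,
  between x y z rho -> between y z w rho -> rho + D < dist y z -> between y q z r ->
  [/\ between x y q (2 * rho + D + r), between x q w (2 * rho + D + r) &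
      between q z w (2 * rho + D + r)].
Proof.
have [D D0 h] := cdist_hyperbolic X; exists D => // rho r x y z w q b1 b2 far bq.
have key : dist x y + dist y z + dist z w <= dist x w + 2 * rho + D.
  have := h x y z w; move: b1 b2 far; rewrite /between maxElt (addrC (dist y z)).
  by case: ifP => _; glra2.
have := cdist_triangle x q w; have := cdist_triangle x y q; have := cdist_triangle q z w.
have := cdist_triangle x q z; have := cdist_triangle y q w; have := cdist_triangle x z w.
have := cdist_triangle x y w; move: key bq; rewrite /between.
repeat match goal with
  | |- context [@cdist ?R ?n ?P ?X ?a ?b] => move: (@cdist R n P X a b) => ?
  end.
by move=> *; split; lra.
Qed.

End chains.

Lemma count_close (a : pred nat) (N B : nat) :
  (forall i j, a i -> a j -> (i <= j)%N -> (j < i + B)%N) -> (count a (iota 0 N) <= B)%N.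
Proof.
move=> close; rewrite -size_filter; case E : [seq i <- iota 0 N | a i] => [//|i l].
have ai : a i by have : i \in [seq i <- iota 0 N | a i] by [rewrite E mem_head]; rewrite mem_filter => /andP[].
rewrite -E -[B](size_iota i); apply: uniq_leq_size; first exact/filter_uniq/iota_uniq.
move=> j; rewrite mem_filter => /andP[aj jN]; rewrite mem_iota.
have ij : (i <= j)%N.
  have srt : sorted ltn [seq i <- iota 0 N | a i] by apply: sorted_filter (iota_ltn_sorted 0 N); exact: ltn_trans.
  have : j \in [seq i <- iota 0 N | a i] by rewrite mem_filter aj.
  move: srt; rewrite E /= => srt; rewrite inE => /orP[/eqP->//|jl].
  by apply: ltnW; move: (order_path_min ltn_trans srt) => /allP/(_ j jl).
by rewrite ij close.
Qed.

Section shells.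
Variables (R : realType) (n : nat) (P : right_angled_polytope R n.+2).
Variables (X : building P) (q : facet P -> nat).
Hypothesis q_gt0 : forall s, (0 < q s)%N.
Hypothesis q_card : forall s (x : X), (panel s x #= `I_(q s).+1)%card.
Variables (xi0 : boundary X) (c0 : X).
Variables (nu : probability (borel_stab c0) R) (nu_haar : is_haar_probability nu).
Variable mu : {measure set (borel_boundary xi0) -> \bar R}.
Hypothesis mu_def : is_boundary_measure nu mu.
Variables (G : groupType) (act : G -> aut X).
Hypothesis act_action : is_aut_action act.
Hypothesis act_trans : strongly_transitive act.
Variable D : G -> borel_boundary xi0 -> R.
Hypothesis D_density : forall g : G,
  is_density mu (pushforward mu (borel_act (act g))) (D g).
Local Notation dist := (@cdist R n.+1 P X).
Local Notation weight := (@weight R n P X).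
Local Notation annulus := (@annulus R n P X q q_card c0).
Local Notation pairs := (@pairs R n P X q q_card c0).
Local Notation pair_weight := (@pair_weight R n P X c0).
Local Notation Omega := (borel_boundary xi0).
Local Notation gact := (@gact R n P X xi0 G act).
Local Notation osh := (@open_shadow_at R n P X xi0).
Local Notation both_sides := (@both_sides R n P X xi0 c0 G act).
Implicit Types (x y z c : X) (p : X * X) (omega : boundary X) (g h : G) (a : pred (X * X)).

(* If the bound failed at every chamber, outer regularity would give [mu E = 0]. *)
Lemma concentrated (rho : R) : tile_radius X <= rho -> exists2 C : R, 0 < C &
  forall (E : set Omega) (f : Omega -> R) (e : R),
  measurable E -> (0 < mu E)%E -> measurable_fun setT f ->
  (\int[mu]_w (f w ^+ 2)%:E < +oo)%E -> (forall w, E w -> f w ^+ 2 <= 9) -> 0 < e ->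
  exists y, (\int[mu]_(w in osh c0 y rho) ((f w * \1_(~` E) w) ^+ 2)%:E <= (e * weight c0 y)%:E)%E /\
    (\int[mu]_(w in osh c0 y rho) (f w ^+ 2)%:E <= ((C + e) * weight c0 y)%:E)%E.
Proof.
move=> rhoP; have [C C0 hC] := mu_upper q_gt0 q_card nu_haar mu_def act_trans rho.
have [c cpos hc] := tile_mass_upper q_gt0 q_card nu_haar mu_def act_trans.
have [B hB] := cover_compare q_card c0 mu rhoP.
exists (9 * C); first exact: mulr_gt0.
move=> E f e mE E0 mf f2 f9 e0.
pose th w := f w * \1_(~` E) w.
have mth : measurable_fun setT th.
  apply: measurable_funM => //; apply: measurable_indic; exact: measurableC.
have msq (u : Omega -> R) : measurable_fun setT u -> measurable_fun setT (fun w => (u w ^+ 2)%:E).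
  by move=> mu'; apply/measurable_EFinP; exact: measurable_funX.
have sq0 (u : Omega -> R) w : (0 <= (u w ^+ 2)%:E)%E by rewrite lee_fin sqr_ge0.
have mo y : measurable (osh c0 y rho) by exact: open_shadow_measurable.
have fE : (mu E < +oo)%E.
  apply: (le_lt_trans _ (mu_finite q_gt0 q_card nu_haar mu_def act_trans)).
  by apply: le_measure; [exact/mem_set|exact/mem_set|].
have [y hy] : exists y, (\int[mu]_(w in osh c0 y rho) (th w ^+ 2)%:E <= (e * weight c0 y)%:E)%E.
  apply: contrapT => no.
  have big y : (((e * weight c0 y)%:E) <= \int[mu]_(w in osh c0 y rho) (th w ^+ 2)%:E)%E.
    by rewrite leNgt; apply/negP => /ltW h; apply: no; exists y.
  pose K := c / e; have K0 : 0 < K by exact: divr_gt0.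
  (* If the estimate fails at every chamber, each tile is dominated by an integral of [th ^+ 2], and
     the covering comparison extends this to all open sets. *)
  have cmp (U : set Omega) : boundary_open U ->
      (mu U <= (K * B%:R)%:E * \int[mu]_(w in U) (th w ^+ 2)%:E)%E.
    move=> oU; apply: (hB idfun (fun w => (th w ^+ 2)%:E) K 0 U _ _ _ (ltW K0) oU) => //.
    - exact: measurable_id.
    - exact: msq.
    move=> y _ _; apply: le_trans (hc y) _.
    rewrite (_ : (c * weight c0 y)%:E = (K%:E * (e * weight c0 y)%:E)%E); last first.
      by rewrite -EFinM /K (mulrA (c / e) e) divfK// gt_eqF.
    by rewrite lee_wpmul2l// lee_fin ltW.
  have mE_fin : mu E \is a fin_num by rewrite ge0_fin_numE.
  pose m := fine (mu E); have mEm : mu E = m%:E by rewrite fineK.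
  have m0 : 0 < m by rewrite -lte_fin -mEm.
  pose eta := m / (K * B%:R + 1).
  have KB : 0 <= K * B%:R by rewrite mulr_ge0// ltW.
  have eta0 : 0 < eta by rewrite divr_gt0//; lra.
  have intf : mu.-integrable setT (EFin \o (fun w => f w ^+ 2)).
    apply/integrableP; split; first exact: msq.
    rewrite (eq_integral (fun w => (f w ^+ 2)%:E))// => w _ /=.
    by rewrite ger0_norm ?sqr_ge0.
  (* Absolute continuity of the integral: as [th] vanishes on [E], an open set close to [E] in
     measure carries little of [th ^+ 2]. *)
  have [d [d0 hd]] := integral_normr_continuous intf eta0.
  have d20 : 0 < d / 2 by rewrite divr_gt0.
  have [U [oU EU hU]] := boundary_outer_regular q_gt0 q_card nu_haar mu_def act_trans mE d20.
  have mU : measurable U by exact: boundary_open_measurable.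
  have mUE : measurable (U `\` E) by exact: measurableD.
  have small : (mu (U `\` E) < d%:E)%E by apply: le_lt_trans hU _; rewrite lte_fin; lra.
  have := hd _ mUE small; rewrite /Rintegral => lt_eta.
  have E1 : (\int[mu]_(w in U) (th w ^+ 2)%:E = \int[mu]_(w in U `\` E) (f w ^+ 2)%:E)%E.
    rewrite [LHS]integral_mkcond [RHS]integral_mkcond; apply: eq_integral => w _; rewrite !patchE.
    have [Uw|nUw] := boolP (w \in U); last first.
      by rewrite ifF//; apply/negbTE; apply: contra nUw => /set_mem[Uw _]; exact/mem_set.
    have [Ew|nEw] := pselect (E w).
      rewrite ifF; last by apply/negP => /set_mem[].
      by rewrite /th indicE memNset ?mulr0 ?expr0n//= => h; exact: h.
    rewrite ifT; last by apply/mem_set; split=> //; exact/set_mem.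
    by rewrite /th indicE mem_set// mulr1.
  have fin : (\int[mu]_(w in U `\` E) (f w ^+ 2)%:E)%E \is a fin_num.
    rewrite ge0_fin_numE; last by apply: integral_ge0.
    apply: le_lt_trans f2; apply: ge0_subset_integral => //; exact: msq.
  have lt2 : (\int[mu]_(w in U `\` E) (f w ^+ 2)%:E < eta%:E)%E.
    rewrite -(fineK fin) lte_fin; apply: le_lt_trans lt_eta.
    by rewrite le_eqVlt; apply/orP; left; apply/eqP; congr fine; apply: eq_integral => w _ /=; rewrite ger0_norm ?sqr_ge0.
  have : (m%:E <= (K * B%:R * eta)%:E)%E.
    rewrite -mEm; apply: (@le_trans _ _ (mu U)).
      by apply: le_measure; [exact/mem_set|exact/mem_set|].
    apply: le_trans (cmp U oU) _; rewrite E1 [leRHS]EFinM lee_wpmul2l//.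
    exact: ltW.
  rewrite lee_fin /eta mulrA ler_pdivlMr; last by lra.
  by rewrite mulrDr mulr1 mulrC; lra.
exists y; split=> //.
have W0 := weight_gt0 q_gt0 q_card c0 y.
apply: (@le_trans _ _ (\int[mu]_(w in osh c0 y rho) ((cst 9%:E w + (th w ^+ 2)%:E)))%E).
  rewrite [leLHS]integral_mkcond [leRHS]integral_mkcond; apply: ge0_le_integralT => w.
    by rewrite patchE; case: ifP.
  rewrite !patchE; case: ifP => // _; rewrite -EFinD lee_fin /th.
  have [Ew|nEw] := pselect (E w); first by have := f9 w Ew; have := sqr_ge0 (f w * \1_(~` E) w); lra.
  by rewrite indicE mem_set// mulr1; lra.
rewrite ge0_integralD//; last by apply: measurable_funTS; exact: msq.
have -> : (((9 * C + e) * weight c0 y)%:E = 9%:E * (C * weight c0 y)%:E + (e * weight c0 y)%:E)%E.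
  by rewrite -EFinM -EFinD; congr EFin; move: (weight c0 y) => w; ring.
rewrite integral_cst//; apply: leeD => //; rewrite lee_wpmul2l//.
  by apply: hC => //; exact: open_shadow_sub.
by move=> w _; rewrite lee_fin.
Qed.

(* The pairs [(g c0, g^-1 c0)] for which [g c0] and [g^-1 c0] are not in the
   directions of two given chambers carry a definite part of the weight. *)
Lemma good_pairs : exists rho c : R, [/\ 0 <= rho, 0 < c & forall z1 z2 k,
  c <= \sum_(p <- pairs k | `[< between z1 c0 p.1 rho >] && `[< between z2 c0 p.2 rho >]) pair_weight p].
Proof.
have [D1 D10 h1] := between_turn X.
have [c cpos hc] := annulus_total q_gt0 q_card nu_haar mu_def act_trans.
have [C C0 hC] := annulus_sum q_gt0 q_card nu_haar mu_def act_trans D1.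
have [L [L0 hL]] : exists L : R, 0 <= L /\ C * expR (D1 - L) <= c / 4.
  exists (Num.max 0 (D1 - ln (c / (4 * C)))); rewrite le_max lexx; split=> //.
  have h : expR (D1 - Num.max 0 (D1 - ln (c / (4 * C)))) <= c / (4 * C).
    rewrite -[leRHS]lnK ?posrE ?divr_gt0 ?mulr_gt0// ler_expR.
    have : D1 - ln (c / (4 * C)) <= Num.max 0 (D1 - ln (c / (4 * C))) by rewrite le_max lexx orbT.
    lra.
  apply: le_trans (ler_wpM2l (ltW C0) h) _.
  by rewrite le_eqVlt; apply/orP; left; apply/eqP; field; rewrite gt_eqF.
exists (2 * L + D1), (c / 2); split; [by rewrite addr_ge0// mulr_ge0|by rewrite divr_gt0|].
move=> z1 z2 k.
(* When [z] is within [L] of [c0] no chamber is bad. Otherwise the bad chambers lie beyond one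
   chamber at distance about [L], and [annulus_sum] bounds their weight. *)
have bad z : \sum_(x <- annulus k | ~~ `[< between z c0 x (2 * L + D1) >]) weight c0 x <= c / 4.
  have [Lz|zL] := leP L (dist z c0); last first.
    rewrite big_pred0; first by rewrite divr_ge0// ltW.
    move=> x; apply/negbTE; rewrite negbK; apply/asboolP; rewrite /between.
    by have := cdist_triangle c0 z x; rewrite (cdistC c0 z); move: zL L0 D10; glra2.
  have [u [e1 e2]] := h1 L z c0 L0 Lz.
  apply: (@le_trans _ _ (C * weight c0 u)).
    apply: le_trans (hC k u); rewrite big_mkcond [leRHS]big_mkcond; apply: ler_sum => x _.
    case: ifP => [/asboolP/e2 h|_]; first by rewrite ifT//; exact/asboolP.
    by case: ifP => // _; rewrite ltW// (weight_gt0 q_gt0 q_card).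
  apply: le_trans hL; rewrite ler_wpM2l ?(ltW C0)//.
  apply: le_trans (weight_le_expR q_gt0 q_card _ _) _; rewrite ler_expR.
  by move: e1; rewrite ler_norml => /andP[e1 e3]; lra.
have tot := hc k; rewrite -(pairs_sum1 q_gt0 q_card c0 k predT) in tot.
have bad1 := bad z1; rewrite -(pairs_sum1 q_gt0 q_card) in bad1.
have bad2 := bad z2; rewrite -(pairs_sum2 q_gt0 q_card) in bad2.
have split_sum (l : seq (X * X)) (a b : pred (X * X)) : \sum_(p <- l) pair_weight p <=
    \sum_(p <- l | a p && b p) pair_weight p +
    (\sum_(p <- l | ~~ a p) pair_weight p + \sum_(p <- l | ~~ b p) pair_weight p).
  elim: l => [|p l IH]; first by rewrite !big_nil !addr0.
  have := pair_weight_ge0 q_gt0 q_card c0 p; rewrite !big_cons; move: IH.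
  by case: (a p); case: (b p) => /=; lra.
have := split_sum (pairs k) (fun p => `[< between z1 c0 p.1 (2 * L + D1) >])
  (fun p => `[< between z2 c0 p.2 (2 * L + D1) >]).
by lra.
Qed.

(* The shells [Q j] sit along a geodesic from [c0] to [p.1]; the end regions are
   those of radius [M] around [c0] and [act gt c0]. *)
Lemma pair_shells (rho : R) : 0 <= rho -> exists r c : R, exists K B : nat,
  [/\ 0 <= r, tile_radius X <= r, 0 < c & forall g1 g2,
    exists2 M : R, r <= M /\
      2 * (dist c0 (act g1^-1%g c0) + dist c0 (act g2^-1%g c0)) + level_gap X <= M &
    forall N p, p \in pairs (N + 2 * K) ->
    between (act g1^-1%g c0) c0 p.1 rho -> between (act g2^-1%g c0) c0 p.2 rho ->
    exists (gam : G) (Q : nat -> X), let gt := (g1 * gam * g2^-1)%g in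
    [/\ act gam c0 = p.1 /\ act gam^-1%g c0 = p.2,
      forall j, (j < N)%N -> [/\ between c0 (Q j) p.1 r, `|dist c0 (Q j) - (K + j)%:R| <= r,
        between c0 (act g1 c0) (act g1 (Q j)) r,
        between c0 (act g2 c0) (act g2 (act gam^-1%g (Q j))) r &
        ((c * Num.sqrt (weight c0 (act gt c0)))%:E <=
          \int[mu]_(w in both_sides gt (act g1 (Q j)) r) (Num.sqrt (D gt w))%:E)%E],
      forall w, (count (fun j => w \in both_sides gt (act g1 (Q j)) r) (iota 0 N) <= B)%N &
      forall w, [\/ both_sides gt c0 M w, both_sides gt (act gt c0) M w |
        exists2 j, (j < N)%N & both_sides gt (act g1 (Q j)) r w]]].
Proof.
move=> rho0; have [D2 D20 geo] := cdist_geodesic X; have [D3 D30 chain] := between_chain X.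
have [D1 D10 appr] := shadow_approx X.
(* [tau] is the error in [between_chain] for a chamber coarsely on a geodesic with error [2 * D2];
   [s] also allows for rounding a level to an integer. *)
pose tau := 2 * rho + D3 + 2 * D2; pose s := 1 + D2 + tau.
have [L [r0 [L0 mass]]] := sqrt_density_mass q_gt0 q_card nu_haar mu_def act_action act_trans D_density tau.
have [Cb hb] := branch_chamber X tau s.
pose gap := level_gap X; have gap0 : 0 <= gap := level_gap_ge0 X.
pose sg := shadow_gap X; have sg0 : 0 <= sg := shadow_gap_ge0 X.
have trE : tile_radius X = gap + 4 + sg by [].
(* One radius that satisfies the demands of [sqrt_density_mass], of [branch_chamber], of the tiles
   and of the alignment. *)
pose r := `|r0| + `|Cb| + tile_radius X + tau + D2.
have n1 := normr_ge0 r0; have n2 := normr_ge0 Cb.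
have n3 := ler_norm r0; have n4 := ler_norm Cb.
have rE : r = `|r0| + `|Cb| + tile_radius X + tau + D2 by [].
have tE : tau = 2 * rho + D3 + 2 * D2 by [].
have rr0 : r0 <= r by lra.
have Cbr : Cb + sg <= r by lra.
have r_ge0 : 0 <= r by lra.
have [c cpos hc] := mass r rr0.
have natb (b : R) : exists K : nat, b < K%:R.
  by exists (Num.truncn `|b|).+1; apply: le_lt_trans (ler_norm b) _; apply: truncnS_gt.
(* Dropping [K] levels at each end keeps all shells farther than [L] from [c0] and from
   [act gt c0]. *)
have [K hK] := natb (L + gap + D2 + tau + rho + D3 + 1).
have [B hB] := natb (r + D1 + 2 * D2 + tau).
exists r, c, K, B; split=> //; first by lra.
move=> g1 g2; set z1 := act g1^-1%g c0; set z2 := act g2^-1%g c0.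
have az := cdist_ge0 c0 z1; have bz := cdist_ge0 c0 z2.
(* Unlike [r], [c], [K] and [B], the radius [M] depends on [g1] and [g2]: it covers the distances by
   which they move [c0] and the levels dropped at the ends. *)
pose M := r + 2 * (dist c0 z1 + dist c0 z2 + K%:R + gap + D2); exists M; first by rewrite -/gap /M; lra.
move=> N p pk b1 b2; have [/annulusP p1k _ wE] := pairsP pk.
have [gam [e1 e2]] := transitive_pairs act_trans wE.
have e3 : act gam^-1%g c0 = p.2 by rewrite -e2 (actK act_action).
have {p1k} [dlo dhi] : (N + 2 * K)%:R - gap <= dist c0 p.1 /\ dist c0 p.1 <= (N + 2 * K)%:R + gap.
  by move: p1k; rewrite -/gap ler_norml => /andP[h1 h2]; split; move: h1 h2; glra3.
rewrite natrD natrM in dlo dhi.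
have exQ j : exists z, (j < N)%N -> `|dist c0 z - (K + j)%:R| <= D2 /\
    `|dist z p.1 - (dist c0 p.1 - (K + j)%:R)| <= D2.
  have [jN|jN] := boolP (j < N)%N; last by exists c0.
  have jN' : j%:R + 1 <= N%:R :> R by rewrite natr1 ler_nat.
  have tj : 0 <= ((K + j)%:R : R) <= dist c0 p.1.
    by rewrite ler0n /= natrD; move: jN' dlo hK L0 gap0 D20 D30 rho0 tE; glra3.
  by have [z [h1 h2 _ _ _]] := geo c0 p.1 _ tj; exists z.
have [Q hQ] := choice exQ; exists gam, Q; set gt := (g1 * gam * g2^-1)%g.
pose z2' := act gam z2.
have tr g u v : dist (act g u) (act g v) = dist u v := dist_act act g u v.
have g1z : act g1 z1 = c0 by rewrite /z1 (actVK act_action).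
have g2z : act g2 z2 = c0 by rewrite /z2 (actVK act_action).
have xE : act gt c0 = act g1 z2' by rewrite /gt !act_action.2.
have zz : dist z2' p.1 = dist c0 z2 by rewrite -e1 tr cdistC.
have b2' : between c0 p.1 z2' rho.
  have h1 : dist c0 p.2 = dist c0 p.1 by rewrite -(tr gam) e1 e2 cdistC.
  have h2 : dist z2 p.2 = dist c0 z2' by rewrite -(tr gam) e2 cdistC.
  move: b2; rewrite /between h1 h2 (cdistC z2 c0) (cdistC p.1 z2') zz; glra3.
have far : rho + D3 < dist c0 p.1.
  have := ler0n R N; move: dlo hK L0 gap0 D20 D30 rho0 tE; glra3.
have dcx : dist c0 (act gt c0) = dist z1 z2' by rewrite xE -[X in dist X _]g1z tr.
have dcP j : dist c0 (act g1 (Q j)) = dist z1 (Q j) by rewrite -[X in dist X _]g1z tr.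
have dxP j : dist (act gt c0) (act g1 (Q j)) = dist z2' (Q j) by rewrite xE tr.
have shells j : (j < N)%N -> [/\ between z1 c0 (Q j) tau, between z1 (Q j) z2' tau, between (Q j) p.1 z2' tau &
    [/\ (K + j)%:R - D2 <= dist c0 (Q j), dist c0 (Q j) <= (K + j)%:R + D2,
     dist c0 p.1 - (K + j)%:R - D2 <= dist (Q j) p.1 & dist (Q j) p.1 <= dist c0 p.1 - (K + j)%:R + D2]].
  move=> /hQ[]; rewrite !ler_norml => /andP[h1 h2] /andP[h3 h4].
  have bq : between c0 (Q j) p.1 (2 * D2) by move: h1 h2 h3 h4; rewrite /between; glra3.
  by have [k1 k2 k3] := chain _ _ _ _ _ _ _ b1 b2' far bq; split=> //; split; move: h1 h2 h3 h4; glra3.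
split=> //.
- move=> j jN; have [k1 k2 k3 [h1 h2 h3 h4]] := shells j jN.
  have jN' : j%:R + 1 <= N%:R :> R by rewrite natr1 ler_nat.
  have j0 := ler0n R j; have kj := natrD R K j.
  have dQ : dist c0 (Q j) <= dist z1 (Q j) + tau.
    by move: k1; rewrite /between; have := cdist_ge0 z1 c0; glra3.
  have dQ' : dist (Q j) p.1 <= dist z2' (Q j) + tau.
    by move: k3; rewrite /between (cdistC z2' (Q j)); have := cdist_ge0 p.1 z2'; glra3.
  split.
  + by move: h2 h4 rE tE n1 n2 trE gap0 sg0 D20 D30 rho0; rewrite /between; glra3.
  + rewrite ler_norml; apply/andP; split; move: h1 h2 rE tE n1 n2 trE gap0 sg0 D20 D30 rho0; glra3.
  + rewrite /between -[X in dist X _ + _]g1z -[X in _ <= dist X _ + _]g1z !tr.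
    by move: k1 rE n1 n2 trE gap0 sg0 D20; rewrite /between; glra3.
  + rewrite /between -[X in dist X _ + _]g2z -[X in _ <= dist X _ + _]g2z !tr.
    rewrite -(tr gam c0) -(tr gam z2 (act _ _)) (actVK act_action) e1 -/z2' (cdistC z2 c0) -zz.
    move: k3 rE n1 n2 trE gap0 sg0 D20; rewrite /between (cdistC (Q j)) (cdistC (Q j) z2') (cdistC p.1 z2').
    by glra3.
  + apply: hc.
    * by rewrite /between dcx dcP (cdistC _ (act gt c0)) dxP (cdistC z2').
    * by rewrite dcP; move: dQ h1 kj j0 hK gap0 D20 D30 rho0; glra3.
    * by rewrite dxP; move: dQ' h3 kj jN' hK dlo gap0 D20 D30 rho0; glra3.
- move=> w; pose a j := (j < N)%N && (w \in both_sides gt (act g1 (Q j)) r).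
  rewrite (eq_in_count (a2 := a)); last by move=> j; rewrite mem_iota /a => /andP[_ ->].
  (* If [w] lies beyond shell [i] seen from [act gt c0] and beyond the later shell [j] seen from
     [c0], the two levels are close. *)
  apply: count_close => i j /andP[iN /set_mem[_ /open_shadow_sub si]] /andP[jN /set_mem[/open_shadow_sub sj _]] ij.
  have [k1 _ k3 [h1 h2 h3 h4]] := shells i iN; have [k1' _ k3' [h1' h2' h3' h4']] := shells j jN.
  have [v [_ hv]] := appr c0 w (dist c0 (act g1 (Q i)) + dist c0 (act g1 (Q j)) + dist c0 (act gt c0)).
  have u1 := cdist_ge0 c0 (act g1 (Q i)); have u2 := cdist_ge0 c0 (act g1 (Q j)); have u3 := cdist_ge0 c0 (act gt c0).
  have v1 : between c0 (act g1 (Q j)) v (r + D1) by apply: (hv _ _ _ _ _).1 sj; rewrite ?cdistxx; move: u1 u2 u3; glra3.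
  have v2 : between (act gt c0) (act g1 (Q i)) v (r + D1) by apply: (hv _ _ _ _ _).1 si; move: u1 u2 u3; glra3.
  rewrite -(ltr_nat R) natrD; move: v1 v2; rewrite /between dcP dxP.
  have := cdist_triangle c0 (act g1 (Q i)) v; have := cdist_triangle (act gt c0) (act g1 (Q j)) v.
  rewrite dcP dxP; have := cdist_triangle z1 c0 (Q i); have := cdist_triangle z2' p.1 (Q j).
  move: k1 k3 k1' k3' h1 h2 h3 h4 h1' h2' h3' h4'; rewrite /between !natrD.
  rewrite !(cdistC (Q _) z2') !(cdistC p.1); move: hB; glra3.
(* The level [t] at which [w] branches off the geodesic from [c0] to [act gt c0] decides the case:
   near either end it gives an end region, and in between the integer part of the shifted level
   selects a shell. *)
move=> w; have [t /andP[t0 tx] ht] := hb c0 (act gt c0) w.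
have sall z (b : R) : 0 <= b -> osh z z (b + sg) w.
  by move=> b0; apply: (sub_open_shadow _ (lexx _)); apply: shadow_mono b0 _ (shadow_all z w).
have [z [y1 y2 _ _ _]] : exists z, [/\ `|dist c0 z - t| <= D2,
    `|dist z (act gt c0) - (dist c0 (act gt c0) - t)| <= D2, True, True & True].
  have tt : 0 <= t <= dist c0 (act gt c0) by rewrite t0.
  by have [z [y1 y2 _ _ _]] := geo _ _ _ tt; exists z.
have bz' : between c0 z (act gt c0) tau.
  by move: y1 y2 tE D30 rho0; rewrite /between !ler_norml => /andP[q1 q2] /andP[q3 q4]; move: q1 q2 q3 q4; glra3.
have zs : `|dist c0 z - t| <= s by apply: le_trans y1 _; move: tE D20 D30 rho0; rewrite /s; glra3.
have [sz1 sz2] := ht z bz' zs.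
have K0 := ler0n R K.
have M1 : M = (r - sg + 2 * (dist c0 z1 + dist c0 z2 + K%:R + gap + D2)) + sg by rewrite /M; ring.
move: y1 y2; rewrite !ler_norml => /andP[y1 y1'] /andP[y2 y2'].
have [tlo|tlo] := ltP t (dist z1 c0 + K%:R).
  apply: Or31; split; first by rewrite M1; apply: sall; move: rE n1 n2 trE gap0 tE D20 D30 rho0 K0 az bz; glra3.
  apply: (sub_open_shadow _ (_ : Cb + 2 * dist z c0 + sg <= M)); last exact: shadow_lip sz2.
  rewrite M1; move: Cbr y1' tlo gap0 bz; rewrite (cdistC z c0) (cdistC z1 c0); glra3.
have [thi|thi] := ltP t (dist z1 c0 + K%:R + N%:R); last first.
  apply: Or32; split; last by rewrite M1; apply: sall; move: rE n1 n2 trE gap0 tE D20 D30 rho0 K0 az bz; glra3.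
  apply: (sub_open_shadow _ (_ : Cb + 2 * dist z (act gt c0) + sg <= M)); last exact: shadow_lip sz1.
  rewrite M1; have := cdist_triangle z1 c0 z2'; have := cdist_triangle c0 p.1 z2'.
  move: Cbr y2' thi gap0 az dhi; rewrite dcx (cdistC p.1 z2') zz (cdistC z1 c0); glra3.
pose u := t - dist z1 c0 - K%:R; have u0 : 0 <= u by move: tlo; rewrite /u; glra3.
have /andP[ul uh] := truncn_itv u0; have jN : (Num.truncn u < N)%N.
  by rewrite -(ltr_nat R); apply: le_lt_trans ul _; move: thi; rewrite /u; glra3.
have [k1 k2 k3 [h1 h2 h3 h4]] := shells _ jN.
apply: Or33; exists (Num.truncn u) => //.
have bt : between c0 (act g1 (Q (Num.truncn u))) (act gt c0) tau.
  by rewrite /between dcx dcP (cdistC _ (act gt c0)) dxP (cdistC z2').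
have near : `|dist c0 (act g1 (Q (Num.truncn u))) - t| <= s.
  rewrite dcP ler_norml /s; have := cdist_triangle z1 c0 (Q (Num.truncn u)).
  rewrite -natr1 in uh; rewrite natrD in h1 h2.
  move: k1 h1 h2 ul uh; rewrite /between /u => q1 q2 q3 q4 q5 q6.
  by apply/andP; split; move: q1 q2 q3 q4 q5 q6 D20 D30 rho0 tE; glra3.
by have [s1 s2] := ht _ bt near; split; apply: (sub_open_shadow _ Cbr).
Qed.

End shells.

(** * The averaged inequality and its contradiction *)

Section no_cancellation.
Variables (R : realType) (n : nat) (P : right_angled_polytope R n.+2).
Variables (X : building P) (q : facet P -> nat).
Hypothesis q_gt0 : forall s, (0 < q s)%N.
Hypothesis q_card : forall s (x : X), (panel s x #= `I_(q s).+1)%card.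
Variables (xi0 : boundary X) (c0 : X).
Variables (nu : probability (borel_stab c0) R) (nu_haar : is_haar_probability nu).
Variable mu : {measure set (borel_boundary xi0) -> \bar R}.
Hypothesis mu_def : is_boundary_measure nu mu.
Variables (G : groupType) (act : G -> aut X).
Hypothesis act_action : is_aut_action act.
Hypothesis act_trans : strongly_transitive act.
Variable D : G -> borel_boundary xi0 -> R.
Hypothesis D_density : forall g : G,
  is_density mu (pushforward mu (borel_act (act g))) (D g).
Local Notation dist := (@cdist R n.+1 P X).
Local Notation weight := (@weight R n P X).
Local Notation pairs := (@pairs R n P X q q_card c0).
Local Notation pair_weight := (@pair_weight R n P X c0).
Local Notation Omega := (borel_boundary xi0).
Local Notation gact := (@gact R n P X xi0 G act).
Local Notation osh := (@open_shadow_at R n P X xi0).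
Local Notation both_sides := (@both_sides R n P X xi0 c0 G act).
Implicit Types (x y z c : X) (p : X * X) (g : G).

Definition coeff g (f h : Omega -> R) (w : Omega) : \bar R :=
  (f (gact g^-1%g w) * h w * Num.sqrt (D g w))%:E.

Lemma coeff_measurable g (f h : Omega -> R) : measurable_fun setT f -> measurable_fun setT h ->
  measurable_fun setT (coeff g f h).
Proof.
move=> mf mh; apply/measurable_EFinP; have [mD _ _] := D_density g.
apply: measurable_funM.
  apply: measurable_funM => //; apply: measurableT_comp => //.
  exact: (@gact_measurable R n P X xi0 G act).
by apply: (measurableT_comp _ mD); apply: continuous_measurable_fun; exact: sqrt_continuous.
Qed.

Lemma coeff_ge0 g (f h : Omega -> R) w : (forall w, 0 <= f w) -> (forall w, 0 <= h w) ->
  (0 <= coeff g f h w)%E.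
Proof. by move=> f0 h0; rewrite lee_fin !mulr_ge0 ?sqrtr_ge0. Qed.

(* The sum over good pairs of the left-hand sides grows linearly with the
   number of shells, the end terms stay bounded, and near density points of [E1]
   and [E2] the remaining terms are small compared with the number of shells. *)
Lemma no_cancellation (f h : Omega -> R) (E1 E2 : set Omega) :
  measurable_fun setT f -> measurable_fun setT h -> (forall w, 0 <= f w) -> (forall w, 0 <= h w) ->
  (\int[mu]_w (f w ^+ 2)%:E < +oo)%E -> (\int[mu]_w (h w ^+ 2)%:E < +oo)%E ->
  measurable E1 -> measurable E2 -> (0 < mu E1)%E -> (0 < mu E2)%E ->
  (forall w, E1 w -> h w ^+ 2 <= 9) -> (forall w, E2 w -> f w ^+ 2 <= 9) ->
  ~ (forall g (J : set Omega), measurable J ->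
    ((7 / 10)%:E * \int[mu]_(w in J) (Num.sqrt (D g w))%:E <=
      \int[mu]_(w in ~` J) coeff g f h w +
      (\int[mu]_(w in J) coeff g f (fun w => h w * \1_(~` E1) w)%R w +
       \int[mu]_(w in J) coeff g (fun w => f w * \1_(~` E2) w)%R h w))%E).
Proof.
move=> mf mh f0 h0 f2 h2 mE1 mE2 E1p E2p h9 f9 hyp.
have [rho [cg [rho0 cg0 hg]]] := good_pairs q_gt0 q_card nu_haar mu_def act_trans.
have [r [c [K [B [r0 rt cpos sh]]]]] :=
  pair_shells q_gt0 q_card nu_haar mu_def act_action act_trans D_density rho0.
have [C C0 hC] := shell_bound q_gt0 q_card nu_haar mu_def act_action act_trans D_density r0.
have rt2 : tile_radius X <= 2 * r + shadow_gap X by have := shadow_gap_ge0 X; lra.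
have [C1 C10 conc] := concentrated q_gt0 q_card nu_haar mu_def act_trans rt2.
(* The gain per shell: [7 / 10] comes from the inequality to be refuted, [c] from the mass of a
   shell, and [B.+1] accounts for overlaps, with the successor keeping the denominator positive. *)
pose c2 := 7 / 10 * c / B.+1%:R.
have c20 : 0 < c2 by rewrite divr_gt0 ?mulr_gt0// ltr0n.
(* Chosen so that the two errors per shell, at most [C * v * (C1 + 2)] each, use up at most half of
   the averaged gain [c2 * cg]. *)
pose v := Num.min 1 (c2 * cg / (4 * C * (C1 + 2))).
have CC0 : 0 < 4 * C * (C1 + 2) by rewrite !mulr_gt0//; lra.
have v0 : 0 < v by rewrite lt_min ltr01 divr_gt0// mulr_gt0.
have v1 : v <= 1 by rewrite ge_min lexx.
have v2 : v ^+ 2 <= 1 by rewrite exprn_ile1// ltW.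
have vC : 2 * (C * v * (C1 + 2)) <= c2 * cg / 2.
  have : v * (4 * C * (C1 + 2)) <= c2 * cg by rewrite -ler_pdivlMr// ge_min lexx orbT.
  by rewrite (_ : 2 * (C * v * (C1 + 2)) = v * (4 * C * (C1 + 2)) / 2); [lra|field].
have vv0 : 0 < v ^+ 2 by rewrite exprn_gt0.
have v2C : C1 + v ^+ 2 + 1 <= C1 + 2 by lra.
have gen (cc mm nn fr : R) : 4 * fr < nn * cc -> mm * 2 <= cc / 2 * nn ->
    cc * nn <= fr + fr + mm + mm -> False.
  by rewrite (mulrC nn) (mulrAC cc); move: (cc * nn) => x; lra.
(* The squared integral of [h] off [E1] over a shadow of [y1], and that of [f] off [E2] over a
   shadow of [y2], are at most [v ^+ 2] times the weight. *)
have [y1 [h11 h12]] := conc E1 h (v ^+ 2) mE1 E1p mh h2 h9 vv0.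
have [y2 [h21 h22]] := conc E2 f (v ^+ 2) mE2 E2p mf f2 f9 vv0.
have [g1 e1] := transitive_chambers act_trans c0 y1.
have [g2 e2] := transitive_chambers act_trans c0 y2.
have [M [rM M2] hM] := sh g1 g2.
have M0 : 0 <= M by exact: le_trans rM.
(* The end regions obey the same bound with radius [M]. Its constant may depend on [g1] and [g2],
   since it is not multiplied by the number of shells. *)
have [CM CM0 hCM] := shell_bound q_gt0 q_card nu_haar mu_def act_action act_trans D_density M0.
have W0 x y := weight_gt0 q_gt0 q_card x y.
set z1 := act g1^-1%g c0 in hM M2; set z2 := act g2^-1%g c0 in hM M2.
pose h1 w := h w * \1_(~` E1) w; pose f1 w := f w * \1_(~` E2) w.
have ind0 (E : set Omega) w : 0 <= \1_E w :> R by rewrite indicE.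
have mh1 : measurable_fun setT h1.
  by apply: measurable_funM => //; apply: measurable_indic; exact: measurableC.
have mf1 : measurable_fun setT f1.
  by apply: measurable_funM => //; apply: measurable_indic; exact: measurableC.
have h10 w : 0 <= h1 w by rewrite mulr_ge0.
have f10 w : 0 <= f1 w by rewrite mulr_ge0.
have sq0 (u : Omega -> R) w : (0 <= (u w ^+ 2)%:E)%E by rewrite lee_fin sqr_ge0.
have msq (u : Omega -> R) : measurable_fun setT u -> measurable_fun setT (fun w => (u w ^+ 2)%:E).
  by move=> mu'; apply/measurable_EFinP; exact: measurable_funX.
pose IF (s : R) (y : X) (u : Omega -> R) := (\int[mu]_(w in osh c0 y (2 * s + shadow_gap X)) (u w ^+ 2)%:E)%E.
have IF0 s y u : (0 <= IF s y u)%E by apply: integral_ge0 => w _.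
have IFfin s y (u : Omega -> R) : measurable_fun setT u -> (\int[mu]_w (u w ^+ 2)%:E < +oo)%E -> IF s y u \is a fin_num.
  move=> mu' u2; rewrite ge0_fin_numE//; apply: le_lt_trans u2.
  by apply: ge0_subset_integral => //; [exact: open_shadow_measurable|exact: msq].
pose F : \bar R := ((CM * 1 / weight c0 y2)%:E * IF M y2 f + (CM * 1^-1 / weight c0 y1)%:E * IF M y1 h)%E.
have Ffin : F \is a fin_num by rewrite fin_numD !fin_numM ?IFfin.
pose m := C * v * (C1 + 2).
(* The full integral enters with the factor [v] and the exceptional one, of order [v ^+ 2], with the
   factor [v^-1], so both contribute terms of order [v]. *)
have mid1 : ((C * v / weight c0 y2)%:E * IF r y2 f + (C * v^-1 / weight c0 y1)%:E * IF r y1 h1 <= m%:E)%E.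
  apply: (@le_trans _ _ ((C * v / weight c0 y2)%:E * ((C1 + v ^+ 2) * weight c0 y2)%:E +
      (C * v^-1 / weight c0 y1)%:E * (v ^+ 2 * weight c0 y1)%:E)%E).
    by apply: leeD; apply: lee_wpmul2l => //; rewrite lee_fin !mulr_ge0 ?invr_ge0 ?(ltW C0) ?(ltW v0) ?(ltW (W0 _ _)).
  rewrite -!EFinM -EFinD lee_fin /m; have := W0 c0 y1; have := W0 c0 y2.
  move: (weight c0 y1) (weight c0 y2) => a1 a2 a20 a10.
  have -> : C * v / a2 * ((C1 + v ^+ 2) * a2) + C / v / a1 * (v ^+ 2 * a1) = C * v * (C1 + v ^+ 2 + 1).
    by field; rewrite !gt_eqF.
  by rewrite ler_wpM2l// mulr_ge0 ?(ltW C0) ?(ltW v0).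
have mid2 : ((C * v^-1 / weight c0 y2)%:E * IF r y2 f1 + (C * v^-1^-1 / weight c0 y1)%:E * IF r y1 h <= m%:E)%E.
  rewrite invrK.
  apply: (@le_trans _ _ ((C * v^-1 / weight c0 y2)%:E * (v ^+ 2 * weight c0 y2)%:E +
      (C * v / weight c0 y1)%:E * ((C1 + v ^+ 2) * weight c0 y1)%:E)%E).
    by apply: leeD; apply: lee_wpmul2l => //; rewrite lee_fin !mulr_ge0 ?invr_ge0 ?(ltW C0) ?(ltW v0) ?(ltW (W0 _ _)).
  rewrite -!EFinM -EFinD lee_fin /m; have := W0 c0 y1; have := W0 c0 y2.
  move: (weight c0 y1) (weight c0 y2) => a1 a2 a20 a10.
  have -> : C / v / a2 * (v ^+ 2 * a2) + C * v / a1 * ((C1 + v ^+ 2) * a1) = C * v * (C1 + v ^+ 2 + 1).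
    by field; rewrite !gt_eqF.
  by rewrite ler_wpM2l// mulr_ge0 ?(ltW C0) ?(ltW v0).
have claim (N : nat) : ((c2 * cg * N%:R)%:E <= F + F + (m * N%:R)%:E + (m * N%:R)%:E)%E.
  have muleD4 (s u1 u2 u3 u4 : \bar R) : (0 <= u1)%E -> (0 <= u2)%E -> (0 <= u3)%E -> (0 <= u4)%E ->
      (s * (u1 + u2 + u3 + u4) = s * u1 + s * u2 + s * u3 + s * u4)%E.
    by move=> u10 u20 u30 u40; rewrite !ge0_muleDr ?adde_ge0.
  have bsum (u : bool -> \bar R) : (\sum_(b <- [:: true; false]) u b = u true + u false)%E.
    by rewrite 2!big_cons big_nil adde0.
  have csum (b : R) : (\sum_(j <- iota 0 N) b%:E = (b * N%:R)%:E)%E.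
    by rewrite sumEFin big_const_seq iter_addr_0 count_predT size_iota mulr_natr.
  pose k := (N + 2 * K)%N.
  pose a p := (p \in pairs k) && (`[< between z1 c0 p.1 rho >] && `[< between z2 c0 p.2 rho >]).
  have ex p : exists gQ : G * (nat -> X), a p -> let gt := (g1 * gQ.1 * g2^-1)%g in
    [/\ act gQ.1 c0 = p.1 /\ act gQ.1^-1%g c0 = p.2,
      forall j, (j < N)%N -> [/\ between c0 (gQ.2 j) p.1 r, `|dist c0 (gQ.2 j) - (K + j)%:R| <= r,
        between c0 (act g1 c0) (act g1 (gQ.2 j)) r,
        between c0 (act g2 c0) (act g2 (act gQ.1^-1%g (gQ.2 j))) r &
        ((c * Num.sqrt (weight c0 (act gt c0)))%:E <=
          \int[mu]_(w in both_sides gt (act g1 (gQ.2 j)) r) (Num.sqrt (D gt w))%:E)%E],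
      forall w, (count (fun j => w \in both_sides gt (act g1 (gQ.2 j)) r) (iota 0 N) <= B)%N &
      forall w, [\/ both_sides gt c0 M w, both_sides gt (act gt c0) M w |
        exists2 j, (j < N)%N & both_sides gt (act g1 (gQ.2 j)) r w]].
    have [/andP[pk /andP[/asboolP b1 /asboolP b2]]|na] := boolP (a p); last by exists (1%g, fun=> c0).
    by have [gam [Q hQ]] := hM N p pk b1 b2; exists (gam, Q).
  have [gq hq] := choice ex; pose gam p := (gq p).1; pose Q p := (gq p).2.
  pose gt p := (g1 * gam p * g2^-1)%g; pose sm p := Num.sqrt (weight c0 (act (gt p) c0)).
  have sm0 p : 0 < sm p by rewrite sqrtr_gt0.
  pose A p j := both_sides (gt p) (act g1 (Q p j)) r.
  pose As p := both_sides (gt p) (act g1 z1) M.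
  pose Ae p := both_sides (gt p) (act g1 (act (gam p) z2)) M.
  have mb g x s : measurable (both_sides g x s) by exact: both_sides_measurable.
  have g1z : act g1 z1 = c0 by rewrite /z1 (actVK act_action).
  have gtE p : act (gt p) c0 = act g1 (act (gam p) z2) by rewrite /gt !act_action.2.
  pose I p (S : set Omega) (u w' : Omega -> R) := (\int[mu]_(w in S) coeff (gt p) u w' w)%E.
  have I0 p S (u w' : Omega -> R) : (forall w, 0 <= u w) -> (forall w, 0 <= w' w) -> (0 <= I p S u w')%E.
    by move=> u0 w0; apply: integral_ge0 => w _; exact: coeff_ge0.
  have step p : a p -> ((c2 * N%:R * sm p)%:E <= I p (As p) f h + I p (Ae p) f h +
      \sum_(j <- iota 0 N) I p (A p j) f h1 + \sum_(j <- iota 0 N) I p (A p j) f1 h)%E.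
    move=> ap; have [e3 hj hcnt hcov] := hq p ap.
    pose J := \big[setU/set0]_(j <- iota 0 N) A p j.
    have mJ : measurable J by apply: bigsetU_measurable => j _; exact: mb.
    have JP w : J w <-> exists2 j, j \in iota 0 N & A p j w.
      by rewrite /J -bigcup_seq; split=> -[j]; exists j.
    have low : ((c2 * N%:R * sm p)%:E <= (7 / 10)%:E * \int[mu]_(w in J) (Num.sqrt (D (gt p) w))%:E)%E.
      have [mD _ _] := D_density (gt p).
      have msD : measurable_fun setT (fun w => (Num.sqrt (D (gt p) w))%:E).
        apply/measurable_EFinP; apply: (measurableT_comp _ mD).
        by apply: continuous_measurable_fun; exact: sqrt_continuous.
      have sub : forall j, j \in iota 0 N -> A p j `<=` J by move=> j jN w Aw; apply/JP; exists j.
      have sD0 w : (0 <= (Num.sqrt (D (gt p) w))%:E)%E by rewrite lee_fin sqrtr_ge0.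
      have mA j : measurable (A p j) by exact: mb.
      have := @sum_integral_le _ Omega R mu nat (iota 0 N) (A p) J _ B mA mJ msD sD0 sub hcnt.
      have : ((c * sm p * N%:R)%:E <= \sum_(j <- iota 0 N) \int[mu]_(w in A p j) (Num.sqrt (D (gt p) w))%:E)%E.
        apply: (@le_trans _ _ (\sum_(j <- iota 0 N) (c * sm p)%:E)%E).
          by rewrite csum.
        rewrite big_seq [leRHS]big_seq; apply: lee_sum => j; rewrite mem_iota => /andP[_ jN].
        by have [_ _ _ _ +] := hj j jN.
      move=> l1 l2; have {l1 l2} := le_trans l1 l2; set JI := (\int[mu]_(w in J) _)%E.
      have JI0 : (0 <= JI)%E by apply: integral_ge0 => w _.
      move=> l3; have {l3} : ((c * sm p * N%:R)%:E <= B.+1%:R%:E * JI)%E.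
        by apply: le_trans l3 _; rewrite lee_wpmul2r// lee_fin ler_nat.
      move=> l3; rewrite (_ : c2 * N%:R * sm p = 7 / 10 / B.+1%:R * (c * sm p * N%:R)); last first.
        by rewrite /c2; have : (B.+1%:R : R) != 0 by [rewrite pnatr_eq0]; move: (B.+1%:R : R) => b b0; field.
      apply: (@le_trans _ _ ((7 / 10 / B.+1%:R)%:E * (B.+1%:R%:E * JI))%E).
        by rewrite EFinM lee_wpmul2l// lee_fin divr_ge0//; lra.
      by rewrite muleA -EFinM divfK// pnatr_eq0.
    apply: (le_trans low); apply: le_trans (hyp (gt p) J mJ) _.
    rewrite -/h1 -/f1 -[leRHS]addeA; apply: leeD; last (apply: leeD; last first).
    - have mc := coeff_measurable (gt p) mf mh.
      have cov w : (~` J) w -> exists2 b : bool, b \in [:: true; false] & (if b then As p else Ae p) w.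
        move=> nJ; have [s|s|[j jN s]] := hcov w.
        + by exists true => //; rewrite /As g1z.
        + by exists false => //; rewrite /Ae -gtE.
        + by case: nJ; apply/JP; exists j; rewrite ?mem_iota.
      apply: (@le_trans _ _ (\sum_(b <- [:: true; false]) \int[mu]_(w in if b then As p else Ae p) coeff (gt p) f h w)%E).
        apply: (@integral_cover_le _ Omega R mu bool [:: true; false] (fun b => if b then As p else Ae p) (~` J) _ _ mc _ cov); first by case; exact: mb.
        by move=> w; exact: coeff_ge0.
      rewrite (bsum (fun b => \int[mu]_(w in if b then As p else Ae p) coeff (gt p) f h w)%E) /=.
      exact: lexx.
    - apply: integral_cover_le; [by move=> j; exact: mb|exact: coeff_measurable| |by move=> w /JP].
      by move=> w; exact: coeff_ge0.
    - apply: integral_cover_le; [by move=> j; exact: mb|exact: coeff_measurable| |by move=> w /JP].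
      by move=> w; exact: coeff_ge0.
  pose S p := pair_weight p / sm p.
  have S0 p : 0 <= S p by rewrite divr_ge0 ?(ltW (sm0 _))// (pair_weight_ge0 q_gt0 q_card).
  apply: (@le_trans _ _ (\sum_(p <- pairs k | a p) (S p)%:E * (I p (As p) f h + I p (Ae p) f h +
      \sum_(j <- iota 0 N) I p (A p j) f h1 + \sum_(j <- iota 0 N) I p (A p j) f1 h))%E).
    apply: (@le_trans _ _ (\sum_(p <- pairs k | a p) (S p)%:E * (c2 * N%:R * sm p)%:E)%E); last first.
      by apply: lee_sum => p ap; apply: lee_wpmul2l; [rewrite lee_fin|exact: step].
    rewrite (eq_bigr (fun p => (c2 * N%:R * pair_weight p)%:E)); last first.
      by move=> p _; rewrite -EFinM /S; congr EFin; have := gt_eqF (sm0 p); move: (sm p) => s ns; field; rewrite ns.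
    rewrite sumEFin lee_fin -mulr_sumr mulrAC ler_wpM2l//; first exact: mulr_ge0 (ltW c20) (ler0n _ _).
    by apply: le_trans (hg z1 z2 k) _; rewrite big_seq_cond.
  have sum0 p (u w' : Omega -> R) : (forall w, 0 <= u w) -> (forall w, 0 <= w' w) -> (0 <= \sum_(j <- iota 0 N) I p (A p j) u w')%E.
    by move=> u0 w0; apply: sume_ge0 => j _; exact: I0.
  have -> : (\sum_(p <- pairs k | a p) (S p)%:E * (I p (As p) f h + I p (Ae p) f h +
      \sum_(j <- iota 0 N) I p (A p j) f h1 + \sum_(j <- iota 0 N) I p (A p j) f1 h) =
      \sum_(p <- pairs k | a p) (S p)%:E * I p (As p) f h + \sum_(p <- pairs k | a p) (S p)%:E * I p (Ae p) f h +
      \sum_(j <- iota 0 N) \sum_(p <- pairs k | a p) (S p)%:E * I p (A p j) f h1 +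
      \sum_(j <- iota 0 N) \sum_(p <- pairs k | a p) (S p)%:E * I p (A p j) f1 h)%E.
    rewrite [X in (_ = _ + X + _)%E]exchange_big [X in (_ = _ + X)%E]exchange_big /= -!big_split /=.
    apply: eq_bigr => p _; rewrite -!ge0_sume_distrr; [|by move=> j _; exact: I0..].
    by apply: muleD4; [exact: I0|exact: I0|exact: sum0|exact: sum0].
  have thr (u w' : Omega -> R) j lam : (j < N)%N -> 0 < lam ->
      measurable_fun setT u -> measurable_fun setT w' -> (forall w, 0 <= u w) -> (forall w, 0 <= w' w) ->
      (\sum_(p <- pairs k | a p) (S p)%:E * I p (A p j) u w' <=
       (C * lam / weight c0 y2)%:E * IF r y2 u + (C * lam^-1 / weight c0 y1)%:E * IF r y1 w')%E.
    move=> jN l0 mu' mw' u0 w0; rewrite -e1 -e2.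
    apply: (hC g1 g2 k gam (fun p => Q p j) (K + j)%:R a u w' lam l0 mu' mw' u0 w0) => p ap.
    have [e3 hj _ _] := hq p ap; have [k1 k2 k3 k4 _] := hj j jN.
    by split=> //; case/andP: ap.
  have ends (Qe : X * X -> X) t : (forall p, a p -> through q_card c0 act g1 g2 k gam Qe t M p) ->
      (\sum_(p <- pairs k | a p) (S p)%:E * I p (both_sides (gt p) (act g1 (Qe p)) M) f h <= F)%E.
    by move=> tp; rewrite /F -e1 -e2; exact: (hCM g1 g2 k gam Qe t a f h 1 ltr01 mf mh f0 h0 tp).
  have tr g u w : dist (act g u) (act g w) = dist u w := dist_act act g u w.
  have gap0 := level_gap_ge0 X.
  have d1 := cdist_ge0 c0 z1; have d2 := cdist_ge0 c0 z2.
  have y1z : dist c0 (act g1 c0) = dist c0 z1 by rewrite -{1}g1z tr cdistC.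
  have y2z : dist c0 (act g2 c0) = dist c0 z2.
    by rewrite -{1}(_ : act g2 z2 = c0) ?tr ?(cdistC z2)// /z2 (actVK act_action).
  apply: leeD; first (apply: leeD; first apply: leeD).
  (* The end regions are treated as shells around [act g1 z1], which is [c0], at level 0, and around
     [act g1 (act (gam p) z2)], which is [act (gt p) c0], at level [k]. *)
  - apply: (ends (fun=> z1) 0) => p ap; have [e3 _ _ _] := hq p ap; case/andP: ap => pk _; split=> //.
    + split; last by rewrite subr0 ger0_norm//; move: d1 d2 gap0 M2; glra3.
      by rewrite /between; have := cdist_triangle z1 c0 p.1; rewrite (cdistC z1 c0); move: d1 d2 gap0 M2; glra3.
    + by rewrite /between g1z y1z (cdistC (act g1 c0)) y1z cdistxx; move: d1 d2 gap0 M2; glra3.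
    + rewrite /between y2z; have := cdist_triangle (act g2 c0) c0 (act g2 (act (gam p)^-1%g z1)).
      by rewrite (cdistC (act g2 c0) c0) y2z; move: d1 d2 gap0 M2; glra3.
  - apply: (ends (fun p => act (gam p) z2) k%:R) => p ap; have [[e3 e4] _ _ _] := hq p ap.
    case/andP: ap => pk _; have [/annulusP p1 _ _] := pairsP pk; split=> //.
    + have l1 : dist (act (gam p) z2) p.1 = dist c0 z2 by rewrite -e3 tr cdistC.
      split.
        rewrite /between l1; have := cdist_triangle c0 p.1 (act (gam p) z2).
        by rewrite (cdistC p.1) l1; move: d1 d2 gap0 M2; glra3.
      have := cdist_triangle c0 p.1 (act (gam p) z2); have := cdist_triangle c0 (act (gam p) z2) p.1.
      rewrite (cdistC p.1) l1; move: p1 d1 d2 gap0 M2; rewrite !ler_norml => /andP[q1 q2].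
      by move: q1 q2 => q1 q2 d1' d2' g' m' t1 t2; apply/andP; split; move: q1 q2 d1' d2' g' m' t1 t2; glra3.
    + rewrite /between y1z; have := cdist_triangle (act g1 c0) c0 (act g1 (act (gam p) z2)).
      by rewrite (cdistC (act g1 c0) c0) y1z; move: d1 d2 gap0 M2; glra3.
    + rewrite (actK act_action) /z2 (actVK act_action) /between -/z2 y2z (cdistC (act g2 c0)) y2z cdistxx.
      by move: d1 d2 gap0 M2; glra3.
  - rewrite -csum big_seq [leRHS]big_seq; apply: lee_sum => j; rewrite mem_iota => /andP[_ jN].
    by apply: le_trans mid1; exact: thr.
  - rewrite -csum big_seq [leRHS]big_seq; apply: lee_sum => j; rewrite mem_iota => /andP[_ jN].
    by apply: le_trans mid2; apply: thr => //; rewrite invr_gt0.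
pose Fr := fine F; have c2g : 0 < c2 * cg by rewrite mulr_gt0.
(* Enough shells for the remaining half of the gain to exceed the fixed contribution [F + F] of the
   ends. *)
pose N := (Num.truncn `|4 * Fr / (c2 * cg)|).+1.
have hN : 4 * Fr / (c2 * cg) < N%:R.
  by apply: le_lt_trans (ler_norm _) _; exact: truncnS_gt.
rewrite ltr_pdivrMr// in hN.
have := claim N; rewrite -(fineK Ffin) -!EFinD lee_fin -/Fr.
have n0 := ler0n R N; have : m * N%:R * 2 <= c2 * cg / 2 * N%:R.
  by rewrite mulrAC ler_wpM2r// mulrC.
exact: gen hN.
Qed.

End no_cancellation.

(** * Square-integrable functions *)

Section square_integrable.
Local Open Scope complex_scope.
Context (disp : measure_display) (T : measurableType disp) (R : realType).
Variable mu : {measure set T -> \bar R}.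
Local Notation C := R[i].
Local Notation Re := (@complex.Re R).
Local Notation Im := (@complex.Im R).
Implicit Types (f g h u v : T -> C) (t : R) (x : T).

Definition sqn (z : C) : R := Re z ^+ 2 + Im z ^+ 2.
(* The real part of the Hermitian product. *)
Definition dotp (z w : C) : R := Re z * Re w + Im z * Im w.

Lemma sqn_ge0 z : 0 <= sqn z.
Proof. by rewrite addr_ge0 ?sqr_ge0. Qed.

Lemma sqnD z w t : sqn (z + t%:C * w) = sqn z + (2 * t * dotp z w + t ^+ 2 * sqn w).
Proof. by case: z => a b; case: w => c d; rewrite /sqn /dotp /=; ring. Qed.

Lemma Lfun2P (a : T -> R) :
  a \in Lfun mu 2%:E <-> measurable_fun setT a /\ (\int[mu]_x (a x ^+ 2)%:E < +oo)%E.
Proof.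
split=> [af|[ma a2]].
  split; first exact: (set_mem (sub_Lfun_mfun af)).
  have /integrableP[_] := Lfun2_integrable_sqr af; apply: le_lt_trans.
  by apply: ge0_le_integralT => x; rewrite /= lee_fin ?sqr_ge0 ?ler_norm.
apply/andP; split; apply/mem_set => //=; rewrite /finite_norm unlock poweR_lty//.
rewrite (eq_integral (fun x => (a x ^+ 2)%:E))// => x _ /=.
by rewrite powR_mulrn ?normr_ge0// real_normK ?num_real.
Qed.

Lemma measurable_sqn f : measurable_fun setT (Re \o f) -> measurable_fun setT (Im \o f) ->
  measurable_fun setT (fun x => (sqn (f x))%:E).
Proof.
by move=> m1 m2; apply/measurable_EFinP; apply: measurable_funD; exact: (measurable_funX 2).
Qed.

Lemma L2P f : L2 mu f <-> [/\ measurable_fun setT (Re \o f), measurable_fun setT (Im \o f) &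
  (\int[mu]_x (sqn (f x))%:E < +oo)%E].
Proof.
split=> [[/Lfun2P[m1 i1] /Lfun2P[m2 i2]]|[m1 m2 i]].
  split=> //; rewrite (eq_integral (fun x => (Re (f x) ^+ 2)%:E + (Im (f x) ^+ 2)%:E)%E)//.
  rewrite ge0_integralD//; [exact: lte_add_pinfty|..].
  - by move=> x _; rewrite lee_fin sqr_ge0.
  - by apply/measurable_EFinP; exact: (measurable_funX 2).
  - by move=> x _; rewrite lee_fin sqr_ge0.
  - by apply/measurable_EFinP; exact: (measurable_funX 2).
split; apply/Lfun2P; split=> //; apply: le_lt_trans i; apply: ge0_le_integralT => x.
- by rewrite lee_fin sqr_ge0.
- by rewrite lee_fin lerDl sqr_ge0.
- by rewrite lee_fin sqr_ge0.
- by rewrite lee_fin lerDr sqr_ge0.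
Qed.

Lemma integrable_sqn f : L2 mu f -> mu.-integrable setT (EFin \o (sqn \o f)).
Proof.
move=> /L2P[m1 m2 i]; apply/integrableP; split; first exact: measurable_sqn.
rewrite (eq_integral (fun x => (sqn (f x))%:E))// => x _ /=.
by rewrite ger0_norm ?sqn_ge0.
Qed.

Lemma measurable_dotp f g : L2 mu f -> L2 mu g -> measurable_fun setT (fun x => dotp (f x) (g x)).
Proof.
move=> /L2P[m1 m2 _] /L2P[m3 m4 _].
by apply: measurable_funD; [exact: (measurable_funM m1 m3)|exact: (measurable_funM m2 m4)].
Qed.

Lemma integrable_dotp f g : L2 mu f -> L2 mu g ->
  mu.-integrable setT (EFin \o (fun x => dotp (f x) (g x))).
Proof.
move=> Lf Lg; apply: (le_integrable _ _ _ (integrableD measurableT (integrable_sqn Lf) (integrable_sqn Lg))) => //.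
  by apply/measurable_EFinP; exact: measurable_dotp.
move=> x _ /=; rewrite lee_fin [leRHS]ger0_norm; last exact: addr_ge0 (sqn_ge0 _) (sqn_ge0 _).
rewrite ler_norml /dotp /sqn; case: (f x) => a b; case: (g x) => c d /=.
have := sqr_ge0 (a + c); have := sqr_ge0 (a - c); have := sqr_ge0 (b + d); have := sqr_ge0 (b - d).
have := sqr_ge0 a; have := sqr_ge0 b; have := sqr_ge0 c; have := sqr_ge0 d.
by move=> *; apply/andP; split; nra.
Qed.

Definition nsq f : R := \int[mu]_x sqn (f x).
Definition ip f g : R := \int[mu]_x dotp (f x) (g x).

Lemma integral_sqn f : L2 mu f -> (\int[mu]_x (sqn (f x))%:E)%E = (nsq f)%:E.
Proof.
move=> Lf; rewrite /nsq /Rintegral fineK// ge0_fin_numE; first by have /L2P[] := Lf.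
by apply: integral_ge0 => x _; rewrite lee_fin sqn_ge0.
Qed.

Lemma nsq_ge0 f : 0 <= nsq f.
Proof. by apply: fine_ge0; apply: integral_ge0 => x _; rewrite lee_fin sqn_ge0. Qed.

Lemma L2_comb f g t : L2 mu f -> L2 mu g -> L2 mu (fun x => f x + t%:C * g x).
Proof.
move=> Lf Lg; have [m1 m2 _] := (L2P f).1 Lf; have [m3 m4 _] := (L2P g).1 Lg; apply/L2P; split.
- rewrite (_ : _ \o _ = fun x => Re (f x) + t * Re (g x)).
    by apply: measurable_funD => //; apply: measurable_funM => //; exact: measurable_cst.
  by apply/funext => x /=; case: (f x) => a b; case: (g x) => c d /=; ring.
- rewrite (_ : _ \o _ = fun x => Im (f x) + t * Im (g x)).
    by apply: measurable_funD => //; apply: measurable_funM => //; exact: measurable_cst.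
  by apply/funext => x /=; case: (f x) => a b; case: (g x) => c d /=; ring.
apply: (@le_lt_trans _ _ (\int[mu]_x ((2 * sqn (f x))%:E + (2 * t ^+ 2 * sqn (g x))%:E))%E).
  apply: ge0_le_integralT => x; rewrite -?EFinD lee_fin ?sqn_ge0//.
  rewrite sqnD /dotp /sqn; case: (f x) => a b; case: (g x) => c d /=.
  have := sqr_ge0 (a - t * c); have := sqr_ge0 (b - t * d).
  by rewrite !sqrrB !exprMn; lra.
have nn := integrable_sqn Lf; have := integrable_sqn Lg => nn2.
rewrite ge0_integralD//; first last.
- by apply/measurable_EFinP; apply: measurable_funM; [exact: measurable_cst|exact/measurable_EFinP/measurable_sqn].
- by move=> x _; rewrite lee_fin; apply: mulr_ge0 (sqn_ge0 _); rewrite mulr_ge0 ?sqr_ge0.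
- by apply/measurable_EFinP; apply: measurable_funM; [exact: measurable_cst|exact/measurable_EFinP/measurable_sqn].
- by move=> x _; rewrite lee_fin; apply: mulr_ge0 (sqn_ge0 _).
rewrite (eq_integral (fun x => 2%:E * (sqn (f x))%:E)%E)//.
rewrite [X in (_ + X)%E](eq_integral (fun x => (2 * t ^+ 2)%:E * (sqn (g x))%:E)%E)//.
rewrite !ge0_integralZl_EFin//; try by [exact: measurable_sqn|move=> x _; rewrite lee_fin sqn_ge0|rewrite mulr_ge0 ?sqr_ge0].
by rewrite !integral_sqn// -!EFinM -EFinD ltry.
Qed.

Lemma nsqD f g t : L2 mu f -> L2 mu g ->
  nsq (fun x => f x + t%:C * g x) = nsq f + (2 * t * ip f g + t ^+ 2 * nsq g).
Proof.
move=> Lf Lg; rewrite /nsq /ip; under eq_Rintegral do rewrite sqnD.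
have i1 := integrable_sqn Lf; have i2 := integrable_sqn Lg; have i3 := integrable_dotp Lf Lg.
have z1 : mu.-integrable setT (EFin \o (fun x => 2 * t * dotp (f x) (g x))).
  by rewrite (_ : _ \o _ = fun x => ((2 * t)%:E * (dotp (f x) (g x))%:E)%E)//; exact: (integrableZl measurableT (2 * t) i3).
have z2 : mu.-integrable setT (EFin \o (fun x => t ^+ 2 * sqn (g x))).
  by rewrite (_ : _ \o _ = fun x => ((t ^+ 2)%:E * (sqn (g x))%:E)%E)//; exact: (integrableZl measurableT (t ^+ 2) i2).
rewrite RintegralD//; last exact: (integrableD measurableT z1 z2).
by rewrite (RintegralD measurableT z1 z2) (RintegralZl _ measurableT i3) (RintegralZl _ measurableT i2).
Qed.

Lemma fatou_bound (a_ : nat -> T -> R) (a : T -> R) (b : R) (K : nat) :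
  (forall k, measurable_fun setT (a_ k)) -> (forall k x, 0 <= a_ k x) ->
  (forall x, a_ k x @[k --> \oo] --> a x) ->
  (forall k, (K <= k)%N -> (\int[mu]_x (a_ k x)%:E <= b%:E)%E) -> (\int[mu]_x (a x)%:E <= b%:E)%E.
Proof.
move=> ma a0 cva ub.
have := @fatou _ T R mu setT measurableT (fun k x => (a_ (k + K)%N x)%:E)
  (fun k => (measurable_EFinP _ _).2 (ma (k + K)%N)) (fun k x _ => a0 (k + K)%N x).
rewrite (eq_integral (fun x => (a x)%:E)); last first.
  move=> x _; apply: (cvg_limn_einf_sup _).1; apply: cvg_EFin.
    by near=> k.
  by rewrite (@cvg_shiftn K _ (fun k => a_ k x)); exact: cva.
move/le_trans; apply; rewrite limn_einf_lim; apply: lime_le.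
  exact: is_cvg_einfs.
apply: nearW => k; apply: le_trans (ub (k + K)%N (leq_addl _ _)).
by apply: ereal_inf_lbound; exists k => //=.
Unshelve. all: by end_near. Qed.

(** The increments are dominated by a geometric series of ratio 1/2. *)
Lemma square_summable_cvg (a : nat -> R) (S : R) :
  (forall k, 4 ^+ k * (a k.+1 - a k) ^+ 2 <= S) -> cvgn a.
Proof.
move=> h; have S0 : 0 <= S by apply: le_trans (h 0%N); rewrite mulr_ge0 ?sqr_ge0.
have bnd k : `|telescope a k| <= geometric (Num.sqrt S) 2^-1 k.
  rewrite /telescope /geometric /= -(@ler_pXn2r _ 2) ?nnegrE ?mulr_ge0 ?sqrtr_ge0 ?exprn_ge0 ?invr_ge0//.
  rewrite real_normK ?num_real// exprMn sqr_sqrtr// -exprM mulnC exprM exprVn -exprVn.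
  rewrite (_ : 2^-1 ^+ 2 = 4^-1 :> R); last by field.
  by rewrite exprVn ler_pdivlMr ?exprn_gt0// mulrC.
have c : cvgn (series (telescope a)).
  apply: normed_cvg; apply: (@series_le_cvg _ _ (geometric (Num.sqrt S) 2^-1)) => //.
  - by move=> k; exact: normr_ge0.
  - by move=> k; exact: le_trans (normr_ge0 _) (bnd k).
  - by apply: is_cvg_geometric_series; rewrite ger0_norm ?invr_ge0// invf_lt1// ltr1n.
rewrite (_ : a = (fun k => a 0%N + series (telescope a) k)); last first.
  by apply/funext => k; exact: eq_sum_telescope.
by apply: is_cvgD => //; exact: is_cvg_cst.
Qed.

Local Notation sub f g := (fun x => f x + (-1)%:C * g x).

Lemma nsq_ae f g : L2 mu f -> L2 mu g -> {ae mu, forall x, f x = g x} -> nsq f = nsq g.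
Proof.
move=> Lf Lg fg; rewrite /nsq /Rintegral; congr fine.
have [m1 m2 _] := (L2P f).1 Lf; have [m3 m4 _] := (L2P g).1 Lg.
apply: ge0_ae_eq_integral => //; try by [exact: measurable_sqn|move=> x _; rewrite lee_fin sqn_ge0].
by apply: filterS fg => x -> _.
Qed.

Lemma nsq0_ae f : L2 mu f -> {ae mu, forall x, f x = 0} -> nsq f = 0.
Proof.
move=> Lf f0; rewrite (nsq_ae Lf _ f0); first last.
  apply/L2P; split; [exact: measurable_cst|exact: measurable_cst|].
  by rewrite (eq_integral (cst 0%E)) ?integral0 ?ltry// => x _; rewrite /sqn /= expr0n/= addr0.
by rewrite /nsq /Rintegral (eq_integral (cst 0%E)) ?integral0// => x _; rewrite /sqn /= expr0n/= addr0.
Qed.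

Lemma L2_dist2E f g : L2 mu f -> L2 mu g -> L2_dist2 mu f g = (nsq (sub f g))%:E.
Proof.
move=> Lf Lg; rewrite -(integral_sqn (L2_comb (-1) Lf Lg)); apply: eq_integral => x _; congr EFin.
by case: (f x) => a b; case: (g x) => c d; rewrite /sqn /=; ring.
Qed.

Lemma nsq_sub f g : L2 mu f -> L2 mu g -> nsq (sub f g) = nsq f - 2 * ip f g + nsq g.
Proof. by move=> Lf Lg; rewrite nsqD//; ring. Qed.

Lemma nsq_add f g : L2 mu f -> L2 mu g -> nsq (fun x => f x + 1%:C * g x) = nsq f + 2 * ip f g + nsq g.
Proof. by move=> Lf Lg; rewrite nsqD//; ring. Qed.

(** The weighted sum of the squared increments has a finite integral, so it is finite almost
    everywhere. Resetting the functions to 0 on the exceptional set makes them converge at every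
    point, and measurability passes to the limit. *)
Lemma rapid_limit (u_ : nat -> T -> C) : (forall k, L2 mu (u_ k)) ->
  (forall k, 4 ^+ k * nsq (sub (u_ k.+1) (u_ k)) <= 8 / (2 ^ k.+1)%:R) ->
  exists w_ v, (forall k, L2 mu (w_ k) /\ {ae mu, forall x, w_ k x = u_ k x}) /\
    forall x, (Re (w_ k x) @[k --> \oo] --> Re (v x)) /\ (Im (w_ k x) @[k --> \oo] --> Im (v x)).
Proof.
move=> Lu hu; pose s k x := 4 ^+ k * sqn (u_ k.+1 x + (-1)%:C * u_ k x).
have Ld k := L2_comb (-1) (Lu k.+1) (Lu k).
have s0 k x : 0 <= s k x by rewrite mulr_ge0 ?sqn_ge0 ?exprn_ge0.
have ms k : measurable_fun setT (fun x => (s k x)%:E).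
  have [m1 m2 _] := (L2P _).1 (Ld k); apply/measurable_EFinP; apply: measurable_funM.
    exact: measurable_cst.
  exact/measurable_EFinP/measurable_sqn.
pose S x := (\sum_(0 <= k <oo) (s k x)%:E)%E.
have S0 x : (0 <= S x)%E by apply: nneseries_ge0 => k _ _; rewrite lee_fin.
have mS : measurable_fun setT S.
  by apply: (ge0_emeasurable_sum (P := predT)) => // k x _ _; rewrite lee_fin.
have iS : (\int[mu]_x S x < +oo)%E.
  rewrite integral_nneseries//; last by move=> k x _; rewrite lee_fin.
  apply: (@le_lt_trans _ _ 8%:E); last exact: ltry.
  apply: le_trans (epsilon_trick0 predT (_ : 0 <= 8)); last by [].
  apply: lee_nneseries => [k _ _|k _]; first by apply: integral_ge0 => x _; rewrite lee_fin.
  rewrite (eq_integral (fun x => (4 ^+ k)%:E * (sqn (u_ k.+1 x + (-1)%:C * u_ k x))%:E)%E)//.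
  have [m1 m2 _] := (L2P _).1 (Ld k).
  rewrite ge0_integralZl_EFin ?exprn_ge0//;
    try by [exact: measurable_sqn|move=> x _; rewrite lee_fin sqn_ge0].
  by rewrite integral_sqn// -EFinM lee_fin.
pose Gd := [set x | (S x < +oo)%E].
have mG : measurable Gd.
  by have := emeasurable_fun_infty_o measurableT mS +oo%E; rewrite setTI.
have aeG : {ae mu, forall x, Gd x}.
  have intS : mu.-integrable setT S.
    apply/integrableP; split=> //; rewrite (eq_integral S)// => x _.
    by rewrite gee0_abs.
  by apply: filterS (integrable_ae measurableT intS) => x /(_ I); rewrite ge0_fin_numE.
pose w k x : C := if x \in Gd then u_ k x else 0.
have cv (pr : C -> R) x : (forall z t' z', pr (z + t'%:C * z') = pr z + t' * pr z') -> pr 0 = 0 ->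
    (forall z, pr z ^+ 2 <= sqn z) -> cvgn (fun k => pr (w k x)).
  move=> prD pr0 prs; have [xG|xG] := boolP (x \in Gd); last first.
    by rewrite /w (negbTE xG); exact: is_cvg_cst.
  have Gx := set_mem xG; rewrite /w xG.
  have fS : S x \is a fin_num by rewrite ge0_fin_numE.
  apply: (@square_summable_cvg _ (fine (S x))) => k; rewrite -lee_fin fineK//.
  apply: (@le_trans _ _ (s k x)%:E).
    rewrite lee_fin ler_wpM2l ?exprn_ge0//; apply: le_trans (prs _).
    by rewrite prD mulN1r.
  apply: le_trans (nneseries_lim_ge k.+1 _); last by move=> j _ _; rewrite lee_fin.
  by rewrite big_nat_recr//= leeDr// sume_ge0// => j _; rewrite lee_fin.
have cR x : cvgn (fun k => Re (w k x)).
  apply: (cv Re) => //= [[a b] t' [c d]|[a b]] /=; first by ring.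
  by rewrite /sqn /= lerDl sqr_ge0.
have cI x : cvgn (fun k => Im (w k x)).
  apply: (cv Im) => //= [[a b] t' [c d]|[a b]] /=; first by ring.
  by rewrite /sqn /= lerDr sqr_ge0.
exists w, (fun x => (limn (fun k => Re (w k x)) +i* limn (fun k => Im (w k x)))%C); split=> [k|x]; last first.
  by split; [exact: cR|exact: cI].
split; last by apply: filterS aeG => x Gx; rewrite /w mem_set.
have [m1 m2 i] := (L2P _).1 (Lu k); apply/L2P; split.
- rewrite (_ : _ \o _ = fun x => Re (u_ k x) * \1_Gd x).
    by apply: measurable_funM => //; exact: measurable_indic.
  by apply/funext => x /=; rewrite /w indicE; case: ifP; rewrite ?mulr1 ?mulr0.
- rewrite (_ : _ \o _ = fun x => Im (u_ k x) * \1_Gd x).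
    by apply: measurable_funM => //; exact: measurable_indic.
  by apply/funext => x /=; rewrite /w indicE; case: ifP; rewrite ?mulr1 ?mulr0.
apply: le_lt_trans i; apply: ge0_le_integralT => x; rewrite lee_fin ?sqn_ge0//.
by rewrite /w; case: ifP => // _; rewrite /sqn /= expr0n /= addr0 sqn_ge0.
Qed.

Section closed.
Variable V : set (T -> C).
Hypothesis Vc : closed_subspace mu V.

Lemma closed_L2 f : V f -> L2 mu f.
Proof. by case: Vc => + _ _ _ _; apply. Qed.

Lemma closed_comb f g t : V f -> V g -> V (fun x => f x + t%:C * g x).
Proof. by case: Vc => _ _ VD VZ _ Vf Vg; apply: VD => //; exact: VZ. Qed.

Lemma closed_ae f g : V f -> L2 mu g -> {ae mu, forall x, f x = g x} -> V g.
Proof.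
move=> Vf Lg fg; have Lf := closed_L2 Vf; case: (Vc) => _ _ _ _ /(_ (fun=> f) g); apply=> //.
rewrite L2_dist2E// nsq0_ae; [exact: cvg_cst|exact: L2_comb|].
apply: filterS fg => x ->; case: (g x) => a b; apply/eqP; rewrite eq_complex /=.
by apply/andP; split; apply/eqP; ring.
Qed.

(** Projection of a vector outside [V]: a minimising sequence is Cauchy by the parallelogram law,
    its limit [v] lies in [V], and minimality along every line through [v] makes the difference
    orthogonal to [V]. *)
Lemma orthogonal_exists : V <> L2 mu -> exists h, [/\ L2 mu h, ~ {ae mu, forall x, h x = 0} &
  forall u, V u -> ip u h = 0].
Proof.
move=> VL; have V0 : V (fun=> 0) by case: Vc.
have [h0 [Lh0 nV]] : exists h0, L2 mu h0 /\ ~ V h0.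
  apply: contrapT => no; apply: VL; apply/seteqP; split=> f; first exact: closed_L2.
  by move=> Lf; apply: contrapT => nVf; apply: no; exists f.
pose E := [set r | exists2 v, V v & r = nsq (sub h0 v)].
have E0 : E !=set0 by exists (nsq (sub h0 (fun=> 0))); exists (fun=> 0).
have lbE : has_lbound E by exists 0 => _ [v _ ->]; exact: nsq_ge0.
have hiE : has_inf E by split.
pose d := inf E; have dle v : V v -> d <= nsq (sub h0 v) by move=> Vv; apply: ge_inf => //; exists v.
(* With these errors the squared norms of the increments are of order [16 ^- k], which leaves a
   convergent series after the factor [4 ^+ k] of [rapid_limit]. *)
have e0 k : 0 < (16 ^+ k)^-1 :> R by rewrite invr_gt0 exprn_gt0.
have exu k : exists u, V u /\ nsq (sub h0 u) <= d + (16 ^+ k)^-1.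
  by have [_ [u Vu ->] /ltW h] := inf_adherent (e0 k) hiE; exists u.
have [u hu] := choice exu; have Vu k := (hu k).1; have Lu k := closed_L2 (Vu k).
have par f g : V f -> V g -> nsq (sub f g) <= 2 * (nsq (sub h0 f) - d) + 2 * (nsq (sub h0 g) - d).
  move=> Vf Vg; have Lf := closed_L2 Vf; have Lg := closed_L2 Vg.
  have Lm := L2_comb 1 Lf Lg.
  (* The midpoint of [f] and [g], written with a leading 0 to fit [closed_comb]. *)
  have Vm : V (fun x => 0 + 2^-1%:C * (f x + 1%:C * g x)) by apply: closed_comb => //; exact: closed_comb.
  have := dle _ Vm; rewrite (nsq_sub Lh0 (closed_L2 Vm)) (nsq_sub Lh0 Lf) (nsq_sub Lh0 Lg) (nsq_sub Lf Lg) => hd.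
  have L0 : L2 mu (fun=> 0 : C) := closed_L2 V0.
  have ip0 g' : L2 mu g' -> ip (fun=> 0) g' = 0.
    by move=> _; rewrite /ip /dotp /=; under eq_Rintegral do rewrite !mul0r addr0; rewrite /Rintegral integral0.
  have ipm : ip h0 (fun x => 0 + 2^-1%:C * (f x + 1%:C * g x)) = 2^-1 * (ip h0 f + ip h0 g).
    have i1 := integrable_dotp Lh0 Lf; have i2 := integrable_dotp Lh0 Lg.
    rewrite /ip -(RintegralD measurableT i1 i2) -RintegralZl//; last exact: (integrableD measurableT i1 i2).
    apply: eq_Rintegral => x _; case: (h0 x) => a b; case: (f x) => c e; case: (g x) => a' b'.
    by rewrite /dotp /=; ring.
  have nm : nsq (fun x => 0 + 2^-1%:C * (f x + 1%:C * g x)) = 4^-1 * (nsq f + 2 * ip f g + nsq g).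
    rewrite (nsqD 2^-1 L0 Lm) nsq_add// ip0// /nsq; under eq_Rintegral do rewrite /sqn /= expr0n /= addr0.
    by rewrite /Rintegral integral0 /=; field.
  by rewrite ipm nm in hd; lra.
have pu j k : nsq (sub (u j) (u k)) <= 2 * (16 ^+ j)^-1 + 2 * (16 ^+ k)^-1.
  by apply: le_trans (par _ _ (Vu j) (Vu k)) _; have := (hu j).2; have := (hu k).2; lra.
have pow_le j k : (j <= k)%N -> (16 ^+ k)^-1 <= (16 ^+ j)^-1 :> R.
  by move=> jk; rewrite lef_pV2 ?posrE ?exprn_gt0// ler_eXn2l ?ltr1n.
have [|w [v [hw cvw]]] := rapid_limit Lu.
  move=> k; apply: (@le_trans _ _ (4 ^+ k * (4 * (16 ^+ k)^-1))).
    rewrite ler_wpM2l ?exprn_ge0//; apply: le_trans (pu k.+1 k) _.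
    by have := pow_le _ _ (leqnSn k); lra.
  rewrite (_ : 16 = 4 * 4 :> R); last by rewrite -natrM.
  rewrite exprMn invfM (mulrC 4) mulrA mulrA mulfV ?mul1r; last by rewrite expf_neq0.
  rewrite natrX exprS (_ : 4 = 2 * 2 :> R); last by rewrite -natrM.
  rewrite exprMn invfM [leRHS](_ : _ = (2 ^+ k)^-1 * (2 * 2)); last by field; rewrite expf_neq0.
  by rewrite ler_wpM2r// ler_piMr ?invr_ge0 ?exprn_ge0// invf_le1 ?exprn_gt0// exprn_ege1// ler1n.
have Lw k := (hw k).1.
have Vw k : V (w k).
  by apply: closed_ae (Vu k) (Lw k) _; apply: filterS (hw k).2 => x ->.
have eq_sub f g f' g' : L2 mu f -> L2 mu g -> L2 mu f' -> L2 mu g' ->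
    {ae mu, forall x, f x = f' x} -> {ae mu, forall x, g x = g' x} -> nsq (sub f g) = nsq (sub f' g').
  move=> *; apply: nsq_ae; [exact: L2_comb|exact: L2_comb|].
  near=> x; congr (_ + _ * _); near: x => //.
have mv : measurable_fun setT (Re \o v) /\ measurable_fun setT (Im \o v).
  split.
    apply: (measurable_fun_cvg (h := fun k => Re \o w k)) => [k|x _]; last exact: (cvw x).1.
    by have [] := (L2P _).1 (Lw k).
  apply: (measurable_fun_cvg (h := fun k => Im \o w k)) => [k|x _]; last exact: (cvw x).2.
  by have [] := (L2P _).1 (Lw k).
have lim_bound g b K : L2 mu g -> (forall j, (K <= j)%N -> nsq (sub g (w j)) <= b) ->
    (\int[mu]_x (sqn (g x + (-1)%:C * v x))%:E <= b%:E)%E.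
  move=> Lg hb; apply: (@fatou_bound (fun j x => sqn (g x + (-1)%:C * w j x)) _ _ K).
  - by move=> j; have [m1 m2 _] := (L2P _).1 (L2_comb (-1) Lg (Lw j)); exact/measurable_EFinP/measurable_sqn.
  - by move=> j x; exact: sqn_ge0.
  - move=> x; have [cr ci] := cvw x.
    have E' (z z' : C) : sqn (z + (-1)%:C * z') = (Re z - Re z') * (Re z - Re z') + (Im z - Im z') * (Im z - Im z').
      by case: z => a c; case: z' => a' c'; rewrite /sqn /=; ring.
    under eq_fun do rewrite E'; rewrite E'.
    by apply: cvgD; apply: cvgM; apply: cvgB => //; exact: cvg_cst.
  by move=> j Kj; rewrite integral_sqn ?lee_fin; [exact: hb|exact: L2_comb].
have Lv : L2 mu v.
  have [m1 m2] := mv; apply/L2P; split=> //.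
  have Lw0v : L2 mu (sub (w 0%N) v).
    have [m3 m4 _] := (L2P _).1 (Lw 0%N); apply/L2P; split.
    - rewrite (_ : _ \o _ = fun x => Re (w 0%N x) - Re (v x)); first exact: measurable_funB.
      by apply/funext => x /=; case: (w 0%N x) => a c; case: (v x) => a' c' /=; ring.
    - rewrite (_ : _ \o _ = fun x => Im (w 0%N x) - Im (v x)); first exact: measurable_funB.
      by apply/funext => x /=; case: (w 0%N x) => a c; case: (v x) => a' c' /=; ring.
    apply: le_lt_trans (lim_bound (w 0%N) 4 0%N (Lw 0%N) _) (ltry _) => j _.
    rewrite (eq_sub _ _ _ _ (Lw _) (Lw _) (Lu _) (Lu _) (hw _).2 (hw _).2).
    by apply: le_trans (pu 0%N j) _; have := pow_le _ _ (leq0n j); rewrite expr0 invr1; lra.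
  have [_ _ +] := (L2P _).1 (L2_comb (-1) (Lw 0%N) Lw0v); apply: le_lt_trans.
  apply: ge0_le_integralT => x; rewrite lee_fin ?sqn_ge0//.
  by rewrite le_eqVlt; apply/orP; left; apply/eqP; case: (w 0%N x) => a c; case: (v x) => a' c'; rewrite /sqn /=; ring.
have Vv : V v.
  case: (Vc) => _ _ _ _ /(_ w v Vw Lv); apply.
  under eq_fun do rewrite (L2_dist2E (Lw _) Lv); apply: cvg_EFin; first by near=> k.
  apply: (@squeeze_cvgr _ _ _ _ (fun=> 0) (fun k => 4 * (16^-1) ^+ k)); last 2 first.
  - exact: cvg_cst.
  - rewrite -[X in _ --> X](mulr0 4); apply: cvgMr; apply: cvg_expr.
    by rewrite ger0_norm ?invr_ge0// invf_lt1// ltr1n.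
  apply: nearW => k; rewrite nsq_ge0 /= -lee_fin -integral_sqn; last exact: L2_comb.
  apply: (lim_bound _ _ k) => // j kj.
  rewrite (eq_sub _ _ _ _ (Lw _) (Lw _) (Lu _) (Lu _) (hw _).2 (hw _).2).
  by apply: le_trans (pu k j) _; have := pow_le _ _ kj; rewrite exprVn; lra.
have hmin : nsq (sub h0 v) <= d.
  apply/ler_addgt0Pr => e epos.
  have [K hK] : exists K, (16 ^+ K)^-1 <= e :> R.
    exists (Num.truncn e^-1).+1; rewrite -[leRHS]invrK lef_pV2 ?posrE ?exprn_gt0 ?invr_gt0//.
    apply: (@le_trans _ _ (Num.truncn e^-1).+1%:R); first exact/ltW/truncnS_gt.
    by rewrite -natrX ler_nat ltnW// ltn_expl.
  rewrite -lee_fin -integral_sqn; last exact: L2_comb.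
  apply: (lim_bound _ _ K) => // j Kj.
  have re : {ae mu, forall x, h0 x = h0 x} by apply: aeW.
  rewrite (eq_sub _ _ _ _ Lh0 (Lw _) Lh0 (Lu _) re (hw _).2).
  by apply: le_trans (hu j).2 _; have := pow_le _ _ Kj; lra.
have Lh := L2_comb (-1) Lh0 Lv.
exists (sub h0 v); split=> //.
  move=> h_0; apply: nV; apply: closed_ae Vv Lh0 _; apply: filterS h_0 => x.
  case: (h0 x) => a b; case: (v x) => a' b' /eqP; rewrite eq_complex /= => /andP[/eqP h1 /eqP h2].
  by apply/eqP; rewrite eq_complex /=; apply/andP; split; apply/eqP; lra.
move=> g Vg; have Lg := closed_L2 Vg.
have ipC : ip g (sub h0 v) = ip (sub h0 v) g.
  by apply: eq_Rintegral => x _; rewrite /dotp mulrC [X in _ + X]mulrC.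
rewrite ipC; set b := ip _ _; pose c := nsq g; have c0 : 0 <= c by exact: nsq_ge0.
have quad t : 0 <= 2 * t * b + t ^+ 2 * c.
  have Vt : V (fun x => v x + (- t)%:C * g x) by exact: closed_comb.
  have E' : sub h0 (fun x => v x + (- t)%:C * g x) = fun x => (h0 x + (-1)%:C * v x) + t%:C * g x.
    apply/funext => x; case: (h0 x) => a1 b1; case: (v x) => a2 b2; case: (g x) => a3 b3.
    by apply/eqP; rewrite eq_complex /=; apply/andP; split; apply/eqP; ring.
  by have := le_trans hmin (dle _ Vt); rewrite E' (nsqD t Lh Lg) -/b -/c; lra.
have c1 : 0 < c + 1 by lra.
(* At this argument the quadratic is negative unless [b] vanishes; the 1 avoids a division by zero
   when [c] is 0. *)
have := quad (- b / (c + 1)).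
have -> : 2 * (- b / (c + 1)) * b + (- b / (c + 1)) ^+ 2 * c = - (b ^+ 2 * ((c + 2) / (c + 1) ^+ 2)).
  by field; rewrite gt_eqF.
rewrite oppr_ge0 pmulr_lle0; last by rewrite divr_gt0 ?exprn_gt0//; lra.
by move=> b2; apply/eqP; rewrite -sqrf_eq0 eq_le b2 sqr_ge0.
Unshelve. all: by end_near. Qed.

End closed.

End square_integrable.

(** * Functions close to a nonzero constant on a set of positive measure *)

Section nonvanishing.
Context (disp : measure_display) (T : measurableType disp) (R : realType).
Variable mu : {measure set T -> \bar R}.
Local Open Scope complex_scope.
Local Notation C := R[i].
Local Notation Re := (@complex.Re R).
Local Notation Im := (@complex.Im R).
Implicit Types (f : T -> C) (z w : C) (x : T).

Definition mod z : R := Num.sqrt (sqn z).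

Lemma mod_ge0 z : 0 <= mod z. Proof. exact: sqrtr_ge0. Qed.

Lemma dotp_ge z w : - (mod z * mod w) <= dotp z w.
Proof.
have h : `|dotp z w| <= mod z * mod w.
  rewrite -sqrtr_sqr /mod -sqrtrM ?sqn_ge0//; apply: ler_wsqrtr.
  case: z => a b; case: w => c d; rewrite /dotp /sqn /= -subr_ge0.
  have -> : (a ^+ 2 + b ^+ 2) * (c ^+ 2 + d ^+ 2) - (a * c + b * d) ^+ 2 = (a * d - b * c) ^+ 2 by ring.
  exact: sqr_ge0.
by move: h; rewrite ler_norml => /andP[].
Qed.

Lemma near_one_bounds z : sqn (z - 1) <= 100^-1 ->
  [/\ 9 / 10 <= Re z, Re z <= 11 / 10, - (1 / 10) <= Im z & Im z <= 1 / 10].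
Proof.
case: z => a b; rewrite /sqn /= oppr0 addr0 => h.
have ha : `|a - 1| <= 1 / 10.
  rewrite -(@ler_pXn2r _ 2) ?nnegrE// real_normK ?num_real//.
  by have := sqr_ge0 b; move: h; rewrite expr_div_n expr1n; lra.
have hb : `|b| <= 1 / 10.
  rewrite -(@ler_pXn2r _ 2) ?nnegrE// real_normK ?num_real//.
  by have := sqr_ge0 (a - 1); move: h; rewrite expr_div_n expr1n; lra.
by move: ha hb; rewrite !ler_norml => /andP[h1 h2] /andP[h3 h4]; split; lra.
Qed.

Lemma dotp_near_one z w : sqn (z - 1) <= 100^-1 -> sqn (w - 1) <= 100^-1 -> 7 / 10 <= dotp z w.
Proof.
move=> /near_one_bounds[h1 h2 h3 h4] /near_one_bounds[k1 k2 k3 k4]; rewrite /dotp.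
move: (Re z) (Im z) (Re w) (Im w) h1 h2 h3 h4 k1 k2 k3 k4 => a b c d *.
have : 81 / 100 <= a * c by nra.
have : - (1 / 100) <= b * d by nra.
by lra.
Qed.

Lemma mod_near_one z : sqn (z - 1) <= 100^-1 -> (1 + mod z) ^+ 2 <= 9.
Proof.
move=> /near_one_bounds[h1 h2 h3 h4]; have s4 : sqn z <= 2 ^+ 2.
  rewrite /sqn; move: (Re z) (Im z) h1 h2 h3 h4 => a b *.
  have : a ^+ 2 <= 121 / 100 by nra.
  have : b ^+ 2 <= 1 / 100 by nra.
  by lra.
have m2 : mod z <= 2 by apply: le_trans (ler_wsqrtr s4) _; rewrite sqrtr_sqr ger0_norm.
by have := mod_ge0 z; move: (mod z) m2 => m *; nra.
Qed.

Lemma measurable_complexM f a : measurable_fun setT (Re \o f) -> measurable_fun setT (Im \o f) ->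
  measurable_fun setT (Re \o (fun x => a * f x)) /\ measurable_fun setT (Im \o (fun x => a * f x)).
Proof.
move=> m1 m2; have mc (r : R) (u : T -> R) : measurable_fun setT u -> measurable_fun setT (fun x => r * u x).
  by move=> mu'; apply: measurable_funM => //; exact: measurable_cst.
split.
- rewrite (_ : _ \o _ = fun x => Re a * Re (f x) - Im a * Im (f x)).
    by apply: measurable_funB; exact: mc.
  by apply/funext => x /=; case: a => a b; case: (f x).
- rewrite (_ : _ \o _ = fun x => Re a * Im (f x) + Im a * Re (f x)).
    by apply: measurable_funD; exact: mc.
  by apply/funext => x /=; case: a => a b; case: (f x).
Qed.

Lemma near_one_measurable f a : measurable_fun setT (Re \o f) -> measurable_fun setT (Im \o f) ->
  measurable [set x | sqn (a * f x - 1) <= 100^-1].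
Proof.
move=> m1 m2; have [m3 m4] := measurable_complexM a m1 m2.
have m5 : measurable_fun setT (fun x => (sqn (a * f x - 1))%:E).
  apply: measurable_sqn.
  - rewrite (_ : _ \o _ = fun x => Re (a * f x) - 1); last by apply/funext => x /=; case: (a * f x).
    by apply: measurable_funB => //; exact: measurable_cst.
  - rewrite (_ : _ \o _ = fun x => Im (a * f x)); first exact: m4.
    by apply/funext => x /=; case: (a * f x) => c d /=; rewrite oppr0 addr0.
have := measurable_lee measurableT m5 (measurable_cst (100^-1)%:E).
by rewrite setTI (_ : [set x | _] = [set x | sqn (a * f x - 1) <= 100^-1]).
Qed.

(* The discs [|a z - 1| <= 1/10], [a] rational, cover the nonzero complex numbers. *)
Lemma near_one f : measurable_fun setT (Re \o f) -> measurable_fun setT (Im \o f) ->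
  ~ {ae mu, forall x, f x = 0} -> exists a : C, (0 < mu [set x | (sqn (a * f x - 1) <= 100^-1)%R])%E.
Proof.
move=> m1 m2 nf; apply: contrapT => no; apply: nf.
pose E a := [set x | sqn (a * f x - 1) <= 100^-1].
have E0 a : mu.-negligible (E a).
  apply/negligibleP; first exact: near_one_measurable.
  by apply/eqP; rewrite eq_le measure_ge0 andbT leNgt; apply/negP => h; apply: no; exists a.
pose a_ (i : nat * int * int) : C := ((i.1.2)%:~R / (i.1.1)%:R +i* ((i.2)%:~R / (i.1.1)%:R)).
pose F k := if (choice.unpickle k : option (nat * int * int)) is Some i then E (a_ i) else set0.
have F0 : mu.-negligible (\bigcup_k F k).
  apply: negligible_bigcup => k; rewrite /F; case: (choice.unpickle k) => [i|]; first exact: E0.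
  exact: negligible_set0.
apply: negligibleS F0 => x /= fx0.
suff [i hi] : exists i, E (a_ i) x by exists (choice.pickle i) => //; rewrite /F choice.pickleK.
move: fx0; rewrite /E /=; case: (f x) => c d cd.
pose s := c ^+ 2 + d ^+ 2; have s0 : 0 < s.
  rewrite lt_neqAle addr_ge0 ?sqr_ge0// andbT eq_sym; apply/negP => /eqP h; apply: cd.
  have c2 := sqr_ge0 c; have d2 := sqr_ge0 d.
  have /eqP : c ^+ 2 = 0 by move: h; rewrite /s; lra.
  have /eqP : d ^+ 2 = 0 by move: h; rewrite /s; lra.
  by rewrite !sqrf_eq0 => /eqP -> /eqP ->.
have [m hm] : exists m : nat, 200 * s <= m%:R ^+ 2 /\ 0 < m%:R :> R.
  exists (Num.truncn (200 * s)).+1; split; last by rewrite ltr0n.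
  have h1 := ltW (truncnS_gt (200 * s)); apply: (le_trans h1).
  by rewrite expr2 ler_peMr// ler1n.
have [hm2 m0] := hm.
pose p := Num.floor (m%:R * (c / s)); pose q := Num.floor (m%:R * (- d / s)).
exists (m, p, q); rewrite /a_ /sqn /=.
have e1 : `|p%:~R / m%:R - c / s| <= m%:R^-1.
  have /andP[f1 f2] := floor_itv (m%:R * (c / s)); rewrite -/p intrD in f1 f2.
  rewrite -(ler_pM2l m0) mulfV ?gt_eqF// -{1}(ger0_norm (ltW m0)) -normrM mulrBr mulrCA mulfV ?gt_eqF// mulr1.
  by rewrite ler_norml; apply/andP; split; lra.
have e2 : `|q%:~R / m%:R - - d / s| <= m%:R^-1.
  have /andP[f1 f2] := floor_itv (m%:R * (- d / s)); rewrite -/q intrD in f1 f2.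
  rewrite -(ler_pM2l m0) mulfV ?gt_eqF// -{1}(ger0_norm (ltW m0)) -normrM mulrBr mulrCA mulfV ?gt_eqF// mulr1.
  by rewrite ler_norml; apply/andP; split; lra.
set u := p%:~R / m%:R in e1 *; set v := q%:~R / m%:R in e2 *.
have -> : (u * c - v * d + - 1) ^+ 2 + (u * d + v * c + - 0) ^+ 2 =
    ((u - c / s) ^+ 2 + (v - - d / s) ^+ 2) * s.
  by rewrite /s; field; rewrite -/s gt_eqF.
have sq (y : R) : `|y| <= m%:R^-1 -> y ^+ 2 <= (m%:R ^+ 2)^-1.
  by move=> h; rewrite -(@real_normK _ y) ?num_real// -exprVn ler_pXn2r ?nnegrE// invr_ge0.
apply: (@le_trans _ _ (2 * (m%:R ^+ 2)^-1 * s)).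
  by rewrite ler_wpM2r ?(ltW s0)//; have := sq _ e1; have := sq _ e2; lra.
by rewrite mulrAC ler_pdivrMr ?exprn_gt0//; lra.
Qed.

End nonvanishing.

(** * Irreducibility *)

Section irreducibility.
Variables (R : realType) (n : nat) (P : right_angled_polytope R n.+2).
Variables (X : building P) (q : facet P -> nat).
Hypothesis q_gt0 : forall s, (0 < q s)%N.
Hypothesis q_card : forall s (x : X), (panel s x #= `I_(q s).+1)%card.
Variables (xi0 : boundary X) (c0 : X).
Variables (nu : probability (borel_stab c0) R) (nu_haar : is_haar_probability nu).
Variable mu : {measure set (borel_boundary xi0) -> \bar R}.
Hypothesis mu_def : is_boundary_measure nu mu.
Variables (G : groupType) (act : G -> aut X).
Hypothesis act_action : is_aut_action act.
Hypothesis act_trans : strongly_transitive act.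
Variable D : G -> borel_boundary xi0 -> R.
Hypothesis D_density : forall g : G,
  is_density mu (pushforward mu (borel_act (act g))) (D g).
Local Open Scope complex_scope.
Local Notation Omega := (borel_boundary xi0).
Local Notation gact := (@gact R n P X xi0 G act).
Local Notation coeff := (@coeff R n P X xi0 G act D).
Local Notation Re := (@complex.Re R).
Local Notation Im := (@complex.Im R).
Implicit Types (g : G).

Lemma majorant_measurable (f : Omega -> R[i]) : L2 mu f ->
  measurable_fun setT (fun w => 1 + mod (f w)).
Proof.
move=> /L2P[m1 m2 _]; apply: measurable_funD; first exact: measurable_cst.
have /measurable_EFinP mq := measurable_sqn m1 m2.
by apply: (measurableT_comp _ mq); apply: continuous_measurable_fun; exact: sqrt_continuous.
Qed.

Lemma majorant_square (f : Omega -> R[i]) : L2 mu f ->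
  (\int[mu]_w ((1 + mod (f w)) ^+ 2)%:E < +oo)%E.
Proof.
move=> Lf; have [m1 m2 i] := (L2P mu f).1 Lf.
apply: (@le_lt_trans _ _ (\int[mu]_w (2%:E * (1%:E + (sqn (f w))%:E)))%E).
  apply: ge0_le_integralT => w; rewrite -?EFinD -?EFinM lee_fin ?sqr_ge0//.
  rewrite -[sqn _]sqr_sqrtr ?sqn_ge0// -/(mod _); have := sqr_ge0 (mod (f w) - 1).
  by move: (mod (f w)) => m; nra.
have msq := measurable_sqn m1 m2.
have s0 (w : Omega) : [set: Omega] w -> (0 <= (sqn (f w))%:E)%E by move=> _; rewrite lee_fin sqn_ge0.
rewrite ge0_integralZl_EFin//; last 2 first.
- by move=> w _; rewrite adde_ge0// s0.
- by apply: emeasurable_funD => //; exact: measurable_cst.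
rewrite ge0_integralD//; try by [exact: measurable_cst|move=> w _; rewrite lee_fin].
rewrite integral_cst// mul1e lte_mul_pinfty// lte_add_pinfty//.
exact: (mu_finite q_gt0 q_card nu_haar mu_def act_trans).
Qed.

(** Because [dotp (u w) (h w)] integrates to 0, it may be added to the right-hand integrand of the
    inequality excluded by [no_cancellation]. The inequality then holds pointwise: by
    [dotp_near_one] where both factors are close to 1, and elsewhere because
    [(1 + mod F) * (1 + mod H)] exceeds [mod F * mod H] by at least 1. *)
Lemma orthogonal_translates (f h : Omega -> R[i]) : L2 mu f -> L2 mu h ->
  (0 < mu [set w | (sqn (f w - 1) <= 100^-1)%R])%E ->
  (0 < mu [set w | (sqn (h w - 1) <= 100^-1)%R])%E ->
  ~ (forall g, L2 mu (rho0 act D g f) /\ ip mu (rho0 act D g f) h = 0).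
Proof.
move=> Lf Lh E2p E1p orth.
have [mf1 mf2 _] := (L2P mu f).1 Lf; have [mh1 mh2 _] := (L2P mu h).1 Lh.
have mE (u : Omega -> R[i]) : measurable_fun setT (Re \o u) -> measurable_fun setT (Im \o u) ->
    measurable [set w | sqn (u w - 1) <= 100^-1].
  move=> m1 m2; have := near_one_measurable 1 m1 m2.
  by under eq_fun do rewrite mul1r.
set E1 := [set w | (sqn (h w - 1) <= 100^-1)%R] in E1p.
set E2 := [set w | (sqn (f w - 1) <= 100^-1)%R] in E2p.
have mE1 : measurable E1 by exact: mE.
have mE2 : measurable E2 by exact: mE.
have pos (u : Omega -> R[i]) w : 0 <= 1 + mod (u w) by rewrite addr_ge0 ?mod_ge0.
apply: (no_cancellation q_gt0 q_card nu_haar mu_def act_action act_trans D_density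
  (majorant_measurable Lf) (majorant_measurable Lh) (pos f) (pos h)
  (majorant_square Lf) (majorant_square Lh) mE1 mE2 E1p E2p) => //.
- by move=> w; exact: mod_near_one.
- by move=> w; exact: mod_near_one.
move=> g J mJ; have [Lu ip0] := orth g; set u := rho0 act D g f in Lu ip0.
pose p w := 1 + mod (f w); pose r w := 1 + mod (h w).
pose r1 w := r w * \1_(~` E1) w; pose p1 w := p w * \1_(~` E2) w.
rewrite -/p -/r -/r1 -/p1; pose s w := Num.sqrt (D g w).
have s0 w : 0 <= s w by exact: sqrtr_ge0.
have ind0 (E : set Omega) w : 0 <= \1_E w :> R by rewrite indicE.
have mp : measurable_fun setT p by exact: majorant_measurable.
have mr : measurable_fun setT r by exact: majorant_measurable.
have mp1 : measurable_fun setT p1.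
  by apply: measurable_funM => //; apply: measurable_indic; exact: measurableC.
have mr1 : measurable_fun setT r1.
  by apply: measurable_funM => //; apply: measurable_indic; exact: measurableC.
have p0 w : 0 <= p w by exact: pos.
have r0 w : 0 <= r w by exact: pos.
have p10 w : 0 <= p1 w by rewrite mulr_ge0.
have r10 w : 0 <= r1 w by rewrite mulr_ge0.
have mC a b : measurable_fun setT a -> measurable_fun setT b -> measurable_fun setT (coeff g a b).
  exact: (coeff_measurable D_density).
have C0 (a b : Omega -> R) w : (forall w, 0 <= a w) -> (forall w, 0 <= b w) -> (0 <= coeff g a b w)%E.
  by move=> a0 b0; exact: coeff_ge0.
(* The three integrals on the right as the integral of one function, to be compared pointwise with
   the integrand [d] of the vanishing product. *)
pose k w := if w \in J then fine (coeff g p r1 w) + fine (coeff g p1 r w) else fine (coeff g p r w).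
have k0 w : 0 <= k w by rewrite /k; case: ifP => _; rewrite ?addr_ge0// fine_ge0// C0.
have rm (A : set Omega) a b : measurable A -> measurable_fun setT a -> measurable_fun setT b ->
    measurable_fun setT ((coeff g a b) \_ A).
  by move=> mA ma mb; apply/(measurable_restrictT _ mA)/measurable_funTS; exact: mC.
have rm0 (A : set Omega) (a b : Omega -> R) w : (forall w, 0 <= a w) -> (forall w, 0 <= b w) ->
    (0 <= ((coeff g a b) \_ A) w)%E.
  by move=> a0 b0; rewrite patchE; case: ifP => // _; exact: C0.
have mJC : measurable (~` J) by exact: measurableC.
have EFk w : (k w)%:E = ((coeff g p r) \_ (~` J) w + ((coeff g p r1) \_ J w + (coeff g p1 r) \_ J w))%E.
  rewrite /k !patchE; have [wJ|wJ] := boolP (w \in J).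
    by rewrite ifF ?add0e//; apply/negbTE/negP => /set_mem; apply; exact/set_mem.
  rewrite ifT ?adde0//; apply/mem_set => Jw; move/negP: wJ; apply; exact/mem_set.
have mk : measurable_fun setT (fun w => (k w)%:E).
  rewrite (_ : (fun w => _) = fun w => ((coeff g p r) \_ (~` J) w + ((coeff g p r1) \_ J w + (coeff g p1 r) \_ J w))%E).
    by apply: emeasurable_funD; [exact: rm|apply: emeasurable_funD; exact: rm].
  by apply/funext => w; exact: EFk.
have -> : (\int[mu]_(w in ~` J) coeff g p r w +
    (\int[mu]_(w in J) coeff g p r1 w + \int[mu]_(w in J) coeff g p1 r w) = \int[mu]_w (k w)%:E)%E.
  rewrite (integral_mkcond (~` J)) !(integral_mkcond J).
  rewrite -ge0_integralD//; [|by move=> w _; exact: rm0|exact: rm|by move=> w _; exact: rm0|exact: rm].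
  rewrite -ge0_integralD//; [|by move=> w _; exact: rm0|exact: rm|by move=> w _; rewrite adde_ge0 ?rm0|].
    by apply: eq_integral => w _; rewrite EFk.
  by apply: emeasurable_funD; exact: rm.
(* An infinite right side makes the inequality trivial; a finite one makes [k] integrable, so that
   [d] can be added. *)
have [fin|] := boolP (\int[mu]_w (k w)%:E \is a fin_num)%E; last first.
  by rewrite ge0_fin_numE ?integral_ge0// -?leNgt ?leye_eq => [/eqP ->|w _]; rewrite ?leey ?lee_fin.
have ik : mu.-integrable setT (EFin \o k).
  apply/integrableP; split=> //; rewrite (eq_integral (fun w => (k w)%:E)).
    by rewrite -ge0_fin_numE// integral_ge0// => w _; rewrite lee_fin.
  by move=> w _ /=; rewrite ger0_norm.
pose d w := dotp (u w) (h w); have id := integrable_dotp Lu Lh.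
have d0 : (\int[mu]_w (d w)%:E = 0)%E.
  have fd : (\int[mu]_w (d w)%:E)%E \is a fin_num by exact: (integrable_fin_num measurableT id).
  by rewrite -(fineK fd); congr EFin.
have uE w : d w = dotp (f (gact g^-1%g w)) (h w) * s w.
  rewrite /d /u /rho0 -/(s w) /dotp; case: (f _) => a b; case: (h w) => c e /=.
  by rewrite !mulr0 subr0 add0r; ring.
have -> : (\int[mu]_w (k w)%:E = \int[mu]_w ((d w)%:E + (k w)%:E))%E.
  by rewrite (integralD measurableT id ik) d0 add0e.
have ms : measurable_fun setT (fun w => (s w)%:E).
  have [mD _ _] := D_density g; apply/measurable_EFinP; apply: (measurableT_comp _ mD).
  by apply: continuous_measurable_fun; exact: sqrt_continuous.
have c7 : 0 <= 7 / 10 :> R by lra.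
rewrite -ge0_integralZl_EFin//; try by [move=> w _; rewrite lee_fin s0|exact: measurable_funTS].
rewrite integral_mkcond; apply: ge0_le_integralT => w.
  by rewrite patchE; case: ifP => // _; rewrite -EFinM lee_fin mulr_ge0//; lra.
rewrite patchE -EFinD /k uE /=; set F := f _; set H := h w.
have cs := dotp_ge F H; have mF := mod_ge0 F; have mH := mod_ge0 H; have mFH := mulr_ge0 mF mH.
case: ifPn => [wJ|wJ]; last first.
  rewrite lee_fin -mulrDl mulr_ge0//; rewrite /p /r -/F -/H.
  by move: cs mF mH mFH; move: (dotp F H) (mod F) (mod H) => x y z *; nra.
rewrite -EFinM lee_fin /r1 /p1 -!mulrDl ler_wpM2r// /p /r -/F -/H !indicE.
have case1 x : (x \in ~` E1) = false -> sqn (h x - 1) <= 100^-1.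
  by move/negbT/negP => nx; apply: contrapT => h'; apply: nx; exact/mem_set.
have case2 x : (x \in ~` E2) = false -> sqn (f x - 1) <= 100^-1.
  by move/negbT/negP => nx; apply: contrapT => h'; apply: nx; exact/mem_set.
case h1 : (w \in ~` E1); case h2 : (gact g^-1%g w \in ~` E2); rewrite ?mulr1 ?mulr0 ?mul0r ?addr0 ?add0r.
- by move: cs mF mH mFH; move: (dotp F H) (mod F) (mod H) => x y z *; nra.
- by move: cs mF mH mFH; move: (dotp F H) (mod F) (mod H) => x y z *; nra.
- by move: cs mF mH mFH; move: (dotp F H) (mod F) (mod H) => x y z *; nra.
exact: dotp_near_one (case2 _ h2) (case1 _ h1).
Qed.

End irreducibility.

Theorem theorem0p1 (R : realType) (n : nat)
    (P : right_angled_polytope R n.+2) (X : building P)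
    (X_thick : finite_thickness X)
    (xi0 : boundary X) (c0 : X)
    (nu : probability (borel_stab c0) R) (nu_haar : is_haar_probability nu)
    (mu : {measure set (borel_boundary xi0) -> \bar R})
    (mu_def : is_boundary_measure nu mu)
    (G : groupType) (act : G -> aut X) (act_action : is_aut_action act)
    (act_trans : strongly_transitive act)
    (D : G -> borel_boundary xi0 -> R)
    (D_density : forall g : G,
       is_density mu (pushforward mu (borel_act (act g))) (D g)) :
  irreducible_on_L2 mu (rho0 act D).
Proof.
have [q [q_gt0 q_card]] := X_thick.
move=> V Vc Vinv; have [->|VL] := pselect (V = L2 mu); [by right|left].
have V0 : V (fun=> 0) by case: Vc.
apply/seteqP; split=> f => [Vf|[Lf f0]]; last first.
  by apply: (closed_ae Vc V0 Lf); apply: filterS f0 => x ->.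
have Lf := closed_L2 Vc Vf; split=> //; apply: contrapT => nf.
have [h [Lh nh oh]] := orthogonal_exists Vc VL.
have [mf1 mf2 _] := (L2P mu f).1 Lf; have [mh1 mh2 _] := (L2P mu h).1 Lh.
have [a fa] := near_one mf1 mf2 nf; have [b hb] := near_one mh1 mh2 nh.
have Vaf : V (fun x => a * f x)%R by case: Vc => _ _ _ VZ _; exact: VZ.
have Lbh : L2 mu (fun x => b * h x)%R.
  have [m1 m2] := measurable_complexM b mh1 mh2; apply/L2P; split=> //.
  rewrite (eq_integral (fun x => (sqn b)%:E * (sqn (h x))%:E)%E); last first.
    move=> x _; rewrite -EFinM; congr EFin; case: b {hb m1 m2} => b1 b2; case: (h x) => c d.
    by rewrite /sqn /=; ring.
  rewrite ge0_integralZl_EFin ?sqn_ge0//.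
  - by rewrite integral_sqn// -EFinM ltry.
  - by move=> x _; rewrite lee_fin sqn_ge0.
  - exact: measurable_sqn.
apply: (orthogonal_translates q_gt0 q_card nu_haar mu_def act_action act_trans D_density
  (closed_L2 Vc Vaf) Lbh fa hb) => g.
have Vu := Vinv g _ Vaf; split; first exact: closed_L2 Vu.
(* [<v, b h> = <conj b v, h>] *)
have Vbu : V (fun x => (complex.Re b -i* complex.Im b)%C * rho0 act D g (fun x => a * f x)%R x)%R.
  by case: Vc => _ _ _ VZ _; exact: VZ.
rewrite -(oh _ Vbu); apply: eq_Rintegral => x _; case: b {hb Lbh Vbu} => b1 b2.
by case: (rho0 _ _ _ _ _) => c d; case: (h x) => e e'; rewrite /dotp /=; ring.
Qed.
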